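(* Let $X\in\overline{\mathcal M}$ and let $U$ be an open subset of the regular set $\mathcal R$ such that $(U,g_X|_U)$ is a $C^\infty$-Riemannian manifold. Then $R_X$ coincides a.e. on $U$ with the ordinary Riemannian curvature tensor (of type $(0,4)$) of $(U,g_X|_U)$. In particular, $\mathrm{Ric}_X$ and $s_X$ coincide a.e. on $U$ with the ordinary Ricci curvature and scalar curvature of $(U,g_X|_U)$.
   Context: Setting. Let $n\in\mathbf N$, $d,v\in(0,\infty)$, $K_1,K_2\in\mathbf R$. $\mathcal M=\mathcal M(n,d,K_1,K_2,v)$ is the set of (isometry classes of) $n$-dimensional closed Riemannian manifolds $M$ with $\mathrm{diam}\,M\le d$, $H^n(M)\ge v$ and $K_1\le\mathrm{Ric}_M\le K_2$ ($H^n$ is $n$-dimensional Hausdorff measure); $\overline{\mathcal M}$ is the set of Gromov-Hausdorff limits of sequences in $\mathcal M$. Each $X\in\overline{\mathcal M}$ carries the measure $H^n$. The regular set $\mathcal R\subset X$ (points all of whose tangent cones are isometric to $\mathbf R^n$) is open, of full $H^n$-measure, and is a smooth manifold with a Riemannian metric $g_X$ which is $C^{1,\alpha}$ for every $\alpha\in(0,1)$. Tensor fields on $X$ are Borel sections over $\mathcal R$ up to a.e. equality; $T^r_sX=\bigotimes^rTX\otimes\bigotimes^sT^*X$; $\langle\cdot,\cdot\rangle$ is induced by $g_X$, $*$ is duality via $g_X$. Functions. $\mathrm{LIP}(X)$ is the set of Lipschitz functions; $H^{1,2}(X)$ is its completion for $(\|f\|_{L^2}^2+\|\nabla f\|_{L^2}^2)^{1/2}$.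 $\mathcal D^2(\Delta,X)$ is the set of $f\in H^{1,2}(X)$ for which there is a (unique) $\Delta f\in L^2(X)$ with $\int_X\langle\nabla f,\nabla h\rangle dH^n=\int_Xh\,\Delta f\,dH^n$ for all $h\in H^{1,2}(X)$. $\mathrm{Test}F(X)=\{f\in\mathcal D^2(\Delta,X)\cap\mathrm{LIP}(X):\Delta f\in H^{1,2}(X)\}$. For $f\in\mathrm{Test}F(X)$, $\mathrm{Hess}_f\in L^2(T^0_2X)$ is given by $2\mathrm{Hess}_f(\nabla g,\nabla h)=\langle\nabla g,\nabla\langle\nabla f,\nabla h\rangle\rangle+\langle\nabla h,\nabla\langle\nabla f,\nabla g\rangle\rangle-\langle\nabla f,\nabla\langle\nabla g,\nabla h\rangle\rangle$ for $g,h\in\mathrm{Test}F(X)$, and $[\nabla f,\nabla g]^*=\mathrm{Hess}_g(\nabla f,\cdot)-\mathrm{Hess}_f(\nabla g,\cdot)$. Curvature. $R_X$ is the unique tensor in $\bigcap_{q<2}L^q(T^0_4X)$ such that for all $f_0,\dots,f_4\in\mathrm{Test}F(X)$ $$\int_Xf_0\langle R_X,df_1\otimes df_2\otimes df_3\otimes df_4\rangle=\int_X\big((-\langle\nabla f_0,\nabla f_1\rangle+f_0\Delta f_1)\mathrm{Hess}_{f_3}(\nabla f_2,\nabla f_4)-f_0\langle\mathrm{Hess}_{f_3}(\nabla f_2,\cdot),\mathrm{Hess}_{f_4}(\nabla f_1,\cdot)\rangle\big)$$ $$-\int_X\big((-\langle\nabla f_0,\nabla f_2\rangle+f_0\Delta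 f_2)\mathrm{Hess}_{f_3}(\nabla f_1,\nabla f_4)-f_0\langle\mathrm{Hess}_{f_3}(\nabla f_1,\cdot),\mathrm{Hess}_{f_4}(\nabla f_2,\cdot)\rangle\big)-\int_Xf_0\mathrm{Hess}_{f_3}([\nabla f_1,\nabla f_2],\nabla f_4)$$ (integrals with respect to $H^n$; existence and uniqueness may be taken as given). $\mathrm{Ric}_X(u,v)=\sum_iR_X(e_i,u,v,e_i)$ and $s_X(x)=\sum_i\mathrm{Ric}_X(e_i,e_i)$ for an orthonormal basis $\{e_i\}$ of $T_xX$. The ordinary curvature tensor uses the convention $R(V,W,Z,Y)=\langle\nabla_V\nabla_WZ-\nabla_W\nabla_VZ-\nabla_{[V,W]}Z,Y\rangle$. *)

(* Defs.v *)
From HB Require Import structures.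
From mathcomp Require Import all_boot all_order all_algebra.
From mathcomp Require Import all_classical all_reals all_analysis.

Set Implicit Arguments.
Unset Strict Implicit.
Unset Printing Implicit Defensive.

Import Order.TTheory GRing.Theory Num.Theory.
Import numFieldNormedType.Exports.

Local Open Scope classical_set_scope.
Local Open Scope ring_scope.

(* The measurable structures of the library live on pointed types. *)
#[short(type="pmetricType")]
HB.structure Definition PointedMetric (K : numDomainType) :=
  {M of Pointed M & Metric K M}.

Section HausdorffMeasure.
Variable R : realType.

(* Volume of the unit ball of R^n: omega_n = (2 pi / n) omega_(n-2). *)
Fixpoint ball_volume (n : nat) : R :=
  match n with
  | 0 => 1
  | 1 => 2
  | k.+2 => 2 * pi / k.+2%:R * ball_volume k
  end.

Variable X : metricType R.
Local Open Scope ereal_scope.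

Definition diam (A : set X) : \bar R :=
  ereal_sup ([set 0] `|` [set (mdist x y)%:E | x in A & y in A]).

(* The case distinction only matters for n = 0, where 0 ^+ 0 = 1. *)
Definition hausdorff_weight (n : nat) (A : set X) : \bar R :=
  if `[< A = set0 >] then 0
  else (ball_volume n / 2 ^+ n)%R%:E * diam A ^+ n.

Definition hausdorff_pre (n : nat) (delta : R) (A : set X) : \bar R :=
  ereal_inf [set \sum_(k <oo) hausdorff_weight n (C k) | C in
    [set C : nat -> set X |
      A `<=` \bigcup_k C k /\ forall k, diam (C k) <= delta%:E]].

Definition hausdorff (n : nat) (A : set X) : \bar R :=
  ereal_sup [set hausdorff_pre n delta A | delta in [set t : R | (0 < t)%R]].

End HausdorffMeasure.

Notation borel X := (g_sigma_algebraType (@open X)).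

Section GromovHausdorff.
Variable R : realType.

Definition dist_preserving (X Y : metricType R) (f : X -> Y) :=
  forall x y, mdist (f x) (f y) = mdist x y.

(* The images of X and Y in some common metric space are at Hausdorff distance
   at most e. *)
Definition GH_close (e : R) (X Y : metricType R) :=
  exists (Z : metricType R) (f : X -> Z) (g : Y -> Z),
    [/\ dist_preserving f, dist_preserving g,
        forall x, exists y, mdist (f x) (g y) < e
      & forall y, exists x, mdist (f x) (g y) < e].

Definition GH_cvg (M : nat -> metricType R) (X : metricType R) :=
  forall e : R, 0 < e -> \forall k \near \oo, GH_close e (M k) X.

Definition proper_space (Y : metricType R) :=
  forall (y : Y) (r : R), compact [set z | mdist y z <= r].

(* (Y, y) is a pointed Gromov-Hausdorff limit of the rescaled pointed spaces
   (X, mdist / r_k, x), for some scales r_k -> 0. *)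
Definition tangent_cone (X : metricType R) (x : X) (Y : metricType R) (y : Y) :=
  proper_space Y /\
  exists r : nat -> R,
    [/\ forall k, 0 < r k, r k @[k --> \oo] --> (0 : R) &
    forall rho e : R, 0 < rho -> 0 < e -> \forall k \near \oo,
      exists f : X -> Y,
      [/\ f x = y,
          forall a b, mdist x a < rho * r k -> mdist x b < rho * r k ->
            `|mdist (f a) (f b) - mdist a b / r k| < e
        & forall z, mdist y z < rho - e ->
            exists a, mdist x a < rho * r k /\ mdist (f a) z < e]].

(* The norm of 'rV[R]_n in the library is the sup norm. *)
Definition eucl_dist (n : nat) (u v : 'rV[R]_n) : R :=
  Num.sqrt (\sum_(i < n) (u 0 i - v 0 i) ^+ 2).

Definition isometric_eucl (n : nat) (Y : metricType R) :=
  exists f : Y -> 'rV[R]_n,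
    bijective f /\ forall a b, eucl_dist (f a) (f b) = mdist a b.

Definition regular (n : nat) (X : metricType R) : set X :=
  [set x | forall (Y : metricType R) (y : Y),
     tangent_cone x y -> isometric_eucl n Y].

End GromovHausdorff.
Arguments regular {R} n X.

Section Calculus.
Variables (R : realType) (n : nat).
Local Notation V := 'rV[R]_n.

Definition bvec (a : 'I_n) : V := delta_mx 0 a.

Definition pd (a : 'I_n) (f : V -> R) : V -> R := 'D_(bvec a) f.

Definition smooth_on (A : set V) (f : V -> R) :=
  forall (s : seq 'I_n) y, A y -> differentiable (foldr pd f s) y.

(* C^{1,alpha} for every alpha in (0,1), locally in the open set A. *)
Definition C1alpha_on (A : set V) (f : V -> R) :=
  (forall y, A y -> differentiable f y) /\
  forall alpha : R, 0 < alpha < 1 -> forall y, A y ->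
    exists e C : R, 0 < e /\ forall a z w, ball y e z -> ball y e w ->
      `|pd a f z - pd a f w| <= C * `|z - w| `^ alpha.

(* Tensors of type (0,k) on R^n, given by their coefficients. *)
Definition tensor (k : nat) := {ffun 'I_k -> 'I_n} -> R.

Definition teval k (T : tensor k) (v : k.-tuple V) : R :=
  \sum_(s : {ffun 'I_k -> 'I_n}) T s * \prod_(j < k) (tnth v j) 0 (s j).

Definition tprod k (w : k.-tuple (tensor 1)) : tensor k :=
  fun s => \prod_(j < k) tnth w j [ffun=> s j].

(* T (u, .) *)
Definition tslot (T : tensor 2) (u : V) : tensor 1 :=
  fun s => teval T [tuple u; bvec (s ord0)].

(* Inner product of (0,k)-tensors, and vector dual to a covector, for the
   scalar product on R^n with Gram matrix G. *)
Definition tdot k (G : 'M[R]_n) (S T : tensor k) : R :=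
  \sum_(s : {ffun 'I_k -> 'I_n}) \sum_(t : {ffun 'I_k -> 'I_n})
    S s * T t * \prod_(j < k) (invmx G) (s j) (t j).

Definition sharp (G : 'M[R]_n) (w : tensor 1) : V :=
  (\row_a w [ffun=> a]) *m invmx G.

Definition vdot (G : 'M[R]_n) (u v : V) : R := (u *m G *m v^T) 0 0.

(* Ricci tensor and scalar of a (0,4)-tensor T, with respect to the basis
   formed by the rows of e. *)
Definition ric_contr (e : 'M[R]_n) (T : tensor 4) (u v : V) : R :=
  \sum_(i < n) teval T [tuple row i e; u; v; row i e].

Definition scal_contr (e : 'M[R]_n) (T : tensor 4) : R :=
  \sum_(i < n) ric_contr e T (row i e) (row i e).

Definition orthonormal_basis (G e : 'M[R]_n) := e *m G *m e^T = 1%:M.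

(* Levi-Civita connection and curvature of a metric tensor G on an open subset
   of R^n. *)
Section Curvature.
Variable G : V -> 'M[R]_n.

Definition christoffel (y : V) (c a b : 'I_n) : R :=
  2^-1 * \sum_(l < n) (invmx (G y)) c l *
    (pd a (fun z => G z b l) y + pd b (fun z => G z a l) y
     - pd l (fun z => G z a b) y).

Definition nabla (v w : V -> V) : V -> V := fun y => \row_c
  (\sum_(a < n) v y 0 a * pd a (fun z => w z 0 c) y
   + \sum_(a < n) \sum_(b < n) christoffel y c a b * v y 0 a * w y 0 b).

Definition lie_bracket (v w : V -> V) : V -> V := fun y => \row_c
  \sum_(a < n) (v y 0 a * pd a (fun z => w z 0 c) y
                - w y 0 a * pd a (fun z => v z 0 c) y).

Definition curv_op (v w z : V -> V) : V -> V := fun y =>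
  nabla v (nabla w z) y - nabla w (nabla v z) y - nabla (lie_bracket v w) z y.

Definition coord_field (a : 'I_n) : V -> V := fun=> bvec a.

Definition riem_tensor (y : V) : tensor 4 := fun s =>
  vdot (G y)
    (curv_op (coord_field (s (inord 0))) (coord_field (s (inord 1)))
             (coord_field (s (inord 2))) y)
    (coord_field (s (inord 3)) y).

(* Ric (u, v) is the trace of w |-> R(w, u) v. *)
Definition ric_tensor (y : V) : tensor 2 := fun s =>
  \sum_(a < n) (curv_op (coord_field a) (coord_field (s (inord 0)))
                        (coord_field (s (inord 1))) y) 0 a.

Definition scal_curv (y : V) : R :=
  \sum_(a < n) \sum_(b < n)
    (invmx (G y)) a b * teval (ric_tensor y) [tuple bvec a; bvec b].

End Curvature.
End Calculus.

Section Riemannian.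
Variables (R : realType) (n : nat).

(* Derivative of the transition map from the chart i to the chart j. As vectors
   are rows, v *m jacobian expresses in the chart j the vector v of the chart
   i. *)
Definition jacobian (X I : Type) (phi : I -> X -> 'rV[R]_n)
    (psi : I -> 'rV[R]_n -> X) (i j : I) (y : 'rV[R]_n) : 'M[R]_n :=
  \matrix_(a, b) pd a (fun z => phi j (psi i z) 0 b) y.

(* A smooth n-dimensional manifold structure on a subset D of X (necessarily
   open), with a Riemannian metric given by its coefficients in the charts; the
   regularity of the metric is a separate predicate. The tangent space at x is
   'rV[R]_n, through the preferred chart chart_at x. *)
Record riem_structure (X : topologicalType) (D : set X) := RiemStructure {
  chart : Type;
  dom : chart -> set X;
  phi : chart -> X -> 'rV[R]_n;
  psi : chart -> 'rV[R]_n -> X;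
  chart_at : X -> chart;
  gram : chart -> 'rV[R]_n -> 'M[R]_n;
  dom_open : forall i, open (dom i);
  dom_sub : forall i, dom i `<=` D;
  dom_chart_at : forall x, D x -> dom (chart_at x) x;
  img_open : forall i, open (phi i @` dom i);
  phiK : forall i x, dom i x -> psi i (phi i x) = x;
  phi_continuous : forall i x, dom i x -> {for x, continuous (phi i)};
  psi_continuous : forall i y, (phi i @` dom i) y ->
    {for y, continuous (psi i)};
  transition_smooth : forall i j b,
    smooth_on (phi i @` (dom i `&` dom j)) (fun y => phi j (psi i y) 0 b);
  gram_sym : forall i y, (phi i @` dom i) y -> (gram i y)^T = gram i y;
  gram_pos : forall i y v, (phi i @` dom i) y -> v != 0 ->
    0 < vdot (gram i y) v v;
  gram_compat : forall i j x, dom i x -> dom j x ->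
    gram i (phi i x) = jacobian phi psi i j (phi i x) *m gram j (phi j x)
                       *m (jacobian phi psi i j (phi i x))^T
}.

Section Structure.
Variables (X : metricType R) (D : set X) (S : riem_structure D).

Definition gram_reg (P : set 'rV[R]_n -> ('rV[R]_n -> R) -> Prop) (U : set X) :=
  forall (i : chart S) a b,
    P (phi i @` (dom i `&` U)) (fun y => gram i y a b).

Definition smooth_metric_on (U : set X) := gram_reg (@smooth_on R n) U.
Definition C1alpha_metric_on (U : set X) := gram_reg (@C1alpha_on R n) U.

Definition coord (x : X) : 'rV[R]_n := phi (chart_at S x) x.
Definition gram_at (x : X) : 'M[R]_n := gram (chart_at S x) (coord x).

Definition riem_at (x : X) : tensor R n 4 :=
  riem_tensor (gram (chart_at S x)) (coord x).
Definition ric_at (x : X) : tensor R n 2 :=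
  ric_tensor (gram (chart_at S x)) (coord x).
Definition scal_at (x : X) : R :=
  scal_curv (gram (chart_at S x)) (coord x).

(* C^1 curves need not be immersed, so that, up to reparametrization, they
   include the piecewise C^1 curves, and may be taken to be defined on R. *)
Definition C1_curve (c : R -> X) :=
  [/\ continuous c, forall t, D (c t) &
      forall (i : chart S) t, dom i (c t) ->
        derivable (phi i \o c) t 1 /\ {for t, continuous ('D_1 (phi i \o c))}].

Definition speed (c : R -> X) (t : R) : R :=
  let u := 'D_1 (phi (chart_at S (c t)) \o c) t in
  Num.sqrt (vdot (gram_at (c t)) u u).

Definition curve_length (c : R -> X) : \bar R :=
  (\int[lebesgue_measure]_(t in `[0%R, 1%R]) (speed c t)%:E)%E.

Definition riem_dist (x y : X) : \bar R :=
  ereal_inf [set curve_length c | c in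
    [set c | [/\ C1_curve c, c 0 = x & c 1 = y]]].

Definition induces_dist := forall x y, D x -> D y ->
  (mdist x y)%:E = riem_dist x y.

Definition locally_induces_dist := forall x, D x ->
  exists2 r : R, 0 < r & forall y z, ball x r y -> ball x r z ->
    (mdist y z)%:E = riem_dist y z.

End Structure.

(* The class M(n, d, K1, K2, v); connectedness follows from finiteness of the
   Riemannian distance. *)
Definition class_M (d K1 K2 v : R) (M : metricType R) :=
  compact [set: M] /\
  exists S : riem_structure [set: M],
    [/\ smooth_metric_on S setT, induces_dist S,
        forall x y : M, mdist x y <= d,
        (v%:E <= hausdorff n [set: M])%E &
        forall x u,
          K1 * vdot (gram_at S x) u u <= teval (ric_at S x) [tuple u; u]
            <= K2 * vdot (gram_at S x) u u].

Definition closure_M (d K1 K2 v : R) (X : metricType R) :=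
  compact [set: X] /\
  exists M : nat -> metricType R,
    (forall k, class_M d K1 K2 v (M k)) /\ GH_cvg M X.

End Riemannian.
Arguments class_M {R} n d K1 K2 v M.
Arguments closure_M {R} n d K1 K2 v X.

(* Analysis on X with the measure hausdorff n. Since the regular set has full
   measure, integrals over X are written over the regular set. A tensor field
   is a family of tensors in the preferred charts; covector fields represent
   vector fields by duality, so that the gradient of f is represented by df. *)
Section Analysis.
Variables (R : realType) (n : nat) (X : pmetricType R).
Variable S : riem_structure R n (regular n X).

Definition tensor_field (k : nat) := X -> tensor R n k.

Definition hausdorffX (A : set (borel X)) : \bar R := @hausdorff R X n A.

Definition integralX (f : X -> R) : \bar R :=
  (\int[hausdorffX]_(x in (regular n X : set (borel X))) (f x)%:E)%E.

Definition aeX (P : X -> Prop) :=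
  {ae hausdorffX, forall x, P x}.

(* Measurability of the coefficients in every chart. *)
Definition borel_section k (T : tensor_field k) :=
  forall (i : chart S) (s : {ffun 'I_k -> 'I_n}),
    measurable_fun (dom i : set (borel X)) (fun x : borel X =>
      teval (T x) [tuple
        row (s j) (jacobian (@phi _ _ _ _ S) (@psi _ _ _ _ S)
                     i (chart_at S x) (phi i x)) | j < k]).

Definition dotX k (T T' : tensor_field k) (x : X) : R :=
  tdot (gram_at S x) (T x) (T' x).

Definition Lp_tensor k (p : R) (T : tensor_field k) :=
  borel_section T /\
  (integralX (fun x => Num.sqrt (dotX T T x) `^ p)%R < +oo)%E.

Definition L2_fun (f : X -> R) :=
  measurable_fun (regular n X : set (borel X)) (f : borel X -> R) /\
  (integralX (fun x => f x ^+ 2)%R < +oo)%E.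

Definition LIP (f : X -> R) :=
  exists K : R, forall x y, `|f x - f y| <= K * mdist x y.

(* df, defined a.e. for Lipschitz f. *)
Definition dfun (f : X -> R) : tensor_field 1 := fun x s =>
  pd (s ord0) (f \o psi (chart_at S x)) (coord S x).

Definition grad (f : X -> R) (x : X) : 'rV[R]_n :=
  sharp (gram_at S x) (dfun f x).

(* f belongs to H^{1,2}(X) with differential W, as limit of Lipschitz
   functions. *)
Definition is_diffH (f : X -> R) (W : tensor_field 1) :=
  [/\ L2_fun f, Lp_tensor 2 W & exists F : nat -> X -> R,
     [/\ forall k, LIP (F k),
        integralX (fun x => (F k x - f x) ^+ 2) @[k --> \oo] --> 0%E &
        integralX (fun x => let w := dfun (F k) x \- W x in
                     tdot (gram_at S x) w w) @[k --> \oo] --> 0%E]].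

Definition H12 (f : X -> R) := exists W, is_diffH f W.

(* f belongs to D^2(Delta, X), with Delta f = L. *)
Definition is_lap (f L : X -> R) :=
  L2_fun L /\ exists2 W, is_diffH f W &
    forall h W', is_diffH h W' ->
      integralX (dotX W W') = integralX (fun x => h x * L x).

Definition TestF (f : X -> R) :=
  LIP f /\ exists2 L, is_lap f L & H12 L.

(* For test functions f, g the function dotX (dfun f) (dfun g) is in H^{1,2};
   its differential is unique up to a.e. equality. *)
Definition is_hess (f : X -> R) (H : tensor_field 2) :=
  Lp_tensor 2 H /\
  forall g h, TestF g -> TestF h ->
  forall Wfh Wfg Wgh : tensor_field 1,
    is_diffH (dotX (dfun f) (dfun h)) Wfh ->
    is_diffH (dotX (dfun f) (dfun g)) Wfg ->
    is_diffH (dotX (dfun g) (dfun h)) Wgh ->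
    aeX (fun x => regular n X x ->
      2 * teval (H x) [tuple grad g x; grad h x] =
        dotX (dfun g) Wfh x + dotX (dfun h) Wfg x - dotX (dfun f) Wgh x).

Section Curvature.
Variable hess : (X -> R) -> tensor_field 2.

(* [grad f, grad g] *)
Definition bracketX (f g : X -> R) (x : X) : 'rV[R]_n :=
  sharp (gram_at S x)
    (tslot (hess g x) (grad f x) \- tslot (hess f x) (grad g x)).

Definition is_curvX (T : tensor_field 4) :=
  (forall q : R, 1 <= q < 2 -> Lp_tensor q T) /\
  forall f0 f1 f2 f3 f4 L1 L2,
    TestF f0 -> TestF f1 -> TestF f2 -> TestF f3 -> TestF f4 ->
    is_lap f1 L1 -> is_lap f2 L2 ->
    (integralX (fun x => (f0 x * tdot (gram_at S x) (T x)
       (tprod [tuple dfun f1 x; dfun f2 x; dfun f3 x; dfun f4 x]))%R) =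
     integralX (fun x => (
       (- dotX (dfun f0) (dfun f1) x + f0 x * L1 x)
         * teval (hess f3 x) [tuple grad f2 x; grad f4 x]
       - f0 x * tdot (gram_at S x) (tslot (hess f3 x) (grad f2 x))
                                   (tslot (hess f4 x) (grad f1 x)))%R)
     - integralX (fun x => (
       (- dotX (dfun f0) (dfun f2) x + f0 x * L2 x)
         * teval (hess f3 x) [tuple grad f1 x; grad f4 x]
       - f0 x * tdot (gram_at S x) (tslot (hess f3 x) (grad f1 x))
                                   (tslot (hess f4 x) (grad f2 x)))%R)
     - integralX (fun x => (
         f0 x * teval (hess f3 x) [tuple bracketX f1 f2 x; grad f4 x])%R))%E.

End Curvature.
End Analysis.

(* Main.v *)
(* In a chart around a point of [U] the metric is smooth, so that test functions can be built by
   cutting off functions of the coordinates: such a function is Lipschitz, its differential and its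
   Laplacian are the classical ones, and the latter is again Lipschitz. Verifying the weak Laplacian
   against an arbitrary element of H^{1,2}, a limit of Lipschitz functions, uses that the measure of
   [X] is sqrt(det g) dy in the chart and that Lipschitz functions on R^n are differentiable almost
   everywhere (Rademacher). Testing the definition of the Hessian with cut-off coordinates shows that
   it is the classical Hessian almost everywhere. In the identity which defines [R_X], the terms
   [- <grad f0, grad f1> + f0 Delta f1] are then removed by integrating by parts against the smooth
   function [Hess_{f3} (grad f2, grad f4)]; since [f0] is arbitrary, the fundamental lemma of the
   calculus of variations yields a pointwise formula, whose right-hand side is the classical curvature
   [R (grad f1, grad f2, grad f3, grad f4)] by metric compatibility of the Levi-Civita connection.
   Gradients of cut-off coordinates span the tangent space, which gives the equality of tensors near
   every point of [U]; countably many such neighbourhoods cover [U]. *)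
Require Import Defs.
From HB Require Import structures.
From mathcomp Require Import all_boot all_order all_algebra fingroup perm.
From mathcomp Require Import all_classical all_reals all_analysis.
From mathcomp Require Import measurable_realfun.
From mathcomp Require Import ring lra zify.

Set Implicit Arguments.
Unset Strict Implicit.
Unset Printing Implicit Defensive.

Import Order.TTheory GRing.Theory Num.Theory.
Import numFieldNormedType.Exports.

Local Open Scope classical_set_scope.
Local Open Scope ring_scope.

(** * Hausdorff measures *)

(** The distance of [X] is known only as an infimum of lengths, and the measure only through that
    distance. Near a point of a chart the distance is bilipschitz, with constants close to 1, to the
    Euclidean one after a linear change [T] such that the Gram matrix is [T *m T^T]. Both measures
    are then Hausdorff measures with one normalisation, and no identification with Lebesgue measure
    on R^n is made. Taking for [T] a Cholesky factor, only triangular maps have to be measured.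
    [hess] and [RX] are constrained by test functions and up to null sets. The Hessians in the
    identity are those of [f1], ..., [f4]; choosing these among the [n] cut-off coordinates leaves
    finitely many exceptional sets, while [f0], which enters through its gradient at most, is free.
    Finitely many derivatives are enough, so cut-offs come from powers of [max(0, t)] and regularity
    is counted by [ck]. Tensors live in preferred charts, which vary with the point without any
    regularity, whereas the analysis takes place in one fixed chart. The passage between them rests
    on writing the Hessian by iterated scalar products of gradients, which are functions and hence
    transport directly. *)

Section GeneralHausdorff.
Variables (R : realType) (n : nat).
Local Open Scope ereal_scope.

Section Def.
Variables (T : Type) (dl : T -> T -> R).

(** An arbitrary function [dl] takes the place of the distance, so that one theory serves [mdist] on
    [X] and [eucl_dist] on R^n, where the metric of the type is the sup norm. For [mdist] the result
    is convertible to [hausdorffX]. *)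
Definition gdiam (A : set T) : \bar R :=
  ereal_sup ([set 0] `|` [set (dl x y)%:E | x in A & y in A]).

Definition gweight (A : set T) : \bar R :=
  if `[< A = set0 >] then 0
  else (ball_volume R n / 2 ^+ n)%R%:E * gdiam A ^+ n.

Definition ghaus_pre (t : R) (A : set T) : \bar R :=
  ereal_inf [set \sum_(k <oo) gweight (C k) | C in
    [set C : nat -> set T |
      A `<=` \bigcup_k C k /\ forall k, gdiam (C k) <= t%:E]].

Definition ghaus (A : set T) : \bar R :=
  ereal_sup [set ghaus_pre t A | t in [set t : R | (0 < t)%R]].

Lemma gdiam_ge0 A : 0 <= gdiam A.
Proof. by apply: ereal_sup_ubound; left. Qed.

Lemma gdiam_ge A x y : A x -> A y -> (dl x y)%:E <= gdiam A.
Proof. by move=> Ax Ay; apply: ereal_sup_ubound; right; exists x => //; exists y. Qed.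

Lemma ball_volume_ge0 m : (0 <= ball_volume R m)%R.
Proof.
suff: (0 <= ball_volume R m)%R /\ (0 <= ball_volume R m.+1)%R by case.
elim: m => [|m [IH1 IH2]]; first by split=> /=.
by split=> //=; rewrite mulr_ge0// divr_ge0// mulr_ge0// pi_ge0.
Qed.

Lemma ball_const_ge0 : (0 <= ball_volume R n / 2 ^+ n)%R.
Proof. by rewrite divr_ge0 ?ball_volume_ge0 ?exprn_ge0. Qed.

Lemma gweight0 : gweight set0 = 0.
Proof. by rewrite /gweight; case: asboolP. Qed.

Lemma gweight_ge0 A : 0 <= gweight A.
Proof.
rewrite /gweight; case: asboolP => // _.
by rewrite mule_ge0 ?lee_fin ?ball_const_ge0 ?expe_ge0 ?gdiam_ge0.
Qed.

Lemma gweight_neq0 A : A !=set0 ->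
  gweight A = (ball_volume R n / 2 ^+ n)%R%:E * gdiam A ^+ n.
Proof. by rewrite /gweight; case: asboolP => // -> [? []]. Qed.

Lemma ghaus_pre_ge0 t A : 0 <= ghaus_pre t A.
Proof.
apply: le_ereal_inf_tmp => _ [C _ <-].
by apply: nneseries_ge0 => *; exact: gweight_ge0.
Qed.

Lemma ghaus_pre_le t A : (0 < t)%R -> ghaus_pre t A <= ghaus A.
Proof. by move=> t0; apply: ereal_sup_ubound; exists t. Qed.

Lemma ghaus_pre_anti s t A : (s <= t)%R -> ghaus_pre t A <= ghaus_pre s A.
Proof.
move=> st; apply: ereal_inf_le_tmp => _ [C [AC dC] <-]; exists C => //.
by split=> // k; rewrite (le_trans (dC k))// lee_fin.
Qed.

Lemma ghaus_ge0 A : 0 <= ghaus A.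
Proof. exact: le_trans (ghaus_pre_ge0 1 A) (ghaus_pre_le _ _). Qed.

Lemma gdiam_set0 : gdiam set0 = 0.
Proof.
apply/eqP; rewrite eq_le gdiam_ge0 andbT; apply: ge_ereal_sup => _ [->//|[x []]].
Qed.

Lemma ghaus0 : ghaus set0 = 0.
Proof.
apply/eqP; rewrite eq_le ghaus_ge0 andbT; apply: ge_ereal_sup => _ [t t0 <-].
apply: ereal_inf_lbound; exists (fun=> set0).
  by split=> // k; rewrite gdiam_set0 lee_fin ltW.
by apply: eseries0 => k _ _; exact: gweight0.
Qed.

Lemma ghaus_mono : {homo ghaus : A B / A `<=` B >-> A <= B}.
Proof.
move=> A B AB; apply: ge_ereal_sup => _ [t t0 <-].
apply: le_trans (ghaus_pre_le _ t0).
by apply: ereal_inf_le_tmp => _ [C [BC dC] <-]; exists C => //; split=> // x /AB/BC.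
Qed.

Lemma gdiam_mono A B : A `<=` B -> gdiam A <= gdiam B.
Proof.
move=> AB; apply: ge_ereal_sup => _ [->|[x Ax [y Ay <-]]]; first exact: gdiam_ge0.
by apply: gdiam_ge; exact: AB.
Qed.

Lemma expe_le (a b : \bar R) m : 0 <= a -> a <= b -> a ^+ m <= b ^+ m.
Proof.
move=> a0 ab; elim: m => // m IH; rewrite !expeS.
by apply: lee_pmul => //; exact: expe_ge0.
Qed.

End Def.

Section Lipschitz.
Variables (T T' : Type) (dl : T -> T -> R) (dl' : T' -> T' -> R).
Variables (f : T -> T') (L : R) (A : set T).
Hypotheses (L0 : (0 < L)%R)
  (fL : forall x y, A x -> A y -> (dl' (f x) (f y) <= L * dl x y)%R).

Lemma gdiam_image B : B `<=` A -> gdiam dl' (f @` B) <= L%:E * gdiam dl B.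
Proof.
move=> BA; apply: ge_ereal_sup => _ [->|[_ [x Bx <-] [_ [y By <-] <-]]].
  by rewrite mule_ge0 ?gdiam_ge0 ?lee_fin ?ltW.
apply: (@le_trans _ _ (L * dl x y)%:E); first by rewrite lee_fin fL//; exact: BA.
by rewrite EFinM lee_pmul2l ?lte_fin// gdiam_ge.
Qed.

Lemma expeZ (c : R) (a : \bar R) m : (0 < c)%R ->
  (c%:E * a) ^+ m = (c ^+ m)%:E * a ^+ m.
Proof.
move=> c0; elim: m => [|m IH]; first by rewrite !expe0 expr0 mule1.
by rewrite !expeS IH exprS EFinM -!muleA; congr (_ * _); rewrite !muleA (muleC a).
Qed.

Lemma gweight_image B C : B `<=` A -> B `<=` C ->
  gweight dl' (f @` B) <= (L ^+ n)%:E * gweight dl C.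
Proof.
move=> BA BC; have [->|B0] := eqVneq B set0.
  by rewrite image_set0 gweight0 mule_ge0 ?gweight_ge0 ?lee_fin ?exprn_ge0 ?ltW.
move/set0P : B0 => [b Bb].
rewrite !gweight_neq0; last 2 first.
  by exists b; exact: BC.
  by exists (f b); exists b.
rewrite muleCA -expeZ//; apply: lee_wpmul2l; first by rewrite lee_fin ball_const_ge0.
apply: expe_le; first exact: gdiam_ge0.
apply: le_trans (gdiam_image BA) _.
by rewrite lee_pmul2l ?lte_fin// gdiam_mono.
Qed.

(** Intersecting the sets of a cover with [A] before taking images makes the Lipschitz bound
    available; covers of mesh [t / L] then become covers of mesh [t], each weight growing at most by
    [L ^+ n]. *)
Lemma ghaus_image : ghaus dl' (f @` A) <= (L ^+ n)%:E * ghaus dl A.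
Proof.
apply: ge_ereal_sup => _ [t t0 <-].
have tL : (0 < t / L)%R by rewrite divr_gt0.
apply: (@le_trans _ _ ((L ^+ n)%:E * ghaus_pre dl (t / L) A)); last first.
  by rewrite lee_pmul2l ?lte_fin ?exprn_gt0// ghaus_pre_le.
rewrite -lee_pdivrMl ?exprn_gt0//; apply: le_ereal_inf_tmp => _ [C [AC dC] <-].
rewrite lee_pdivrMl ?exprn_gt0//.
apply: (@le_trans _ _ (\sum_(k <oo) gweight dl' (f @` (C k `&` A)))).
  apply: ereal_inf_lbound; exists (fun k => f @` (C k `&` A)) => //; split.
    by move=> _ [x Ax <-]; have [k _ Ck] := AC _ Ax; exists k => //; exists x.
  move=> k; apply: le_trans (gdiam_image _) _; first by move=> ? [].
  apply: (@le_trans _ _ (L%:E * (t / L)%:E)); last by rewrite -EFinM mulrC divfK ?gt_eqF.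
  by rewrite lee_pmul2l ?lte_fin// (le_trans _ (dC k))//; apply: gdiam_mono => ? [].
rewrite -nneseriesZl => [|? _]; last exact: gweight_ge0.
apply: lee_nneseries => [k _ _|k _]; first exact: gweight_ge0.
by apply: gweight_image => ? [].
Qed.

End Lipschitz.

Section Outer.
Variables (T : pointedType) (dl : T -> T -> R).
Let TD := g_sigma_algebraType [set: set T].

(** Giving infinite weight to the sets of diameter above [t] absorbs the mesh condition, and the
    discrete sigma-algebra [TD] admits every set in a cover; [ghaus_pre] thus becomes an instance of
    [mu_ext] and inherits its subadditivity. *)
Let trunc_weight (t : R) (A : set TD) : \bar R :=
  if gdiam dl A <= t%:E then gweight dl A else +oo.

Let trunc_weight_ge0 t A : 0 <= trunc_weight t A.
Proof. by rewrite /trunc_weight; case: ifP => // _; exact: gweight_ge0. Qed.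

Let ghaus_preE (t : R) A : (0 < t)%R -> ghaus_pre dl t A = mu_ext (trunc_weight t) A.
Proof.
move=> t0; apply/eqP; rewrite eq_le; apply/andP; split.
  apply: le_ereal_inf_tmp => _ [C [mC AC] <-].
  have [dC|] := pselect (forall k, gdiam dl (C k) <= t%:E).
    apply: ereal_inf_lbound; exists C => //.
    by apply: eq_eseriesr => k _; rewrite /trunc_weight dC.
  move=> /existsNP[k /negP dk]; rewrite (@eseries_pinfty _ _ _ k) ?leey//.
    by move=> i _; rewrite gt_eqF// (lt_le_trans _ (trunc_weight_ge0 _ _)).
  by rewrite /trunc_weight (negbTE dk).
apply: ereal_inf_le_tmp => _ [C [AC dC] <-]; exists C.
  by split=> // k; apply: sub_sigma_algebra.
by apply: eq_eseriesr => k _; rewrite /trunc_weight dC.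
Qed.

Lemma ghaus_sigma_subadditive : sigma_subadditive (ghaus dl).
Proof.
move=> F; apply: ge_ereal_sup => _ [t t0 <-]; rewrite ghaus_preE//.
apply: le_trans (mu_ext_sigma_subadditive (trunc_weight_ge0 t) _) _.
apply: lee_nneseries => [k _ _|k _]; first exact: mu_ext_ge0.
by rewrite -ghaus_preE// ghaus_pre_le.
Qed.

HB.instance Definition _ := isOuterMeasure.Build R T (ghaus dl)
  (ghaus0 dl) (ghaus_ge0 dl) (@ghaus_mono T dl) ghaus_sigma_subadditive.

(** A covering set of diameter at most [t < eta] cannot meet both [P] and [Q], so each term of a
    cover of the union is charged to at most one of them. *)
Lemma ghaus_pre_sep (P Q : set T) (eta t : R) : (t < eta)%R ->
  (forall x y, P x -> Q y -> (eta <= dl x y)%R) ->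
  ghaus_pre dl t P + ghaus_pre dl t Q <= ghaus_pre dl t (P `|` Q).
Proof.
move=> te sep; apply: le_ereal_inf_tmp => _ [C [AC dC] <-].
pose CC (P : set T) k := if `[< C k `&` P !=set0 >] then C k else set0.
have CCP (S : set T) : S `<=` P `|` Q ->
    ghaus_pre dl t S <= \sum_(k <oo) gweight dl (CC S k).
  move=> SPQ; apply: ereal_inf_lbound; exists (CC S) => //; split.
    move=> x Sx; have [k _ Ck] := AC _ (SPQ _ Sx).
    by exists k => //; rewrite /CC; case: asboolP => // -[]; exists x.
  move=> k; rewrite /CC; case: asboolP => // _.
  by rewrite gdiam_set0 (le_trans (gdiam_ge0 dl (C k))).
apply: (le_trans (leeD (CCP P _) (CCP Q _))) => [? ?|? ?|]; [by left|by right|].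
rewrite -nneseriesD => [|? *|? *]; rewrite ?gweight_ge0//.
apply: lee_nneseries => [k _ _|k _]; first by rewrite adde_ge0 ?gweight_ge0.
rewrite /CC; case: asboolP => [[x [Cx Px]]|_]; case: asboolP => [[y [Cy Qy]]|_];
  rewrite ?gweight0 ?adde0 ?add0e ?gweight_ge0//.
have := le_trans (gdiam_ge dl Cx Cy) (dC k); rewrite lee_fin => /le_lt_trans/(_ te).
by rewrite ltNge sep.
Qed.

Lemma ghaus_sep (P Q : set T) (eta : R) : (0 < eta)%R ->
  (forall x y, P x -> Q y -> (eta <= dl x y)%R) ->
  ghaus dl P + ghaus dl Q <= ghaus dl (P `|` Q).
Proof.
move=> eta0 sep.
(* [ghaus_pre] increases as the mesh decreases, so two meshes may be replaced by a common one below
   [eta]. *)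
have key (s t : R) : (0 < s)%R -> (0 < t)%R ->
    ghaus_pre dl s P + ghaus_pre dl t Q <= ghaus dl (P `|` Q).
  move=> s0 t0; pose u := Num.min (Num.min s t) (eta / 2)%R.
  have u0 : (0 < u)%R by rewrite !lt_min s0 t0 divr_gt0.
  have ue : (u < eta)%R by rewrite gt_min; apply/orP; right; lra.
  apply: le_trans (ghaus_pre_le dl _ u0); apply: le_trans (ghaus_pre_sep ue sep).
  by apply: leeD; apply: ghaus_pre_anti; rewrite !ge_min lexx ?orbT.
have [->|fPQ] := eqVneq (ghaus dl (P `|` Q)) +oo; first by rewrite leey.
have fin (x : \bar R) : 0 <= x -> x <= ghaus dl (P `|` Q) -> x \is a fin_num.
  move=> x0 xl; rewrite ge0_fin_numE// (le_lt_trans xl)// lt_neqAle fPQ leey//.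
have fQ : ghaus dl Q \is a fin_num.
  by apply: fin; [exact: ghaus_ge0|apply: ghaus_mono => ?; right].
rewrite -leeBrDr//; apply: ge_ereal_sup => _ [s s0 <-].
have fs : ghaus_pre dl s P \is a fin_num.
  apply: fin; [exact: ghaus_pre_ge0|apply: le_trans (ghaus_pre_le dl _ s0) _].
  by apply: ghaus_mono => ?; left.
rewrite leeBrDr// addeC -leeBrDr//; apply: ge_ereal_sup => _ [t t0 <-].
by rewrite leeBrDr// addeC key.
Qed.

End Outer.
End GeneralHausdorff.

Section Caratheodory.
Variables (R : realType) (n : nat) (T : pointedType) (dl : T -> T -> R).
Hypotheses (dl_sym : forall x y, dl x y = dl y x)
  (dl_tri : forall x y z, dl x z <= dl x y + dl y z).
Local Open Scope ereal_scope.
Let mu := ghaus n dl.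

Definition dist_closed (F : set T) :=
  forall x, ~ F x -> exists2 r : R, (0 < r)%R & forall y, F y -> (r <= dl x y)%R.

(* Caratheodory's criterion: mu is additive on sets at positive distance, hence on A `&` F and the
   part A_k of A at distance >= 1/(k+1) from F; the annuli A_(k+1) \ A_k of the
   same parity are at positive distance, so that their measures are summable. *)
Lemma ghaus_caratheodory_closed (F : set T) : dist_closed F ->
  caratheodory_measurable mu F.
Proof.
move=> Fcl; apply: (@le_caratheodory_measurable R T (ghaus n dl)) => A.
pose q (k : nat) : R := (k.+1%:R^-1)%R.
have q0 k : (0 < q k)%R by rewrite /q invr_gt0.
have qd k l : (k < l)%N -> (q l < q k)%R by move=> kl; rewrite /q ltf_pV2 ?posrE// ltr_nat.
pose B k := [set x | A x /\ forall y, F y -> (q k <= dl x y)%R].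
pose D k := B k.+1 `\` B k.
have BS k l : (k <= l)%N -> B k `<=` B l.
  move=> kl x [Ax Bx]; split=> // y Fy; apply: le_trans (Bx y Fy).
  by rewrite /q lef_pV2 ?posrE// ler_nat.
have DA k : D k `<=` A by move=> x [[]].
have AFB : A `&` ~` F `<=` \bigcup_k B k.
  move=> x [Ax /Fcl[r r0 Fr]].
  have [N Nr] : exists N : nat, (q N <= r)%R.
    exists (Num.truncn r^-1); rewrite /q invf_ple ?posrE//.
    by apply/ltW; rewrite truncnS_gt ?invr_ge0 ?ltW.
  by exists N => //; split=> // y Fy; exact: le_trans (Fr _ Fy).
change (ghaus n dl (A `&` F) + ghaus n dl (A `&` ~` F) <= ghaus n dl A).
have [->|Afin] := eqVneq (ghaus n dl A) +oo; first by rewrite leey.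
have fin (P : set T) : P `<=` A -> ghaus n dl P \is a fin_num.
  move=> PA; rewrite ge0_fin_numE ?ghaus_ge0//.
  by rewrite (le_lt_trans (ghaus_mono n dl PA))// lt_neqAle Afin leey.
have FB k : ghaus n dl (A `&` F) + ghaus n dl (B k) <= ghaus n dl A.
  have sep x y : (A `&` F) x -> B k y -> (q k <= dl x y)%R.
    by move=> [_ Fx] [_ By]; rewrite dl_sym By.
  apply: le_trans (ghaus_sep n (q0 k) sep) _.
  by apply: ghaus_mono => x [[]|[]].
(* A point of [D l] has some point of [F] within [q l], while a point of [D k] is at distance at
   least [q k.+1] from all of [F]. *)
have Dsep k l : (k.+1 < l)%N -> forall x y, D k x -> D l y ->
    (q k.+1 - q l <= dl x y)%R.
  move=> kl x y [[Ax Bx] _] [[Ay _] nBy].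
  have [z [Fz zy]] : exists z, F z /\ (dl y z < q l)%R.
    apply: contrapT => nz; apply: nBy; split=> // z Fz.
    by rewrite leNgt; apply/negP => zy; apply: nz; exists z.
  have := Bx _ Fz; have := dl_tri x y z; lra.
have par (b : nat) m : \sum_(j < m) ghaus n dl (D (j.*2 + b)%N) <=
    ghaus n dl (\bigcup_(j < m) D (j.*2 + b)%N).
  elim: m => [|m IH]; first by rewrite big_ord0 ghaus_ge0.
  rewrite big_ord_recr/=; apply: (le_trans (leeD2r _ IH)).
  have e0 : (0 < q (m.*2 + b).+1 - q (m.*2 + b).+2)%R by rewrite subr_gt0 qd.
  case: m IH e0 => [|m] IH e0.
    apply: (@le_trans _ _ (ghaus n dl (D (0.*2 + b)%N))).
      rewrite (_ : \bigcup_(j < 0) _ = set0) ?ghaus0 ?add0e//.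
      by apply: bigcup0 => i.
    by apply: ghaus_mono => x Dx; exists 0%N.
  have e1 : (0 < q (m.*2 + b).+1 - q (m.+1.*2 + b))%R by rewrite subr_gt0 qd.
  apply: (le_trans (ghaus_sep n e1 _)) => [x y [j /= jm Dx] Dy|].
    apply: le_trans (Dsep (j.*2 + b)%N (m.+1.*2 + b)%N _ _ _ Dx Dy); last first.
      by rewrite doubleS; lia.
    rewrite lerD2r; have [->//|jm'] := eqVneq j m.
    by apply/ltW/qd; rewrite ltnS ltn_add2r ltn_double ltn_neqAle jm' -ltnS.
  apply: ghaus_mono => x [[j /= jm Dx]|Dx]; last by exists m.+1 => /=.
  by exists j => //=; exact: ltnW.
have par2 m : \sum_(j < m.*2) ghaus n dl (D j) <= ghaus n dl A + ghaus n dl A.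
  apply: (@le_trans _ _ (\sum_(j < m) ghaus n dl (D (j.*2 + 0)%N) +
                         \sum_(j < m) ghaus n dl (D (j.*2 + 1)%N))).
    rewrite -big_split/=; elim: m => [|m IH]; first by rewrite !big_ord0.
    rewrite doubleS 2!big_ord_recr/= [leRHS]big_ord_recr/= -addeA addn0 addn1.
    exact: leeD2r.
  by apply: leeD; apply: le_trans (par _ _) _; apply: ghaus_mono => x [j _ /DA].
have sumfin : \sum_(0 <= j <oo) ghaus n dl (D j) < +oo.
  apply: (@le_lt_trans _ _ (ghaus n dl A + ghaus n dl A)); last first.
    have fA : ghaus n dl A \is a fin_num by apply: fin.
    by rewrite -(fineK fA) -EFinD ltry.
  apply: lime_le; first by apply: is_cvg_nneseries => *; exact: ghaus_ge0.
  apply: nearW => m; apply: le_trans (par2 m); rewrite big_mkord.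
  have mm : (m <= m.*2)%N by rewrite -addnn leq_addr.
  rewrite -!(big_mkord xpredT (fun j => ghaus n dl (D j))).
  by apply: lee_sum_nneg_natr => // i _ _; exact: ghaus_ge0.
have tail := @nneseries_tail_cvg R (fun j => ghaus n dl (D j)) xpredT sumfin
  (fun j _ => ghaus_ge0 n dl (D j)).
have bnd k : ghaus n dl (A `&` F) + ghaus n dl (A `&` ~` F) <=
    ghaus n dl A + \sum_(k <= j <oo) ghaus n dl (D j).
  apply: (@le_trans _ _ (ghaus n dl (A `&` F) + (ghaus n dl (B k) +
            \sum_(k <= j <oo) ghaus n dl (D j)))); last by rewrite addeA leeD2r.
  apply: leeD2l.
  have sub : A `&` ~` F `<=` B k `|` \bigcup_(j in ~` `I_k) D j.
    move=> x /AFB[m _]; elim: m => [|m IH] Bx.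
      by left; exact: BS Bx.
    have [/IH//|nBm] := pselect (B m x).
    have [mk|km] := leqP m.+1 k; first by left; exact: BS mk _ Bx.
    by right; exists m => //; apply/negP; rewrite -leqNgt.
  apply: le_trans (ghaus_mono n dl sub) _.
  have U2 := @outer_measureU2 T R (ghaus n dl) (B k)
    (\bigcup_(j in ~` `I_k) D j).
  apply: (le_trans U2); apply: leeD2l.
  exact: (@outer_measure_sigma_subadditive_tail T R (ghaus n dl) k D).
have lim : (fun k => ghaus n dl A + \sum_(k <= j <oo) ghaus n dl (D j)) @ \oo
    --> ghaus n dl A.
  rewrite -[X in _ --> X]adde0; apply: cvgeD => //; last exact: cvg_cst.
  by rewrite fin_num_adde_defl.
rewrite -(cvg_lim _ lim)//; apply: lime_ge; first by apply/cvg_ex; eexists; exact: lim.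
exact: nearW.
Qed.
End Caratheodory.

Section BorelHausdorff.
Variables (R : realType) (n : nat) (T : ptopologicalType) (dl : T -> T -> R).
Hypotheses (dl_sym : forall x y, dl x y = dl y x)
  (dl_tri : forall x y z, dl x z <= dl x y + dl y z)
  (dl_closed : forall F, closed F -> dist_closed dl F).
Local Open Scope ereal_scope.

Lemma ghaus_caratheodory_borel (A : set (borel T)) : measurable A ->
  caratheodory_measurable (ghaus n dl) A.
Proof.
pose mu := ghaus n dl.
move=> mA; suff: <<s [set A : set T | caratheodory_measurable mu A] >> A.
  have : sigma_algebra setT [set A : set T | caratheodory_measurable mu A].
    split.
    - exact: (@caratheodory_measurable_set0 R T (ghaus n dl)).
    - move=> B mB; rewrite setTD.
      exact: (@caratheodory_measurable_setC R T (ghaus n dl)).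
    - by move=> F mF; exact: (@caratheodory_measurable_bigcup R T (ghaus n dl)).
  by move=> /sigma_algebra_id ->.
apply: sub_sigma_algebra2 mA => O oO; rewrite -(setCK O).
apply: (@caratheodory_measurable_setC R T (ghaus n dl)).
by apply: ghaus_caratheodory_closed => //; apply: dl_closed; exact: open_closedC.
Qed.

Lemma ghaus_semi_sigma_additive :
  semi_sigma_additive (ghaus n dl : set (borel T) -> \bar R).
Proof.
move=> F mF tF mUF.
apply: (@caratheodory_measure_sigma_additive R T (ghaus n dl)) => //.
  by move=> k; exact: ghaus_caratheodory_borel.
exact: ghaus_caratheodory_borel.
Qed.

End BorelHausdorff.

Lemma mdist_closed (R : realType) (X : pmetricType R) (F : set X) :
  closed F -> dist_closed (@mdist R X) F.
Proof.
move=> cF x Fx; have : nbhs x (~` F) by apply: open_nbhs_nbhs; split=> //; exact: closed_openC.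
move/nbhs_ballP => -[r /= r0 rF]; exists r => // y Fy.
by rewrite leNgt; apply/negP => xy; apply: (rF y) => //; rewrite ballEmdist.
Qed.

Section HausdorffX.
Variables (R : realType) (n : nat) (X : pmetricType R).

Lemma hausdorffXE : @hausdorffX R n X = ghaus n (@mdist R X).
Proof. by []. Qed.

Lemma hausdorffX0 : @hausdorffX R n X set0 = 0%E.
Proof. exact: ghaus0. Qed.

Lemma hausdorffX_ge0 A : (0 <= @hausdorffX R n X A)%E.
Proof. exact: ghaus_ge0. Qed.

Lemma hausdorffX_sigma_additive : semi_sigma_additive (@hausdorffX R n X).
Proof.
apply: ghaus_semi_sigma_additive; [exact: metric_sym|exact: metric_triangle|exact: mdist_closed].
Qed.

HB.instance Definition _ := isMeasure.Build _ _ _ (@hausdorffX R n X)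
  hausdorffX0 hausdorffX_ge0 hausdorffX_sigma_additive.

End HausdorffX.

Lemma sum_CauchySchwarz (R : realFieldType) (I : finType) (a b : I -> R) :
  (\sum_i a i * b i) ^+ 2 <= (\sum_i a i ^+ 2) * (\sum_i b i ^+ 2).
Proof.
set A := \sum_i a i ^+ 2; set B := \sum_i a i * b i; set C := \sum_i b i ^+ 2.
have A0 : 0 <= A by apply: sumr_ge0 => i _; exact: sqr_ge0.
have C0 : 0 <= C by apply: sumr_ge0 => i _; exact: sqr_ge0.
have [A00|An0] := eqVneq A 0.
  have a0 i : a i = 0.
    by apply/eqP; rewrite -sqrf_eq0; move/eqP: A00;
      rewrite psumr_eq0 => [/allP/(_ i (mem_index_enum _)) //|j _]; exact: sqr_ge0.
  rewrite /B big1 ?expr0n ?mulr_ge0// => i _; by rewrite a0 mul0r.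
have : 0 <= \sum_i (A * b i - B * a i) ^+ 2 by apply: sumr_ge0 => i _; exact: sqr_ge0.
have -> : \sum_i (A * b i - B * a i) ^+ 2 = A * (A * C - B ^+ 2).
  rewrite (eq_bigr (fun i => A ^+ 2 * b i ^+ 2 - (2 * A * B) * (a i * b i)
     + B ^+ 2 * a i ^+ 2)) => [|i _]; last by ring.
  rewrite big_split/= big_split/= sumrN -!mulr_sumr -/A -/B -/C; ring.
by rewrite pmulr_rge0 ?lt_neqAle ?A0 1?eq_sym ?An0// subr_ge0.
Qed.

(** * Row vectors: Euclidean norm, Borel structure and Hausdorff measure *)

Section RowVectors.
Variables (R : realType) (n : nat).
Local Notation V := 'rV[R]_n.
Implicit Types u v w : V.

Lemma rV_normP v (r : R) : 0 <= r -> reflect (forall i, `|v 0 i| <= r) (`|v| <= r).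
Proof.
move=> r0; rewrite /Num.norm/= mx_normrE; apply: (iffP idP).
  by move=> /bigmax_leP[_ +] i => /(_ (0, i)); apply.
by move=> H; apply/bigmax_leP; split=> // -[j i] _; rewrite ord1 H.
Qed.

Lemma rV_coord_le v i : `|v 0 i| <= `|v|.
Proof. by apply/rV_normP. Qed.

Definition enorm v : R := Num.sqrt (\sum_(i < n) v 0 i ^+ 2).

Lemma enorm_sqr v : enorm v ^+ 2 = \sum_(i < n) v 0 i ^+ 2.
Proof. by rewrite sqr_sqrtr//; apply: sumr_ge0 => i _; exact: sqr_ge0. Qed.

Lemma enorm_ge0 v : 0 <= enorm v. Proof. exact: sqrtr_ge0. Qed.

Lemma eucl_distE u v : eucl_dist u v = enorm (u - v).
Proof. by congr Num.sqrt; apply: eq_bigr => i _; rewrite !mxE. Qed.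

Lemma enormN v : enorm (- v) = enorm v.
Proof. by congr Num.sqrt; apply: eq_bigr => i _; rewrite mxE sqrrN. Qed.

Lemma enorm_dot u v : \sum_i u 0 i * v 0 i <= enorm u * enorm v.
Proof.
apply: le_trans (ler_norm _) _.
rewrite -(@ler_pXn2r _ 2) ?nnegrE ?normr_ge0 ?mulr_ge0 ?enorm_ge0//.
by rewrite exprMn !enorm_sqr real_normK ?num_real// sum_CauchySchwarz.
Qed.

Lemma enormD u v : enorm (u + v) <= enorm u + enorm v.
Proof.
rewrite -(@ler_pXn2r _ 2) ?nnegrE ?addr_ge0 ?enorm_ge0// enorm_sqr sqrrD !enorm_sqr.
rewrite (eq_bigr (fun i => u 0 i ^+ 2 + 2 * (u 0 i * v 0 i) + v 0 i ^+ 2)) => [|i _].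
  by rewrite !big_split/= -mulr_sumr; have := enorm_dot u v; lra.
by rewrite mxE sqrrD -mulr_natl.
Qed.

Lemma enormZ (c : R) v : enorm (c *: v) = `|c| * enorm v.
Proof.
rewrite /enorm (eq_bigr (fun i => c ^+ 2 * v 0 i ^+ 2)) => [|i _].
  by rewrite -mulr_sumr sqrtrM ?sqr_ge0// sqrtr_sqr.
by rewrite mxE exprMn.
Qed.

Lemma norm_le_enorm v : `|v| <= enorm v.
Proof.
apply/rV_normP => [|i]; first exact: enorm_ge0.
rewrite -(@ler_pXn2r _ 2) ?nnegrE ?enorm_ge0// enorm_sqr real_normK ?num_real//.
by rewrite (bigD1 i)//= lerDl; apply: sumr_ge0 => j _; exact: sqr_ge0.
Qed.

Lemma enorm_le_norm v : enorm v <= n%:R * `|v|.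
Proof.
rewrite -(@ler_pXn2r _ 2) ?nnegrE ?enorm_ge0 ?mulr_ge0// enorm_sqr exprMn.
apply: (@le_trans _ _ (\sum_(i < n) `|v| ^+ 2)).
  apply: ler_sum => i _; rewrite -[leLHS]real_normK ?num_real//.
  by rewrite ler_pXn2r ?nnegrE//; exact: rV_coord_le.
rewrite sumr_const card_ord -[leLHS]mulr_natl ler_wpM2r ?sqr_ge0//.
by rewrite -natrX ler_nat; case: (n) => // k; nia.
Qed.

Lemma eucl_dist_sym u v : eucl_dist u v = eucl_dist v u.
Proof. by rewrite !eucl_distE -opprB enormN. Qed.

Lemma eucl_dist_triangle u v w : eucl_dist u w <= eucl_dist u v + eucl_dist v w.
Proof. by rewrite !eucl_distE (le_trans _ (enormD _ _))// addrA subrK. Qed.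

Lemma nbhs_rV u (P : set V) : nbhs u P <->
  exists2 r : R, 0 < r & forall v, `|u - v| < r -> P v.
Proof.
split=> [/nbhs_ballP[r /= r0 rP]|[r r0 rP]].
  by exists r => // v uv; apply: rP; rewrite -ball_normE.
by apply/nbhs_ballP; exists r => // v; rewrite -ball_normE => /rP.
Qed.

Lemma eucl_dist_closed (F : set V) : closed F -> dist_closed (@eucl_dist R n) F.
Proof.
move=> cF x Fx; have : nbhs x (~` F) by apply: open_nbhs_nbhs; split=> //; exact: closed_openC.
move=> /nbhs_rV[r r0 rF]; exists r => // y Fy.
rewrite leNgt; apply/negP => xy; apply: (rF y) => //.
by rewrite (le_lt_trans (norm_le_enorm _))// -eucl_distE.
Qed.

(** The reference measure on R^n is the Hausdorff measure of the Euclidean distance itself. It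
    carries the normalisation of [hausdorffX], so that Lipschitz maps compare the two without any
    constant. *)
Definition muV (A : set (borel V)) : \bar R := ghaus n (@eucl_dist R n) A.

Lemma muV0 : muV set0 = 0%E. Proof. exact: ghaus0. Qed.
Lemma muV_ge0 A : (0 <= muV A)%E. Proof. exact: ghaus_ge0. Qed.
Lemma muV_sigma_additive : semi_sigma_additive muV.
Proof.
apply: ghaus_semi_sigma_additive; [exact: eucl_dist_sym|exact: eucl_dist_triangle|
  exact: eucl_dist_closed].
Qed.

HB.instance Definition _ := isMeasure.Build _ _ _ muV muV0 muV_ge0 muV_sigma_additive.

Lemma open_borel (T : ptopologicalType) (A : set T) : open A -> measurable (A : set (borel T)).
Proof. exact: sub_sigma_algebra. Qed.

Lemma closed_borel (T : ptopologicalType) (A : set T) : closed A ->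
  measurable (A : set (borel T)).
Proof. by move=> cA; rewrite -(setCK A); apply: measurableC; exact: (open_borel (closed_openC cA)). Qed.

Lemma continuous_borel (T : ptopologicalType) (D : set T) (f : T -> R) : open D ->
  (forall x, D x -> {for x, continuous f}) ->
  measurable_fun (D : set (borel T)) (f : borel T -> R).
Proof.
move=> oD cf; apply: (measurability _ (measurable_realfun.RGenOpens.measurableE R)) => _ [_ [a [b ->]] <-].
apply: open_borel; rewrite openE => x [Dx abx].
have : nbhs x D by exact: open_nbhs_nbhs.
have : nbhs x (f @^-1` `]a, b[) by apply: (cf x Dx); apply: open_nbhs_nbhs; split=> //; exact: interval_open.
by apply: filterS2 => y.
Qed.

(** An open set is the countable union of the rational boxes that it contains, and the preimage of a
    box is a finite intersection of preimages under the coordinates. *)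
Lemma measurable_rV d (T : measurableType d) (D : set T) (f : T -> borel V) :
  (forall i, measurable_fun D (fun x => (f x : V) 0 i)) -> measurable_fun D f.
Proof.
move=> mf mD; move: (mD).
suff : measurable_fun D f by apply.
apply: (@measurability _ _ T (borel V) D f (@open V)); first by [].
move=> _ [W oW <-].
pose box (q : 'rV[rat]_n * nat) : set V :=
  [set y : V | forall i, `|ratr (q.1 0 i) - y 0 i| < q.2.+1%:R^-1].
have -> : D `&` f @^-1` W = \bigcup_(q : 'rV[rat]_n * nat)
  (if `[< box q `<=` W >] then D `&` f @^-1` box q else set0).
  apply/seteqP; split=> [x [Dx Wx]|x [q _]]; last by case: asboolP => // qO [Dx /qO].
  have : nbhs (f x : V) W by exact: open_nbhs_nbhs.
  move=> /nbhs_rV[r r0 rW].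
  have [k kr] : exists k : nat, k.+1%:R^-1 < r / 2.
    exists (Num.truncn (r / 2)^-1); rewrite invf_plt ?posrE ?divr_gt0//.
    by rewrite truncnS_gt ?invr_ge0 ?ltW ?divr_gt0.
  have k0 : 0 < k.+1%:R^-1 :> R by rewrite invr_gt0.
  have [e ek] : exists e : R, e = k.+1%:R^-1 by exists k.+1%:R^-1.
  rewrite -ek in kr k0.
  have /choice[q qf] : forall i : 'I_n, exists q : rat, `|ratr q - (f x : V) 0 i| < e.
    move=> i; have /rat_in_itvoo[q] : (f x : V) 0 i - e < (f x : V) 0 i + e by lra.
    by rewrite in_itv/= => qi; exists q; rewrite ltr_norml; lra.
  exists (\row_i q i, k) => //; case: asboolP => [_|[]]; first by split=> // i; rewrite /= mxE -ek.
  move=> y /= yq; apply: rW; apply: (@le_lt_trans _ _ (e + e)); last lra.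
  apply/rV_normP => [|i]; first lra.
  have := yq i; have := qf i; rewrite -ek !mxE !ltr_norml ler_norml; lra.
apply: countable_bigcupT_measurable => [|q]; first exact: countableP.
case: asboolP => // _.
have -> : D `&` f @^-1` box q = D `&` \bigcap_(i in [set: 'I_n])
    (D `&` (fun x => (f x : V) 0 i) @^-1` [set t | `|ratr (q.1 0 i) - t| < q.2.+1%:R^-1]).
  apply/seteqP; split=> x [Dx bx]; split=> // i; last by have [] := bx i I.
  by split=> //; exact: bx.
apply: measurableI => //; apply: fin_bigcap_measurable => // i _.
apply: mf => //; apply: open_measurable.
rewrite (_ : [set t | _] = ball (ratr (q.1 0 i) : R) q.2.+1%:R^-1); first exact: ball_open.
by rewrite -ball_normE.
Qed.

Lemma measurable_coord (i : 'I_n) :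
  measurable_fun setT (fun x : borel V => (x : V) 0 i).
Proof.
by apply: (@continuous_borel V setT) => [|x _]; [exact: openT|exact: coord_continuous].
Qed.

Lemma continuous_borel_rV (T : ptopologicalType) (D : set T) (f : T -> V) : open D ->
  (forall x, D x -> {for x, continuous f}) ->
  measurable_fun (D : set (borel T)) (f : borel T -> borel V).
Proof.
move=> oD cf; apply: measurable_rV => i; apply: continuous_borel => // x Dx.
apply: (@continuous_comp _ _ _ f (fun y : V => y 0 i)); first exact: cf.
exact: coord_continuous.
Qed.

End RowVectors.

(** * Hausdorff measure on R^n *)

Section EuclideanMeasure.
Variables (R : realType) (n : nat).
Local Notation V := 'rV[R]_n.
Local Notation mu := (@muV R n).

Lemma muV_image (f : V -> V) (L : R) (A : set V) : 0 < L ->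
  (forall x y, A x -> A y -> enorm (f x - f y) <= L * enorm (x - y)) ->
  (mu (f @` A) <= (L ^+ n)%:E * mu A)%E.
Proof.
move=> L0 fL; apply: ghaus_image => // x y Ax Ay.
by rewrite !eucl_distE fL.
Qed.

Lemma muV_isometry (f g : V -> V) (A : set V) : cancel g f -> cancel f g ->
  (forall x y, enorm (f x - f y) = enorm (x - y)) ->
  mu (f @^-1` A) = mu A.
Proof.
move=> gK fK fi; apply/eqP; rewrite eq_le; apply/andP; split.
  have -> : f @^-1` A = g @` A.
    apply/seteqP; split=> [x /= Ax|_ [x Ax <-]]; first by exists (f x).
    by rewrite /= gK.
  apply: le_trans (@muV_image g 1 A ltr01 _) _ => [x y _ _|].
    by rewrite mul1r -fi !gK.
  by rewrite expr1n mul1e.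
have {1}-> : A = f @` (f @^-1` A).
  by apply/seteqP; split=> [x Ax|_ [x Ax <-]//]; exists (g x); rewrite /= gK.
apply: le_trans (@muV_image f 1 _ ltr01 _) _ => [x y _ _|].
  by rewrite mul1r fi.
by rewrite expr1n mul1e.
Qed.

Lemma muV_translate (v : V) (A : set V) : mu ((fun y => y + v) @^-1` A) = mu A.
Proof.
apply: (@muV_isometry _ (fun y => y - v)) => [x|x|x y]; rewrite ?subrK ?addrK//.
by rewrite opprD addrACA subrr addr0.
Qed.

Definition vball (r : R) : set V := [set y | `|y| <= r].

Lemma closed_vball r : closed (vball r).
Proof.
rewrite (_ : vball r = (fun y : V => `|y|) @^-1` [set t | t <= r])//.
apply: closed_comp (@closed_le R r) => y _; exact: norm_continuous.
Qed.

Lemma measurable_vball r : measurable (vball r : set (borel V)).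
Proof. exact: (closed_borel (@closed_vball r)). Qed.

Lemma nneseries_ord (f : nat -> \bar R) (N : nat) :
  (forall k, (0 <= f k)%E) -> (forall k, (N <= k)%N -> f k = 0%E) ->
  (\sum_(k <oo) f k = \sum_(k < N) f k)%E.
Proof.
move=> f0 fN; rewrite (@nneseries_split R f 0 N)// add0n big_mkord.
rewrite (@eseries0 R f N predT); first by rewrite adde0.
by move=> k kN _; exact: fN.
Qed.

(** The sup-norm ball is a cube. Cut into [m ^ n] cells of side [2 * r / m], it gets a total weight
    that does not depend on [m], while the mesh tends to 0. *)
Lemma muV_vball_fin (r : R) : (mu (vball r) < +oo)%E.
Proof.
wlog r0 : r / 0 < r.
  move=> H; have [|r0] := ltP 0 r; first exact: H.
  apply: le_lt_trans (H 1 ltr01); apply: le_measure; rewrite ?inE.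
  - exact: measurable_vball.
  - exact: measurable_vball.
  by move=> y /= yr; apply: le_trans yr _; rewrite (le_trans r0).
pose c := ball_volume R n / 2 ^+ n * (n%:R * (2 * r)) ^+ n.
apply: (@le_lt_trans _ _ c%:E); last exact: ltry.
apply: ge_ereal_sup => _ [t /= t0 <-].
pose m := (Num.truncn (n%:R * (2 * r) / t)).+1.
have m0 : 0 < m%:R :> R by rewrite ltr0n.
have mt : n%:R * (2 * r) / m%:R <= t.
  rewrite ler_pdivrMr//; have : n%:R * (2 * r) / t < m%:R by exact: truncnS_gt.
  by rewrite ltr_pdivrMr// [m%:R * t]mulrC => /ltW.
have [dt dtE] : exists dt : R, dt = 2 * r / m%:R by exists (2 * r / m%:R).
have dt0 : 0 < dt by rewrite dtE divr_gt0 ?mulr_gt0.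
pose cell (f : {ffun 'I_n -> 'I_m}) : set V := [set y | forall i,
  - r + (f i)%:R * dt <= y 0 i <= - r + (f i).+1%:R * dt].
have dcell f : (gdiam (@eucl_dist R n) (cell f) <= (n%:R * (2 * r) / m%:R)%:E)%E.
  apply: ge_ereal_sup => _ [->|[x fx [y fy <-]]].
    by rewrite lee_fin divr_ge0 ?mulr_ge0// ltW.
  rewrite lee_fin eucl_distE (le_trans (enorm_le_norm _))// -mulrA ler_wpM2l// -dtE.
  apply/rV_normP => [|i]; first exact: ltW.
  rewrite !mxE; have := fx i; have := fy i.
  rewrite -natr1 !(mulrDl _ _ dt) mul1r ler_norml.
  set z := _ * dt; lra.
pose F := {ffun 'I_n -> 'I_m}.
pose C (k : nat) : set V := if insub k is Some j then cell (@enum_val F xpredT j) else set0.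
apply: (@le_trans _ _ (\sum_(k <oo) gweight n (@eucl_dist R n) (C k))%E).
  apply: ereal_inf_lbound; exists C => //; split.
    move=> y /= /rV_normP yr.
    (* On the far faces of the cube the quotient equals [m]; [minn] puts those points into the last
       cell. *)
    pose k i := minn (Num.truncn ((y 0 i + r) / dt)) m.-1.
    have km i : (k i < m)%N by rewrite /k ltnS geq_minr.
    exists (enum_rank ([ffun i => Ordinal (km i)] : F)) => //.
    rewrite /C valK enum_rankK => i; rewrite ffunE/=.
    have yi := yr (ltW r0) i; rewrite ler_norml in yi.
    have z0 : 0 <= (y 0 i + r) / dt by rewrite divr_ge0 ?(ltW dt0)//; lra.
    have := truncn_itv z0; rewrite ler_pdivlMr// ltr_pdivrMr//.
    rewrite /k; set j := Num.truncn _ => jz.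
    have mdt : m%:R * dt = 2 * r by rewrite dtE mulrC divfK// gt_eqF.
    have [jm|mj] := leqP j m.-1; first by lra.
    have : m%:R * dt <= j%:R * dt by rewrite ler_wpM2r ?(ltW dt0)// ler_nat.
    have : m.-1.+1%:R = m%:R :> R by [].
    have : m.-1.+1%:R = m.-1%:R + 1 :> R by rewrite -addn1 natrD.
    move: (m.-1.+1%:R) (m.-1%:R) mdt => a b; nra.
  move=> j; rewrite /C; case: insubP => [i _ _|_].
    by rewrite (le_trans (dcell _))// lee_fin.
  by rewrite gdiam_set0 lee_fin ltW.
rewrite (@nneseries_ord _ #|F|) => [|k|k kF]; last 2 first.
  exact: gweight_ge0.
  by rewrite /C insubN ?gweight0// -leqNgt.
apply: (@le_trans _ _ (\sum_(k < #|F|) (ball_volume R n / 2 ^+ n *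
    (n%:R * (2 * r) / m%:R) ^+ n)%:E)%E).
  apply: lee_sum => k _; rewrite /C insubT//= => kF.
  rewrite /gweight; case: asboolP => _.
    by rewrite lee_fin mulr_ge0 ?ball_const_ge0// exprn_ge0// divr_ge0 ?mulr_ge0// ltW.
  rewrite [X in (_ <= X)%E]EFinM EFin_expe; apply: lee_wpmul2l.
    by rewrite lee_fin ball_const_ge0.
  by apply: expe_le; [exact: gdiam_ge0|exact: dcell].
rewrite sumEFin lee_fin sumr_const card_ord card_ffun !card_ord -[leLHS]mulr_natr.
rewrite /c natrX; move: (ball_volume R n / 2 ^+ n) => b.
by rewrite expr_div_n -mulrA divfK// expf_neq0// gt_eqF.
Qed.

Lemma muV_sigma_finite : sigma_finite setT mu.
Proof.
exists (fun k => vball k%:R) => [|k]; last first.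
  by split; [exact: measurable_vball|exact: muV_vball_fin].
apply/esym/seteqP; split=> // y _; exists (Num.truncn `|y|).+1 => //=.
by apply/ltW; rewrite truncnS_gt.
Qed.

HB.instance Definition _ := Measure_isSigmaFinite.Build _ _ _ mu muV_sigma_finite.

Definition lin (S : 'M[R]_n) (y : borel V) : borel V := (y : V) *m S.

Lemma linN1 (y : borel V) : lin (- 1%:M) y = - (y : V).
Proof. by rewrite /lin mulmxN mulmx1. Qed.

Lemma measurable_lin S : measurable_fun setT (lin S).
Proof.
apply: measurable_rV => i; under eq_fun do rewrite /lin mxE.
by apply: measurable_sum => j; apply: measurable_funM => //; exact: measurable_coord.
Qed.

Lemma measurable_lin_preimage S A : measurable A -> measurable (lin S @^-1` A).
Proof. by move=> mA; rewrite -[X in measurable X]setTI; exact: measurable_lin. Qed.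

Definition badd (x y : borel V) : borel V := (x : V) + (y : V).

Lemma measurable_badd d (T : measurableType d) (D : set T) (f g : T -> borel V) :
  measurable_fun D f -> measurable_fun D g -> measurable_fun D (fun z => badd (f z) (g z)).
Proof.
move=> mf mg; apply: measurable_rV => i; under eq_fun do rewrite /badd mxE.
apply: measurable_funD; first exact: (measurableT_comp (measurable_coord i) mf).
exact: (measurableT_comp (measurable_coord i) mg).
Qed.

(* Weil's argument: both sides are the integral of 1_A (x + y S) 1_Q (y S) in x and y,
   for the symmetric set Q. *)
Lemma muV_lin_unif (T S : 'M[R]_n) (A Q : set (borel V)) : T *m S = 1%:M ->
  measurable A -> measurable Q -> (forall y : V, Q y -> Q (- y)) ->
  (mu A * mu (lin S @^-1` Q) = mu (lin S @^-1` A) * mu Q)%E.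
Proof.
move=> TS mA mQ Qsym.
pose E : set (borel V * borel V) :=
  [set xy | A (badd xy.1 (lin S xy.2)) /\ Q (lin S xy.2)].
have mS2 : measurable_fun setT (fun z : borel V * borel V => lin S z.2).
  exact: (measurableT_comp (measurable_lin S) measurable_snd).
have mE : measurable E.
  rewrite (_ : E = (fun z => badd z.1 (lin S z.2)) @^-1` A `&` (fun z => lin S z.2) @^-1` Q)//.
  apply: measurableI; rewrite -[X in measurable X]setTI.
    by apply: measurable_badd => //; exact: measurable_fst.
  exact: mS2.
pose f (z : borel V * borel V) : \bar R := (\1_E z)%:E.
have mf : measurable_fun setT f.
  by apply/measurable_EFinP; exact: measurable_indic.
have f0 z : (0 <= f z)%E by rewrite lee_fin.
pose E' : set (borel V * borel V) :=
  [set xy | A (lin S xy.2) /\ Q (badd (lin S xy.2) (lin (- 1%:M) xy.1))].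
have mE' : measurable E'.
  rewrite (_ : E' = (fun z => lin S z.2) @^-1` A `&`
     (fun z => badd (lin S z.2) (lin (- 1%:M) z.1)) @^-1` Q)//.
  apply: measurableI; rewrite -[X in measurable X]setTI; first exact: mS2.
  apply: measurable_badd => //.
  exact: (measurableT_comp (measurable_lin _) measurable_fst).
pose f' (z : borel V * borel V) : \bar R := (\1_E' z)%:E.
have mf' : measurable_fun setT f'.
  by apply/measurable_EFinP; exact: measurable_indic.
have f'0 z : (0 <= f' z)%E by rewrite lee_fin.
have sect1 y : (\int[mu]_x f (x, y) = mu A * (\1_(lin S @^-1` Q) y)%:E)%E.
  have [Qy|nQy] := pselect (Q (lin S y)).
    rewrite [X in (_ * X)%E](_ : _ = 1%E) ?mule1; last by rewrite indicE mem_set.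
    rewrite -[RHS](muV_translate (lin S y)) -[X in mu X]setIT -integral_indic//.
      apply: eq_integral => x _; rewrite /f !indicE; congr ((_ : bool)%:R%:E).
      by apply/idP/idP; rewrite !inE => // -[].
    rewrite -[X in measurable X]setTI; apply: measurable_rV => // i.
    under eq_fun do rewrite mxE.
    by apply: measurable_funD => //; exact: measurable_coord.
  rewrite [X in (_ * X)%E](_ : _ = 0%E) ?mule0; last by rewrite indicE memNset.
  apply: integral0_eq => x _; rewrite /f indicE memNset//.
  by move=> [].
have sect2 y : (\int[mu]_x f' (x, y) = (\1_(lin S @^-1` A) y)%:E * mu Q)%E.
  have [Ay|nAy] := pselect (A (lin S y)).
    rewrite [X in (X * _)%E](_ : _ = 1%E) ?mul1e; last by rewrite indicE mem_set.
    rewrite -[RHS](@muV_isometry (fun x : V => (lin S y : V) - x) (fun x : V => (lin S y : V) - x)); last 3 first.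
    - by move=> x; rewrite subKr.
    - by move=> x; rewrite subKr.
    - by move=> x z; rewrite -[in RHS]enormN !opprB addrC addrA subrK.
    rewrite -[X in mu X]setIT -integral_indic//.
      apply: eq_integral => x _; rewrite /f' !indicE; congr ((_ : bool)%:R%:E).
      by apply/idP/idP; rewrite !inE /E'/= /badd linN1 => // -[].
    rewrite -[X in measurable X]setTI; apply: measurable_rV => // i.
    under eq_fun do rewrite !mxE.
    by apply: measurable_funB => //; exact: measurable_coord.
  rewrite [X in (X * _)%E](_ : _ = 0%E) ?mul0e; last by rewrite indicE memNset.
  apply: integral0_eq => x _; rewrite /f' indicE memNset//.
  by move=> [].
(* Translating [y] by [x *m T] adds [x] to [y *m S], because [T *m S = 1], and turns [f'] into
   [f]. *)
have shift x : (\int[mu]_y f (x, y) = \int[mu]_y f' (x, y))%E.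
  rewrite /f /f'.
  have mX (F : set (borel V * borel V)) : measurable F ->
      (\int[mu]_y (\1_F (x, y))%:E = mu (xsection F x))%E.
    move=> mF; rewrite -(setIT (xsection F x)) -integral_indic//; last exact: measurable_xsection.
    by apply: eq_integral => y _; rewrite !indicE mem_xsection.
  rewrite !mX// -[RHS](muV_translate ((x : V) *m T)); congr mu.
  apply/seteqP; split=> y; rewrite /xsection/= !inE /E /E'/= /badd linN1;
  by rewrite /lin mulmxDl -mulmxA TS mulmx1 addrK addrC.
have mI (B : set (borel V)) : measurable B -> measurable_fun setT (fun y => (\1_B y)%:E : \bar R).
  by move=> mB; apply/measurable_EFinP; exact: measurable_indic.
have mSA := measurable_lin_preimage S mA.
have mSQ := measurable_lin_preimage S mQ.
have F1 : (\int[mu]_x \int[mu]_y f (x, y) = mu A * mu (lin S @^-1` Q))%E.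
  rewrite (fubini_tonelli f mf f0); under eq_integral do rewrite sect1.
  by rewrite ge0_integralZl ?integral_indic ?setIT//; exact: mI.
have F2 : (\int[mu]_x \int[mu]_y f' (x, y) = mu (lin S @^-1` A) * mu Q)%E.
  rewrite (fubini_tonelli f' mf' f'0); under eq_integral do rewrite sect2.
  by rewrite ge0_integralZr ?integral_indic ?setIT//; exact: mI.
by rewrite -F1 -F2; apply: eq_integral => x _; exact: shift.
Qed.

End EuclideanMeasure.

(** * Linear maps multiply the measure of R^n by a constant *)

Section LinearScaling.
Variables (R : realType) (n : nat).
Local Notation V := 'rV[R]_n.
Local Notation mu := (@muV R n).
Local Notation Q := (@vball R n 1).
Implicit Types (T S : 'M[R]_n) (c : R).

(** Preimages under [lin S] are images under [lin T], the two matrices being inverse to each other;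
    in this form the measurability of images comes for free. *)
Definition scales T S c := [/\ T *m S = 1%:M, 0 <= c &
  forall A, measurable A -> mu (lin S @^-1` A) = (c%:E * mu A)%E].

Lemma lin_norm_le T (b : R) : 0 <= b -> (forall i j, `|T i j| <= b) ->
  forall y : V, `|y *m T| <= n%:R * b * `|y|.
Proof.
move=> b0 Tb y; apply/rV_normP => [|j]; first by rewrite !mulr_ge0.
rewrite mxE (le_trans (ler_norm_sum _ _ _))//.
apply: (@le_trans _ _ (\sum_(i < n) b * `|y|)).
  apply: ler_sum => i _; rewrite normrM mulrC ler_pM//; exact: rV_coord_le.
by rewrite sumr_const card_ord -[leLHS]mulr_natl mulrA.
Qed.

Definition mx_bound T : R := \sum_i \sum_j `|T i j|.

Lemma mx_boundP T i j : `|T i j| <= mx_bound T.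
Proof.
rewrite /mx_bound (bigD1 i)//= (bigD1 j)//= -addrA lerDl addr_ge0//.
  by apply: sumr_ge0.
by apply: sumr_ge0 => k _; apply: sumr_ge0.
Qed.

Lemma mx_bound_ge0 T : 0 <= mx_bound T.
Proof. by apply: sumr_ge0 => k _; apply: sumr_ge0. Qed.

Lemma lin_enorm_le T (b : R) : 0 <= b -> (forall i j, `|T i j| <= b) ->
  forall y : V, enorm (y *m T) <= n%:R * (n%:R * b) * enorm y.
Proof.
move=> b0 Tb y; apply: le_trans (enorm_le_norm _) _; rewrite -mulrA ler_wpM2l//.
apply: le_trans (lin_norm_le b0 Tb y) _.
by rewrite ler_wpM2l ?mulr_ge0// norm_le_enorm.
Qed.

Lemma lin_preimageE T S (A : set V) : T *m S = 1%:M ->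
  lin S @^-1` A = (fun y : V => y *m T) @` A.
Proof.
move=> TS; have ST := mulmx1C TS; apply/seteqP; split=> [y Ay|_ [y Ay <-]].
  by exists (y *m S) => //; rewrite -mulmxA ST mulmx1.
by rewrite /= /lin -mulmxA TS mulmx1.
Qed.

(** It suffices to compare on the unit ball, whose measure is finite and assumed nonzero. *)
Lemma scales_lipschitz T S c (L : R) : mu Q != 0%E -> 0 < L ->
  (forall y : V, enorm (y *m T) <= L * enorm y) -> scales T S c -> c <= L ^+ n.
Proof.
move=> Q0 L0 TL [TS c0 /(_ Q (@measurable_vball R n 1)) Tc].
have : (mu (lin S @^-1` Q) <= (L ^+ n)%:E * mu Q)%E.
  by rewrite (lin_preimageE _ TS); apply: muV_image => // x y _ _; rewrite -mulmxBl.
have Qfin : mu Q \is a fin_num by rewrite ge0_fin_numE// muV_vball_fin.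
by rewrite Tc -(fineK Qfin) -!EFinM lee_fin ler_pM2r// fine_gt0//
  muV_vball_fin lt_neqAle eq_sym Q0 measure_ge0.
Qed.

Lemma scalesM T S T' S' c c' : scales T S c -> scales T' S' c' ->
  scales (T *m T') (S' *m S) (c * c').
Proof.
move=> [TS c0 Tc] [TS' c0' Tc']; split; last 1 first.
- move=> A mA; have -> : lin (S' *m S) @^-1` A = lin S' @^-1` (lin S @^-1` A).
    by apply/seteqP; split=> y; rewrite /= /lin mulmxA.
  by rewrite Tc' ?Tc//; [rewrite EFinM muleA (muleC c'%:E)|exact: measurable_lin_preimage].
- by rewrite mulmxA -(mulmxA T) TS' mulmx1.
- exact: mulr_ge0.
Qed.

Lemma scales1 : scales 1%:M 1%:M 1.
Proof.
split=> // [|A mA]; first by rewrite mulmx1.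
by rewrite mul1e; congr mu; apply/seteqP; split=> y; rewrite /= /lin mulmx1.
Qed.

(** No positive lower bound for the measure of a ball is proved. If the unit ball is null, [muV]
    vanishes identically and [muV_trig] holds trivially; otherwise the unit ball serves to normalise
    scaling factors. *)
Hypothesis Q0 : mu Q != 0%E.

Lemma muQ_gt0 : (0 < mu Q)%E.
Proof. by rewrite lt_neqAle eq_sym Q0 measure_ge0. Qed.

Lemma muQ_fin : mu Q \is a fin_num.
Proof. by rewrite ge0_fin_numE// muV_vball_fin. Qed.

(** Uniqueness of translation-invariant measures up to a factor, in the form of [muV_lin_unif] with
    the unit ball as symmetric set; the factor is read off on that ball. *)
Lemma scales_exists T S : T *m S = 1%:M -> exists c, scales T S c.
Proof.
move=> TS.
have Sfin : mu (lin S @^-1` Q) \is a fin_num.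
  rewrite ge0_fin_numE//.
  apply: le_lt_trans (@muV_vball_fin R n (n%:R * mx_bound T * 1)); apply: le_measure.
  - by rewrite inE; apply: measurable_lin_preimage; exact: measurable_vball.
  - by rewrite inE; exact: measurable_vball.
  rewrite (lin_preimageE _ TS) => _ [y /= y1 <-].
  apply: le_trans (lin_norm_le (mx_bound_ge0 T) (mx_boundP T) y) _.
  by rewrite ler_wpM2l// mulr_ge0// mx_bound_ge0.
have q0 : 0 < fine (mu Q) by rewrite fine_gt0// muQ_gt0 muV_vball_fin.
exists (fine (mu (lin S @^-1` Q)) / fine (mu Q)); split=> // [|A mA].
  by rewrite divr_ge0 ?fine_ge0 ?measure_ge0.
have AQ : (mu A * mu (lin S @^-1` Q) = mu (lin S @^-1` A) * mu Q)%E.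
  by apply: (muV_lin_unif TS) => // [|y]; [exact: measurable_vball|rewrite /vball/= normrN].
rewrite EFinM fineK// -muleA [(_ * mu A)%E]muleC muleA [(_ * mu A)%E]muleC AQ.
rewrite -muleA -{1}(fineK muQ_fin) -EFinM divff ?mule1//.
by rewrite gt_eqF.
Qed.

Lemma scales_uniq T S S' c c' : scales T S c -> scales T S' c' -> c = c'.
Proof.
move=> [TS c0 Tc] [TS' c0' Tc'].
have SS : S = S' by rewrite -[S]mulmx1 -TS' mulmxA (mulmx1C TS) mul1mx.
have := Tc _ (@measurable_vball R n 1); rewrite SS Tc'; last exact: measurable_vball.
rewrite -(fineK muQ_fin) -!EFinM => -[/esym]; apply: mulIf.
by rewrite gt_eqF// fine_gt0// muQ_gt0 muV_vball_fin.
Qed.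

Lemma scales_inv T S c c' : scales T S c -> scales S T c' -> c * c' = 1.
Proof.
move=> Tc Sc; have [TS _ _] := Tc; have := scalesM Tc Sc.
by rewrite TS => /scales_uniq/(_ scales1).
Qed.

(** The Lipschitz bounds for [T] and for its inverse give [c <= L ^+ n] and [c' <= L^-1 ^+ n], and
    [c * c' = 1] forces equality. *)
Lemma scales_similarity T S c (L : R) : 0 < L ->
  (forall y : V, enorm (y *m T) = L * enorm y) -> scales T S c -> c = L ^+ n.
Proof.
move=> L0 TL Tc; have [TS c0 _] := Tc; have ST := mulmx1C TS.
have [c' Sc] := scales_exists ST; have [_ c0' _] := Sc.
have cL : c <= L ^+ n by apply: scales_lipschitz Tc => // y; rewrite TL.
have c'L : c' <= L^-1 ^+ n.
  apply: scales_lipschitz Sc => // [|y]; first by rewrite invr_gt0.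
  by rewrite -[y in leRHS]mulmx1 -ST mulmxA TL mulrA mulVf ?mul1r// gt_eqF.
apply/eqP; rewrite eq_le cL /= -[leLHS]mulr1 -(scales_inv Tc Sc) mulrCA ler_piMr//.
apply: le_trans (ler_wpM2l _ c'L) _; first by rewrite exprn_ge0// ltW.
by rewrite -exprMn divff ?expr1n// gt_eqF.
Qed.

Definition dmx (s : seq 'I_n) (d : 'I_n -> R) : 'M[R]_n :=
  diag_mx (\row_j if j \in s then d j else 1).

Lemma dmxM s d e : dmx s d *m dmx s e = dmx s (fun i => d i * e i).
Proof.
rewrite mulmx_diag; congr diag_mx; apply/rowP => j; rewrite !mxE.
by case: ifP; rewrite ?mulr1.
Qed.

Lemma dmxV s d : (forall i, 0 < d i) -> dmx s d *m dmx s (fun i => (d i)^-1) = 1%:M.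
Proof.
move=> d0; rewrite dmxM -diag_const_mx; congr diag_mx; apply/rowP => j; rewrite !mxE.
by case: ifP => // _; rewrite divff// gt_eqF.
Qed.

Lemma dmx_cons i s d : i \notin s -> dmx (i :: s) d = dmx [:: i] d *m dmx s d.
Proof.
move=> si; rewrite mulmx_diag; congr diag_mx; apply/rowP => j; rewrite !mxE !inE.
by have [->|_] := eqVneq j i; rewrite ?(negbTE si) ?mulr1 ?mul1r.
Qed.

Lemma scales_dmx_prod s d (cs : 'I_n -> R) : uniq s ->
  (forall i, exists S, scales (dmx [:: i] d) S (cs i)) ->
  exists S, scales (dmx s d) S (\prod_(i <- s) cs i).
Proof.
move=> us H; elim: s us => [_|i s IH /= /andP[si us]].
  exists 1%:M; rewrite big_nil (_ : dmx [::] d = 1%:M); first exact: scales1.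
  by rewrite -diag_const_mx; congr diag_mx; apply/rowP => j; rewrite !mxE.
have [S Ss] := IH us; have [S' Si] := H i.
by exists (S *m S'); rewrite dmx_cons// big_cons; exact: scalesM.
Qed.

Lemma scales_tperm i j : scales (tperm_mx i j) (tperm_mx i j) 1.
Proof.
have PP : tperm_mx i j *m tperm_mx i j = 1%:M :> 'M[R]_n.
  by rewrite -perm_mxM tperm2 perm_mx1.
have [c Pc] := scales_exists PP.
suff <- : c = 1 by [].
rewrite (scales_similarity ltr01 _ Pc) ?expr1n// => y; rewrite mul1r.
congr Num.sqrt; rewrite [RHS](reindex_inj (@perm_inj _ (tperm i j)))/=.
apply: eq_bigr => k _; congr (_ ^+ 2).
have -> : y *m tperm_mx i j = col_perm (tperm i j) y.
  by rewrite col_permE tpermV.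
by rewrite mxE.
Qed.

Lemma scales_dmx1 (i j : 'I_n) (a : R) S c : scales (dmx [:: i] (fun=> a)) S c ->
  exists S', scales (dmx [:: j] (fun=> a)) S' c.
Proof.
move=> Hi; exists (tperm_mx i j *m (S *m tperm_mx i j)).
have := scalesM (scalesM (scales_tperm i j) Hi) (scales_tperm i j).
rewrite mul1r mulr1; congr (scales _ _ _).
have -> : tperm_mx i j *m dmx [:: i] (fun=> a) = row_perm (tperm i j) (dmx [:: i] (fun=> a)).
  by rewrite row_permE.
have -> (B : 'M[R]_n) : B *m tperm_mx i j = col_perm (tperm i j) B.
  by rewrite col_permE tpermV.
apply/matrixP => k l; rewrite !mxE (inj_eq perm_inj) !inE.
have -> : (tperm i j k == i) = (k == j).
  by rewrite -(inj_eq (@perm_inj _ (tperm i j)) k j) tpermR.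
by [].
Qed.

(** Conjugation by transpositions, which are isometries, gives the dilations of the [n] axes the
    same factor [c]. Their product is the homothety of ratio [a], hence [c ^+ n = a ^+ n]. *)
Lemma scales_dmx1E (i : 'I_n) (a : R) : 0 < a ->
  exists S, scales (dmx [:: i] (fun=> a)) S a.
Proof.
move=> a0; have [c Hc] := scales_exists (dmxV [:: i] (fun=> a0)).
exists (dmx [:: i] (fun=> a^-1)); suff ca : c = a by move: Hc; rewrite ca.
have [S HS] := @scales_dmx_prod (enum 'I_n) (fun=> a) (fun=> c) (enum_uniq _)
  (fun j => @scales_dmx1 i j a _ _ Hc).
have : \prod_(j <- enum 'I_n) c = a ^+ n.
  apply: scales_similarity HS => // y.
  have -> : dmx (enum 'I_n) (fun=> a) = a%:M.
    by rewrite -diag_const_mx; congr diag_mx; apply/rowP => j; rewrite !mxE mem_enum.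
  by rewrite mul_mx_scalar enormZ gtr0_norm.
rewrite big_enum/= prodr_const card_ord => /eqP.
have [_ c0 _] := Hc.
have n0 : (0 < n)%N by exact: leq_ltn_trans (ltn_ord i).
by rewrite eqrXn2 ?(ltW a0)// => /eqP.
Qed.

Lemma scales_dmx (d : 'I_n -> R) : (forall i, 0 < d i) ->
  exists S, scales (diag_mx (\row_j d j)) S (\prod_i d i).
Proof.
move=> d0; have [|S] := @scales_dmx_prod (enum 'I_n) d d (enum_uniq _).
  move=> i; have [S HS] := scales_dmx1E i (d0 i); exists S.
  rewrite (_ : dmx [:: i] d = dmx [:: i] (fun=> d i))//.
  congr diag_mx; apply/rowP => j; rewrite !mxE inE.
  by have [->|] := eqVneq j i.
rewrite big_enum/= => HS; exists S.
rewrite (_ : diag_mx _ = dmx (enum 'I_n) d)//.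
by congr diag_mx; apply/rowP => j; rewrite !mxE mem_enum.
Qed.

(** The constant 3 closes the induction: for [e <= 1] the coefficient of [e] goes from [b] to at
    most [1 + 2 * b], and [b >= 1]. *)
Lemma expr1D_le (e : R) : 0 <= e <= 1 -> (1 + e) ^+ n <= 1 + 3 ^+ n * e.
Proof.
move=> /andP[e0 e1]; elim: (n) => [|m IH]; first by rewrite !expr0 mul1r; lra.
rewrite exprS; apply: (@le_trans _ _ ((1 + e) * (1 + 3 ^+ m * e))).
  by rewrite ler_wpM2l//; lra.
have : 1 <= 3 ^+ m :> R by rewrite exprn_ege1//; lra.
rewrite [3 ^+ m.+1]exprS; move: (3 ^+ m) => b b1.
have h1 : 0 <= (b - 1) * e by rewrite mulr_ge0//; lra.
have h2 : 0 <= b * (e * (1 - e)) by rewrite !mulr_ge0//; lra.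
nra.
Qed.

Lemma le1_of_small (c : R) : (forall e, 0 < e <= 1 -> c <= (1 + e) ^+ n) -> c <= 1.
Proof.
move=> H; apply/ler_addgt0Pr => e e0.
have p0 : 0 < 3 ^+ n :> R by rewrite exprn_gt0.
pose e' := Num.min 1 (e / 3 ^+ n).
have e'0 : 0 < e' by rewrite lt_min ltr01 divr_gt0.
have e'1 : e' <= 1 by rewrite ge_min lexx.
have e'e : 3 ^+ n * e' <= e by rewrite mulrC -ler_pdivlMr// ge_min lexx orbT.
have e'I : 0 < e' <= 1 by rewrite e'0.
apply: le_trans (H _ e'I) _; apply: le_trans (expr1D_le _) _; last by rewrite lerD2l.
by rewrite (ltW e'0).
Qed.

(* Conjugation by diag(t^i) leaves the scaling factor unchanged and tends to the identity
   as t -> 0. *)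
Lemma scales_unipotent (L S : 'M[R]_n) c : is_trig_mx L -> (forall i, L i i = 1) ->
  scales L S c -> c = 1.
Proof.
move=> /is_trig_mxP Ltri L1 Lc.
have key (e : R) : 0 < e <= 1 -> exists (M S' : 'M[R]_n), scales M S' c /\
    forall y : V, enorm (y *m M - y) <= e * enorm y.
  (* Conjugation multiplies the entry [(i, j)] below the diagonal by [t ^+ (i - j) <= t]. With
     [t = e / K] the matrix differs from the identity by a map of norm at most [e], [K - 1] being
     the bound of [lin_enorm_le]. *)
  move=> /andP[e0 e1]; pose K := n%:R * (n%:R * mx_bound L) + 1.
  have K1 : 1 <= K by rewrite lerDr !mulr_ge0// mx_bound_ge0.
  have K0 : 0 < K by lra.
  pose t := e / K; have t0 : 0 < t by rewrite divr_gt0.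
  have t1 : t <= 1 by rewrite ler_pdivrMr// mul1r; lra.
  have d0 (i : 'I_n) : 0 < t ^+ i by rewrite exprn_gt0.
  have [S' HS'] := scales_dmx d0; have [DS _ _] := HS'.
  have [c' Hc'] := scales_exists (mulmx1C DS).
  pose D := diag_mx (\row_(j < n) t ^+ j).
  have S'E : S' = diag_mx (\row_(j < n) (t ^+ j)^-1).
    have DD : D *m diag_mx (\row_(j < n) (t ^+ j)^-1) = 1%:M.
      rewrite mulmx_diag -diag_const_mx; congr diag_mx; apply/rowP => j; rewrite !mxE.
      by rewrite divff// gt_eqF.
    by rewrite -[LHS]mulmx1 -DD mulmxA (mulmx1C DS) mul1mx.
  exists (D *m L *m S'), (D *m (S *m S')); split.
    have := scalesM (scalesM HS' Lc) Hc'.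
    by rewrite mulrAC (scales_inv HS' Hc') mul1r.
  move=> y; rewrite -[X in _ - X]mulmx1 -mulmxBr.
  have tb i j : `|(D *m L *m S' - 1%:M) i j| <= t * mx_bound L.
    have -> : (D *m L *m S' - 1%:M) i j = t ^+ i * L i j / t ^+ j - (i == j)%:R.
      by rewrite S'E mul_mx_diag mul_diag_mx !mxE.
    have [ij|ji|ij] := ltngtP i j.
    - rewrite Ltri// mulr0 mul0r (_ : (i == j) = false) ?subr0 ?normr0.
        by rewrite mulr_ge0 ?mx_bound_ge0// ltW.
      by apply/negbTE; rewrite neq_ltn ij.
    - rewrite (_ : (i == j) = false) ?subr0; last by apply/negbTE; rewrite neq_ltn ji orbT.
      rewrite mulrAC normrM ler_pM//; last exact: mx_boundP.
      rewrite -expfB// gtr0_norm ?exprn_gt0//.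
      rewrite -[leRHS]expr1; apply: ler_wiXn2l; rewrite ?(ltW t0)//.
      by rewrite subn_gt0.
    - have -> : i = j by exact: val_inj.
      rewrite L1 mulr1 eqxx divff ?subrr ?normr0; last by rewrite gt_eqF.
      by rewrite mulr_ge0 ?mx_bound_ge0// ltW.
  have tb0 : 0 <= t * mx_bound L by rewrite mulr_ge0 ?mx_bound_ge0// ltW.
  apply: le_trans (lin_enorm_le tb0 tb y) _; rewrite ler_wpM2r ?enorm_ge0//.
  have -> : n%:R * (n%:R * (t * mx_bound L)) = t * (K - 1) by rewrite /K; ring.
  by rewrite /t mulrAC ler_pdivrMr//; nra.
have c1 : c <= 1.
  apply: le1_of_small => e e01; have [M [S' [Mc My]]] := key e e01.
  apply: scales_lipschitz Mc => // [|y]; first lra.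
  by have := enormD (y *m M - y) y; rewrite subrK; have := My y; lra.
have [LS _ _] := Lc; have [c' Sc'] := scales_exists (mulmx1C LS).
have c'1 : c' <= 1.
  (* The inverse of a map [e / 2]-close to the identity is Lipschitz with constant
     [1 / (1 - e / 2)], which is at most [1 + e] when [e <= 1]. *)
  apply: le1_of_small => e e01; have e2 : 0 < e / 2 <= 1 by lra.
  have [M [S' [Mc My]]] := key _ e2; have [MS _ _] := Mc.
  have [c'' Sc''] := scales_exists (mulmx1C MS).
  have <- : c'' = c'.
    have c0 : c != 0 by have /eqP := scales_inv Lc Sc'; apply: contraTneq => ->; rewrite mul0r eq_sym oner_eq0.
    by apply: (mulfI c0); rewrite (scales_inv Lc Sc') (scales_inv Mc Sc'').
  apply: scales_lipschitz Sc'' => // [|y]; first lra.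
  have := My (y *m S'); have := enormD (y *m S' - y) y; rewrite subrK.
  rewrite -mulmxA (mulmx1C MS) mulmx1 -[enorm (y - _)]enormN opprB.
  have := enorm_ge0 (y *m S'); move: (enorm (y *m S')) (enorm (y *m S' - y)) (enorm y).
  move=> p q r p0 pqr qp.
  have h1 : 0 <= (1 + e) * (r - (1 - e / 2) * p) by rewrite mulr_ge0//; lra.
  have h2 : 0 <= p * (e * (1 - e)) by rewrite !mulr_ge0//; lra.
  nra.
have := scales_inv Lc Sc'; have [_ c0 _] := Lc; have [_ c0' _] := Sc'; nra.
Qed.

(** Factor [T] as its diagonal times a unipotent triangular matrix, whose scaling factor is 1. *)
Lemma scales_trig T : is_trig_mx T -> (forall i, 0 < T i i) ->
  exists S, scales T S (\det T).
Proof.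
move=> Ttri T0; have [S HS] := scales_dmx T0.
pose L := \matrix_(i, j) (T i j / T i i).
have TL : T = diag_mx (\row_j T j j) *m L.
  by apply/matrixP => i j; rewrite mul_diag_mx !mxE mulrC divfK// gt_eqF.
have Ltri : is_trig_mx L.
  by apply/is_trig_mxP => i j ij; rewrite mxE (is_trig_mxP Ttri)// mul0r.
have L1 i : L i i = 1 by rewrite mxE divff// gt_eqF.
have : L \in unitmx.
  rewrite unitmxE det_trig// big1 ?unitr1// => i _.
move=> /mulmxV/scales_exists[c Lc].
have c1 := scales_unipotent Ltri L1 Lc.
exists (invmx L *m S); rewrite det_trig// [X in scales X]TL -[\prod_i _]mulr1 -{2}c1.
exact: scalesM.
Qed.

End LinearScaling.

Section Cholesky.
Variable R : realType.

(** Induction on the dimension through the Schur complement [C'] of the first diagonal entry. A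
    triangular factor, rather than a symmetric square root, is wanted because scaling factors are
    computed for triangular matrices. *)
Lemma cholesky n (G : 'M[R]_n) : G^T = G -> (forall v : 'rV_n, v != 0 -> 0 < vdot G v v) ->
  exists T : 'M[R]_n, [/\ is_trig_mx T, forall i, 0 < T i i & G = T *m T^T].
Proof.
elim: n G => [G _ _|n IH].
  by exists 0; split=> [|[]//|]; [apply/is_trig_mxP => -[]|apply/matrixP => -[]].
rewrite -[n.+1]/(1 + n)%N => G GT Gpos.
pose a := ulsubmx G; pose b := ursubmx G; pose C := drsubmx G.
have bT : b^T = dlsubmx G by rewrite /b trmx_ursub GT.
have CT : C^T = C by rewrite /C trmx_drsub GT.
have GE : G = block_mx a b b^T C by rewrite bT submxK.
pose a0 := a 0 0; have aE : a = a0%:M by exact: mx11_scalar.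
have a0_gt0 : 0 < a0.
  pose u : 'rV[R]_(1 + n) := row_mx 1%:M 0.
  have -> : a0 = vdot G u u.
    rewrite /vdot GE mul_row_block tr_row_mx mul_row_col.
    by rewrite !mul0mx !addr0 !mul1mx trmx1 mulmx1 trmx0 mulmx0 addr0.
  apply: Gpos; apply/eqP => /(congr1 lsubmx); rewrite row_mxKl linear0 => /matrixP/(_ 0 0).
  by rewrite !mxE => /eqP; rewrite oner_eq0.
pose s := Num.sqrt a0; have s0 : 0 < s by rewrite sqrtr_gt0.
have ss : s * s = a0 by rewrite -expr2 sqr_sqrtr// ltW.
pose w := s^-1 *: b; have bw : b = s *: w by rewrite scalerA divff ?scale1r// gt_eqF.
pose C' := C - w^T *m w.
have C'T : C'^T = C' by rewrite /C' linearB /= trmx_mul trmxK CT.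
have C'pos (v : 'rV_n) : v != 0 -> 0 < vdot C' v v.
  (* [x] minimises the quadratic form of [G] over the vectors with last block [v], and the minimum
     is the form of the Schur complement at [v]. *)
  move=> v0; pose k := (v *m w^T) 0 0; pose x : 'M[R]_1 := (- (k / s))%:M.
  have kE : v *m w^T = k%:M by exact: mx11_scalar.
  have kE' : w *m v^T = k%:M by rewrite -[LHS]trmxK trmx_mul trmxK kE tr_scalar_mx.
  have -> : vdot C' v v = vdot G (row_mx x v) (row_mx x v).
    rewrite /vdot GE mul_row_block tr_row_mx mul_row_col bw linearZ/= aE tr_scalar_mx.
    have -> : v *m C' *m v^T = v *m C *m v^T - (k * k)%:M.
      by rewrite /C' mulmxBr mulmxBl !mulmxA kE -(mulmxA k%:M) kE' -scalar_mxM.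
    rewrite -(scalemxAr s v) kE (mulmxDl _ (v *m C)) -(scalemxAr s x) -(scalemxAl s) -(mulmxA x) kE'.
    move: (v *m C *m v^T) => Z.
    rewrite /x !(mul_scalar_mx, mul_mx_scalar, scale_scalar_mx) -ss.
    rewrite !mxE eqxx !mulr1n; field; exact: lt0r_neq0.
  apply: Gpos; apply: contra_neq v0 => /(congr1 rsubmx); by rewrite row_mxKr linear0.
have [T' [T'tri T'pos T'E]] := IH _ C'T C'pos.
exists (block_mx s%:M 0 w^T T'); split.
- apply/is_trig_mxP => i j.
  case: (split_ordP i) => i' ->; case: (split_ordP j) => j' ->.
  + by rewrite !ord1 ltnn.
  + by rewrite block_mxEur mxE.
  + by rewrite /= ltnNge ltnW// (leq_trans (ltn_ord j')).
  + by rewrite block_mxEdr /= ltn_add2l => /(is_trig_mxP T'tri).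
- move=> i; case: (split_ordP i) => i' ->; last by rewrite block_mxEdr.
  by rewrite block_mxEul mxE !ord1 eqxx.
- rewrite tr_block_mx mulmx_block trmx0 trmxK tr_scalar_mx !mul0mx !mulmx0 !addr0.
  rewrite -scalar_mxM ss -aE mul_scalar_mx -bw GE; congr block_mx.
    by rewrite bw linearZ /= mul_mx_scalar.
  by rewrite -T'E /C' addrC subrK.
Qed.

End Cholesky.

Section MuVTriangular.
Variables (R : realType) (n : nat).
Local Notation V := 'rV[R]_n.
Local Notation mu := (@muV R n).

(** The balls of integer radius are images of the unit ball under homotheties, which are Lipschitz,
    and they cover the space. Outer subadditivity then treats every set [A], measurable or not. *)
Lemma muV_null (A : set (borel V)) : mu (@vball R n 1) = 0%E -> mu A = 0%E.
Proof.
move=> Q0; apply/eqP; rewrite eq_le measure_ge0 andbT.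
have Qk k : mu (@vball R n k.+1%:R) = 0%E.
  apply/eqP; rewrite eq_le measure_ge0 andbT.
  have -> : @vball R n k.+1%:R = (fun y : V => k.+1%:R *: y) @` @vball R n 1.
    apply/seteqP; split=> [y /= yk|_ [y /= y1 <-]].
      exists (k.+1%:R^-1 *: y); last by rewrite scalerA divff ?scale1r.
      by rewrite /vball/= normrZ normrV ?unitfE// normr_nat ler_pdivrMl// mulr1.
    by rewrite /vball/= normrZ normr_nat ler_piMr.
  apply: le_trans (@muV_image R n _ k.+1%:R _ _ _) _ => // [x y _ _|].
    by rewrite -scalerBr enormZ normr_nat.
  by rewrite Q0 mule0.
have AQ : A `<=` \bigcup_k @vball R n k.+1%:R.
  move=> y _; exists (Num.truncn `|y|) => //=; apply/ltW; exact: truncnS_gt.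
apply: le_trans (ghaus_mono n (@eucl_dist R n) AQ) _.
apply: le_trans (@ghaus_sigma_subadditive R n V (@eucl_dist R n) _) _.
by rewrite eseries0// => k _ _; exact: Qk.
Qed.

Lemma muV_trig (T S : 'M[R]_n) (A : set (borel V)) : is_trig_mx T -> (forall i, 0 < T i i) ->
  T *m S = 1%:M -> measurable A -> mu (lin S @^-1` A) = ((\det T)%:E * mu A)%E.
Proof.
move=> Ttri T0 TS mA; have [Q0|Q0] := eqVneq (mu (@vball R n 1)) 0%E.
  by rewrite (@muV_null (lin S @^-1` A) Q0) (@muV_null A Q0) mule0.
have [S' [TS' _ H]] := scales_trig Q0 Ttri T0.
have -> : S = S' by rewrite -[S]mulmx1 -TS' mulmxA (mulmx1C TS) mul1mx.
exact: H.
Qed.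

End MuVTriangular.

(** * Functions of class C^k *)

Section Derivatives.
Variables (R : realType) (n : nat).
Local Notation V := 'rV[R]_n.
Local Notation bvec := (@bvec R n).

Lemma differentiable_eps (f : V -> R) x : differentiable f x ->
  forall e, 0 < e -> \forall h \near (0 : V), `|f (h + x) - f x - 'd f x h| <= e * `|h|.
Proof.
move=> /diff_locally/eqaddoP H e e0; have := H e e0.
by apply: filterS => h; rewrite /cst /= opprD addrA.
Qed.

Lemma eps_differentiable (f : V -> R) x (df : {linear V -> R}) : continuous df ->
  (forall e, 0 < e -> \forall h \near (0 : V), `|f (h + x) - f x - df h| <= e * `|h|) ->
  differentiable f x /\ 'd f x = df :> (V -> R).
Proof.
move=> cdf H; have E : f \o shift x = cst (f x) + df +o_ (0 : V) id.
  by apply/eqaddoP => e e0; have := H e e0; apply: filterS => h; rewrite /cst /= opprD addrA.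
have dE := diff_unique cdf E; split=> //.
by apply/diff_locallyP; rewrite dE.
Qed.

Lemma nbhs0_shift (x : V) (P : V -> Prop) : nbhs x P -> \forall h \near (0 : V), P (h + x).
Proof.
move=> /nbhs_rV[r r0 rP]; apply/nbhs_rV; exists r => // v; rewrite sub0r normrN => vr.
by apply: rP; rewrite opprD addrCA subrr addr0 normrN.
Qed.

Lemma near_eq_differentiable (f g : V -> R) x : (\near x, f x = g x) ->
  differentiable f x -> differentiable g x.
Proof.
move=> fg dfx; have cd : continuous ('d f x) by exact: diff_continuous.
have [] // := @eps_differentiable g x ('d f x) cd.
move=> e e0; rewrite -(nbhs_singleton fg).
have := differentiable_eps dfx e0; have := nbhs0_shift fg.
by apply: filterS2 => h ->.
Qed.

Lemma deriveE_pd (f : V -> R) (y v : V) : differentiable f y ->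
  'D_v f y = \sum_a v 0 a * pd a f y.
Proof.
move=> df; rewrite deriveE// {1}[v]row_sum_delta linear_sum; apply: eq_bigr => a _.
by rewrite linearZ /= /pd deriveE.
Qed.

Lemma derive_coord (g : R -> V) t a : derivable g t 1 ->
  derivable (fun s => g s 0 a) t 1 /\ ('D_1 g t) 0 a = 'D_1 (fun s => g s 0 a) t.
Proof. by move=> dg; split; [exact: (derivable_mxP _ _ _).1|rewrite derive_mx// mxE]. Qed.

Lemma derive_comp_curve (g : R -> V) (f : V -> R) t : derivable g t 1 -> differentiable f (g t) ->
  is_derive t 1 (f \o g) (\sum_a ('D_1 g t) 0 a * pd a f (g t)).
Proof.
move=> /derivable1_diffP dg df; have dfg := differentiable_comp dg df.
apply: DeriveDef; first exact/derivable1_diffP.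
by rewrite -(deriveE_pd _ df) !deriveE// diff_comp.
Qed.

Lemma is_derive_line (f : V -> R) (y v : V) (s : R) : differentiable f (y + s *: v) ->
  is_derive s 1 (fun t => f (y + t *: v)) ('D_v f (y + s *: v)).
Proof.
move=> df; have dl : is_derive s 1 (fun t => y + t *: v) v.
  have := @is_deriveD R R V (cst y) (fun t => t *: v) s 1 0 v _ _.
  rewrite add0r; apply; have := @is_diff_scalel R V s v => H.
  apply: DeriveDef; first by apply: diff_derivable.
  by rewrite deriveE// diff_val /= scale1r.
have := @derive_comp_curve (fun t => y + t *: v) f s _ df.
rewrite derive_val -deriveE_pd//; apply; exact: ex_derive.
Qed.

Lemma differentiable_rV (F : V -> V) y : (forall b, differentiable (fun z => F z 0 b) y) ->
  differentiable F y.
Proof.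
move=> dF; have -> : F = \sum_(b < n) (fun z => F z 0 b *: delta_mx 0 b).
  by apply/funext => z; rewrite {1}[F z]row_sum_delta fct_sumE.
by apply: differentiable_sum => b; apply: differentiableZl.
Qed.

Lemma pd_comp (F : V -> V) (f : V -> R) y : (forall b, differentiable (fun z => F z 0 b) y) ->
  differentiable f (F y) ->
  differentiable (f \o F) y /\
  forall a, pd a (f \o F) y = \sum_b pd a (fun z => F z 0 b) y * pd b f (F y).
Proof.
move=> dF df; have dF' := differentiable_rV dF; have dfF := differentiable_comp dF' df.
split=> // a; rewrite /pd deriveE// diff_comp//= -deriveE// (deriveE_pd _ df).
apply: eq_bigr => b _; congr (_ * _).
by rewrite -(deriveE _ dF') derive_mx ?mxE//; exact: diff_derivable.
Qed.

Lemma near_eq_pd (f g : V -> R) y a : (\near y, f y = g y) -> pd a f y = pd a g y.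
Proof. exact: near_eq_derive. Qed.

Section Rules.
Variables (f g : V -> R) (y : V) (a : 'I_n).
Hypotheses (df : differentiable f y) (dg : differentiable g y).

Lemma pdD : pd a (fun z => f z + g z) y = pd a f y + pd a g y.
Proof. by rewrite /pd deriveD//; exact: diff_derivable. Qed.

Lemma pdM : pd a (fun z => f z * g z) y = f y * pd a g y + g y * pd a f y.
Proof. by rewrite /pd (@deriveM _ _ f g)//; exact: diff_derivable. Qed.

Lemma pdV : f y != 0 -> pd a (fun z => (f z)^-1) y = - (f y) ^- 2 * pd a f y.
Proof. by move=> f0; rewrite /pd (@deriveV _ _ f)//; exact: diff_derivable. Qed.
End Rules.

Lemma pd_cst (c : R) a (y : V) : pd a (fun=> c) y = 0.
Proof. exact: derive_cst. Qed.

Lemma pd_coord (a b : 'I_n) y : pd a (fun z : V => z 0 b) y = (a == b)%:R.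
Proof.
rewrite /pd -[RHS](_ : 'D_(bvec a) (@id V) y 0 b = _); last first.
  by rewrite derive_id mxE eqxx eq_sym.
by rewrite derive_mx ?mxE//; exact: derivable_id.
Qed.

Lemma pd_sum (I : Type) (r : seq I) (P : pred I) (f : I -> V -> R) y a :
  (forall i, P i -> differentiable (f i) y) ->
  differentiable (fun z => \sum_(i <- r | P i) f i z) y /\
  pd a (fun z => \sum_(i <- r | P i) f i z) y = \sum_(i <- r | P i) pd a (f i) y.
Proof.
move=> df; elim: r => [|i r [IHd IH]].
  under eq_fun do rewrite big_nil; rewrite big_nil; split; first exact: differentiable_cst.
  exact: pd_cst.
under eq_fun do rewrite big_cons; rewrite big_cons; case: ifP => // Pi.
by split; [apply: differentiableD => //; exact: df|rewrite pdD ?IH//; exact: df].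
Qed.

(** Class C^k with an explicit count, since the cut-offs built below have finitely many derivatives;
    [smooth_on] implies it for all [k]. For [k > 0] it demands total differentiability at the points
    of [A], not just partial derivatives. *)
Fixpoint ck (k : nat) (A : set V) (f : V -> R) : Prop :=
  if k is j.+1 then (forall y, A y -> differentiable f y) /\ forall a, ck j A (pd a f)
  else forall y, A y -> {for y, continuous f}.

Lemma ckW k A f : ck k.+1 A f -> ck k A f.
Proof.
elim: k f => [f [df _] y Ay|k IH f [df pf]]; first exact/differentiable_continuous/df.
by split=> // a; apply: IH; exact: pf.
Qed.

Lemma ck_le k j A f : (k <= j)%N -> ck j A f -> ck k A f.
Proof.
by elim: j => [|j IH]; rewrite leq_eqVlt => /orP[/eqP->//|//]; rewrite ltnS => /IH kj /ckW.
Qed.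

Lemma ck_continuous k A f y : ck k A f -> A y -> {for y, continuous f}.
Proof. by move=> /(@ck_le 0) H Ay; exact: H. Qed.

Lemma ck_differentiable k A f y : ck k.+1 A f -> A y -> differentiable f y.
Proof. by case=> df _; exact: df. Qed.

Lemma ck_pd k A f a : ck k.+1 A f -> ck k A (pd a f).
Proof. by case=> _; apply. Qed.

Lemma ck_sub k A B f : A `<=` B -> ck k B f -> ck k A f.
Proof.
move=> AB; elim: k f => [f cf y /AB|k IH f [df pf]]; first exact: cf.
by split=> [y /AB|a]; [exact: df|apply: IH; exact: pf].
Qed.

Lemma ckU k A B f : ck k A f -> ck k B f -> ck k (A `|` B) f.
Proof.
elim: k f => [f cA cB y [/cA|/cB]//|k IH f [dA pA] [dB pB]].
by split=> [y [/dA|/dB]//|a]; apply: IH; [exact: pA|exact: pB].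
Qed.

Lemma ck_ext k (A : set V) (f g : V -> R) : open A -> (forall y, A y -> f y = g y) -> ck k A f -> ck k A g.
Proof.
move=> oA; have nA y : A y -> \near y, A y by move=> Ay; exact: open_nbhs_nbhs.
elim: k f g => [f g fg cf y Ay|k IH f g fg [df pf]].
  have := cf y Ay; rewrite /prop_for /continuous_at -(fg y Ay) => c; apply: cvg_trans c.
  by apply: (@near_eq_cvg _ _ (nbhs y) _ f g); near=> z; apply: fg; near: z; exact: nA.
have nfg y : A y -> \near y, f y = g y by move=> Ay; near=> z; apply: fg; near: z; exact: nA.
split=> [y Ay|a]; first exact: near_eq_differentiable (nfg _ Ay) (df _ Ay).
by apply: (IH (pd a f)); [move=> y Ay; exact: near_eq_pd (nfg _ Ay)|exact: pf].
Unshelve. all: by end_near. Qed.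

Lemma smooth_ck k A f : smooth_on A f -> ck k A f.
Proof.
elim: k f => [f sf y Ay|k IH f sf]; first exact/differentiable_continuous/(sf [::]).
split=> [y Ay|a]; first exact: (sf [::]).
by apply: IH => s y Ay; have := sf (rcons s a) y Ay; rewrite foldr_rcons.
Qed.

Lemma ck_cst k A (c : R) : ck k A (fun=> c).
Proof.
elim: k c => [c y _|k IH c]; first exact: cst_continuous.
split=> [y _|a]; first exact: differentiable_cst.
by rewrite (_ : pd a _ = fun=> 0) //; apply/funext => y; exact: pd_cst.
Qed.

Lemma ck_coord k A (b : 'I_n) : ck k A (fun z : V => z 0 b).
Proof.
case: k => [|k]; first by move=> y _; exact: coord_continuous.
split=> [y _|a]; first exact: differentiable_coord.
rewrite (_ : pd a _ = fun=> (a == b)%:R); first exact: ck_cst.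
by apply/funext => y; exact: pd_coord.
Qed.

Section Closure.
Variable A : set V.
Hypothesis oA : open A.

Lemma ckD k f g : ck k A f -> ck k A g -> ck k A (fun y => f y + g y).
Proof.
elim: k f g => [f g cf cg y Ay|k IH f g [df pf] [dg pg]].
  by apply: continuousD; [exact: cf|exact: cg].
split=> [y Ay|a]; first by apply: differentiableD; [exact: df|exact: dg].
apply: (@ck_ext _ _ (fun y => pd a f y + pd a g y)) => // [y Ay|]; last by apply: IH; [exact: pf|exact: pg].
by rewrite pdD//; [exact: df|exact: dg].
Qed.

Lemma ckM k f g : ck k A f -> ck k A g -> ck k A (fun y => f y * g y).
Proof.
elim: k f g => [f g cf cg y Ay|k IH f g /[dup] /ckW cf [df pf] /[dup] /ckW cg [dg pg]].
  by apply: continuousM; [exact: cf|exact: cg].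
split=> [y Ay|a]; first by apply: differentiableM; [exact: df|exact: dg].
apply: (@ck_ext _ _ (fun y => f y * pd a g y + g y * pd a f y)) => // [y Ay|].
  by rewrite pdM//; [exact: df|exact: dg].
by apply: ckD; apply: IH => //; [exact: pg|exact: pf].
Qed.

Lemma ckN k f : ck k A f -> ck k A (fun y => - f y).
Proof.
move=> cf; apply: (@ck_ext _ _ (fun y => -1 * f y)) => // [y _|]; first by rewrite mulN1r.
by apply: ckM => //; exact: ck_cst.
Qed.

Lemma ckB k f g : ck k A f -> ck k A g -> ck k A (fun y => f y - g y).
Proof. by move=> cf cg; apply: ckD => //; exact: ckN. Qed.

Lemma ck_sum k (I : Type) (r : seq I) (P : pred I) (f : I -> V -> R) :
  (forall i, P i -> ck k A (f i)) -> ck k A (fun y => \sum_(i <- r | P i) f i y).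
Proof.
move=> cf; elim: r => [|i r IH]; first by under eq_fun do rewrite big_nil; exact: ck_cst.
have [Pi|nPi] := boolP (P i); last by under eq_fun do rewrite big_cons (negbTE nPi).
by under eq_fun do rewrite big_cons Pi; apply: ckD => //; exact: cf.
Qed.

Lemma ck_prod k (I : Type) (r : seq I) (P : pred I) (f : I -> V -> R) :
  (forall i, P i -> ck k A (f i)) -> ck k A (fun y => \prod_(i <- r | P i) f i y).
Proof.
move=> cf; elim: r => [|i r IH]; first by under eq_fun do rewrite big_nil; exact: ck_cst.
have [Pi|nPi] := boolP (P i); last by under eq_fun do rewrite big_cons (negbTE nPi).
by under eq_fun do rewrite big_cons Pi; apply: ckM => //; exact: cf.
Qed.

Lemma ckV k (f : V -> R) : (forall y, A y -> f y != 0) -> ck k A f -> ck k A (fun y => (f y)^-1).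
Proof.
move=> f0; elim: k => [cf y Ay|k IH /[dup] /ckW cf [df pf]].
  by apply: continuousV; [exact: f0|exact: cf].
split=> [y Ay|a]; first by apply: differentiableV; [exact: df|exact: f0].
apply: (@ck_ext _ _ (fun y => - ((f y)^-1 * (f y)^-1) * pd a f y)) => // [y Ay|].
  by rewrite pdV ?f0//; [rewrite -exprVn expr2|exact: df].
apply: ckM; last exact: pf.
by apply: ckN; apply: ckM; exact: IH.
Qed.

Lemma ck_sqrt k (f : V -> R) : (forall y, A y -> 0 < f y) -> ck k A f -> ck k A (fun y => Num.sqrt (f y)).
Proof.
move=> f0; have sq0 y : A y -> Num.sqrt (f y) != 0 by move=> /f0; rewrite -sqrtr_gt0; exact: lt0r_neq0.
have ds y : A y -> is_derive (f y) 1 (@Num.sqrt R) (2 * Num.sqrt (f y))^-1.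
  by move=> Ay; apply: is_derive1_sqrt; exact: f0.
elim: k => [cf y Ay|k IH /[dup] /ckW cf [df pf]].
  by apply: (@continuous_comp _ _ _ f Num.sqrt); [exact: cf|exact: sqrt_continuous].
have dS y : A y -> differentiable (@Num.sqrt R) (f y).
  by move=> Ay; apply/derivable1_diffP; case: (ds y Ay).
split=> [y Ay|a].
  by apply: (@differentiable_comp _ _ _ _ f Num.sqrt); [exact: df|exact: dS].
apply: (@ck_ext _ _ (fun y => pd a f y * (2^-1 * (Num.sqrt (f y))^-1))) => // [y Ay|].
  rewrite /pd [RHS]deriveE; last by apply: (@differentiable_comp _ _ _ _ f Num.sqrt); [exact: df|exact: dS].
  rewrite (@diff_comp _ _ _ _ f Num.sqrt) /=; [|exact: df|exact: dS].
  rewrite -(deriveE _ (df _ Ay)) diff1E; last exact: dS.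
  by case: (ds y Ay) => _ dsE; rewrite derive1E dsE invfM.
apply: ckM; first exact: pf.
apply: ckM; first exact: ck_cst.
by apply: ckV => //; exact: IH.
Qed.

Lemma ck_comp k (B : set V) (F : V -> V) f : (forall b, ck k A (fun y => F y 0 b)) ->
  (forall y, A y -> B (F y)) -> ck k B f -> ck k A (f \o F).
Proof.
move=> cF AB; elim: k cF f => [cF f cf y Ay|k IH cF f [df pf]].
  apply: continuous_comp; last exact/cf/AB.
  move=> P /nbhs_rV[e e0 eP]; change (nbhs y (fun z => P (F z))).
  have : \forall z \near y, forall b, `|F y 0 b - F z 0 b| < e / 2.
    apply: (@filter_forall V 'I_n (fun b z => `|F y 0 b - F z 0 b| < e / 2) (nbhs y)) => b.
    have := cF b y Ay.
    by move=> /cvgrPdist_lt; apply; rewrite divr_gt0.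
  apply: filterS => z Fz; apply: eP; apply: (@le_lt_trans _ _ (e / 2)); last lra.
  by apply/rV_normP => [|b]; [lra|rewrite !mxE; exact/ltW].
have dFb b y : A y -> differentiable (fun z => F z 0 b) y by move=> Ay; case: (cF b) => + _; exact.
split=> [y Ay|a]; first by apply: (pd_comp _ _).1 => [b|]; [exact: dFb|exact/df/AB].
apply: (@ck_ext _ _ (fun y => \sum_b pd a (fun z => F z 0 b) y * (pd b f \o F) y)) => // [y Ay|].
  by rewrite (pd_comp _ _).2// => [b|]; [exact: dFb|exact/df/AB].
apply: ck_sum => b _; apply: ckM; first exact: ck_pd (cF b).
by apply: IH => [c|]; [exact: ckW|exact: pf].
Qed.

End Closure.

Lemma mean_value (g dg : R -> R) (h : R) : 0 < h ->
  (forall s, 0 <= s <= h -> is_derive s 1 g (dg s)) ->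
  exists2 c, 0 <= c <= h & g h - g 0 = dg c * h.
Proof.
move=> h0 dgP; have [c] : exists2 c, c \in `[0, h]%R & g h - g 0 = dg c * (h - 0).
  apply: MVT_segment; first exact: ltW.
    by move=> x; rewrite in_itv/= => /andP[x0 xh]; apply: dgP; rewrite !ltW.
  apply: derivable_within_continuous => x; rewrite in_itv/= => xh.
  by case: (dgP x xh).
by rewrite in_itv/= subr0 => ch E; exists c.
Qed.

(* Mean value theorem applied twice to the second difference of f. *)
Lemma second_difference (A : set V) f (y : V) (a b : 'I_n) (r h : R) : ck 2 A f ->
  (forall z : V, `|y - z| <= r -> A z) -> 0 < h -> h + h <= r ->
  exists2 z : V, `|y - z| <= h + h &
    f (y + h *: bvec a + h *: bvec b) - f (y + h *: bvec a) - f (y + h *: bvec b) + f y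
      = h ^+ 2 * pd b (pd a f) z.
Proof.
move=> [df pf] Ar h0 hr.
have Ain (s t : R) : 0 <= s <= h -> 0 <= t <= h -> `|y - (y + s *: bvec a + t *: bvec b)| <= h + h.
  move=> /andP[s0 sh] /andP[t0 th]; rewrite opprD addrA opprD addrA subrr add0r -opprD normrN.
  apply: le_trans (ler_normD _ _) _; rewrite !normrZ !ger0_norm//.
  have bn c : `|bvec c| <= 1.
    by apply/rV_normP => // i; rewrite mxE; case: (_ && _); rewrite ?normr1 ?normr0.
  by apply: lerD; [rewrite -[leRHS]mulr1|rewrite -[leRHS]mulr1]; apply: ler_pM.
have AA (s t : R) : 0 <= s <= h -> 0 <= t <= h -> A (y + s *: bvec a + t *: bvec b).
  by move=> sh th; apply: Ar; apply: le_trans (Ain _ _ sh th) hr.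
have h0h : 0 <= h <= h by rewrite lexx ltW.
have z0h : (0 : R) <= 0 <= h by rewrite lexx ltW.
pose g (s : R) := f (y + h *: bvec b + s *: bvec a) - f (y + s *: bvec a).
have dg (s : R) : 0 <= s <= h -> is_derive s 1 g
    (pd a f (y + h *: bvec b + s *: bvec a) - pd a f (y + s *: bvec a)).
  move=> sh; apply: is_deriveB.
    by apply: is_derive_line; apply: df; rewrite addrAC; exact: AA.
  apply: is_derive_line; apply: df.
  by rewrite -[_ + _]addr0 -[X in _ + X](scale0r (bvec b)); exact: AA.
have [xi xih gE] := mean_value h0 dg.
pose k (t : R) := pd a f (y + xi *: bvec a + t *: bvec b).
have dk (t : R) : 0 <= t <= h -> is_derive t 1 k (pd b (pd a f) (y + xi *: bvec a + t *: bvec b)).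
  by move=> th; apply: is_derive_line; case: (pf a) => + _; apply; exact: AA.
have [et eth kE] := mean_value h0 dk.
exists (y + xi *: bvec a + et *: bvec b); first exact: Ain.
have -> : f (y + h *: bvec a + h *: bvec b) - f (y + h *: bvec a) - f (y + h *: bvec b) + f y
    = g h - g 0.
  by rewrite /g !scale0r !addr0 [y + h *: bvec b + _]addrAC; ring.
rewrite gE [y + h *: bvec b + _]addrAC.
have -> : pd a f (y + xi *: bvec a + h *: bvec b) - pd a f (y + xi *: bvec a) = k h - k 0.
  by rewrite /k scale0r addr0.
by rewrite kE; ring.
Qed.

(** The second difference is symmetric in [a] and [b], so the two mixed derivatives share a value,
    each taking it at some point as close to [y] as desired; continuity concludes. *)
Lemma schwarz (A : set V) f y (a b : 'I_n) : open A -> ck 2 A f -> A y ->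
  pd a (pd b f) y = pd b (pd a f) y.
Proof.
move=> oA cf Ay; have [df pf] := cf.
have [r r0 rA] : exists2 r : R, 0 < r & forall v, `|y - v| < r -> A v.
  by apply/nbhs_rV; exact: open_nbhs_nbhs.
apply/eqP; rewrite -subr_eq0 -normr_le0; apply/ler_addgt0Pl => e e0; rewrite addr0.
have cont c d : {for y, continuous (pd c (pd d f))}.
  exact: (pf d).2 c y Ay.
have near1 c d : exists2 t, 0 < t & forall z, `|y - z| < t ->
    `|pd c (pd d f) y - pd c (pd d f) z| < e / 2.
  by apply/nbhs_rV; have := cont c d; move=> /cvgrPdist_lt; apply; rewrite divr_gt0.
have [s s0 sP] := near1 a b; have [t t0 tP] := near1 b a.
pose h := Num.min r (Num.min s t) / 4.
have m0 : 0 < Num.min r (Num.min s t) by rewrite !lt_min r0 s0.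
have h0 : 0 < h by rewrite divr_gt0.
have [hr hs ht] : [/\ h + h < r, h + h < s & h + h < t].
  have : h + h < Num.min r (Num.min s t) by rewrite /h; lra.
  by rewrite !lt_min => /and3P[].
have rA' z : `|y - z| <= h + h -> A z by move=> yz; apply: rA; exact: le_lt_trans yz hr.
have [z zh zE] := @second_difference A f y a b (h + h) h cf rA' h0 (lexx _).
have [w wh wE] := @second_difference A f y b a (h + h) h cf rA' h0 (lexx _).
have zw : pd b (pd a f) z = pd a (pd b f) w.
  have h20 : h ^+ 2 != 0 by rewrite expf_neq0// gt_eqF.
  have yba : y + h *: bvec b + h *: bvec a = y + h *: bvec a + h *: bvec b by exact: addrAC.
  apply: (mulfI h20); apply: etrans (esym zE) _; apply: etrans _ wE; rewrite yba.
  by rewrite -!addrA; congr (_ + _); rewrite !addrA (addrC (- _)).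
have := sP w (le_lt_trans wh hs); have := tP z (le_lt_trans zh ht); rewrite zw.
move: (pd b (pd a f) y) (pd a (pd b f) y) (pd a (pd b f) w) => p q u.
by clear; rewrite !ltr_norml ler_norml; lra.
Qed.
End Derivatives.

(* The integral of a nonnegative function is a supremum over simple functions, so that it is
   monotone without any measurability assumption. *)
Lemma integral_le_nomeas d (T : measurableType d) (R : realType)
    (mu : {measure set T -> \bar R}) (D E : set T) (f g : T -> \bar R) :
  D `<=` E -> (forall x, D x -> (f x <= g x)%E) -> (forall x, E x -> (0 <= g x)%E) ->
  (\int[mu]_(x in D) f x <= \int[mu]_(x in E) g x)%E.
Proof.
move=> DE fg g0.
have fD : (\int[mu]_(x in D) f x <= \int[mu]_(x in D) f^\+ x)%E.
  rewrite integralE -[leRHS]sube0; apply: leeB => //.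
  by apply: integral_ge0 => x _; exact: funeneg_ge0.
apply: le_trans fD _; rewrite [leRHS]ge0_integralE// ge0_integralE; last first.
  by move=> x _; exact: funepos_ge0.
apply: ge_ereal_sup => _ [h hf <-]; apply: ereal_sup_ubound; exists h => // x.
apply: le_trans (hf x) _; rewrite !patchE.
have [xD|xD] := boolP (x \in D); have [xE|xE] := boolP (x \in E) => //.
- by rewrite funeposE ge_max fg ?g0//; exact: set_mem.
- by case/negP: xE; apply/mem_set/DE/set_mem.
- by apply: g0; exact: set_mem.
Qed.

Lemma FTC_interval (R : realType) (g dg : R -> R) (a b : R) : a < b ->
  (forall t, a <= t <= b -> is_derive t 1 g (dg t)) ->
  (forall t, a <= t <= b -> {for t, continuous dg}) ->
  (\int[lebesgue_measure]_(t in `[a, b]) (dg t)%:E = (g b - g a)%:E)%E.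
Proof.
move=> ab dgP cdg; rewrite (@continuous_FTC2 _ dg g)//.
- apply/continuous_in_subspaceT => t; rewrite inE/= in_itv/= => tab; exact: cdg.
- have cg t : a <= t <= b -> {for t, continuous g}.
    by move=> /dgP[+ _] => /derivable1_diffP/differentiable_continuous.
  have aab : a <= a <= b by rewrite lexx ltW.
  have bab : a <= b <= b by rewrite lexx ltW.
  split.
  + by move=> t; rewrite in_itv/= => /andP[at' tb]; case: (dgP t); rewrite ?ltW.
  + by apply: cvg_at_right_filter; exact: cg.
  + by apply: cvg_at_left_filter; exact: cg.
- move=> t; rewrite in_itv/= => /andP[at' tb]; rewrite derive1E.
  by case: (dgP t); rewrite ?ltW.
Qed.

(** * Estimates for Gram matrices *)

Section LinearAlgebra.
Variables (R : realType) (n : nat).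
Local Notation V := 'rV[R]_n.

Lemma continuous_rV (T : topologicalType) (g : T -> V) (t : T) :
  (forall b, {for t, continuous (fun s => g s 0 b)}) -> {for t, continuous g}.
Proof.
move=> cg P /nbhs_rV[e e0 eP]; change (nbhs t (fun z => P (g z))).
have : \forall z \near t, forall b, `|g t 0 b - g z 0 b| < e / 2.
  apply: (@filter_forall T 'I_n (fun b z => `|g t 0 b - g z 0 b| < e / 2) (nbhs t)) => b.
  by have := cg b; move=> /cvgrPdist_lt; apply; rewrite divr_gt0.
apply: filterS => z Fz; apply: eP; apply: (@le_lt_trans _ _ (e / 2)); last lra.
by apply/rV_normP => [|b]; [lra|rewrite !mxE; exact/ltW].
Qed.

Lemma vdotE (G : 'M[R]_n) (u v : V) : vdot G u v = \sum_a \sum_b u 0 a * G a b * v 0 b.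
Proof.
rewrite /vdot mxE exchange_big/=; apply: eq_bigr => b _; rewrite !mxE mulr_suml.
by apply: eq_bigr.
Qed.

Lemma vdot_congr (G J : 'M[R]_n) (u v : V) : vdot (J *m G *m J^T) u v = vdot G (u *m J) (v *m J).
Proof. by rewrite /vdot trmx_mul !mulmxA. Qed.

Lemma vdot_enorm (T : 'M[R]_n) (v : V) : vdot (T *m T^T) v v = enorm (v *m T) ^+ 2.
Proof.
rewrite enorm_sqr /vdot mulmxA -mulmxA -trmx_mul mxE.
by apply: eq_bigr => k _; rewrite [in X in _ * X]mxE expr2.
Qed.

Lemma vdot_bound (G : 'M[R]_n) (b : R) (v : V) : 0 <= b -> (forall i j, `|G i j| <= b) ->
  `|vdot G v v| <= n%:R * (n%:R * b) * `|v| ^+ 2.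
Proof.
move=> b0 Gb; rewrite /vdot mxE; apply: le_trans (ler_norm_sum _ _ _) _.
apply: (@le_trans _ _ (\sum_(k < n) (n%:R * b * `|v|) * `|v|)).
  apply: ler_sum => k _; rewrite normrM; apply: ler_pM => //; last by rewrite mxE rV_coord_le.
  exact: le_trans (rV_coord_le _ _) (lin_norm_le b0 Gb v).
by rewrite sumr_const card_ord -[leLHS]mulr_natl expr2 !mulrA.
Qed.

Lemma enorm_inv (T S : 'M[R]_n) (v : V) : T *m S = 1%:M ->
  `|v| <= n%:R * mx_bound S * enorm (v *m T).
Proof.
move=> TS; rewrite -{1}[v]mulmx1 -TS mulmxA.
apply: le_trans (lin_norm_le (mx_bound_ge0 S) (mx_boundP S) _) _.
by apply: ler_wpM2l (norm_le_enorm _); rewrite mulr_ge0// mx_bound_ge0.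
Qed.

(** The entries of [G] vary little near [y0], and the sup norm of [v] is controlled by
    [enorm (v *m T)] since [T] is invertible; the error is therefore small relative to the form at
    [y0]. *)
Lemma gram_near (G : V -> 'M[R]_n) (T S : 'M[R]_n) (y0 : V) (e : R) : 0 < e ->
  G y0 = T *m T^T -> T *m S = 1%:M ->
  (forall a b, {for y0, continuous (fun y => G y a b)}) ->
  \forall y \near y0, forall v : V,
    (1 - e) * enorm (v *m T) ^+ 2 <= vdot (G y) v v <= (1 + e) * enorm (v *m T) ^+ 2.
Proof.
move=> e0 G0 TS cG; pose K := n%:R * n%:R * (n%:R * mx_bound S) ^+ 2 : R.
have K0 : 0 <= K by rewrite /K mulr_ge0 ?sqr_ge0 ?mulr_ge0.
pose dt := e / (K + 1); have dt0 : 0 < dt by rewrite divr_gt0//; lra.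
have : \forall y \near y0, forall ab : 'I_n * 'I_n, `|G y0 ab.1 ab.2 - G y ab.1 ab.2| < dt.
  apply: (@filter_forall V ('I_n * 'I_n)%type
    (fun ab y => `|G y0 ab.1 ab.2 - G y ab.1 ab.2| < dt) (nbhs y0)) => -[a b].
  by have := cG a b; move=> /cvgrPdist_lt; apply.
apply: filterS => y Gy v.
have GB : `|vdot (G y) v v - vdot (G y0) v v| <= e * enorm (v *m T) ^+ 2.
  have -> : vdot (G y) v v - vdot (G y0) v v = vdot (G y - G y0) v v.
    by rewrite /vdot mulmxBr mulmxBl !mxE.
  apply: le_trans (vdot_bound v (ltW dt0) _) _ => [a b|].
    by rewrite !mxE distrC ltW//; exact: (Gy (a, b)).
  have vN := enorm_inv v TS.
  have v2 : `|v| ^+ 2 <= (n%:R * mx_bound S) ^+ 2 * enorm (v *m T) ^+ 2.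
    by rewrite -exprMn ler_pXn2r ?nnegrE// mulr_ge0 ?enorm_ge0// mulr_ge0// mx_bound_ge0.
  apply: (@le_trans _ _ (n%:R * (n%:R * dt) * ((n%:R * mx_bound S) ^+ 2 * enorm (v *m T) ^+ 2))).
    by apply: ler_wpM2l => //; rewrite mulr_ge0// mulr_ge0// ltW.
  have -> : n%:R * (n%:R * dt) * ((n%:R * mx_bound S) ^+ 2 * enorm (v *m T) ^+ 2) =
      dt * K * enorm (v *m T) ^+ 2 by rewrite /K; ring.
  rewrite ler_wpM2r ?sqr_ge0// /dt mulrAC ler_pdivrMr ?ler_pM2l//; lra.
move: GB; rewrite G0 vdot_enorm; move: (vdot _ _ _) (enorm _ ^+ 2) => p q.
by clear; rewrite ler_norml; lra.
Qed.

End LinearAlgebra.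

(** * Riemannian distance in a chart *)

Section Curves.
Variables (R : realType) (n : nat) (X : metricType R) (D : set X).
Variable S : riem_structure R n D.
Local Notation V := 'rV[R]_n.
Implicit Types (i j : chart S) (c : R -> X).

Lemma img_phi i y : (phi i @` dom i) y -> dom i (psi i y) /\ phi i (psi i y) = y.
Proof. by move=> [x dx <-]; rewrite phiK. Qed.

Lemma open_transition_dom i j : open (phi i @` (dom i `&` dom j)).
Proof.
rewrite (_ : phi i @` _ = (phi i @` dom i) `&` psi i @^-1` dom j); last first.
  apply/seteqP; split=> [_ [x [di dj] <-]|y [/img_phi[dy yK] dj]].
    by split; [exists x|rewrite /= phiK].
  by exists (psi i y).
rewrite openE => y [iy jy]; apply: filterI.
  by apply: open_nbhs_nbhs; split=> //; exact: img_open.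
apply: (psi_continuous iy); apply: open_nbhs_nbhs; split=> //; exact: dom_open.
Qed.

Lemma transition_differentiable i j b y : (phi i @` (dom i `&` dom j)) y ->
  differentiable (fun z => phi j (psi i z) 0 b) y.
Proof. by move=> ijy; exact: (@transition_smooth _ _ _ _ S i j b [::]). Qed.

Lemma derive_chart c t i j : continuous c -> dom i (c t) -> dom j (c t) ->
  derivable (phi i \o c) t 1 ->
  derivable (phi j \o c) t 1 /\
  'D_1 (phi j \o c) t = 'D_1 (phi i \o c) t *m Defs.jacobian (@phi _ _ _ _ S) (@psi _ _ _ _ S) i j (phi i (c t)).
Proof.
move=> cc di dj dt.
have near_i : \near t, phi j (c t) = phi j (psi i (phi i (c t))).
  have : \near t, dom i (c t).
    by apply: (cc t); apply: open_nbhs_nbhs; split=> //; exact: dom_open.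
  by apply: filterS => s ds; rewrite phiK.
have dtr b : is_derive t 1 (fun s => phi j (c s) 0 b)
    (\sum_a ('D_1 (phi i \o c) t) 0 a * pd a (fun z => phi j (psi i z) 0 b) (phi i (c t))).
  have H := @derive_comp_curve R n (phi i \o c) (fun z => phi j (psi i z) 0 b) t dt.
  apply: (@near_eq_is_derive _ _ _ ((fun z => phi j (psi i z) 0 b) \o (phi i \o c))).
    by apply: filterS near_i => s /= <-.
  apply: H; apply: transition_differentiable; exists (c t) => //.
have dj' : derivable (phi j \o c) t 1.
  by apply/derivable_mxP => k b; rewrite ord1; case: (dtr b).
split=> //; apply/rowP => b; rewrite derive_mx// !mxE.
by case: (dtr b) => _ ->; apply: eq_bigr => a _; rewrite mxE.
Qed.

(** [speed] is defined by the preferred chart at each time; [gram_compat] brings it to a chart that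
    stays fixed along the curve. *)
Lemma speedE c t i : C1_curve S c -> dom i (c t) ->
  speed S c t = Num.sqrt (vdot (gram i (phi i (c t))) ('D_1 (phi i \o c) t) ('D_1 (phi i \o c) t)).
Proof.
move=> [cc cD cd] di; have dj := dom_chart_at S (cD t); have [dt _] := cd i t di.
rewrite /speed /gram_at /coord (gram_compat di dj) vdot_congr.
by have [_ <-] := derive_chart cc di dj dt.
Qed.

(** Calibration: the linear function [q] in the direction of the displacement [e] grows by
    [k * enorm e] along the curve, and by Cauchy-Schwarz its derivative is at most the speed. *)
Lemma length_ge c i (T : 'M[R]_n) (k tau : R) : C1_curve S c -> 0 < tau -> 0 <= k ->
  (forall t, 0 <= t <= tau -> dom i (c t) /\
     forall v : V, k ^+ 2 * enorm (v *m T) ^+ 2 <= vdot (gram i (phi i (c t))) v v) ->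
  ((k * enorm ((phi i (c tau) - phi i (c 0)) *m T))%:E <=
   \int[lebesgue_measure]_(t in `[0%R, tau]) (speed S c t)%:E)%E.
Proof.
move=> cS tau0 k0 H; have [cc cD cd] := cS.
set e := (phi i (c tau) - phi i (c 0)) *m T.
have [e0|e0] := eqVneq (enorm e) 0.
  by rewrite e0 mulr0; apply: integral_ge0 => t _; rewrite lee_fin sqrtr_ge0.
have ep : 0 < enorm e by rewrite lt_neqAle eq_sym e0 enorm_ge0.
pose u := phi i \o c.
have du t : 0 <= t <= tau -> derivable u t 1 by move=> /H[di _]; case: (cd i t di).
have cu t : 0 <= t <= tau -> {for t, continuous ('D_1 u)} by move=> /H[di _]; case: (cd i t di).
pose w : 'I_n -> R := fun a => \sum_b T a b * (e 0 b * (k / enorm e)).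
pose q (t : R) := \sum_a u t 0 a * w a.
pose dq (t : R) := \sum_a ('D_1 u t) 0 a * w a.
have qE (v : V) : \sum_a v 0 a * w a = (k / enorm e) * \sum_b (v *m T) 0 b * e 0 b.
  rewrite /w mulr_sumr; under eq_bigr do rewrite mulr_sumr.
  rewrite exchange_big/=; apply: eq_bigr => b _; rewrite [(v *m T) 0 b]mxE mulr_suml mulr_sumr.
  by apply: eq_bigr => a _; move: (e 0 b) (k / enorm e) => p p'; ring.
have dqP t : 0 <= t <= tau -> is_derive t 1 q (dq t).
  move=> tt; rewrite (_ : q = \sum_a (fun t => u t 0 a * w a)); last first.
    by apply/funext => s; rewrite fct_sumE.
  apply: is_derive_sum => a; have [da ->] := derive_coord a (du t tt).
  have H1 := @is_deriveM R R (fun s => u s 0 a) (cst (w a)) t 1 _ 0 (derivableP da)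
    (is_derive_cst (w a) t 1).
  by apply: is_derive_eq; rewrite scaler0 add0r; exact: mulrC.
have cdq t : 0 <= t <= tau -> {for t, continuous dq}.
  move=> tt; rewrite (_ : dq = \sum_a (fun t => ('D_1 u t) 0 a * w a)); last first.
    by apply/funext => s; rewrite fct_sumE.
  apply: (big_ind (fun f : R -> R => {for t, continuous f})).
  - exact: cst_continuous.
  - by move=> f g cf cg; exact: continuousD.
  - move=> a _; apply: continuousM; last exact: cst_continuous.
    apply: (@continuous_comp _ _ _ ('D_1 u) (fun y : V => y 0 a)); first exact: cu.
    exact: coord_continuous.
have <- : (q tau - q 0 = k * enorm e)%R.
  rewrite /q !qE -mulrBr -sumrB.
  rewrite (eq_bigr (fun b => e 0 b ^+ 2)) => [|b _]; last first.
    rewrite -mulrBl expr2; congr (_ * _).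
    by rewrite /e mulmxBl [in RHS]mxE [X in _ = _ + X]mxE.
  by rewrite -enorm_sqr expr2 mulrA divfK.
rewrite -(FTC_interval tau0 dqP cdq); apply: integral_le_nomeas => //.
- move=> t /=; rewrite in_itv/= => tt; rewrite lee_fin.
  have [di vG] := H t tt; rewrite (speedE cS di) /dq qE.
  apply: (@le_trans _ _ (k * enorm ('D_1 u t *m T))).
    rewrite -mulrA ler_wpM2l// mulrC ler_pdivrMr//; exact: enorm_dot.
  have kp : 0 <= k * enorm ('D_1 u t *m T) by rewrite mulr_ge0 ?enorm_ge0.
  by rewrite -(ger0_norm kp) -sqrtr_sqr exprMn ler_wsqrtr// vG.
- by move=> t _; rewrite lee_fin sqrtr_ge0.
Qed.

(** Curves are defined on all of R and must never leave the regular set. This time change keeps a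
    segment between its endpoints at every real time, and it is nondecreasing on [0, 1]. *)
Definition reparam (t : R) : R := (1 - cos (pi * t)) / 2.
Definition dreparam (t : R) : R := pi * sin (pi * t) / 2.

Lemma is_derive_reparam (t : R) : is_derive t 1 reparam (dreparam t).
Proof.
have Hl : is_derive t 1 ((pi : R) \*: (@id R)) (pi *: (1 : R)) by exact: is_deriveZ.
have Hc := @is_derive1_comp _ cos _ t _ _ (is_derive_cos (pi * t)) Hl.
have H1 := @is_deriveB R R R (cst 1) _ t 1 _ _ (is_derive_cst (1 : R) t (1 : R)) Hc.
have H2 := @is_deriveM R R _ (cst (2^-1)) t 1 _ 0 H1 (is_derive_cst (2^-1 : R) t (1 : R)).
apply: is_derive_eq; rewrite scaler0 add0r sub0r mulNr opprK.
rewrite /dreparam -[pi *: 1]/(pi * 1) mulr1 -[LHS]/(2^-1 * (sin (pi * t) * pi)) mulrC [sin _ * _]mulrC.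
by [].
Qed.

Lemma reparam01 (t : R) : 0 <= reparam t <= 1.
Proof. by have := cos_le1 (pi * t); have := cos_geN1 (pi * t); rewrite /reparam; lra. Qed.

Lemma reparam0 : reparam 0 = 0.
Proof. by rewrite /reparam mulr0 cos0 subrr mul0r. Qed.

Lemma reparam1 : reparam 1 = 1.
Proof. by rewrite /reparam mulr1 cospi; lra. Qed.

Lemma dreparam_ge0 (t : R) : 0 <= t <= 1 -> 0 <= dreparam t.
Proof.
move=> /andP[t0 t1]; rewrite divr_ge0// mulr_ge0 ?pi_ge0// sin_ge0_pi//.
by rewrite mulr_ge0 ?pi_ge0//= ler_piMr ?pi_ge0.
Qed.

Lemma continuous_dreparam (t : R) : {for t, continuous dreparam}.
Proof.
apply: continuousM; last exact: cst_continuous.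
apply: continuousM; first exact: cst_continuous.
apply: (@continuous_comp _ _ _ (fun s => pi * s) sin); last exact: continuous_sin.
by apply: continuousM; [exact: cst_continuous|move=> ?; exact: cvg_id].
Qed.

Lemma is_derive_seg (y w : V) (t : R) : is_derive t 1 (fun s => y + reparam s *: w) (dreparam t *: w).
Proof.
have [dr drE] := is_derive_reparam t.
have dseg b : is_derive t 1 (fun s => (y + reparam s *: w) 0 b) (dreparam t * w 0 b).
  rewrite (_ : (fun s => _) = (fun s => y 0 b + reparam s * w 0 b)); last first.
    by apply/funext => s; rewrite !mxE.
  have H0 := is_derive_cst (y 0 b) t (1 : R).
  have H1 := is_derive_reparam t.
  have H2 := @is_deriveM R R reparam (cst (w 0 b)) t 1 _ 0 H1 (is_derive_cst (w 0 b) t 1).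
  have H3 := @is_deriveD R R R (cst (y 0 b)) (reparam * cst (w 0 b)) t 1 _ _ H0 H2.
  by apply: is_derive_eq; rewrite add0r scaler0 add0r; exact: mulrC.
have dd : derivable (fun s => y + reparam s *: w) t 1.
  by apply/derivable_mxP => k b; rewrite ord1; case: (dseg b).
apply: DeriveDef => //; apply/rowP => b; rewrite derive_mx// !mxE.
by case: (dseg b).
Qed.

(** [C1_curve] asks for a continuous derivative in every chart that the curve meets; the smooth
    transition maps carry this property over from the chart [i]. *)
Lemma C1_segment i (y z : V) :
  (forall s : R, 0 <= s <= 1 -> (phi i @` dom i) (y + s *: (z - y))) ->
  let c t := psi i (y + reparam t *: (z - y)) in
  [/\ C1_curve S c, forall t, dom i (c t),
     forall t, phi i (c t) = y + reparam t *: (z - y) &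
     forall t, 'D_1 (phi i \o c) t = dreparam t *: (z - y)].
Proof.
move=> H c; set g := fun t => y + reparam t *: (z - y).
have im t : (phi i @` dom i) (g t) by exact: H (reparam01 t).
have di t : dom i (c t) by case: (img_phi (im t)).
have pc t : phi i (c t) = g t by case: (img_phi (im t)).
have pcg : phi i \o c = g by apply/funext => t; exact: pc.
have dg (t : R) : is_derive t 1 g (dreparam t *: (z - y)) by exact: is_derive_seg.
have cg (t : R) : {for t, continuous g}.
  by apply/differentiable_continuous/derivable1_diffP; case: (dg t).
have cc : continuous c.
  move=> t; apply: (@continuous_comp _ _ _ g (psi i)); first exact: cg.
  exact: psi_continuous (im t).
split=> // [|t]; last by rewrite pcg; case: (dg t).
split=> // [t|j t dj]; first exact: (dom_sub (di t)).
have dt (s : R) : derivable (phi i \o c) s 1 by rewrite pcg; case: (dg s).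
split; first by case: (derive_chart cc (di t) dj (dt t)).
have ij s : dom j (c s) -> (phi i @` (dom i `&` dom j)) (g s).
  by move=> ds; exists (c s) => //; split=> //; exact: di.
have near_eq : \near t, 'D_1 (phi j \o c) t = (dreparam t *: (z - y)) *m
    Defs.jacobian (@phi _ _ _ _ S) (@psi _ _ _ _ S) i j (g t).
  have : \near t, dom j (c t).
    by apply: (cc t); apply: open_nbhs_nbhs; split=> //; exact: dom_open.
  apply: filterS => s ds; have [_ ->] := derive_chart cc (di s) ds (dt s).
  by rewrite pcg pc; case: (dg s) => _ ->.
have cont : {for t, continuous (fun t => (dreparam t *: (z - y)) *m
    Defs.jacobian (@phi _ _ _ _ S) (@psi _ _ _ _ S) i j (g t))}.
  apply: continuous_rV => b.
  rewrite (_ : (fun s => _) = \sum_a (fun s => dreparam s * (z - y) 0 a *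
      pd a (fun w => phi j (psi i w) 0 b) (g s))); last first.
    by apply/funext => s; rewrite mxE fct_sumE; apply: eq_bigr => a _; rewrite !mxE.
  apply: (big_ind (fun f : R -> R => {for t, continuous f})).
  - exact: cst_continuous.
  - by move=> f h cf ch; exact: continuousD.
  - move=> a _; apply: continuousM.
      by apply: continuousM; [exact: continuous_dreparam|exact: cst_continuous].
    apply: (@continuous_comp _ _ _ g (pd a (fun w => phi j (psi i w) 0 b))); first exact: cg.
    apply: differentiable_continuous.
    exact: (@transition_smooth _ _ _ _ S i j b [:: a] _ (ij t dj)).
have := nbhs_singleton near_eq => eqt.
rewrite /prop_for /continuous_at eqt; apply: cvg_trans cont.
apply: (@near_eq_cvg _ _ (nbhs t)).
by apply: filterS near_eq => s ->.
Qed.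

Lemma convex_lt (s p q r : R) : 0 <= s <= 1 -> p < r -> q < r -> (1 - s) * p + s * q < r.
Proof.
move=> /andP[s0 s1] pr qr; have mr : Num.max p q < r by rewrite gt_max pr.
apply: le_lt_trans mr; rewrite [leRHS](_ : _ = (1 - s) * Num.max p q + s * Num.max p q); last by ring.
by apply: lerD; rewrite ler_wpM2l ?le_max ?lexx ?orbT//; lra.
Qed.

Lemma closed_inf_mem (Z : set R) : closed Z -> has_inf Z -> Z (inf Z).
Proof.
move=> cZ hZ; apply: cZ => B /nbhs_ballP[e /= e0 eB].
have [z Zz ze] := inf_adherent e0 hZ.
exists z; split=> //; apply: eB; rewrite /ball/= ltr_norml.
have := ge_inf (proj2 hZ) Zz; lra.
Qed.

(** The exit time is the infimum of the closed set of times spent outside [W]. Before it the curve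
    is in [W], and closedness of [K] keeps the curve in [K] at the exit time as well. *)
Lemma first_exit (W K : set X) (c : R -> X) : open W -> closed K -> W `<=` K ->
  continuous c -> W (c 0) ->
  (forall t, 0 <= t <= 1 -> W (c t)) \/
  exists tau : R, [/\ 0 < tau <= 1, forall t, 0 <= t <= tau -> K (c t) & ~ W (c tau)].
Proof.
move=> oW cK WK cc W0.
have [|] := pselect (forall t, 0 <= t <= 1 -> W (c t)); first by left.
move=> /existsNP[t1 /not_implyP[t01 W1]]; right.
pose Z := `[0, 1]%classic `&` c @^-1` (~` W).
have cZ : closed Z.
  apply: closedI; first exact: interval_closed.
  by apply: closed_comp => [? _|]; [exact: cc|exact: open_closedC].
have hZ : has_inf Z.
  by split; [exists t1; split=> //=; rewrite in_itv|exists 0 => t []; rewrite /= in_itv/= => /andP[]].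
have [/= tauI Wtau] := closed_inf_mem cZ hZ; set tau := inf Z in tauI Wtau *.
move: tauI; rewrite in_itv/= => /andP[tau0 tau1].
have tp : 0 < tau.
  by rewrite lt_neqAle tau0 andbT; apply: contra_notN Wtau => /eqP <-.
have lt_in t : 0 <= t < tau -> W (c t).
  move=> /andP[t0 tt]; apply: contrapT => nW.
  have : tau <= t by apply: (ge_inf (proj2 hZ)); split=> //=; rewrite in_itv/= t0/=; lra.
  lra.
exists tau; split=> //; first by rewrite tp.
move=> t /andP[t0]; rewrite le_eqVlt => /orP[/eqP ->|tt]; last first.
  by apply/WK/lt_in; rewrite t0.
apply: cK => B /cc [/= e e0 eB]; pose s := Num.max 0 (tau - e / 2).
have s0 : 0 <= s < tau by rewrite /s le_max lexx/= gt_max tp; move: e0 => /=; lra.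
exists (c s); split; first exact: WK (lt_in _ s0).
apply: eB; rewrite /ball_ /= ltr_norml; move: s0 e0 => /= /andP[_ s0] e0.
have : tau - e / 2 <= s by rewrite /s le_max lexx orbT.
lra.
Qed.

(** The upper bound is the length of a coordinate segment. For the lower bound, a competing curve
    may leave the region where the metric is almost constant; but then its part up to the exit is
    already long enough. *)
Lemma local_comparison i x0 (T Si : 'M[R]_n) (e : R) : locally_induces_dist S -> dom i x0 ->
  (forall a b, {for phi i x0, continuous (fun y => gram i y a b)}) ->
  T *m Si = 1%:M -> gram i (phi i x0) = T *m T^T -> 0 < e < 1 ->
  exists2 r : R, 0 < r & forall y z, `|phi i x0 - y| < r -> `|phi i x0 - z| < r ->
    (phi i @` dom i) y /\
    (1 - e) * enorm ((z - y) *m T) <= mdist (psi i y) (psi i z)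
      <= (1 + e) * enorm ((z - y) *m T).
Proof.
move=> hS d0 cG TS G0 /andP[e0 e1]; set y0 := phi i x0.
have [r0 r00 distE] := hS x0 (dom_sub d0).
have im0 : (phi i @` dom i) y0 by exists x0.
have : \forall y \near y0, [/\ (phi i @` dom i) y, ball x0 r0 (psi i y) &
    forall v : V, (1 - e) * enorm (v *m T) ^+ 2 <= vdot (gram i y) v v <= (1 + e) * enorm (v *m T) ^+ 2].
  have H1 : \forall y \near y0, (phi i @` dom i) y.
    by apply: open_nbhs_nbhs; split=> //; exact: img_open.
  have H2 : \forall y \near y0, ball x0 r0 (psi i y).
    by apply: (psi_continuous im0); rewrite /y0 phiK//; exact: nbhsx_ballx.
  by near=> y; split; [near: y; exact: H1|near: y; exact: H2|near: y; exact: gram_near G0 TS cG].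
move=> /nbhs_rV[rho1 rho10 HN].
pose C := n%:R * mx_bound T * n%:R + n%:R * mx_bound Si + 1.
have bT := mx_bound_ge0 T; have bS := mx_bound_ge0 Si.
have C0 : 0 < C.
  by rewrite /C ltr_wpDl// addr_ge0// !mulr_ge0.
have NC (v : V) : enorm (v *m T) <= C * `|v|.
  apply: le_trans (enorm_le_norm _) _.
  apply: (@le_trans _ _ (n%:R * (n%:R * mx_bound T * `|v|))).
    by rewrite ler_wpM2l// lin_norm_le//; exact: mx_boundP.
  rewrite (_ : n%:R * _ = n%:R * mx_bound T * n%:R * `|v|); last by ring.
  rewrite ler_wpM2r// /C -addrA lerDl addr_ge0// mulr_ge0//.
have CN (v : V) : `|v| <= C * enorm (v *m T).
  apply: le_trans (enorm_inv v TS) _; rewrite ler_wpM2r ?enorm_ge0//.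
  by rewrite /C -addrA addrCA lerDl addr_ge0// !mulr_ge0.
(* Vectors [v] with [enorm (v *m T) <= rho] have sup norm at most [rho1 / 2], and those of sup norm
   below [rho / (3 * C)] satisfy [enorm (v *m T) <= rho / 3]. *)
pose rho := rho1 / (2 * C).
have rho0 : 0 < rho by rewrite divr_gt0// mulr_gt0.
have rhoC : C * rho = rho1 / 2 by rewrite /rho; move: (C) C0 => c c0; field; rewrite gt_eqF.
have inK y : enorm ((y - y0) *m T) <= rho -> `|y0 - y| < rho1.
  move=> Ny; rewrite distrC; apply: (le_lt_trans (CN _)).
  apply: (@le_lt_trans _ _ (C * rho)); first by rewrite ler_pM2l.
  rewrite rhoC; lra.
(* Since [(1 - e) ^+ 2 <= 1 - e] and [1 + e <= (1 + e) ^+ 2], the factors become squares and come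
   out of the square root in the speed. *)
have sq_lo y : `|y0 - y| < rho1 -> forall v : V, (1 - e) ^+ 2 * enorm (v *m T) ^+ 2 <= vdot (gram i y) v v.
  move=> /HN[_ _ Gy] v; have /andP[+ _] := Gy v; apply: le_trans.
  by rewrite ler_wpM2r ?sqr_ge0// expr2 ler_piMl//; lra.
have sq_hi y : `|y0 - y| < rho1 -> forall v : V, Num.sqrt (vdot (gram i y) v v) <= (1 + e) * enorm (v *m T).
  move=> /HN[_ _ Gy] v; have /andP[_ H] := Gy v.
  have kp : 0 <= (1 + e) * enorm (v *m T) by rewrite mulr_ge0 ?enorm_ge0//; lra.
  rewrite -(ger0_norm kp) -sqrtr_sqr exprMn ler_wsqrtr// (le_trans H)//.
  by rewrite ler_wpM2r ?sqr_ge0// expr2 ler_peMl//; lra.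
exists (rho / (3 * C)); first by rewrite divr_gt0// mulr_gt0.
have near_rho y : `|y0 - y| < rho / (3 * C) -> enorm ((y - y0) *m T) <= rho / 3.
  move=> yr; apply: le_trans (NC _) _; rewrite distrC.
  rewrite (_ : rho / 3 = C * (rho / (3 * C))); first by rewrite ler_pM2l// ltW.
  by move: (C) C0 (rho) => c c0 p; field; rewrite gt_eqF.
move=> y z yr zr.
have Ny := near_rho y yr; have Nz := near_rho z zr.
have yK : `|y0 - y| < rho1 by apply: inK; lra.
have zK : `|y0 - z| < rho1 by apply: inK; lra.
have [iy By _] := HN y yK; have [iz Bz _] := HN z zK.
split=> //; rewrite -!lee_fin distE//; apply/andP; split; last first.
  have seg (s : R) : 0 <= s <= 1 -> `|y0 - (y + s *: (z - y))| < rho1.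
    move=> /andP[s0 s1].
    have -> : y0 - (y + s *: (z - y)) = (1 - s) *: (y0 - y) + s *: (y0 - z).
      by apply/rowP => b; rewrite !mxE; ring.
    apply: le_lt_trans (ler_normD _ _) _; rewrite !normrZ !ger0_norm//; last lra.
    by apply: convex_lt => //; rewrite s0.
  have [|cS dc pc D1] := @C1_segment i y z.
    by move=> s /seg/HN[].
  set c := (fun t : R => _) in cS dc pc D1.
  apply: (@le_trans _ _ (curve_length S c)).
    apply: ereal_inf_lbound; exists c => //; split=> //; rewrite /c ?reparam0 ?reparam1.
      by rewrite scale0r addr0.
    by rewrite scale1r addrC subrK.
  set N := enorm _.
  have dq (t : R) : is_derive t 1 ((1 + e) * N \*: reparam) ((1 + e) * N * dreparam t).
    have := @is_deriveZ R R R reparam ((1 + e) * N) t 1 _ (is_derive_reparam t); exact.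
  rewrite [leRHS](_ : _ = (((1 + e) * N * reparam 1) - ((1 + e) * N * reparam 0))%:E)%E; last first.
    by rewrite reparam0 reparam1 mulr0 mulr1 subr0.
  rewrite -(@FTC_interval R ((1 + e) * N \*: reparam) (fun t => (1 + e) * N * dreparam t) 0 1) => //; last first.
    move=> t _; apply: continuousM; [exact: cst_continuous|exact: continuous_dreparam].
  apply: integral_le_nomeas => // t /=; rewrite in_itv/= => t01; rewrite lee_fin.
    rewrite (speedE cS (dc t)) D1 pc.
    apply: le_trans (sq_hi _ (seg _ (reparam01 t)) _) _.
    rewrite -scalemxAl enormZ ger0_norm ?dreparam_ge0// -/N.
    by rewrite -[leRHS]mulrA (mulrC N).
  by rewrite mulr_ge0 ?dreparam_ge0// mulr_ge0 ?enorm_ge0//; lra.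
apply: le_ereal_inf_tmp => _ [c [cS c0 c1] <-]; have [cc cD _] := cS.
pose W := dom i `&` [set x | enorm ((phi i x - y0) *m T) < rho].
pose K := psi i @` [set w | enorm ((w - y0) *m T) <= rho].
have cN : continuous (fun w : V => enorm ((w - y0) *m T)).
  have sub (w w' : V) : enorm ((w - y0) *m T) - enorm ((w' - y0) *m T) <= C * `|w - w'|.
    rewrite lerBlDr (le_trans _ (lerD (NC _) (lexx _)))// (le_trans _ (enormD _ _))//.
    by rewrite -mulmxDl addrA subrK.
  move=> w B /nbhs_ballP[ep /= ep0 eB]; change (nbhs w (fun w' : V => B (enorm ((w' - y0) *m T)))).
  apply/nbhs_rV; exists (ep / C); first by rewrite divr_gt0.
  move=> w' ww; apply: eB; rewrite /ball/=; have := sub w w'; have := sub w' w; rewrite [`|w' - w|]distrC.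
  have : C * `|w - w'| < ep by rewrite mulrC -ltr_pdivlMr.
  by rewrite ltr_norml; move: (enorm _) (enorm _) (_ * _) => p q q'; clear; lra.
have oW : open W.
  rewrite openE => x [dx Wx]; apply: filterI.
    by apply: open_nbhs_nbhs; split=> //; exact: dom_open.
  have cx : {for x, continuous (fun x => enorm ((phi i x - y0) *m T))}.
    apply: (@continuous_comp _ _ _ (phi i) (fun w : V => enorm ((w - y0) *m T))).
      exact: phi_continuous.
    exact: cN.
  by apply: (cx [set t | t < rho]); apply: open_nbhs_nbhs; split=> //; exact: open_lt.
(* [K] is the image of a compact set, hence closed in the whole of [X]: a curve that leaves [W] is
   still in the chart at its exit time. *)
have cK : closed K.
  apply: compact_closed; first exact: metric_hausdorff.
  apply: continuous_compact.
    apply: continuous_in_subspaceT => w; rewrite inE => /inK/HN[iw _ _].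
    exact: psi_continuous iw.
  apply: bounded_closed_compact.
    exists (`|y0| + rho1); split; first exact: num_real.
    move=> q qr w /inK wr; have := ler_normD (w - y0) y0; rewrite subrK distrC /=.
    by move=> h; apply: (le_trans h); apply: ltW; apply: lt_trans qr; rewrite addrC ltrD2l.
  by apply: (@closed_comp _ _ (fun w : V => enorm ((w - y0) *m T)) [set t | t <= rho]) => [? _|]; [exact: cN|exact: closed_le].
have WK : W `<=` K.
  by move=> x [dx Wx]; exists (phi i x); [exact: ltW|rewrite phiK].
have KP x : K x -> [/\ dom i x, enorm ((phi i x - y0) *m T) <= rho &
    forall v : V, (1 - e) ^+ 2 * enorm (v *m T) ^+ 2 <= vdot (gram i (phi i x)) v v].
  move=> [w wr <-]; have /inK wr1 := wr; have [iw _ _] := HN w wr1.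
  by have [dw pw] := img_phi iw; rewrite pw; split=> //; exact: sq_lo.
have [dy pyK] := img_phi iy; have [dz pzK] := img_phi iz.
have W0 : W (c 0) by rewrite c0; split=> //=; rewrite pyK; lra.
have Wz : W (c 1) by rewrite c1; split=> //=; rewrite pzK; lra.
suff [tau [/andP[tau0 tau1] Kt Ntau]] : exists tau : R, [/\ 0 < tau <= 1, forall t, 0 <= t <= tau -> K (c t) &
    enorm ((z - y) *m T) <= enorm ((phi i (c tau) - y) *m T)].
  apply: (@le_trans _ _ (\int[lebesgue_measure]_(t in `[0%R, tau]) (speed S c t)%:E)%E); last first.
    apply: integral_le_nomeas => [t /=|//|t _]; last by rewrite lee_fin sqrtr_ge0.
    rewrite !in_itv/=; lra.
  apply: le_trans (@length_ge c i T (1 - e) tau cS tau0 _ _); last 2 first.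
  - lra.
  - by move=> t /Kt/KP[].
  by rewrite lee_fin c0 pyK ler_wpM2l//; lra.
have [H|[tau [tau01 Kt nW]]] := first_exit oW cK WK cc W0.
  exists 1; split; [by rewrite ltr01 lexx|by move=> t /H/WK|].
  by rewrite c1 pzK.
exists tau; split=> //.
have Kc : K (c tau) by apply: Kt; lra.
have [dc _ _] := KP _ Kc.
(* At the exit the curve is at distance at least [rho - rho / 3] from [y], whereas [y] and [z] are
   at most [2 * rho / 3] apart. *)
have rN : rho <= enorm ((phi i (c tau) - y0) *m T).
  by rewrite leNgt; apply: contra_notN nW => ?; split.
have t1 : enorm ((phi i (c tau) - y0) *m T) <= enorm ((phi i (c tau) - y) *m T) + enorm ((y - y0) *m T).
  rewrite (le_trans _ (enormD _ _))// -mulmxDl.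
  by rewrite addrA subrK.
have t2 : enorm ((z - y) *m T) <= enorm ((z - y0) *m T) + enorm ((y - y0) *m T).
  rewrite -[X in _ <= _ + X]enormN (le_trans _ (enormD _ _))// -mulNmx -mulmxDl.
  by rewrite opprB addrA subrK.
move: Ny Nz rN t1 t2; move: (enorm _) (enorm _) (enorm _) (enorm _) (enorm _) rho0.
by clear; intros; lra.
Unshelve. all: by end_near.
Qed.

End Curves.

Section SecondCountable.

(** The basic sets that satisfy [P] still cover, as [P] passes to subsets; an index whose basic set
    fails [P] receives [set0]. It makes local statements global for measures and for
    almost-everywhere properties. *)
Lemma countable_local (T : topologicalType) (U : set T) (P : set T -> Prop) :
  @second_countable T -> P set0 -> (forall A B, A `<=` B -> P B -> P A) ->
  (forall x, U x -> exists2 N, nbhs x N & P N) ->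
  exists F : nat -> set T, [/\ forall k, open (F k), forall k, P (F k) & U `<=` \bigcup_k F k].
Proof.
move=> [B cB [oB nB]] P0 anti loc; have /countable_injP[f finj] := cB.
pose Q k := [set b | [/\ B b, f b = k & P b]].
exists (fun k => xget set0 (Q k)); split.
- by move=> k; case: xgetP => [b -> [Bb _ _]|_]; [exact: oB|exact: open0].
- by move=> k; case: xgetP => [b -> [_ _ Pb]|_].
- move=> x Ux; have [N nN PN] := loc x Ux; have [b [Bb bx] bN] := nB x N nN.
  exists (f b) => //; case: xgetP => [b' _ [Bb' fb _]|/(_ b)[]].
    by rewrite (finj _ _ _ _ fb) ?inE.
  by split=> //; exact: anti bN PN.
Qed.

Lemma rV_second_countable (R : realType) n : @second_countable 'rV[R]_n.
Proof.
pose V := 'rV[R]_n; pose q (p : 'rV[rat]_n * nat) : set 'rV[R]_n :=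
  [set v | forall a, `|v 0 a - ratr (p.1 0 a)| < p.2.+1%:R^-1].
exists (range q).
  exact: sub_countable (card_image_le _ _) (countableP setT).
split.
- move=> _ [[u m] _ <-]; rewrite openE => v vq.
  apply: (@filter_forall V 'I_n (fun a (w : V) => `|w 0 a - ratr (u 0 a)| < m.+1%:R^-1) (nbhs v)) => a.
  apply/nbhs_rV; exists (m.+1%:R^-1 - `|v 0 a - ratr (u 0 a)|) => [|w vw].
    by rewrite subr_gt0; exact: vq.
  have := rV_coord_le (v - w) a; rewrite !mxE => h.
  have := ler_distD (v 0 a) (w 0 a) (ratr (u 0 a)); rewrite [`|w 0 a - v 0 a|]distrC.
  by move=> h2; apply: (le_lt_trans h2); move: vw; rewrite ltrBrDr; apply: le_lt_trans; rewrite lerD2r.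
- move=> x N /nbhs_rV[r r0 rP].
  have [m mr] : exists m : nat, m.+1%:R^-1 < r / 2.
    have r2 : 0 < r / 2 by rewrite divr_gt0.
    by near \oo => m; exists m; near: m; exact: (near_infty_natSinv_lt (PosNum r2)).
  have m0 : (0 : R) < m.+1%:R^-1 by rewrite invr_gt0.
  have [u uP] : exists u : 'I_n -> rat, forall a, `|x 0 a - ratr (u a)| < m.+1%:R^-1.
    apply: (@fin_all_exists 'I_n (fun=> rat) (fun a p => `|x 0 a - ratr p| < m.+1%:R^-1)) => a.
    have [|p] := @rat_in_itvoo R (x 0 a) (x 0 a + m.+1%:R^-1); first by rewrite ltrDl.
    rewrite in_itv/= => /andP[p1 p2]; exists p; rewrite ltr_norml; move: p1 p2 m0.
    by move: (ratr _) (_^-1) => p3 p4; lra.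
  exists (q (\row_a u a, m)) => [|v vP].
    by split; [exists (\row_a u a, m)|move=> a /=; rewrite mxE].
  apply: rP; apply: (@le_lt_trans _ _ (2 * m.+1%:R^-1)); last first.
    by move: mr; move: (_^-1) => p; lra.
  apply/rV_normP => [|a]; first by rewrite mulr_ge0// ltW.
  have := vP a; have := uP a; rewrite !mxE/=; have := ler_distD (ratr (u a)) (x 0 a) (v 0 a).
  rewrite [`|ratr _ - v 0 a|]distrC => h h1 h2.
  by apply: (le_trans h); rewrite mulr2n mulrDl mul1r; apply: lerD; exact: ltW.
Unshelve. all: by end_near.
Qed.

End SecondCountable.

Lemma near_lt (R : realType) (T : topologicalType) (f : T -> R) (y : T) (k : R) :
  {for y, continuous f} -> f y < k -> \forall z \near y, f z < k.
Proof. by move=> cf fk; apply: (cf [set t | t < k]); apply: open_nbhs_nbhs; split=> //; exact: open_lt. Qed.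

Lemma near_gt (R : realType) (T : topologicalType) (f : T -> R) (y : T) (k : R) :
  {for y, continuous f} -> k < f y -> \forall z \near y, k < f z.
Proof. by move=> cf fk; apply: (cf [set t | k < t]); apply: open_nbhs_nbhs; split=> //; exact: open_gt. Qed.

Lemma le_factorP (R : realType) (x y : \bar R) : (0 <= y)%E ->
  (forall k : R, 1 < k -> (x <= k%:E * y)%E) -> (x <= y)%E.
Proof.
case: y => [y|_ _|//]; last by rewrite leey.
rewrite lee_fin => y0 H; apply/lee_addgt0Pr => e e0.
apply: (le_trans (H (1 + e / (y + 1)) _)); first by rewrite ltrDl divr_gt0//; lra.
rewrite -EFinM -EFinD lee_fin mulrDl mul1r lerD2l mulrAC ler_pdivrMr; nra.
Qed.

Import HBNNSimple.

(** * Hausdorff measure in a chart *)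

Section Transfer.
Variables (R : realType) (n : nat) (X : pmetricType R) (D : set X).
Variable S : riem_structure R n D.
Hypothesis hS : locally_induces_dist S.
Hypothesis cG : forall (i : chart S) y, (phi i @` dom i) y -> forall a b, {for y, continuous (fun z => gram i z a b)}.
Local Notation V := 'rV[R]_n.
Local Notation mX := (@hausdorffX R n X).
Local Notation mu := (@muV R n).
Implicit Types (i : chart S).

Definition weight i (y : V) : R := Num.sqrt (\det (gram i y)).

Lemma weight_ge0 i y : 0 <= weight i y. Proof. exact: sqrtr_ge0. Qed.

Lemma gram_cholesky i y : (phi i @` dom i) y -> exists T : 'M[R]_n,
  [/\ is_trig_mx T, forall a, 0 < T a a, gram i y = T *m T^T & weight i y = \det T].
Proof.
move=> iy; have [T [tT pT GT]] := cholesky (gram_sym iy) (fun v => @gram_pos _ _ _ _ S i y v iy).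
exists T; split=> //; rewrite /weight GT det_mulmx det_tr -expr2 sqrtr_sqr ger0_norm//.
by rewrite det_trig//; apply: prodr_ge0 => a _; exact: ltW.
Qed.

Lemma weight_gt0 i y : (phi i @` dom i) y -> 0 < weight i y.
Proof.
by move=> /gram_cholesky[T [tT pT _ ->]]; rewrite det_trig//; apply: prodr_gt0.
Qed.

Lemma continuous_weight i y : (phi i @` dom i) y -> {for y, continuous (weight i)}.
Proof.
move=> iy; apply: (@continuous_comp _ _ _ (fun y => \det (gram i y)) Num.sqrt); last exact: sqrt_continuous.
rewrite (_ : (fun y => \det (gram i y)) = \sum_(s : 'S_n) (fun y => (-1) ^+ s * \prod_a gram i y a (s a))); last first.
  by apply/funext => z; rewrite fct_sumE.
apply: (big_ind (fun f : V -> R => {for y, continuous f})).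
- exact: cst_continuous.
- by move=> f g cf cg; exact: continuousD.
move=> s _; apply: continuousM; first exact: cst_continuous.
rewrite (_ : (fun z => _) = \prod_a (fun z => gram i z a (s a))); last first.
  by apply/funext => z; rewrite fct_prodE.
apply: (big_ind (fun f : V -> R => {for y, continuous f})).
- exact: cst_continuous.
- by move=> f g cf cg; exact: continuousM.
- by move=> a _; exact: cG.
Qed.

(** Outside its domain [phi i] is arbitrary; the value 0 there makes the chart Borel on the whole of
    [X]. *)
Definition phi0 i (x : borel X) : borel V := if x \in dom i then phi i x else 0.

Lemma measurable_phi0 i : measurable_fun setT (phi0 i).
Proof.
have md : measurable (dom i : set (borel X)) by apply: open_borel; exact: dom_open.
have domE : (fun x : borel X => x \in dom i) @^-1` [set true] = dom i.
  by apply/seteqP; split=> x /=; [move/set_mem|move/mem_set].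
apply: (@measurable_fun_if _ _ (borel X) (borel V)) => //.
- apply: (@measurable_fun_bool _ _ _ _ true); rewrite setTI domE//.
- rewrite setTI domE.
  by apply: continuous_borel_rV; [exact: dom_open|move=> x; exact: phi_continuous].
Qed.

Lemma psi_image i (A : set V) : A `<=` phi i @` dom i -> psi i @` A = dom i `&` phi0 i @^-1` A.
Proof.
move=> Ai; apply/seteqP; split=> [_ [y Ay <-]|x [dx]]; rewrite /phi0/=.
  by have [dy py] := img_phi (Ai _ Ay); rewrite mem_set// py.
by rewrite mem_set//= => Ax; exists (phi i x) => //; rewrite phiK.
Qed.

Lemma measurable_psi i (A : set (borel V)) : measurable A -> A `<=` phi i @` dom i ->
  measurable (psi i @` A : set (borel X)).
Proof.
move=> mA Ai; rewrite psi_image//; apply: measurableI; first by apply: open_borel; exact: dom_open.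
by rewrite -[_ @^-1` _]setTI; exact: measurable_phi0.
Qed.

Lemma measurable_img i : measurable (phi i @` dom i : set (borel V)).
Proof. by apply: open_borel; exact: img_open. Qed.

Lemma measurable_weight i : measurable_fun (phi i @` dom i : set (borel V)) (weight i).
Proof. by apply: continuous_borel; [exact: img_open|move=> y; exact: continuous_weight]. Qed.

Lemma measurable_weightS i (E : set (borel V)) : E `<=` phi i @` dom i -> measurable_fun E (weight i).
Proof. by move=> Ei; apply: (measurable_funS (measurable_img i) Ei); exact: measurable_weight. Qed.

(** Agreement up to a factor [k > 1] is what almost isometric charts give on small sets. It adds up
    over disjoint pieces, and the limit [k] to 1 is taken only after that. *)
Definition comparable_on i (k : R) (N : set V) := forall A : set (borel V), measurable A -> A `<=` N ->
  [/\ A `<=` phi i @` dom i, (mX (psi i @` A) <= k%:E * \int[mu]_(y in A) (weight i y)%:E)%E &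
    (\int[mu]_(y in A) (weight i y)%:E <= k%:E * mX (psi i @` A))%E].

(** The [n]-th powers come from the bilipschitz constants of a chart, the further factor [1 + e]
    from the oscillation of [weight]. *)
Lemma factor_near (k : R) : 1 < k -> exists e : R, [/\ 0 < e < 1, (1 + e) ^+ n.+1 <= k & 1 + e <= k * (1 - e) ^+ n].
Proof.
move=> k1.
have c1 : {for 0, continuous (fun e : R => (1 + e) ^+ n.+1)}.
  apply: (@continuous_comp _ _ _ (fun e : R => 1 + e) (fun t => t ^+ n.+1)); last exact: exprn_continuous.
  by apply: continuousD; [exact: cst_continuous|move=> ?; exact: cvg_id].
have c2 : {for 0, continuous (fun e : R => k * (1 - e) ^+ n - (1 + e))}.
  apply: continuousB.
    apply: continuousM; first exact: cst_continuous.
    apply: (@continuous_comp _ _ _ (fun e : R => 1 - e) (fun t => t ^+ n)); last exact: exprn_continuous.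
    by apply: continuousB; [exact: cst_continuous|move=> ?; exact: cvg_id].
  by apply: continuousD; [exact: cst_continuous|move=> ?; exact: cvg_id].
have n1 : \forall e \near (0:R), (1 + e) ^+ n.+1 < k.
  by apply: near_lt c1 _; rewrite addr0 expr1n.
have n2 : \forall e \near (0:R), 0 < k * (1 - e) ^+ n - (1 + e).
  by apply: near_gt c2 _; rewrite subr0 addr0 expr1n; lra.
have : \forall e \near (0:R), (1 + e) ^+ n.+1 < k /\ 0 < k * (1 - e) ^+ n - (1 + e) by near=> e; split; near: e.
move=> /nbhs_ballP[r /= r0 rP]; exists (Num.min (r / 2) 2^-1).
set e := Num.min _ _.
have e0 : 0 < e by rewrite /e lt_min divr_gt0//= invr_gt0.
have er : e <= r / 2 by rewrite /e ge_min lexx.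
have e1 : e <= 2^-1 by rewrite /e ge_min lexx orbT.
have [|H1 H2] := rP e; first by rewrite /ball/= sub0r normrN gtr0_norm//; lra.
by split; [lra|exact: ltW|lra].
Unshelve. all: by end_near.
Qed.

(** After the linear change [T] the chart is almost isometric to Euclidean space. By [muV_trig] that
    change multiplies [muV] by [\det T], which is [weight i y0], and [weight] hardly varies near
    [y0]. *)
Lemma comparable_near i y0 (k : R) : (phi i @` dom i) y0 -> 1 < k ->
  exists2 N, nbhs y0 N & comparable_on i k N.
Proof.
move=> iy k1; have [e [/andP[e0 e1] ek1 ek2]] := factor_near k1.
have [T [tT pT GT wT]] := gram_cholesky iy.
have w0 := weight_gt0 iy.
have uT : T \in unitmx by rewrite unitmxE unitfE -wT gt_eqF.
have TS : T *m invmx T = 1%:M by rewrite mulmxV.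
have ST : invmx T *m T = 1%:M by rewrite mulVmx.
have [dy py] := img_phi iy.
have [r r0 cmp] : exists2 r : R, 0 < r & forall y z, `|y0 - y| < r -> `|y0 - z| < r ->
    (phi i @` dom i) y /\
    (1 - e) * enorm ((z - y) *m T) <= mdist (psi i y) (psi i z)
      <= (1 + e) * enorm ((z - y) *m T).
  have := @local_comparison _ _ _ _ S i (psi i y0) T (invmx T) e hS dy; rewrite py.
  by apply=> //; [exact: cG|rewrite e0].
have w1 : \forall y \near y0, weight i y < (1 + e) * weight i y0.
  by apply: near_lt; [exact: continuous_weight|rewrite ltr_pMl//; lra].
have w2 : \forall y \near y0, weight i y0 / (1 + e) < weight i y.
  by apply: near_gt; [exact: continuous_weight|rewrite ltr_pdivrMr ?ltr_pMr//; lra].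
have nr : \forall y \near y0, `|y0 - y| < r by apply/nbhs_rV; exists r.
exists [set y | [/\ `|y0 - y| < r, weight i y < (1 + e) * weight i y0 & weight i y0 / (1 + e) < weight i y]].
  by near=> y; split; near: y.
move=> A mA AN.
have Ai : A `<=` phi i @` dom i.
  by move=> y /AN[yr _ _]; have [] := cmp y y0 yr; rewrite ?subrr ?normr0.
pose AT := lin (invmx T) @^-1` A.
have muAT : mu AT = ((weight i y0)%:E * mu A)%E by rewrite (muV_trig tT pT TS mA) wT.
have mfold c : (\int[mu]_(y in A) (cst c%:E y) = c%:E * mu A)%E by rewrite integral_cst.
have ub : (mX (psi i @` A) <= ((1 + e) ^+ n)%:E * mu AT)%E.
  have -> : psi i @` A = (fun y => psi i (lin (invmx T) y)) @` AT.
    apply/seteqP; split=> [_ [y Ay <-]|_ [y Ay <-]]; last by exists (lin (invmx T) y).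
    have yE : lin (invmx T) (y *m T) = y by rewrite /lin -mulmxA TS mulmx1.
    by exists (y *m T); rewrite ?yE//= /AT/= yE.
  rewrite hausdorffXE; apply: ghaus_image; first lra.
  move=> y z /AN[yr _ _] /AN[zr _ _]; have [_ /andP[_ H]] := cmp _ _ yr zr.
  apply: le_trans H _; rewrite eucl_dist_sym eucl_distE mulmxBl /lin -!mulmxA ST !mulmx1//.
have lb : (((1 - e) ^+ n)%:E * mu AT <= mX (psi i @` A))%E.
  have e1p : 0 < 1 - e by lra.
  have : (mu AT <= (((1 - e)^-1) ^+ n)%:E * mX (psi i @` A))%E.
    have -> : AT = (fun x => (phi i x : V) *m T) @` (psi i @` A).
      apply/seteqP; split=> [y Ay|_ [_ [y Ay <-] <-]]; last first.
        by have [_ ->] := img_phi (Ai _ Ay); rewrite /AT/= /lin -mulmxA TS mulmx1.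
      exists (psi i (lin (invmx T) y)); first by exists (lin (invmx T) y).
      by have [_ ->] := img_phi (Ai _ Ay); rewrite /lin -mulmxA ST mulmx1.
    rewrite hausdorffXE /muV; apply: ghaus_image; first by rewrite invr_gt0.
    move=> _ _ [y Ay <-] [z Az <-].
    have [_ ->] := img_phi (Ai _ Ay); have [_ ->] := img_phi (Ai _ Az).
    have [yr _ _] := AN _ Ay; have [zr _ _] := AN _ Az.
    have [_ /andP[H _]] := cmp _ _ yr zr.
    by rewrite eucl_dist_sym eucl_distE -mulmxBl mulrC ler_pdivlMr// mulrC.
  rewrite exprVn; move: (mu AT) (mX _) => p q H.
  have kp : (0 <= (1 - e) ^+ n)%R by rewrite exprn_ge0// ltW.
  apply: le_trans (lee_wpmul2l _ H) _; first by rewrite lee_fin.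
  by rewrite muleA -EFinM mulfV ?mul1e// gt_eqF// exprn_gt0.
have iub : (\int[mu]_(y in A) (weight i y)%:E <= (1 + e)%:E * mu AT)%E.
  rewrite muAT muleA -EFinM -mfold; apply: integral_le_nomeas => // y Ay.
    by rewrite lee_fin; have [_ /ltW ] := AN _ Ay.
  by rewrite lee_fin mulr_ge0 ?weight_ge0//; lra.
have ilb : (mu AT <= (1 + e)%:E * \int[mu]_(y in A) (weight i y)%:E)%E.
  have H : ((weight i y0 / (1 + e))%:E * mu A <= \int[mu]_(y in A) (weight i y)%:E)%E.
    rewrite -mfold; apply: integral_le_nomeas => // y Ay.
      by rewrite lee_fin; have [_ _ /ltW ] := AN _ Ay.
    by rewrite lee_fin weight_ge0.
  apply: le_trans (lee_wpmul2l _ H); last by rewrite lee_fin; lra.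
  by rewrite muAT muleA -EFinM mulrCA mulfV ?mulr1//; lra.
split=> //.
- apply: (le_trans ub); apply: (le_trans (lee_wpmul2l _ ilb)); first by rewrite lee_fin exprn_ge0//; lra.
  rewrite muleA -EFinM -exprSr lee_wpmul2r// ?lee_fin//.
  by apply: integral_ge0 => y _; rewrite lee_fin weight_ge0.
- apply: (le_trans iub); apply: (@le_trans _ _ ((k * (1 - e) ^+ n)%:E * mu AT)%E).
    by rewrite lee_wpmul2r ?lee_fin.
  by rewrite EFinM -muleA lee_wpmul2l// lee_fin; lra.
Unshelve. all: by end_near.
Qed.

Lemma psi_inj i y z : (phi i @` dom i) y -> (phi i @` dom i) z -> psi i y = psi i z -> y = z.
Proof. by move=> /img_phi[_ {2}<-] /img_phi[_ {2}<-] ->. Qed.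

(** A countable cover by the neighbourhoods of [comparable_near] is made disjoint; [psi i] is
    injective on the image of the chart, so the pieces stay disjoint in [X] and both measures add
    up. *)
Lemma comparable_all i (k : R) : 1 < k -> comparable_on i k (phi i @` dom i).
Proof.
move=> k1 A mA Ai.
have [||y iy|F [oF cF FU]] := @countable_local V (phi i @` dom i) (comparable_on i k) (@rV_second_countable R n).
- move=> B mB; rewrite subset0 => ->; split=> //; rewrite ?image_set0 integral_set0 hausdorffX0 ?mule0//.
- by move=> B C BC cC E mE EB; apply: cC => // y /EB/BC.
- exact: comparable_near.
pose E j := A `&` seqDU F j.
have mE j : measurable (E j : set (borel V)).
  apply: measurableI => //; apply: measurableD; first exact: open_borel.
  by apply: bigsetU_measurable => m _; exact: open_borel.
have EF j : E j `<=` F j by move=> y [_ Fy]; exact: subset_seqDU Fy.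
have Ei j : E j `<=` phi i @` dom i by move=> y [/Ai].
have tE : trivIset setT E by apply: trivIset_setIl; exact: trivIset_seqDU.
have AE : A = \bigcup_j E j.
  rewrite -setI_bigcupr -seqDU_bigcup_eq; apply/seteqP; split=> [y Ay|y []//].
  by split=> //; exact/FU/Ai.
have IE : (\int[mu]_(y in A) (weight i y)%:E = \sum_(j <oo) \int[mu]_(y in E j) (weight i y)%:E)%E.
  rewrite AE ge0_integral_bigcup//.
  - by rewrite -AE; apply/measurable_EFinP; exact: measurable_weightS.
  - by move=> y _; rewrite lee_fin weight_ge0.
have ME : (mX (psi i @` A) = \sum_(j <oo) mX (psi i @` E j))%E.
  rewrite {1}AE image_bigcup measure_bigcup//.
  - by apply: eq_eseriesl => j; rewrite in_setT.
  - by move=> j _; exact: measurable_psi.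
  - move=> j l _ _ [x [[y Ey <-] [z Ez yz]]]; apply: (tE j l) => //; exists y; split=> //.
    by rewrite -(psi_inj (Ei _ _ Ez) (Ei _ _ Ey) yz).
split=> //.
- rewrite ME IE -nneseriesZl => [|j _]; last by apply: integral_ge0 => y _; rewrite lee_fin weight_ge0.
  apply: lee_nneseries => j _ //; by have [] := cF j _ (mE j) (EF j).
- rewrite ME IE -nneseriesZl => [|j _]; last exact: measure_ge0.
  apply: lee_nneseries => [j _ _|j _]; last by have [] := cF j _ (mE j) (EF j).
  by apply: integral_ge0 => y _; rewrite lee_fin weight_ge0.
Qed.

(** [comparable_all] holds for each [k > 1], and [le_factorP] lets [k] tend to 1 in both
    inequalities. *)
Lemma hausdorffX_psi i (A : set (borel V)) : measurable A -> A `<=` phi i @` dom i ->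
  mX (psi i @` A) = (\int[mu]_(y in A) (weight i y)%:E)%E.
Proof.
move=> mA Ai; apply/eqP; rewrite eq_le; apply/andP; split; apply: le_factorP.
- by apply: integral_ge0 => y _; rewrite lee_fin weight_ge0.
- by move=> k k1; have [] := comparable_all k1 mA Ai.
- exact: measure_ge0.
- by move=> k k1; have [] := comparable_all k1 mA Ai.
Qed.

(** The simple function lives on R^n and is pulled back along [phi0], because the functions to be
    approximated are known to be measurable after composition with [psi i]. *)
Lemma transfer_nnsfun i (E : set (borel V)) (h : {nnsfun (borel V) >-> R}) :
  measurable E -> E `<=` phi i @` dom i ->
  (\int[mX]_(x in (psi i @` E : set (borel X))) (h (phi0 i x))%:E = \int[mu]_(y in E) (h y * weight i y)%:E)%E.
Proof.
move=> mE Ei; have mpE := measurable_psi mE Ei.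
have mB r : measurable (h @^-1` [set r]) by [].
have mpB r : measurable (phi0 i @^-1` (h @^-1` [set r])).
  by rewrite -[_ @^-1` _]setTI; exact: measurable_phi0.
have mw := measurable_weightS Ei.
have mI r : measurable_fun (psi i @` E : set (borel X)) (fun x : borel X => \1_(h @^-1` [set r]) (phi0 i x) : R).
  rewrite (_ : (fun x : borel X => _) = \1_(phi0 i @^-1` (h @^-1` [set r])))//.
have hE y : h y = \sum_(r <- finmap.enum_fset (fset_set (range h))) r * \1_(h @^-1` [set r]) y.
  by rewrite fimfunE fsbig_finite.
have r0 r y : 0 <= r * \1_(h @^-1` [set r]) y.
  by rewrite -lee_fin EFinM; exact: nnfun_muleindic_ge0.
under eq_integral do rewrite hE -sumEFin.
under [RHS]eq_integral do rewrite hE mulr_suml -sumEFin.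
rewrite ge0_integral_sum//; last 2 first.
- by move=> r; apply/measurable_EFinP/measurable_funM => //; exact: mI.
- by move=> r x _; rewrite lee_fin.
rewrite ge0_integral_sum//; last 2 first.
- by move=> r; apply/measurable_EFinP/measurable_funM => //; apply: measurable_funM.
- by move=> r x _; rewrite lee_fin mulr_ge0// weight_ge0.
apply: eq_bigr => r _.
transitivity (r%:E * mX (psi i @` (E `&` h @^-1` [set r])))%E.
  have -> : psi i @` (E `&` h @^-1` [set r]) = psi i @` E `&` phi0 i @^-1` (h @^-1` [set r]).
    rewrite psi_image; last by move=> y [/Ei].
    by rewrite preimage_setI setIA -psi_image.
  have [r1|r1] := leP 0 r; last first.
    have -> : h @^-1` [set r] = set0.
      by apply/seteqP; split=> y //= hy; have : 0 <= h y by []; rewrite hy leNgt r1.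
    rewrite preimage_set0 setI0 measure0 mule0; apply: integral0_eq => x _.
    by rewrite indic0 mulr0.
  under eq_integral do rewrite EFinM.
  rewrite ge0_integralZl//; last first.
    by apply/measurable_EFinP; exact: mI.
  congr (_ * _)%E.
  rewrite setIC -integral_indic//.
rewrite hausdorffX_psi; [|exact: measurableI|by move=> y []/Ei].
have [r1|r1] := leP 0 r; last first.
  have -> : h @^-1` [set r] = set0.
    by apply/seteqP; split=> y //= hy; have : 0 <= h y by []; rewrite hy leNgt r1.
  rewrite setI0 integral_set0 mule0; apply/esym/integral0_eq => x _.
  by rewrite indic0 mulr0 mul0r.
under [RHS]eq_integral do rewrite -mulrA EFinM.
rewrite ge0_integralZl//; last 2 first.
- by apply/measurable_EFinP/measurable_funM.
- by move=> y _; rewrite lee_fin mulr_ge0// weight_ge0.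
congr (_ * _)%E; rewrite integral_mkcondr; apply: eq_integral => y _.
by rewrite patchE indicE; case: ifPn => yr; rewrite ?mul1r ?mul0r.
Qed.

Lemma transfer_ge0 i (E : set (borel V)) (F : X -> R) :
  measurable E -> E `<=` phi i @` dom i ->
  measurable_fun E (fun y : borel V => F (psi i y)) -> (forall x, 0 <= F x) ->
  (\int[mX]_(x in (psi i @` E : set (borel X))) (F x)%:E = \int[mu]_(y in E) (F (psi i y) * weight i y)%:E)%E.
Proof.
move=> mE Ei mF F0; have mpE := measurable_psi mE Ei.
have [h [hnd hF]] := approximation mE ((measurable_EFinP _ _).2 mF) (fun y _ => F0 (psi i y)).
have phE x : (psi i @` E) x -> E (phi0 i x) /\ psi i (phi0 i x) = x.
  by rewrite psi_image// => -[dx Ex]; split=> //; rewrite /phi0 mem_set// phiK.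
have mw := measurable_weightS Ei.
have L : (\int[mX]_(x in (psi i @` E : set (borel X))) (F x)%:E =
   \int[mX]_(x in psi i @` E) limn (fun k => (h k (phi0 i x))%:E))%E.
  apply: eq_integral => x /set_mem/phE[Ex xE]; apply/esym/cvg_lim => //.
  by rewrite -[in X in _ --> X%:E]xE; exact: hF.
have Rr : (\int[mu]_(y in E) (F (psi i y) * weight i y)%:E =
   \int[mu]_(y in E) limn (fun k => (h k y * weight i y)%:E))%E.
  apply: eq_integral => y /set_mem Ey; apply/esym/cvg_lim => //.
  under eq_fun do rewrite EFinM; rewrite EFinM.
  by apply: cvgeM; [exact: mule_def_fin|exact: hF|exact: cvg_cst].
have hm k m y : (k <= m)%N -> h k y <= h m y by move=> /hnd/lefP.
have C1 : ((\int[mX]_(x in (psi i @` E : set (borel X))) (h k (phi0 i x))%:E)%E @[k --> \oo] -->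
    (\int[mX]_(x in (psi i @` E : set (borel X))) limn (fun k => (h k (phi0 i x))%:E))%E).
  apply: cvg_monotone_convergence => //.
  - move=> k; apply/measurable_EFinP; apply: measurable_funTS.
    exact: (measurableT_comp _ (measurable_phi0 i)).
  - by move=> k x _; rewrite lee_fin.
  - by move=> x _ k m km; rewrite lee_fin hm.
have C2 : ((\int[mu]_(y in E) (h k y * weight i y)%:E)%E @[k --> \oo] -->
    (\int[mu]_(y in E) limn (fun k => (h k y * weight i y)%:E))%E).
  apply: cvg_monotone_convergence => //.
  - by move=> k; apply/measurable_EFinP/measurable_funM => //; exact: measurable_funTS.
  - by move=> k y _; rewrite lee_fin mulr_ge0 ?weight_ge0.
  - by move=> y _ k m km; rewrite lee_fin ler_wpM2r ?weight_ge0// hm.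
rewrite L Rr -(cvg_lim _ C1)// -(cvg_lim _ C2)//; congr (limn _); apply/funext => k.
exact: transfer_nnsfun.
Qed.

Lemma transfer i (E : set (borel V)) (F : X -> R) :
  measurable E -> E `<=` phi i @` dom i ->
  measurable_fun E (fun y : borel V => F (psi i y)) ->
  (\int[mX]_(x in (psi i @` E : set (borel X))) (F x)%:E = \int[mu]_(y in E) (F (psi i y) * weight i y)%:E)%E.
Proof.
move=> mE Ei mF; rewrite integralE [RHS]integralE; congr (_ - _)%E.
- under eq_integral do rewrite funeposE -EFin_max.
  rewrite (transfer_ge0 (F := fun x => Num.max (F x) 0))//; last by move=> x; rewrite le_max lexx orbT.
    by apply: eq_integral => y _; rewrite funeposE -EFin_max maxr_pMl ?weight_ge0// mul0r.
  by apply: measurable_maxr => //; exact: measurable_cst.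
- under eq_integral do rewrite funenegE -EFinN -EFin_max.
  rewrite (transfer_ge0 (F := fun x => Num.max (- F x) 0))//; last by move=> x; rewrite le_max lexx orbT.
    by apply: eq_integral => y _; rewrite funenegE -EFinN -EFin_max maxr_pMl ?weight_ge0// mul0r mulNr.
  by apply: measurable_maxr; [exact: measurable_funN|exact: measurable_cst].
Qed.

End Transfer.

(** * Almost everywhere differentiability of Lipschitz functions on the line *)

Section LipschitzLine.
Variables (R : realType) (f : R -> R) (K : R).
Hypothesis K0 : 0 < K.
Hypothesis fK : forall x y, `|f x - f y| <= K * `|x - y|.
Local Notation lam := (@lebesgue_measure R).

(* A Lipschitz function becomes monotone after adding a linear one. *)
Definition tilt (x : R) : R := f x + K * x.

Lemma tilt_bound (x y : R) : x <= y -> 0 <= tilt y - tilt x <= 2 * K * (y - x).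
Proof.
move=> xy; have := fK x y; rewrite [`|x - y|]distrC [`|y - x|]ger0_norm ?subr_ge0//.
by rewrite ler_norml /tilt; lra.
Qed.

Lemma tilt_nondecreasing : {homo tilt : x y / x <= y}.
Proof. by move=> x y /tilt_bound; lra. Qed.

Lemma tilt_continuous : continuous tilt.
Proof.
move=> x B /nbhs_ballP[e /= e0 eB]; apply/nbhs_ballP; exists (e / (2 * K)) => /=.
  by rewrite divr_gt0// mulr_gt0.
move=> y; rewrite /ball/= => yx; apply: eB; rewrite /ball/=.
have : `|x - y| * (2 * K) < e by rewrite -ltr_pdivlMr// mulr_gt0.
apply: le_lt_trans; have [xy|/ltW yx'] := leP x y.
  have := tilt_bound xy; rewrite [`|x - y|]distrC [`|tilt x - _|]distrC.
  by move=> /andP[t0 t1]; rewrite !ger0_norm ?subr_ge0//; lra.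
have := tilt_bound yx'; move=> /andP[t0 t1]; rewrite !ger0_norm ?subr_ge0//; lra.
Qed.

Lemma tilt_right_continuous : right_continuous tilt.
Proof. by move=> x; apply: cvg_at_right_filter; exact: tilt_continuous. Qed.

HB.instance Definition _ := isCumulative.Build R _ R tilt tilt_nondecreasing tilt_right_continuous.

Local Notation lsm := (lebesgue_stieltjes_measure tilt).

Lemma wlength_oc (g : R -> R) (a b : R) : a <= b -> wlength g `]a, b]%classic = (g b - g a)%:E.
Proof. by move=> ab; rewrite (wlength_itv_bnd _ _ _ ab). Qed.

(** Both measures are infima over the same covers by half-open intervals, and on one interval the
    comparison is [tilt_bound]. *)
Lemma tilt_measure_le (A : set R) : ((2 * K)^-1%:E * lsm A <= lam A)%E.
Proof.
rewrite /lebesgue_measure /lebesgue_stieltjes_measure /measure_extension /mu_ext.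
apply: le_ereal_inf_tmp => _ [F [mF AF] <-].
have KK : 0 < 2 * K by rewrite mulr_gt0.
rewrite lee_pdivrMl//; apply: le_trans (ereal_inf_lbound _) _; first by exists F.
rewrite -nneseriesZl => [|k _]; last exact: wlength_ge0.
apply: lee_nneseries => [k _ _|k _]; first exact: wlength_ge0.
change (wlength tilt (F k) <= (2 * K)%:E * wlength idfun (F k))%E.
have [FE|[[a b] /= ab FE]] := (ocitvP _).1 (mF k).
  have e1 : wlength tilt (F k) = 0%E by rewrite FE; exact: wlength0.
  have e2 : wlength idfun (F k) = 0%E by rewrite FE; exact: wlength0.
  by rewrite e1 e2 mule0.
have e1 : wlength tilt (F k) = (tilt b - tilt a)%:E by rewrite FE; exact/wlength_oc/ltW.
have e2 : wlength idfun (F k) = (b - a)%:E by rewrite FE; exact/(@wlength_oc idfun)/ltW.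
by rewrite e1 e2 -EFinM lee_fin; have /andP[_] := tilt_bound (ltW ab).
Qed.

Lemma tilt_measure_itv (a b : R) : a <= b -> lsm `]a, b]%classic = (tilt b - tilt a)%:E.
Proof.
move=> ab; rewrite -wlength_oc//; apply: measurable_mu_extE; exact: is_ocitv.
Qed.

(** On a bounded interval the Stieltjes measure of [tilt] is finite and, by [tilt_measure_le],
    absolutely continuous. So [tilt] is, up to a constant, the integral of a Radon-Nikodym density,
    and [FTC1] differentiates it almost everywhere. *)
Lemma lipschitz_derivable_itv (m : R) : {ae lam, forall x, `|x| < m -> derivable f x 1}.
Proof.
have [m0|m0] := leP m 0; first by apply: aeW => x xm; have := normr_ge0 x; lra.
pose J := `](- m), m]%classic : set (measurableTypeR R).
have mJ : measurable J by exact: measurable_itv.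
have Jfin : (lsm J < +oo)%E by rewrite tilt_measure_itv ?ltry//; lra.
pose nu := mfrestr mJ Jfin.
have numu : nu `<< lam.
  apply/null_content_dominatesP => A mA A0.
  have : ((2 * K)^-1%:E * lsm (A `&` J) <= 0)%E.
    apply: le_trans (tilt_measure_le _) _; rewrite -A0; apply: le_measure; rewrite ?inE//.
    exact: measurableI.
  rewrite pmule_rle0 ?lte_fin ?invr_gt0 ?mulr_gt0// => H; apply/eqP; rewrite eq_le H/=.
  exact: measure_ge0.
pose h := Radon_Nikodym_SigmaFinite.f [the {finite_measure set (measurableTypeR R) -> \bar R} of mfrestr mJ Jfin]
  [the {sigma_finite_measure set (measurableTypeR R) -> \bar R} of lam].
have hi : lam.-integrable setT h by exact: Radon_Nikodym_SigmaFinite.f_integrable.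
have hf x : h x \is a fin_num by exact: Radon_Nikodym_SigmaFinite.f_fin_num.
pose g x := fine (h x).
have gi : lam.-integrable setT (EFin \o g).
  by apply: eq_integrable hi => // x _; rewrite /= fineK.
have mI y : measurable (`](- m), y]%classic : set (measurableTypeR R)) by exact: measurable_itv.
have := @FTC1 R g (BRight (- m)) (fun y => integrableS measurableT (mI y) (@subsetT _ _) gi)
  (open_integrable_locally openT gi).
move=> /=; apply: filterS; first exact: (ae_filter_ringOfSetsType lam).
move=> x /= H xm; move: xm; rewrite ltr_norml => /andP[mx xm].
have [|dF _] := H _; first by rewrite /= lte_fin.
have FE y : - m < y < m -> (\int[lam]_(t in `](- m), y]) g t)%R = tilt y - tilt (- m).
  move=> /andP[my ym]; rewrite /Rintegral.
  rewrite (eq_integral h) => [|t _]; last by rewrite fineK.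
  rewrite -Radon_Nikodym_SigmaFinite.f_integral// /nu/= /mfrestr /mrestr.
  rewrite setIidl; last by move=> t /=; rewrite /J/= !in_itv/=; lra.
  by rewrite tilt_measure_itv// ltW.
have dt : derivable tilt x 1.
  have d1 : derivable (fun y => (\int[lam]_(t in `](- m), y]) g t)%R + tilt (- m)) x 1.
    by apply: derivableD; [exact: dF|exact: derivable_cst].
  apply: near_eq_derivable d1 => //; near=> y.
  rewrite FE ?subrK//; apply/andP; split; near: y; [exact: lt_nbhsr|exact: lt_nbhsl].
have -> : f = (fun y => tilt y - K * y) by apply/funext => y; rewrite /tilt addrK.
by apply: derivableB => //; apply: derivableM => //; exact: derivable_cst.
Unshelve. all: by end_near.
Qed.

Lemma lipschitz_ae_derivable : {ae lam, forall x, derivable f x 1}.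
Proof.
have := ae_foralln (fun m : nat => lipschitz_derivable_itv m%:R).
apply: filterS => x H; apply: (H (Num.bound `|x|)).
exact: archi_boundP.
Qed.

End LipschitzLine.

(** * Fundamental lemma of the calculus of variations *)

Section Bumps.
Variables (R : realType).

(** The truncated power is of class C^(m-1). Bumps of any prescribed finite order are obtained from
    it algebraically, in place of the smooth ones built on exp(-1/t). *)
Definition ppow (m : nat) (t : R) : R := Num.max 0 t ^+ m.

Lemma ppow_ge0 m t : 0 <= ppow m t.
Proof. by rewrite exprn_ge0// le_max lexx. Qed.

Lemma continuous_ppow m : continuous (ppow m).
Proof.
rewrite (_ : ppow m = (fun t => t ^+ m) \o (fun t => Num.max 0 t))// => t.
apply: continuous_comp; last exact: exprn_continuous.
by apply: (@continuous_max R R (cst 0) id); [exact: cst_continuous|move=> ?; exact: cvg_id].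
Qed.

Lemma is_derive_ppow m (t : R) : is_derive t 1 (ppow m.+2) (m.+2%:R * ppow m.+1 t).
Proof.
have [t0|t0|->] := ltgtP t 0.
- rewrite /ppow max_l ?ltW// expr0n/= mulr0; apply: (@near_eq_is_derive _ _ _ (cst (0 : R))).
  near=> s; rewrite max_l ?expr0n//; apply: ltW; near: s; exact: lt_nbhsl.
- rewrite {2}/ppow max_r ?ltW//; apply: (@near_eq_is_derive _ _ _ ((@id R) ^+ m.+2)).
    near=> s; rewrite /ppow max_r//; first by rewrite exprfctE.
    by apply: ltW; near: s; exact: lt_nbhsr.
  rewrite (_ : m.+2%:R * t ^+ m.+1 = (m.+2%:R * t ^+ m.+1) *: (1 : R)); last by rewrite -[RHS]/(_ * 1) mulr1.
  exact: (@is_deriveX R R (@id R) m.+2 t 1 1 (is_derive_id _ _)).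
- rewrite {2}/ppow max_l// expr0n/= mulr0.
  have C : (fun h : R => h^-1 *: (ppow m.+2 (h *: 1 + 0) - ppow m.+2 0)) @ 0^' --> (0 : R).
    have c0 : (fun h : R => Num.max 0 h * h ^+ m) @ 0^' --> (0 : R).
      apply: cvg_within_filter => //.
      have : {for 0, continuous (fun h : R => Num.max 0 h * h ^+ m)}.
        apply: continuousM; last exact: exprn_continuous.
        by apply: (@continuous_max R R (cst 0) id); [exact: cst_continuous|move=> ?; exact: cvg_id].
      by rewrite /prop_for /continuous_at max_l// mul0r.
    apply: cvg_trans c0; apply: near_eq_cvg; near=> h.
    have h0 : h != 0 by near: h; exact: nbhs_dnbhs_neq.
    rewrite /ppow addr0 [Num.max 0 0]max_l// expr0n/= subr0 -[h *: 1]/(h * 1) mulr1 -[RHS]/(h^-1 * _).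
    have [hp|hn] := leP 0 h; last by rewrite expr0n/= mulr0 mul0r.
    by rewrite exprS mulKf// exprS.
  by apply: DeriveDef; [apply/cvg_ex; exists 0|apply/cvg_lim].
Unshelve. all: by end_near.
Qed.

Variable n : nat.
Local Notation V := 'rV[R]_n.

Lemma ck_ppow k m (A : set V) (f : V -> R) : open A -> (k < m)%N -> ck k A f -> ck k A (fun y => ppow m (f y)).
Proof.
move=> oA; elim: k m => [|k IH] m km cf.
  by move=> y Ay; apply: (@continuous_comp _ _ _ f (ppow m)); [exact: cf|exact: continuous_ppow].
case: m km => [//|[//|m]] km; have [df pf] := cf.
have dS t : differentiable (ppow m.+2) t.
  by apply/derivable1_diffP; case: (is_derive_ppow m t).
split=> [y Ay|a].
  by apply: (@differentiable_comp _ _ _ _ f (ppow m.+2)); [exact: df|exact: dS].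
apply: (@ck_ext _ _ _ _ (fun y => pd a f y * (m.+2%:R * ppow m.+1 (f y)))) => // [y Ay|].
  rewrite /pd [RHS]deriveE; last by apply: (@differentiable_comp _ _ _ _ f (ppow m.+2)); [exact: df|exact: dS].
  rewrite (@diff_comp _ _ _ _ f (ppow m.+2)) /=; [|exact: df|exact: dS].
  rewrite -(deriveE _ (df _ Ay)) diff1E; last exact: dS.
  by case: (is_derive_ppow m (f y)) => _ dsE; rewrite derive1E dsE.
apply: ckM => //; first exact: pf.
apply: ckM => //; first exact: ck_cst.
by apply: IH => //; exact: ckW.
Qed.

(** The usual quotient for a transition from 0 to 1 on [0, 1]; its denominator is positive because
    [t] and [1 - t] are never both nonpositive. *)
Definition step (m : nat) (t : R) : R := ppow m.+1 t / (ppow m.+1 t + ppow m.+1 (1 - t)).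

Lemma step_den m (t : R) : 0 < ppow m.+1 t + ppow m.+1 (1 - t).
Proof.
have [t0|t0] := leP t 0.
  by rewrite ltr_wpDl ?ppow_ge0// /ppow exprn_gt0// lt_max; apply/orP; right; lra.
by rewrite ltr_wpDr ?ppow_ge0// /ppow exprn_gt0// lt_max t0 orbT.
Qed.

Lemma step_ge0 m t : 0 <= step m t.
Proof. by rewrite divr_ge0 ?ppow_ge0// ltW// step_den. Qed.

Lemma step_le1 m t : step m t <= 1.
Proof. by rewrite ler_pdivrMr ?step_den// mul1r lerDl ppow_ge0. Qed.

Lemma step0 m t : t <= 0 -> step m t = 0.
Proof. by move=> t0; rewrite /step {1}/ppow max_l// expr0n/= mul0r. Qed.

Lemma step1 m t : 1 <= t -> step m t = 1.
Proof.
move=> t1; rewrite /step [X in _ + X](_ : _ = 0) ?addr0 ?divff//.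
  by rewrite gt_eqF// /ppow exprn_gt0// lt_max; apply/orP; right; lra.
by rewrite /ppow max_l ?expr0n//; lra.
Qed.

Definition cutoff (m : nat) (lo hi : V) (s : R) (y : V) : R :=
  \prod_a (step m ((y 0 a - lo 0 a) / s) * step m ((hi 0 a - y 0 a) / s)).

Lemma cutoff_ge0 m lo hi s y : 0 <= cutoff m lo hi s y.
Proof. by apply: prodr_ge0 => a _; rewrite mulr_ge0 ?step_ge0. Qed.

Lemma cutoff_le1 m lo hi s y : cutoff m lo hi s y <= 1.
Proof. by apply: prodr_ile1 => a _; rewrite mulr_ge0 ?step_ge0//= mulr_ile1 ?step_ge0 ?step_le1. Qed.

Lemma cutoff_neq0 m (lo hi : V) (s : R) (y : V) : 0 < s -> cutoff m lo hi s y != 0 ->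
  forall a, lo 0 a < y 0 a < hi 0 a.
Proof.
move=> s0 c0 a; apply/negP => H; move/negP: c0; apply; rewrite /cutoff (bigD1 a)//=.
have [ya|ya] := leP (y 0 a) (lo 0 a).
  by rewrite step0 ?mul0r// pmulr_lle0 ?invr_gt0// subr_le0.
have [yb|yb] := leP (hi 0 a) (y 0 a); last by case: H; rewrite ya yb.
by rewrite [X in _ * X * _]step0 ?mulr0 ?mul0r// pmulr_lle0 ?invr_gt0// subr_le0.
Qed.

Lemma cutoff1 m (lo hi : V) (s : R) (y : V) : 0 < s -> (forall a, lo 0 a + s <= y 0 a <= hi 0 a - s) ->
  cutoff m lo hi s y = 1.
Proof.
move=> s0 H; apply: big1 => a _; have /andP[h1 h2] := H a.
by rewrite !step1 ?mulr1// ler_pdivlMr// mul1r; lra.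
Qed.

Lemma ck_cutoff k m lo hi s : (k <= m)%N -> ck k setT (cutoff m lo hi s).
Proof.
move=> km; have oT : open (setT : set V) by exact: openT.
have cstep (f : V -> R) : ck k setT f -> ck k setT (fun y => step m (f y)).
  move=> cf; have c1 : ck k setT (fun y => ppow m.+1 (f y)) by exact: ck_ppow.
  apply: ckM => //; apply: ckV => //; first by move=> y _; rewrite gt_eqF// step_den.
  apply: ckD => //; apply: (@ck_ppow k m.+1 setT (fun y => 1 - f y)) => //.
  by apply: ckB => //; exact: ck_cst.
apply: ck_prod => // a _; apply: ckM => //; apply: cstep; apply: ckM => //; try exact: ck_cst.
  by apply: ckB => //; [exact: ck_coord|exact: ck_cst].
by apply: ckB => //; [exact: ck_cst|exact: ck_coord].
Qed.

End Bumps.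

Section Density.
Context d (T : measurableType d) (R : realType) (mu : {measure set T -> \bar R}) (f : T -> \bar R).
Hypothesis f0 : forall x, (0 <= f x)%E.
Hypothesis mf : measurable_fun setT f.

(** The proofs of positivity and measurability are arguments, so that the structure of a measure can
    be attached to the term [density f0 mf]. *)
Definition density (f0 : forall x, (0 <= f x)%E) (mf : measurable_fun setT f) (A : set T) : \bar R :=
  (\int[mu]_(x in A) f x)%E.

Let density0 : density f0 mf set0 = 0%E. Proof. exact: integral_set0. Qed.
Let density_ge0 A : (0 <= density f0 mf A)%E.
Proof. by apply: integral_ge0 => x _. Qed.
Let density_sigma_additive : semi_sigma_additive (density f0 mf).
Proof.
move=> F mF tF mUF; rewrite /density ge0_integral_bigcup//.
- by apply: is_cvg_ereal_nneg_natsum_cond => j _ _; exact: density_ge0.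
- exact: measurable_funTS.
Qed.
HB.instance Definition _ := isMeasure.Build _ _ _ (density f0 mf) density0 density_ge0 density_sigma_additive.
Definition density_measure : {measure set T -> \bar R} := density f0 mf.
End Density.

Section Fundamental.
Variables (R : realType) (n : nat).
Local Notation V := 'rV[R]_n.
Local Notation mu := (@muV R n).

Definition obox (lo hi : V) : set V := [set y | forall a, lo 0 a < y 0 a < hi 0 a].

Lemma open_obox lo hi : open (obox lo hi).
Proof.
rewrite openE => y yb.
apply: (@filter_forall V 'I_n (fun a (z : V) => lo 0 a < z 0 a < hi 0 a) (nbhs y)) => a.
have /andP[y1 y2] := yb a; have cy : {for y, continuous (fun z : V => z 0 a)} by exact: coord_continuous.
have n1 := near_gt cy y1; have n2 := near_lt cy y2.
by near=> z; apply/andP; split; near: z.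
Unshelve. all: by end_near.
Qed.

Definition oboxes : set (set V) := [set B | B = set0 \/ exists lo hi, B = obox lo hi].

(** Open boxes together with the empty set are stable under intersection, so they can serve as the
    determining class in [measure_unique]. *)
Lemma borel_oboxes : @measurable _ (borel V) = <<s oboxes >>.
Proof.
apply/seteqP; split=> [A|A]; last first.
  apply: smallest_sub => //; first exact: sigma_algebra_measurable.
  by move=> _ [->//|[lo [hi ->]]]; apply: open_borel; exact: open_obox.
apply: smallest_sub; first exact: smallest_sigma_algebra.
move=> {}A oA.
have cs := @rV_second_countable R n.
have [||x Ax|F [oF PF AF]] := @countable_local V A
    (fun N => exists2 B, oboxes B & N `<=` B /\ B `<=` A) cs.
- by exists set0; [left|split].
- by move=> B C BC [E bE [CE EA]]; exists E => //; split=> //; exact: subset_trans CE.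
- have /nbhs_rV[r r0 rP] : nbhs x A by apply: open_nbhs_nbhs.
  exists (obox (\row_a (x 0 a - r / 2)) (\row_a (x 0 a + r / 2))).
    by apply: open_nbhs_nbhs; split; [exact: open_obox|move=> a; rewrite !mxE; lra].
  exists (obox (\row_a (x 0 a - r / 2)) (\row_a (x 0 a + r / 2))); first by right; eexists; eexists.
  split=> // y yb; apply: rP; apply: (@le_lt_trans _ _ (r / 2)); last lra.
  apply/rV_normP => [|a]; first lra.
  by have := yb a; rewrite !mxE ler_norml; lra.
have /choice[G GP] : forall k, exists B, oboxes B /\ F k `<=` B /\ B `<=` A.
  by move=> k; have [B bB H] := PF k; exists B.
have -> : A = \bigcup_k G k.
  apply/seteqP; split=> [x /AF[k _ Fx]|x [k _]]; last by have [_ [_]] := GP k; apply.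
  by exists k => //; have [_ [+ _]] := GP k; apply.
have [_ _ H] := @smallest_sigma_algebra _ setT oboxes; apply: H => k.
by apply: sub_sigma_algebra; have [] := GP k.
Qed.

Definition cube (y0 : V) (r : R) : set V := obox (y0 - const_mx r) (y0 + const_mx r).

Lemma obox_setI (lo hi lo' hi' : V) : obox lo hi `&` obox lo' hi' =
  obox (\row_a Num.max (lo 0 a) (lo' 0 a)) (\row_a Num.min (hi 0 a) (hi' 0 a)).
Proof.
apply/seteqP; split=> [y [H1 H2] a|y H].
  by have := H1 a; have := H2 a; rewrite !mxE gt_max lt_min; lra.
by split=> a; have := H a; rewrite !mxE gt_max lt_min; lra.
Qed.

Lemma measurable_obox lo hi : measurable (obox lo hi : set (borel V)).
Proof. by apply: open_borel; exact: open_obox. Qed.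

(** Cut-offs of the box intersected with the cube, with margins tending to 0, converge to its
    indicator function; dominated convergence applies, the cut-offs being at most 1. *)
Lemma test_box k (y0 lo hi : V) (r : R) (h : V -> R) : 0 < r ->
  mu.-integrable (cube y0 r : set (borel V)) (EFin \o h) ->
  (forall u, ck k setT u -> (exists2 r', r' < r & forall y, u y != 0 -> cube y0 r' y) ->
     (\int[mu]_(y in (cube y0 r : set (borel V))) (h y * u y)%:E = 0)%E) ->
  (\int[mu]_(y in (obox lo hi `&` cube y0 r : set (borel V))) (h y)%:E = 0)%E.
Proof.
move=> r0 ih H; pose B := cube y0 r.
have mh : measurable_fun (B : set (borel V)) h by apply/measurable_EFinP; case/integrableP: ih.
have mB : measurable (B : set (borel V)) by exact: measurable_obox.
set Q := obox lo hi `&` cube y0 r.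
have mQ : measurable (Q : set (borel V)) by apply: measurableI => //; exact: measurable_obox.
rewrite (_ : (Q : set (borel V)) = B `&` Q); last by rewrite setIC -setIA setIid.
rewrite integral_mkcondr.
have QE : Q = _ := obox_setI lo hi _ _; set lo' := (X in obox X _) in QE; set hi' := (X in obox _ X) in QE.
pose e (j : nat) : R := j.+1%:R^-1.
have e0 j : 0 < e j by rewrite invr_gt0.
(* The box is first shrunk by [e j], which keeps the support strictly inside the cube as the class
   of test functions demands. *)
pose u j := cutoff k (lo' + const_mx (e j)) (hi' - const_mx (e j)) (e j).
have cu j : ck k setT (u j) by exact: ck_cutoff.
have us j y : u j y != 0 -> forall a, lo' 0 a + e j < y 0 a < hi' 0 a - e j.
  by move=> /(cutoff_neq0 (e0 j)) + a => /(_ a); rewrite !mxE.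
have uI j : (\int[mu]_(y in (B : set (borel V))) (h y * u j y)%:E = 0)%E.
  apply: H => //; exists (r - e j); first by rewrite ltrBlDr ltrDl.
  move=> y /us uy a; rewrite !mxE; have := uy a.
  have : y0 0 a - r <= lo' 0 a by rewrite !mxE le_max lexx orbT.
  have : hi' 0 a <= y0 0 a + r by rewrite !mxE ge_min lexx orbT.
  by move: (lo' 0 a) (hi' 0 a) (e j) => p q t; lra.
have C : ((\int[mu]_(y in (B : set (borel V))) (h y * u j y)%:E)%E @[j --> \oo] -->
    (\int[mu]_(y in (B : set (borel V))) ((EFin \o h) \_ Q) y)%E).
  apply: (@dominated_cvg _ _ _ _ _ mB _ _ (fun y => `|(h y)%:E|)%E).
  - move=> j; apply/measurable_EFinP/measurable_funM => //.
    apply: measurable_funS (measurableT) _ _ => //.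
    by apply: continuous_borel => [|y _]; [exact: openT|exact: ck_continuous (cu j) _].
  - move=> y By; rewrite patchE; case: ifPn => yQ; last first.
      rewrite (_ : (fun j => _) = cst 0%E); first exact: cvg_cst.
      apply/funext => j; have [->|/us uy] := eqVneq (u j y) 0; first by rewrite mulr0.
      case/negP: yQ; rewrite inE QE => a; have := uy a; have := e0 j; lra.
    apply: cvg_near_cst; move: yQ; rewrite inE QE => yQ.
    have N : \forall j \near \oo, forall a, lo' 0 a + e j + e j <= y 0 a <= hi' 0 a - e j - e j.
      apply: (@filter_forall nat 'I_n (fun a j => lo' 0 a + e j + e j <= y 0 a <= hi' 0 a - e j - e j)) => a.
      have /andP[y1 y2] := yQ a.
      have p0 : 0 < Num.min (y 0 a - lo' 0 a) (hi' 0 a - y 0 a) / 2.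
        by rewrite divr_gt0// lt_min !subr_gt0 y1.
      have := near_infty_natSinv_lt (PosNum p0); apply: filterS => j /=.
      rewrite -/(e j) ltr_pdivlMr// lt_min; lra.
    apply: filterS N => j Nj; rewrite /u cutoff1 ?mulr1// => a.
    by have := Nj a; rewrite !mxE.
  - by move=> y _; rewrite abse_fin_num.
  - exact: integrable_abse.
  - move=> j y _; rewrite lee_fin normrM ler_piMr//.
    by rewrite ger0_norm ?cutoff_ge0// cutoff_le1.
apply/esym; apply: (@cvg_unique _ _ _ _ _ _ _ C) => //.
by apply: cvg_near_cst; apply: nearW => j; exact: uI.
Qed.

(* The positive and negative parts of [h] are densities of two measures; by testing with cut-offs of
   boxes these agree on boxes, hence everywhere. *)
Lemma fundamental_lemma k (y0 : V) (r : R) (h : V -> R) : 0 < r ->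
  mu.-integrable (cube y0 r : set (borel V)) (EFin \o h) ->
  (forall u, ck k setT u -> (exists2 r', r' < r & forall y, u y != 0 -> cube y0 r' y) ->
     (\int[mu]_(y in (cube y0 r : set (borel V))) (h y * u y)%:E = 0)%E) ->
  ae_eq mu (cube y0 r : set (borel V)) (EFin \o h) (cst 0%E).
Proof.
move=> r0 ih H; pose B : set (borel V) := cube y0 r.
have mB : measurable B by exact: measurable_obox.
have mh : measurable_fun B (EFin \o h) by case/integrableP: ih.
have mp : measurable_fun setT ((EFin \o h)^\+ \_ B)%E by apply/(measurable_restrictT _ mB)/measurable_funepos.
have mn : measurable_fun setT ((EFin \o h)^\- \_ B)%E by apply/(measurable_restrictT _ mB)/measurable_funeneg.
have p0 y : (0 <= ((EFin \o h)^\+ \_ B) y)%E by rewrite patchE; case: ifP => // _; exact: funepos_ge0.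
have n0 y : (0 <= ((EFin \o h)^\- \_ B) y)%E by rewrite patchE; case: ifP => // _; exact: funeneg_ge0.
pose m1 := density_measure mu p0 mp; pose m2 := density_measure mu n0 mn.
have m1E A : m1 A = (\int[mu]_(y in A `&` B) (EFin \o h)^\+ y)%E by rewrite integral_mkcondr.
have m2E A : m2 A = (\int[mu]_(y in A `&` B) (EFin \o h)^\- y)%E by rewrite integral_mkcondr.
have fin_p A : measurable A -> (m1 A \is a fin_num) /\ (m2 A \is a fin_num).
  move=> mA; have iA : mu.-integrable (A `&` B) (EFin \o h).
    by apply: integrableS ih => //; exact: measurableI.
  by rewrite m1E m2E; split; [apply: integrable_pos_fin_num|apply: integrable_neg_fin_num] => //; exact: measurableI.
have m12 A : oboxes A -> m1 A = m2 A.
  move=> [->|[lo [hi ->]]]; first by rewrite !measure0.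
  have [f1 f2] := fin_p _ (measurable_obox lo hi).
  have := test_box lo hi r0 ih H; rewrite integralE -/B -m1E -m2E => /eqP.
  by rewrite sube_eq ?f1// add0e => /eqP.
have m12a A : measurable A -> m1 A = m2 A.
  apply: (@measure_unique _ _ (borel V) oboxes (fun j => obox (const_mx (- j%:R)) (const_mx j%:R))) => //.
  - exact: borel_oboxes.
  - move=> _ _ [->|[lo [hi ->]]] [->|[lo' [hi' ->]]]; rewrite ?set0I ?setI0; [by left..|].
    by right; rewrite obox_setI; eexists; eexists.
  - by move=> j; right; eexists; eexists.
  - apply/seteqP; split=> // y _; exists (Num.bound `|y|) => // a; rewrite !mxE -ltr_norml.
    exact: le_lt_trans (rV_coord_le _ _) (archi_boundP _).
  - by move=> j; rewrite ltey_eq (fin_p _ (measurable_obox _ _)).1.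
(* Where [h > 0] the second density vanishes, elsewhere the first one does; as the two measures
   agree, both are zero. *)
have m1T : m1 setT = 0%E.
  pose A : set (borel V) := B `&` [set y | 0 < h y].
  have mA : measurable A.
    have := (measurable_EFinP _ _).2; move=> _; have /measurable_EFinP mh' := mh.
    by have := mh' mB `]0, +oo[%classic (measurable_itv _); rewrite /A; congr measurable; apply/seteqP; split=> y /=; rewrite in_itv/= andbT.
  have e1 : m1 A = 0%E.
    rewrite m12a// m2E; apply: integral0_eq => y [[_ /= hy] _].
    by rewrite funenegE max_r// -EFinN lee_fin; lra.
  have e2 : m1 (~` A) = 0%E.
    rewrite m1E; apply: integral0_eq => y [nA By]; rewrite funeposE max_r//= lee_fin leNgt.
    by apply/negP => hy; apply: nA.
  rewrite -(setUv A); apply: etrans (measureU _ mA (measurableC mA) _) _; first by rewrite setICr.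
  have e3 : (m1 A + m1 (~` A) = 0)%E by rewrite e1 e2 adde0.
  exact: e3.
have m2T : m2 setT = 0%E by rewrite -m12a.
apply/(ae_eq_integral_abs _ mB mh).
rewrite (eq_integral (fun y : borel V => ((EFin \o h)^\+ y + (EFin \o h)^\- y)%E)); last by move=> y _; rewrite -/((abse \o (EFin \o h)) y) fune_abse.
rewrite ge0_integralD//; [|exact: measurable_funepos|exact: measurable_funeneg].
by move: m1T m2T; rewrite m1E m2E setTI => -> ->; rewrite adde0.
Qed.

End Fundamental.

(** * Rademacher's theorem *)

Section Rademacher.
Variables (R : realType) (n : nat).
Local Notation V := 'rV[R]_n.
Local Notation mu := (@muV R n).
Local Notation RR := (measurableTypeR R).

Definition lipV (K : R) (f : V -> R) := forall y z : V, `|f y - f z| <= K * `|y - z|.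

Lemma lipV_continuous K f : lipV K f -> continuous f.
Proof.
move=> fK y B /nbhs_ballP[e /= e0 eB]; change (nbhs y (fun z => B (f z))).
have K1 : 0 < `|K| + 1 by rewrite ltr_wpDl.
apply/nbhs_rV; exists (e / (`|K| + 1)); first by rewrite divr_gt0.
move=> z yz; apply: eB; rewrite /ball/=; apply: le_lt_trans (fK _ _) _.
apply: (@le_lt_trans _ _ ((`|K| + 1) * `|y - z|)).
  by rewrite ler_wpM2r// (le_trans (ler_norm K))// lerDl.
by rewrite mulrC -ltr_pdivlMr.
Qed.

Lemma lipV_measurable K f : lipV K f -> measurable_fun (setT : set (borel V)) f.
Proof. by move=> fK; apply: continuous_borel; [exact: openT|move=> y _; exact: lipV_continuous fK y]. Qed.

Lemma lipV_shift K f (w : V) : lipV K f -> lipV K (fun y => f (y + w)).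
Proof. by move=> fK y z; apply: le_trans (fK _ _) _; rewrite opprD addrACA subrr addr0. Qed.

Definition dquot (f : V -> R) (v : V) (t : R) (y : V) : R := t^-1 * (f (y + t *: v) - f y).

Definition good (f : V -> R) (v : V) : set (borel V) := [set y | derivable f y v].

Lemma dquotE f v t y : t^-1 *: ((f \o shift y) (t *: v) - f y) = dquot f v t y.
Proof. by rewrite /dquot /= [t *: v + y]addrC. Qed.

Lemma dquot_bound K f v t y : lipV K f -> t != 0 -> `|dquot f v t y| <= K * `|v|.
Proof.
move=> fK t0; rewrite /dquot normrM normfV ler_pdivrMl ?normr_gt0//.
by apply: le_trans (fK _ _) _; rewrite addrAC subrr add0r normrZ mulrCA.
Qed.

Lemma dquot_lip K f v t : lipV K f -> lipV (`|t^-1| * (K + K)) (dquot f v t).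
Proof.
move=> fK y z; rewrite /dquot -mulrBr normrM -mulrA ler_wpM2l// mulrDl opprD opprK.
rewrite addrACA (le_trans (ler_normD _ _))// lerD//; first exact: (lipV_shift (t *: v) fK).
by rewrite addrC distrC; apply: le_trans (fK _ _) _; rewrite distrC.
Qed.

(** A Cauchy condition on difference quotients. For Lipschitz [f] it is closed in [y], which
    exhibits [good] as a Borel set. *)
Definition good_approx f v (j m : nat) : set (borel V) := [set y | forall s t : R,
  0 < `|s| < m.+1%:R^-1 -> 0 < `|t| < m.+1%:R^-1 -> `|dquot f v s y - dquot f v t y| <= j.+1%:R^-1].

Lemma goodE f v : good f v = \bigcap_j \bigcup_m good_approx f v j m.
Proof.
apply/seteqP; split=> [y /cvg_ex[l ly] j _|y H].
  have e0 : 0 < (j.+1%:R^-1 / 2 : R) by rewrite divr_gt0// invr_gt0.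
  have /nbhs_ballP[r /= r0 rP] : \forall h \near 0^', `|l - h^-1 *: ((f \o shift y) (h *: v) - f y)| < j.+1%:R^-1 / 2.
    by have := ly; move/cvgrPdist_lt; apply.
  have [m mr] : exists m : nat, m.+1%:R^-1 < r.
    by near \oo => m; exists m; near: m; exact: (near_infty_natSinv_lt (PosNum r0)).
  exists m => // s t /andP[s0 sm] /andP[t0 tm].
  have N h : 0 < `|h| -> `|h| < m.+1%:R^-1 -> `|l - dquot f v h y| < j.+1%:R^-1 / 2.
    move=> h0 hm; rewrite -dquotE; apply: rP; last by rewrite -normr_gt0.
    by rewrite /ball/= sub0r normrN (lt_trans hm).
  have := ler_distD l (dquot f v s y) (dquot f v t y); rewrite [`|_ - l|]distrC.
  have := N s s0 sm; have := N t t0 tm; move: (`|_|) (`|_|) (`|_|) (_^-1) => p1 p2 p3 p4; lra.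
apply: cauchy_cvg; apply/cauchy_ballP => e e0.
have [j je] : exists j : nat, j.+1%:R^-1 < e.
  by near \oo => m; exists m; near: m; exact: (near_infty_natSinv_lt (PosNum e0)).
have [m _ mP] := H j I.
have N : \forall h \near 0^', 0 < `|h : R| < m.+1%:R^-1.
  have m0 : 0 < (m.+1%:R^-1 : R) by rewrite invr_gt0.
  exists m.+1%:R^-1 => //= h; rewrite /ball_/= sub0r normrN => hm h0.
  by rewrite normr_gt0 h0.
pose A : set R := [set x | exists2 h : R, 0 < `|h| < m.+1%:R^-1 & x = dquot f v h y].
have FA : \forall h \near 0^', A (h^-1 *: ((f \o shift y) (h *: v) - f y)).
  by apply: filterS N => h hN; exists h => //; rewrite dquotE.
exists (A, A) => // -[x z] [/= [s s0 ->] [t t0 ->]].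
by apply: le_lt_trans je; exact: mP.
Unshelve. all: by end_near.
Qed.

Lemma measurable_good K f v : lipV K f -> measurable (good f v).
Proof.
move=> fK; rewrite goodE; apply: bigcapT_measurable => j; apply: bigcupT_measurable => m.
apply: closed_borel.
rewrite (_ : good_approx f v j m = \bigcap_(st in [set st : R * R | 0 < `|st.1| < m.+1%:R^-1 /\ 0 < `|st.2| < m.+1%:R^-1])
    [set y | `|dquot f v st.1 y - dquot f v st.2 y| <= j.+1%:R^-1]); last first.
  apply/seteqP; split=> [y H [s t] [/= s0 t0]|y H s t s0 t0]; first exact: H.
  exact: (H (s, t)).
apply: closed_bigI => -[s t] [s0 t0] /=.
have c h : continuous (dquot f v h) by exact: lipV_continuous (dquot_lip v h fK).
apply: (@closed_comp _ _ (fun y : V => `|dquot f v s y - dquot f v t y|) [set x | x <= j.+1%:R^-1]); last exact: closed_le.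
move=> y _; apply: (@continuous_comp _ _ _ (fun y : V => dquot f v s y - dquot f v t y) (fun x : R => `|x|)).
  by apply: continuousB; exact: c.
exact: norm_continuous.
Qed.

Lemma measurable_line (v : V) : measurable_fun setT (fun p : borel V * RR => ((p.1 : V) + (p.2 : R) *: v) : borel V).
Proof.
apply: measurable_rV => a.
rewrite (_ : (fun p : borel V * RR => _) = (fun p : borel V * RR => (p.1 : V) 0 a + (p.2 : R) * v 0 a)); last first.
  by apply/funext => p; rewrite !mxE.
apply: measurable_funD.
  exact: (measurableT_comp (measurable_coord a) measurable_fst).
by apply: measurable_funM; [exact: measurable_snd|exact: measurable_cst].
Qed.

Lemma measurable_line_set (y v : V) (N : set (borel V)) : measurable N ->
  measurable [set t : RR | N (y + (t : R) *: v : V)].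
Proof.
move=> mN; have mf : measurable_fun setT (fun t : RR => (y + (t : R) *: v : V) : borel V).
  apply: measurable_rV => a.
  rewrite (_ : (fun t : RR => _) = (fun t : RR => y 0 a + (t : R) * v 0 a)); last first.
    by apply/funext => p; rewrite !mxE.
  by apply: measurable_funD => //; apply: measurable_funM.
by have := mf measurableT _ mN; rewrite setTI.
Qed.

Lemma line_good K f v (y : V) : 0 <= K -> lipV K f ->
  @lebesgue_measure R [set t : RR | (~` good f v) (y + (t : R) *: v : V)] = 0%E.
Proof.
move=> K0 fK; pose g (t : R) := f (y + t *: v).
(* [lipschitz_ae_derivable] asks for a positive constant, hence the added 1. *)
have gK s t : `|g s - g t| <= (K * `|v| + 1) * `|s - t|.
  apply: le_trans (fK _ _) _; rewrite opprD addrACA subrr add0r -scalerBl normrZ.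
  by rewrite mulrDl mul1r mulrCA -[leLHS]addr0 lerD// mulrC.
have Kp : 0 < K * `|v| + 1 by rewrite ltr_wpDl// mulr_ge0.
have gd t : derivable g t 1 -> good f v (y + t *: v).
  have E : (fun h : R => h^-1 *: ((g \o shift t) (h *: (1 : R)) - g t)) =
      (fun h => h^-1 *: ((f \o shift (y + t *: v)) (h *: v) - f (y + t *: v))).
    apply/funext => h /=; rewrite /g.
    have -> : y + (h *: (1 : R) + t) *: v = h *: v + (y + t *: v); last by [].
    by rewrite -[h *: (1 : R)]/(h * 1) mulr1 scalerDl addrCA.
  by rewrite /derivable E.
apply/negligibleP.
  by apply: measurable_line_set; apply: measurableC; exact: measurable_good fK.
apply: negligibleS (lipschitz_ae_derivable Kp gK) => t /= nt dt; exact: nt (gd t dt).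
Qed.

(** Instead of slicing R^n along [v], the indicator of the bad set [N] at [y + t *: v] is integrated
    over all pairs [(y, t)]. In [t] first it gives 0 by the theorem on the line; in [y] first it
    gives [mu N] for each [t], by translation invariance. As the line has infinite length,
    [mu N = 0]. *)
Lemma ae_good K f v : 0 <= K -> lipV K f -> mu (~` good f v) = 0%E.
Proof.
move=> K0 fK; set N : set (borel V) := ~` good f v.
have mN : measurable N by apply: measurableC; exact: measurable_good fK.
pose F (p : borel V * RR) : \bar R := (\1_N ((p.1 : V) + (p.2 : R) *: v : borel V))%:E.
have mF : measurable_fun setT F.
  by apply/measurable_EFinP; apply: (measurableT_comp _ (measurable_line v)); exact: measurable_indic.
have F0 p : (0 <= F p)%E by rewrite lee_fin.
have := @fubini_tonelli _ _ (borel V) RR R mu (@lebesgue_measure R) F mF F0.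
rewrite (eq_integral (cst 0%E)) => [|y _]; last first.
  have E : (fun t : RR => F (y, t)) = (fun t : RR => (\1_[set t : RR | N ((y : V) + (t : R) *: v)] t)%:E) by [].
  rewrite E integral_indic ?setIT//; first exact: line_good K0 fK.
  exact: measurable_line_set.
rewrite integral0 (eq_integral (cst (mu N))) => [|t _]; last first.
  pose Nt : set (borel V) := (fun y : V => y + (t : R) *: v) @^-1` N.
  have mb : measurable_fun setT (fun y : borel V => badd y ((t : R) *: v)).
    by apply: measurable_badd => //; exact: measurable_cst.
  have mNt : measurable Nt by have := mb measurableT _ mN; rewrite setTI.
  transitivity (\int[mu]_y (\1_Nt y)%:E)%E; first by [].
  rewrite (integral_indic mu measurableT mNt) setIT; exact: muV_translate.
have lT : @lebesgue_measure R setT = +oo%E by rewrite -set_itvNyy lebesgue_measure_itv.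
rewrite integral_cst//= lT => /esym/eqP.
by rewrite mule_eq0 => /orP[/eqP|].
Qed.

Lemma integral_translate_ge0 (g : borel V -> \bar R) (w : V) : measurable_fun setT g ->
  (forall y, 0 <= g y)%E -> (\int[mu]_y g (badd y w) = \int[mu]_y g y)%E.
Proof.
move=> mg g0; pose T (y : borel V) : borel V := (y : V) + w.
have mT : measurable_fun setT T by apply: measurable_badd => //; exact: measurable_cst.
have := @ge0_integral_pushforward _ _ (borel V) (borel V) R T mT mu setT g measurableT mg (fun y _ => g0 y).
rewrite preimage_setT /comp => <-; apply: eq_measure_integral => A mA _.
exact: muV_translate.
Qed.

Lemma integral_translate (g : V -> R) (w : V) : measurable_fun (setT : set (borel V)) g ->
  (\int[mu]_y (g (badd y w))%:E = \int[mu]_y (g y)%:E)%E.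
Proof.
move=> mg; have mg' : measurable_fun (setT : set (borel V)) (EFin \o g) by exact/measurable_EFinP.
rewrite integralE [RHS]integralE; congr (_ - _)%E.
  apply: etrans (_ : _ = \int[mu]_y ((EFin \o g)^\+)%E (badd y w))%E _.
    by apply: eq_integral => y _; rewrite !funeposE.
  apply: etrans (integral_translate_ge0 w (measurable_funepos mg') (fun y => funepos_ge0 _ y)) _.
  by apply: eq_integral => y _; rewrite !funeposE.
apply: etrans (_ : _ = \int[mu]_y ((EFin \o g)^\-)%E (badd y w))%E _.
  by apply: eq_integral => y _; rewrite !funenegE.
apply: etrans (integral_translate_ge0 w (measurable_funeneg mg') (fun y => funeneg_ge0 _ y)) _.
by apply: eq_integral => y _; rewrite !funenegE.
Qed.

Definition dom_ball (M r : R) (y : V) : R := M * \1_(vball r) y.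

Lemma integrable_dom_ball (M r : R) : mu.-integrable setT (EFin \o dom_ball M r).
Proof.
have mB := @measurable_vball R n r.
have i1 : mu.-integrable setT (fun y : borel V => (\1_(vball r) y)%:E).
  apply/integrableP; split; first by apply/measurable_EFinP; exact: measurable_indic.
  under eq_integral do rewrite gee0_abs ?lee_fin//.
  by rewrite integral_indic// setIT; exact: muV_vball_fin.
rewrite (_ : EFin \o _ = (fun y : borel V => M%:E * (\1_(vball r) y)%:E)%E); last by apply/funext => y /=; rewrite EFinM.
exact: integrableZl.
Qed.

Lemma integrable_ball (g : V -> R) (M r : R) : measurable_fun (setT : set (borel V)) g ->
  (forall y, `|y| <= r -> `|g y| <= M) -> (forall y, r < `|y| -> g y = 0) ->
  mu.-integrable setT (EFin \o g).
Proof.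
move=> mg gM g0; apply: le_integrable (integrable_dom_ball M r) => //; first exact/measurable_EFinP.
move=> y _ /=; rewrite lee_fin /dom_ball indicE.
have [yr|yr] := leP `|y| r; last by rewrite g0// normr0.
rewrite (_ : y \in vball r = true) ?mulr1; last exact/mem_set.
by apply: le_trans (gM _ yr) _; exact: ler_norm.
Qed.

(** The value 0 off [good] makes the directional derivative measurable and bounded everywhere. *)
Definition ddir (f : V -> R) (v : V) : V -> R := (fun y => 'D_v f y) \_ (good f v).

Definition tk (k : nat) : R := k.+1%:R^-1.
Lemma tk_gt0 k : 0 < tk k. Proof. by rewrite invr_gt0. Qed.

Lemma cvg_dquot f v y : derivable f y v -> dquot f v (tk k) y @[k --> \oo] --> 'D_v f y.
Proof.
move=> dy; have C : h^-1 *: ((f \o shift y) (h *: v) - f y) @[h --> 0^'] --> 'D_v f y by exact: dy.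
have T : tk k @[k --> \oo] --> (0 : R)^'.
  move=> B [e /= e0 eB]; have := near_infty_natSinv_lt (PosNum e0); apply: filterS => k ke.
  by apply: eB; rewrite ?gt_eqF ?tk_gt0//= /ball_/= sub0r normrN gtr0_norm// tk_gt0.
have := cvg_comp _ _ T C; apply: cvg_trans; apply: near_eq_cvg; near=> k.
by rewrite /comp dquotE.
Unshelve. all: by end_near.
Qed.

Lemma measurable_ddir K f v : lipV K f -> measurable_fun (setT : set (borel V)) (ddir f v).
Proof.
move=> fK; apply/(measurable_restrictT _ (measurable_good v fK)).
apply: (@measurable_fun_cvg _ (borel V) R (good f v) (fun k y => dquot f v (tk k) y) (fun y => 'D_v f y)).
  by move=> k; apply: measurable_funTS; exact: lipV_measurable (dquot_lip _ _ fK).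
by move=> y gy; exact: cvg_dquot.
Qed.

Lemma ddir_bound K f v y : lipV K f -> `|ddir f v y| <= K * `|v|.
Proof.
move=> fK; rewrite /ddir patchE; case: ifPn => [|_]; last first.
  have := le_trans (normr_ge0 _) (dquot_bound v y fK (oner_neq0 R)); by rewrite normr0.
rewrite inE => gy.
have C : `|dquot f v (tk k) y| @[k --> \oo] --> `|'D_v f y| by apply: cvg_norm; exact: cvg_dquot.
rewrite -(cvg_lim _ C)//; apply: limr_le; first exact: cvgP C.
by apply: nearW => k; apply: dquot_bound => //; rewrite gt_eqF// tk_gt0.
Qed.

Lemma lipV_bound K f (r : R) y : lipV K f -> `|y| <= r -> `|f y| <= `|f 0| + `|K| * r.
Proof.
move=> fK yr; rewrite -[f y](subrK (f 0)) addrC; apply: le_trans (ler_normD _ _) _; rewrite lerD2l.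
apply: le_trans (fK _ _) _; rewrite subr0; apply: (@le_trans _ _ (`|K| * `|y|)).
  by rewrite ler_wpM2r// ler_norm.
by rewrite ler_wpM2l.
Qed.

Lemma integrable_lipM Kp Kq p q (r c : R) : lipV Kp p -> lipV Kq q ->
  (forall y, r < `|y| -> p y * q y = 0) ->
  mu.-integrable setT (EFin \o (fun y => c * (p y * q y))).
Proof.
move=> hp hq H; apply: (@integrable_ball _ (`|c| * ((`|p 0| + `|Kp| * r) * (`|q 0| + `|Kq| * r))) r).
- apply: measurable_funM; first exact: measurable_cst.
  by apply: measurable_funM; [exact: lipV_measurable hp|exact: lipV_measurable hq].
- move=> y yr; rewrite !normrM ler_wpM2l// ler_pM//; exact: lipV_bound.
- by move=> y /H ->; rewrite mulr0.
Qed.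

Lemma tk_le1 k : tk k <= 1.
Proof. by rewrite invf_le1// ler1n. Qed.

(** For difference quotients the formula is translation invariance of the integral, the step passing
    from [f] to [u] with direction [- v]; both sides then converge by domination, the quotients
    being bounded by the Lipschitz constants. *)
Lemma lip_ibp K L f u v (r : R) : 0 <= K -> lipV K f -> ck 1 setT u -> lipV L u -> 0 <= r ->
  (forall y, r < `|y| -> u y = 0) ->
  (\int[mu]_y (ddir f v y * u y)%:E = \int[mu]_y (- (f y * 'D_v u y))%:E)%E.
Proof.
(* The radius [r1] contains the supports of all translates of [u] by [tk k *: v], since
   [tk k <= 1]. *)
move=> K0 fK cu uL r0 ur; pose r1 := r + `|v|.
have ur1 k y : r1 < `|y| -> u (y - tk k *: v) = 0.
  move=> yr; apply: ur; have := ler_normD (y - tk k *: v) (tk k *: v); rewrite subrK => h.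
  have h2 : `|tk k *: v| <= `|v|.
    by rewrite normrZ gtr0_norm ?tk_gt0// ler_piMl// tk_le1.
  have := le_trans h (lerD (lexx _) h2); rewrite -lerBlDr; apply: lt_le_trans.
  by rewrite ltrBrDr.
have mu_u := lipV_measurable uL; have mf := lipV_measurable fK.
have mg := measurable_good v fK.
have AB k : (\int[mu]_y (dquot f v (tk k) y * u y)%:E = \int[mu]_y (f y * dquot u (- v) (tk k) y)%:E)%E.
  set t := tk k; pose c (y : V) := t^-1 * (f y * u (y - t *: v)); pose b (y : V) := t^-1 * (f y * u y).
  have ic : mu.-integrable setT (EFin \o c).
    apply: (@integrable_lipM K L f (fun y => u (y - t *: v)) r1) => //; first exact: lipV_shift.
    by move=> y yr; rewrite /t ur1// mulr0.
  have ib : mu.-integrable setT (EFin \o b).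
    by apply: (@integrable_lipM K L f u r) => // y yr; rewrite ur// mulr0.
  have ia : mu.-integrable setT (EFin \o (fun y => c (y + t *: v))).
    rewrite (_ : (fun y => _) = (fun y => t^-1 * (f (y + t *: v) * u y))); last first.
      by apply/funext => y; rewrite /c addrK.
    apply: (@integrable_lipM K L (fun y => f (y + t *: v)) u r) => //; first exact: lipV_shift.
    by move=> y yr; rewrite ur// mulr0.
  have mc : measurable_fun (setT : set (borel V)) c by case/integrableP: ic => /measurable_EFinP.
  rewrite (eq_integral (fun y : borel V => (EFin \o (fun y => c (y + t *: v)%R)) y - (EFin \o b) y)%E); last first.
    by move=> y _ /=; rewrite -EFinB /c /b addrK /dquot; congr EFin; ring.
  rewrite [RHS](eq_integral (fun y : borel V => (EFin \o c) y - (EFin \o b) y)%E); last first.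
    by move=> y _ /=; rewrite -EFinB /c /b /dquot scalerN; congr EFin; ring.
  rewrite !integralB_EFin//; congr (_ - _)%E; exact: (integral_translate (t *: v) mc).
have LA : (\int[mu]_y (dquot f v (tk k) y * u y)%:E @[k --> \oo] --> \int[mu]_y (ddir f v y * u y)%:E)%E.
  have E k : (\int[mu]_y (dquot f v (tk k) y * u y)%:E = \int[mu]_y ((dquot f v (tk k) \_ (good f v)) y * u y)%:E)%E.
    have md : measurable_fun (setT : set (borel V)) (dquot f v (tk k)) by exact: lipV_measurable (dquot_lip v _ fK).
    apply: ae_eq_integral => //.
    - by apply/measurable_EFinP; exact: measurable_funM.
    - apply/measurable_EFinP; apply: measurable_funM => //.
      by apply/(measurable_restrictT _ mg); exact: measurable_funTS.
    - exists (~` good f v); split; [exact: measurableC|exact: ae_good K0 fK|].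
      by move=> y /= H gy; apply: H => _; rewrite patchE mem_set.
  under eq_cvg do rewrite E.
  apply: (@dominated_cvg _ (borel V) R mu setT measurableT
    (fun k y => ((dquot f v (tk k) \_ (good f v)) y * u y)%:E) (fun y => (ddir f v y * u y)%:E) (EFin \o dom_ball (K * `|v| * (`|u 0| + `|L| * r)) r)).
  - move=> k; apply/measurable_EFinP; apply: measurable_funM => //.
    apply/(measurable_restrictT _ mg); apply: measurable_funTS; exact: lipV_measurable (dquot_lip v _ fK).
  - move=> y _; rewrite /ddir patchE; case: ifPn => gy.
      rewrite (_ : (fun k => _) = (fun k => (dquot f v (tk k) y * u y)%:E)); last first.
        by apply/funext => k; rewrite patchE gy.
      apply: cvg_EFin; first exact: nearW.
      apply: cvgM; [exact: cvg_dquot (set_mem gy)|exact: cvg_cst].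
    rewrite (_ : (fun k => _) = cst (0 * u y)%:E); first exact: cvg_cst.
    by apply/funext => k; rewrite patchE (negbTE gy).
  - by [].
  - exact: integrable_dom_ball.
  - move=> k y _; rewrite lee_fin /dom_ball indicE.
    have [yr|yr] := leP `|y| r; last by rewrite ur// mulr0 normr0 mulr_ge0// mulr_ge0 ?mulr_ge0// addr_ge0// mulr_ge0.
    rewrite (_ : y \in vball r = true) ?mulr1; last exact/mem_set.
    rewrite normrM ler_pM//; last exact: lipV_bound.
    by rewrite patchE; case: ifP => _; rewrite ?normr0 ?mulr_ge0// dquot_bound// gt_eqF// tk_gt0.
have du y : derivable u y (- v) by apply: diff_derivable; exact: ck_differentiable cu _.
have LB : (\int[mu]_y (f y * dquot u (- v) (tk k) y)%:E @[k --> \oo] --> \int[mu]_y (f y * 'D_(- v) u y)%:E)%E.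
  apply: (@dominated_cvg _ (borel V) R mu setT measurableT
    (fun k y => (f y * dquot u (- v) (tk k) y)%:E) (fun y => (f y * 'D_(- v) u y)%:E) (EFin \o dom_ball ((`|f 0| + `|K| * r1) * (`|L| * `|v|)) r1)).
  - move=> k; apply/measurable_EFinP; apply: measurable_funM => //; exact: lipV_measurable (dquot_lip _ _ uL).
  - move=> y _; apply: cvg_EFin; first exact: nearW.
    apply: cvgM; [exact: cvg_cst|exact: cvg_dquot (du y)].
  - by [].
  - exact: integrable_dom_ball.
  - move=> k y _; rewrite lee_fin /dom_ball indicE.
    have [yr|yr] := leP `|y| r1; last first.
      rewrite /dquot scalerN ur1// ur; last by apply: le_lt_trans yr; rewrite lerDl.
      by rewrite subrr !mulr0 normr0 mulr_ge0// mulr_ge0 ?mulr_ge0// addr_ge0// mulr_ge0// addr_ge0.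
    rewrite (_ : y \in vball r1 = true) ?mulr1; last exact/mem_set.
    rewrite normrM ler_pM//; first exact: lipV_bound.
    apply: le_trans (dquot_bound _ _ uL _) _; first by rewrite gt_eqF// tk_gt0.
    by rewrite normrN ler_wpM2r// ler_norm.
have {}LB := cvg_trans _ LB; rewrite -(cvg_lim _ LA)//.
rewrite (_ : (fun k => _) = (fun k => (\int[mu]_y (f y * dquot u (- v) (tk k) y)%:E)%E)); last by apply/funext => k; rewrite AB.
rewrite (cvg_lim _ (LB _ _))//; apply: eq_integral => y _; congr EFin.
have dy : differentiable u y by exact: ck_differentiable cu _.
by rewrite (deriveE _ dy) linearN -deriveE// mulrN.
Qed.

Definition linform (c : 'I_n -> R) (h : V) : R := \sum_a h 0 a * c a.

Lemma linform_is_linear c : linear (linform c : V -> R^o).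
Proof.
move=> k x y; rewrite /linform scaler_sumr -big_split/=; apply: eq_bigr => a _.
by rewrite !mxE mulrDl -mulrA.
Qed.
HB.instance Definition _ c := GRing.isLinear.Build R V R^o *:%R (linform c) (linform_is_linear c).

Definition rdir (q : 'rV[rat]_n) : V := \row_a ratr (q 0 a).

(** Compactness of the support bounds the partial derivatives, and the mean value theorem on
    segments turns their bounds into a Lipschitz constant. *)
Lemma ck1_lip u (r : R) : ck 1 setT u -> (forall y : V, r < `|y| -> u y = 0) -> exists L, lipV L u.
Proof.
move=> [du cu] ur.
have bd a : exists M : R, forall y, `|pd a u y| <= M.
  have cB : compact (@vball R n r).
    apply: bounded_closed_compact; last exact: closed_vball.
    by exists r; split; [exact: num_real|move=> x rx y /= yr; exact: le_trans yr (ltW rx)].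
  have cI : compact (pd a u @` (@vball R n r)).
    by apply: continuous_compact => //; apply: continuous_in_subspaceT => y _; exact: (cu a y I).
  have [M [_ HM]] := compact_bounded cI.
  exists (Num.max 0 (M + 1)) => y; have [yr|yr] := leP `|y| r.
    by rewrite le_max; apply/orP; right; apply: HM; [rewrite ltrDl|exists y].
  rewrite (near_eq_pd (g := cst 0)) ?pd_cst ?normr0 ?le_max ?lexx//.
  have : \forall z \near y, r < `|z| by apply: near_gt yr; exact: norm_continuous.
  by apply: filterS => z; exact: ur.
have [M MP] := fin_all_exists bd.
exists (\sum_a M a) => y z.
have M0 a : 0 <= M a by exact: le_trans (normr_ge0 _) (MP a y).
have [|c _ ce] := @mean_value R (fun s => u (z + s *: (y - z))) (fun s => 'D_(y - z) u (z + s *: (y - z))) 1 ltr01.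
  by move=> s _; apply: is_derive_line; exact: du.
move: ce; rewrite scale1r scale0r addr0 [z + _]addrC subrK mulr1 => ->.
rewrite deriveE_pd; last exact: du.
apply: le_trans (ler_norm_sum _ _ _) _; rewrite mulr_suml; apply: ler_sum => a _.
by rewrite normrM mulrC ler_pM// rV_coord_le.
Qed.

(** Integrated against a C^1 test function, linearity in [v] moves to the derivatives of the test
    function by [lip_ibp], where it is classical; [fundamental_lemma] makes it pointwise again. *)
Lemma ae_linear K f v : 0 <= K -> lipV K f ->
  {ae mu, forall y : V, ddir f v y = linform (fun a => ddir f (bvec R a) y) v}.
Proof.
move=> K0 fK; pose h (y : V) := ddir f v y - linform (fun a => ddir f (bvec R a) y) v.
have mh : measurable_fun (setT : set (borel V)) h.
  apply: measurable_funB; first exact: measurable_ddir fK.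
  by apply: measurable_sum => a; apply: measurable_funM => //; exact: measurable_ddir fK.
pose M := K * `|v| + \sum_a `|v 0 a| * (K * `|bvec R a|).
have hM y : `|h y| <= M.
  apply: le_trans (ler_normB _ _) _; apply: lerD; first exact: ddir_bound.
  apply: le_trans (ler_norm_sum _ _ _) _; apply: ler_sum => a _; rewrite normrM ler_wpM2l//.
  exact: ddir_bound.
have hm (m : nat) : ae_eq mu (cube 0 m.+1%:R : set (borel V)) (EFin \o h) (cst 0%E).
  have mC : measurable (cube 0 m.+1%:R : set (borel V)) by exact: measurable_obox.
  apply: (@fundamental_lemma R n 1 0) => //.
    apply: le_integrable (integrableS measurableT mC (@subsetT _ _) (integrable_dom_ball M m.+1%:R)) => //.
      by apply/measurable_EFinP; exact: measurable_funTS.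
    move=> y yC /=; rewrite lee_fin /dom_ball indicE (_ : y \in vball _ = true) ?mulr1.
      by apply: le_trans (hM y) _; exact: ler_norm.
    by apply/mem_set/rV_normP => // a; have := yC a; rewrite !mxE ler_norml; lra.
  move=> u cu [r' r'm us].
  have ur y : m.+1%:R < `|y| -> u y = 0.
    move=> ym; apply/eqP; apply: contraTT ym => /us yr'; rewrite -leNgt; apply/rV_normP => // a.
    by have := yr' a; rewrite !mxE ler_norml; lra.
  have [L uL] := ck1_lip cu ur.
  have ibp w := lip_ibp w K0 fK cu uL (ler0n R m.+1) ur.
  have mu_u := lipV_measurable uL; have mf := lipV_measurable fK.
  have uB y : `|y| <= m.+1%:R -> `|u y| <= `|u 0| + `|L| * m.+1%:R by exact: lipV_bound.
  have iw w : mu.-integrable setT (EFin \o (fun y => ddir f w y * u y)).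
    apply: (@integrable_ball _ (K * `|w| * (`|u 0| + `|L| * m.+1%:R)) m.+1%:R).
    - by apply: measurable_funM => //; exact: measurable_ddir fK.
    - by move=> y ym; rewrite normrM ler_pM// ?ddir_bound// uB.
    - by move=> y /ur ->; rewrite mulr0.
  have Du w y : 'D_w u y = ddir u w y.
    by rewrite /ddir patchE mem_set//; apply: diff_derivable; exact: ck_differentiable cu _.
  have i2 w : mu.-integrable setT (EFin \o (fun y => - (f y * 'D_w u y))).
    under [X in _.-integrable _ (_ \o X)]eq_fun do rewrite Du.
    apply: (@integrable_ball _ ((`|f 0| + `|K| * m.+1%:R) * (L * `|w|)) m.+1%:R).
    - by apply: measurableT_comp => //; apply: measurable_funM => //; exact: measurable_ddir uL.
    - by move=> y ym; rewrite normrN normrM ler_pM// ?ddir_bound//; exact: lipV_bound.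
    - move=> y ym; rewrite -Du (_ : 'D_w u y = 0) ?mulr0 ?oppr0//.
      rewrite (near_eq_derive _ (g := cst 0)) ?derive_cst//.
      have : \forall z \near y, m.+1%:R < `|z| by apply: near_gt ym; exact: norm_continuous.
      by apply: filterS => z; exact: ur.
  rewrite integral_mkcond.
  transitivity (\int[mu]_y ((ddir f v y * u y)%:E - (\sum_a v 0 a * (ddir f (bvec R a) y * u y))%:E))%E.
    apply: eq_integral => y _; rewrite patchE -EFinB.
    have -> : ddir f v y * u y - \sum_a v 0 a * (ddir f (bvec R a) y * u y) = h y * u y.
      by rewrite /h mulrBl /linform mulr_suml; congr (_ - _); apply: eq_bigr => a _; rewrite mulrA.
    case: ifPn => // yC; have [->|/us yr'] := eqVneq (u y) 0; first by rewrite mulr0.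
    by case/negP: yC; rewrite inE => a; have := yr' a; rewrite !mxE; lra.
  have iZ a : mu.-integrable setT (fun y : borel V => (v 0 a)%:E * (ddir f (bvec R a) y * u y)%:E)%E.
    by apply: integrableZl => //; exact: iw.
  have iZ2 a : mu.-integrable setT (fun y : borel V => (v 0 a)%:E * (- (f y * 'D_(bvec R a) u y))%:E)%E.
    by apply: integrableZl => //; exact: i2.
  have iS : mu.-integrable setT (EFin \o (fun y => \sum_a v 0 a * (ddir f (bvec R a) y * u y))).
    rewrite (_ : EFin \o _ = (fun y : borel V => \sum_(a <- index_enum 'I_n) ((v 0 a)%:E * (ddir f (bvec R a) y * u y)%:E)%E)%E).
      by apply: integrable_sum => // a _; exact: iZ.
    by apply/funext => y /=; rewrite -sumEFin; apply: eq_bigr => a _; rewrite EFinM.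
  rewrite (integralB_EFin measurableT (iw v) iS) ibp.
  rewrite [X in (_ - X)%E](_ : _ = \int[mu]_y (- (f y * 'D_v u y))%:E)%E; last first.
    transitivity (\int[mu]_y \sum_(a <- index_enum 'I_n) ((v 0 a)%:E * (ddir f (bvec R a) y * u y)%:E))%E.
      by apply: eq_integral => y _; rewrite -sumEFin; apply: eq_bigr => a _; rewrite EFinM.
    rewrite integral_sum//.
    transitivity (\sum_(a <- index_enum 'I_n) \int[mu]_y ((v 0 a)%:E * (- (f y * 'D_(bvec R a) u y))%:E))%E.
      apply: eq_bigr => a _; rewrite !integralZl//; [by rewrite ibp|exact: i2|exact: iw].
    rewrite -integral_sum//; apply: eq_integral => y _.
    rewrite deriveE_pd; last exact: ck_differentiable cu _.
    under eq_bigr do rewrite -EFinM; rewrite sumEFin; congr EFin.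
    by rewrite mulr_sumr -sumrN; apply: eq_bigr => a _; rewrite mulrN mulrCA.
  by rewrite subee//; exact: (integrable_fin_num measurableT (i2 v)).
have := ae_foralln (fun m => hm m); apply: filterS => y H.
have [m ym] : exists m : nat, (cube 0 m.+1%:R : set V) y.
  exists (Num.bound `|y|) => a; rewrite !mxE sub0r add0r -ltr_norml.
  apply: le_lt_trans (rV_coord_le _ _) _; apply: lt_le_trans (archi_boundP _) _ => //.
  by rewrite ler_nat.
by have := H m ym; rewrite /= /h => -[/eqP]; rewrite subr_eq0 => /eqP.
Qed.

(** Rounding down on the grid of mesh [1 / m.+1], shifted by 1 so that natural numbers index it.
    Finitely many rational directions thus come within the mesh of every direction of sup norm 1. *)
Lemma rat_approx m (p : R) : `|p| <= 1 ->
  `|p - ratr ((inord (Num.truncn (m.+1%:R * (p + 1))) : 'I_(m.+1 + m.+1).+1)%:R / m.+1%:R - 1)| <= m.+1%:R^-1.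
Proof.
rewrite ler_norml => /andP[p1 p2]; rewrite rmorphB fmorph_div !rmorph_nat rmorph1.
have M0 : 0 < m.+1%:R :> R by rewrite ltr0n.
have p0 : 0 <= p + 1 by lra.
have x0 : 0 <= m.+1%:R * (p + 1) by exact: mulr_ge0 (ltW M0) p0.
have /andP[x1 x2] := truncn_itv x0.
rewrite inordK; last first.
  rewrite ltnS -(ler_nat R); apply: le_trans x1 _; rewrite natrD; move: (m.+1%:R) M0 => M M0; nra.
move: x1 x2; rewrite -[X in _ -> _ < X -> _]natr1; move: (Num.truncn _)%:R => k; move: (m.+1%:R) M0 => M M0 x1 x2.
have M1 : 0 <= M^-1 by rewrite invr_ge0 ltW.
have -> : p - (k / M - 1) = (M * (p + 1) - k) / M by field; rewrite gt_eqF.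
rewrite normrM [X in _ * X]ger0_norm// ler_piMl//.
rewrite ler_norml; lra.
Qed.

(** Off a null set, the derivatives in all rational directions exist and are values of one linear
    form. The Lipschitz bound extends the approximation from a finite net of such directions to all
    directions uniformly. *)
Lemma rademacher K f : 0 <= K -> lipV K f -> {ae mu, forall y : V, differentiable f y}.
Proof.
move=> K0 fK; pose dq k := if unpickle k is Some q then rdir q else 0.
have A1 : {ae mu, forall y : V, forall k, good f (dq k) y /\ ddir f (dq k) y = linform (fun a => ddir f (bvec R a) y) (dq k)}.
  apply: ae_foralln => k; apply: filterI; last exact: ae_linear K0 fK.
  exists (~` good f (dq k)); split; [apply: measurableC; exact: measurable_good fK|exact: ae_good K0 fK|].
  by move=> y /=.
move: A1; apply: filterS; first exact: (ae_filter_ringOfSetsType mu).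
move=> y H; set c := (fun a => ddir f (bvec R a) y).
pose l : {linear V -> R^o} := linform c.
have Hq (q : 'rV[rat]_n) : derivable f y (rdir q) /\ 'D_(rdir q) f y = linform c (rdir q).
  have := H (pickle q); rewrite /dq pickleK => -[gq e]; split; first exact: gq.
  have E : ddir f (rdir q) y = 'D_(rdir q) f y.
    by rewrite /ddir /patch (mem_set gq).
  by rewrite -E e.
have cK a : `|c a| <= K.
  apply: le_trans (ddir_bound _ _ fK) _; rewrite ler_piMr//; apply/rV_normP => // b.
  by rewrite /bvec mxE eqxx/=; case: eqP; rewrite ?normr1 ?normr0.
have lK (w : V) : `|linform c w| <= n%:R * K * `|w|.
  apply: le_trans (ler_norm_sum _ _ _) _.
  apply: (@le_trans _ _ (\sum_(a < n) K * `|w|)); last by rewrite sumr_const card_ord -[leLHS]mulr_natl mulrA.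
  by apply: ler_sum => a _; rewrite normrM mulrC ler_pM// rV_coord_le.
have cl : continuous l.
  apply: (@lipV_continuous (n%:R * K) l) => x z; rewrite -(linearB l); exact: lK.
apply: (eps_differentiable cl _).1 => e e0.
have C0 : 0 < K + n%:R * K + 1 by rewrite ltr_wpDl// addr_ge0// mulr_ge0.
(* An error in the direction costs a factor [K] in [f] and [n * K] in the linear form; the added 1
   keeps the denominator positive. *)
have [m me] : exists m : nat, m.+1%:R^-1 < e / 2 / (K + n%:R * K + 1).
  have p0 : 0 < e / 2 / (K + n%:R * K + 1) by rewrite !divr_gt0.
  by near \oo => m; exists m; near: m; exact: (near_infty_natSinv_lt (PosNum p0)).
pose q (s : {ffun 'I_n -> 'I_(m.+1 + m.+1).+1}) : 'rV[rat]_n := \row_a ((s a)%:R / m.+1%:R - 1).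
have N : \forall t \near (0 : R)^', forall s, `|dquot f (rdir (q s)) t y - linform c (rdir (q s))| < e / 2.
  apply: (@filter_forall R _ (fun s t => `|dquot f (rdir (q s)) t y - linform c (rdir (q s))| < e / 2) (0 : R)^') => s.
  have [ds <-] := Hq (q s); have C : h^-1 *: ((f \o shift y) (h *: rdir (q s)) - f y) @[h --> 0^'] --> 'D_(rdir (q s)) f y by exact: ds.
  have e20 : 0 < e / 2 by rewrite divr_gt0.
  have /cvgrPdist_lt/(_ _ e20) := C; apply: filterS => t; by rewrite dquotE distrC.
have [r /= r0 rP] := N.
apply/nbhs_rV; exists r => // h; rewrite sub0r normrN => hr.
have [->|h0] := eqVneq h 0; first by rewrite add0r subrr linear0 subrr !normr0 mulr0.
have t0 : 0 < `|h| by rewrite normr_gt0.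
set t := `|h| in hr t0 *; pose w := t^-1 *: h.
have hw : h = t *: w by rewrite scalerA mulfV ?scale1r// gt_eqF.
have w1 a : `|w 0 a| <= 1.
  have t1 : 0 <= t^-1 by rewrite invr_ge0 (ltW t0).
  rewrite mxE normrM (ger0_norm t1).
  by apply: le_trans (ler_wpM2l t1 (rV_coord_le h a)) _; rewrite (mulVf (lt0r_neq0 t0)).
have mp : 0 < (m.+1%:R : R) by [].
pose s : {ffun 'I_n -> 'I_(m.+1 + m.+1).+1} := [ffun a => inord (Num.truncn (m.+1%:R * (w 0 a + 1)))].
have wq : `|w - rdir (q s)| <= m.+1%:R^-1.
  have e1 a : (w - rdir (q s)) 0 a = w 0 a - ratr ((s a)%:R / m.+1%:R - 1).
    by rewrite mxE; congr (_ + _); rewrite mxE; congr (- _); rewrite mxE mxE.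
  apply/rV_normP => // a; rewrite e1; move: (w1 a); rewrite /s ffunE; move: (w 0 a) => p wp.
  exact: rat_approx wp.
have Nt := rP t _ _ s.
have {}Nt : `|dquot f (rdir (q s)) t y - linform c (rdir (q s))| < e / 2.
  by apply: Nt; rewrite ?gt_eqF//= /ball_/= sub0r normrN gtr0_norm.
set Q := rdir (q s) in wq Nt.
(* Three errors: replacing the direction [w] by its rational neighbour [Q] in [f], the difference
   quotient along [Q], and the same replacement in the linear form. *)
have -> : f (h + y) - f y - l h = (f (y + t *: w) - f (y + t *: Q)) + t * (dquot f Q t y - linform c Q)
     - t * linform c (w - Q).
  have lB : linform c (w - Q) = linform c w - linform c Q by exact: (linearB l).
  have lZ : l h = t * linform c w by rewrite [in l h]hw; exact: (linearZ_LR l).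
  rewrite lB lZ /dquot {1}hw [t *: w + y]addrC.
  move: (linform c w) (linform c Q) (f _) (f _) (f _) => p1 p2 p3 p4 p5.
  by move: (lt0r_neq0 t0) => t1; field.
apply: le_trans (ler_normB _ _) _; apply: le_trans (lerD (ler_normD _ _) (lexx _)) _.
have h1 : `|f (y + t *: w) - f (y + t *: Q)| <= K * (t * m.+1%:R^-1).
  apply: le_trans (fK _ _) _; rewrite opprD addrACA subrr add0r -scalerBr normrZ gtr0_norm//.
  by rewrite ler_wpM2l// ler_pM2l.
have h2 : `|t * (dquot f Q t y - linform c Q)| <= t * (e / 2).
  by rewrite normrM gtr0_norm// ler_pM2l// ltW.
have h3 : `|t * linform c (w - Q)| <= t * (n%:R * K * m.+1%:R^-1).
  rewrite normrM gtr0_norm// ler_pM2l//; apply: le_trans (lK _) _.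
  by rewrite ler_wpM2l// mulr_ge0.
have h4 : (K + n%:R * K + 1) * m.+1%:R^-1 <= e / 2 by rewrite mulrC -ler_pdivlMr// ltW.
have h5 : 0 <= (m.+1%:R : R)^-1 by rewrite invr_ge0.
apply: le_trans (lerD (lerD h1 h2) h3) _.
move: h4 h5 t0; move: (n%:R * K) (_^-1) (t) => p1 p2 p3 h4 h5 h6.
have : p3 * ((K + p1 + 1) * p2) <= p3 * (e / 2) by rewrite ler_pM2l.
have : 0 <= p3 * p2 by rewrite mulr_ge0// ltW.
rewrite !mulrDl !mulrDr mul1r !(mulrCA p3); move: (K * (p3 * p2)) (p1 * (p3 * p2)) (p3 * p2) (p3 * (e / 2)) (p3 * e) (mulrCA p3 e 2^-1)=> a1 a2 a3 a4 a5; lra.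
Unshelve. all: by end_near.
Qed.

End Rademacher.

Opaque ck.

Section MatrixRegularity.
Variables (R : realType) (n : nat) (A : set 'rV[R]_n) (k : nat).
Hypothesis oA : open A.
Local Notation V := 'rV[R]_n.

Lemma ck_det m (G : V -> 'M[R]_m) : (forall a b, ck k A (fun y => G y a b)) ->
  ck k A (fun y => \det (G y)).
Proof.
move=> cG; apply: ck_sum => // s _; apply: ckM => //; first exact: ck_cst.
by apply: ck_prod.
Qed.

Lemma ck_invmx (G : V -> 'M[R]_n) : (forall y, A y -> G y \in unitmx) ->
  (forall a b, ck k A (fun y => G y a b)) ->
  forall a b, ck k A (fun y => invmx (G y) a b).
Proof.
move=> uG cG a b; apply: (@ck_ext _ _ _ _ (fun y => (\det (G y))^-1 * ((-1) ^+ (b + a) * \det (row' b (col' a (G y)))))) => //.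
  by move=> y /uG Gy; rewrite /invmx Gy !mxE.
apply: ckM => //.
  by apply: ckV => //; [move=> y /uG; rewrite unitmxE unitfE|exact: ck_det].
apply: ckM => //; first exact: ck_cst.
by apply: ck_det => c d; under eq_fun do rewrite !mxE; exact: cG.
Qed.

End MatrixRegularity.

Lemma rV_cancel4 (R : realType) n (p1 s1 p2 s2 : 'rV[R]_n) : p1 + s1 - (p2 + s2) - (p1 - p2) = s1 - s2.
Proof. by apply/rowP => c; rewrite !mxE; ring. Qed.

Lemma rV_cancel (R : realType) n (q1 q2 q3 q4 q5 q6 q7 : 'rV[R]_n) :
  q1 + q2 + q4 + (q3 + q6) - (q1 + q3 + q5 + (q2 + q7)) = q4 - q5 + q6 - q7.
Proof. by apply/rowP => c; rewrite !mxE; ring. Qed.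

(** * Levi-Civita calculus in a chart *)

Section ChartCalculus.
Variables (R : realType) (n : nat).
Local Notation V := 'rV[R]_n.
Variables (A : set V) (G : V -> 'M[R]_n).
Hypothesis oA : open A.
Hypothesis symG : forall y, A y -> (G y)^T = G y.
Hypothesis unitG : forall y, A y -> G y \in unitmx.

Definition pdv (a : 'I_n) (w : V -> V) (y : V) : V := \row_c pd a (fun z => w z 0 c) y.
Definition pdm (a : 'I_n) (M : V -> 'M[R]_n) (y : V) : 'M[R]_n := \matrix_(b, c) pd a (fun z => M z b c) y.
Definition gvec (u : V -> R) (y : V) : V := (\row_a pd a u y) *m invmx (G y).
(** The scalar product of the gradients of [u] and [v], written as the derivative of [v] along the
    gradient of [u]. Iterating it recovers the Hessian ([hmat_gam]). *)
Definition gam (u v : V -> R) (y : V) : R := \sum_a gvec u y 0 a * pd a v y.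
(** The connection form in the direction [a], acting on row vectors from the right. *)
Definition conn (a : 'I_n) (y : V) : 'M[R]_n := \matrix_(b, c) christoffel G y c a b.
Definition cov (a : 'I_n) (w : V -> V) (y : V) : V := pdv a w y + w y *m conn a y.
Definition hmat (u : V -> R) (y : V) : 'M[R]_n :=
  \matrix_(a, b) (pd a (pd b u) y - \sum_c christoffel G y c a b * pd c u y).
Definition diff_field (w : V -> V) (y : V) := forall c, differentiable (fun z => w z 0 c) y.

Lemma invmx_sym y : A y -> (invmx (G y))^T = invmx (G y).
Proof. by move=> Ay; rewrite trmx_inv symG. Qed.

Lemma nablaE v w y : nabla G v w y = \sum_a v y 0 a *: cov a w y.
Proof.
apply/rowP => c; rewrite /nabla mxE summxE -big_split/=; apply: eq_bigr => a _.
rewrite !mxE mulrDr; congr (_ + _); rewrite mulr_sumr; apply: eq_bigr => b _.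
by rewrite mxE; ring.
Qed.

Lemma pd_symG a b c y : A y -> pd a (fun z => G z b c) y = pd a (fun z => G z c b) y.
Proof.
move=> Ay; apply: near_eq_pd; have : \near y, A y by exact: open_nbhs_nbhs.
by apply: filterS => z /symG Gz; rewrite -[in LHS]Gz mxE.
Qed.

Lemma conn_sym a b c y : A y -> conn a y b c = conn b y a c.
Proof.
move=> Ay; rewrite !mxE /christoffel; congr (_ * _); apply: eq_bigr => l _; congr (_ * _).
rewrite (pd_symG l a b Ay); congr (_ - _); exact: addrC.
Qed.

Lemma conn_compat a y : A y -> pdm a G y = conn a y *m G y + G y *m (conn a y)^T.
Proof.
move=> Ay.
(* These are the Christoffel symbols of the first kind; lowering the index of [conn] with [G]
   cancels the inverse Gram matrix in [christoffel]. *)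
pose L (a b c : 'I_n) : R := 2^-1 * (pd a (fun z => G z b c) y + pd b (fun z => G z a c) y
     - pd c (fun z => G z a b) y).
have LE b c : (conn a y *m G y) b c = L a b c.
  rewrite mxE; under eq_bigr do rewrite mxE /christoffel -mulrA mulr_suml.
  rewrite -mulr_sumr /L; congr (_ * _); rewrite exchange_big/=.
  pose r : V := \row_l (pd a (fun z => G z b l) y + pd b (fun z => G z a l) y - pd l (fun z => G z a b) y).
  transitivity ((r *m (invmx (G y) *m G y)) 0 c); last by rewrite mulVmx ?unitG// mulmx1 mxE.
  rewrite mulmxA mxE; under [RHS]eq_bigr do rewrite mxE mulr_suml.
  rewrite exchange_big/=; apply: eq_bigr => l _; apply: eq_bigr => d _; rewrite [r 0 d]mxE.
  have <- : invmx (G y) d l = invmx (G y) l d by rewrite -{1}(invmx_sym Ay) mxE.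
  ring.
have -> : G y *m (conn a y)^T = (conn a y *m G y)^T by rewrite trmx_mul symG.
apply/matrixP => b c; rewrite [RHS]mxE [X in _ + X]mxE !LE [LHS]mxE /L.
rewrite (pd_symG a c b Ay).
by field.
Qed.

Lemma pd_vdot a v w y : A y -> (forall b c, differentiable (fun z => G z b c) y) -> diff_field v y -> diff_field w y ->
  differentiable (fun z => vdot (G z) (v z) (w z)) y /\
  pd a (fun z => vdot (G z) (v z) (w z)) y =
  vdot (G y) (pdv a v y) (w y) + vdot (pdm a G y) (v y) (w y) + vdot (G y) (v y) (pdv a w y).
Proof.
move=> Ay dG dv dw; under eq_fun do rewrite vdotE.
have d1 b c : differentiable (fun z => v z 0 b * G z b c * w z 0 c) y.
  by apply: differentiableM; [exact: differentiableM|exact: dw].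
have d2 b : differentiable (fun z => \sum_c v z 0 b * G z b c * w z 0 c) y.
  by have [] := @pd_sum R n _ (index_enum 'I_n) xpredT (fun c z => v z 0 b * G z b c * w z 0 c) y a (fun c _ => d1 b c).
have [d3 ->] := @pd_sum R n _ (index_enum 'I_n) xpredT (fun b z => \sum_c v z 0 b * G z b c * w z 0 c) y a (fun c _ => d2 c).
split=> //; rewrite !vdotE -!big_split/=; apply: eq_bigr => b _.
have [_ ->] := @pd_sum R n _ (index_enum 'I_n) xpredT (fun c z => v z 0 b * G z b c * w z 0 c) y a (fun c _ => d1 b c).
rewrite -!big_split/=; apply: eq_bigr => c _.
rewrite (@pdM _ _ (fun z => v z 0 b * G z b c) (fun z => w z 0 c))//; last by apply: differentiableM.
rewrite (@pdM _ _ (fun z => v z 0 b) (fun z => G z b c))// !mxE; ring.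
Qed.

Lemma sum_bvec (F : 'I_n -> R) (b : 'I_n) : \sum_c F c * (bvec R b) 0 c = F b.
Proof.
rewrite (bigD1 b)//= /bvec mxE !eqxx mulr1 big1 ?addr0// => c cb.
by rewrite mxE (negbTE cb) andbF mulr0.
Qed.

Lemma sum_bvec_scale (W : lmodType R) (F : 'I_n -> W) (b : 'I_n) : \sum_c (bvec R b) 0 c *: F c = F b.
Proof.
rewrite (bigD1 b)//= /bvec mxE !eqxx scale1r big1 ?addr0// => c cb.
by rewrite mxE (negbTE cb) andbF scale0r.
Qed.

Lemma vdotBl (M : 'M[R]_n) (u v w : V) : vdot M (u - v) w = vdot M u w - vdot M v w.
Proof. by rewrite /vdot !mulmxBl !mxE. Qed.

Lemma vdotDl (M : 'M[R]_n) (u v w : V) : vdot M (u + v) w = vdot M u w + vdot M v w.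
Proof. by rewrite /vdot !mulmxDl mxE. Qed.

Lemma vdotDr (M : 'M[R]_n) (u v w : V) : vdot M w (u + v) = vdot M w u + vdot M w v.
Proof. by rewrite /vdot linearD/= mulmxDr mxE. Qed.

Lemma vdotZl (M : 'M[R]_n) (c : R) (u w : V) : vdot M (c *: u) w = c * vdot M u w.
Proof. by rewrite /vdot -!scalemxAl mxE. Qed.

Lemma vdotC (M : 'M[R]_n) (u v : V) : M^T = M -> vdot M u v = vdot M v u.
Proof.
move=> MT; rewrite /vdot -[in LHS](trmxK (u *m M *m v^T)) mxE !trmx_mul trmxK MT.
by rewrite mulmxA.
Qed.

Lemma vdot_suml (M : 'M[R]_n) (I : finType) (F : I -> V) (w : V) :
  vdot M (\sum_i F i) w = \sum_i vdot M (F i) w.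
Proof. by rewrite /vdot mulmx_suml mulmx_suml summxE. Qed.

Lemma pd_vdot_cov a v w y : A y -> (forall b c, differentiable (fun z => G z b c) y) -> diff_field v y -> diff_field w y ->
  pd a (fun z => vdot (G z) (v z) (w z)) y = vdot (G y) (cov a v y) (w y) + vdot (G y) (v y) (cov a w y).
Proof.
move=> Ay dG dv dw; have [_ ->] := pd_vdot a Ay dG dv dw.
rewrite conn_compat// /cov vdotDl vdotDr.
have -> : vdot (conn a y *m G y + G y *m (conn a y)^T) (v y) (w y) =
    vdot (G y) (v y *m conn a y) (w y) + vdot (G y) (v y) (w y *m conn a y).
  rewrite {1}/vdot mulmxDr mulmxDl mxE; congr (_ + _); rewrite /vdot ?trmx_mul !mulmxA//.
by rewrite -!addrA; congr (_ + (_ + _)); exact: addrC.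
Qed.

Hypothesis cG : forall k a b, ck k A (fun y => G y a b).

Lemma ck_invG k a b : ck k A (fun y => invmx (G y) a b).
Proof. by apply: ck_invmx. Qed.

Lemma ck_gvec k u c : ck k.+1 A u -> ck k A (fun y => gvec u y 0 c).
Proof.
move=> cu; under eq_fun do rewrite mxE; apply: ck_sum => // a _; apply: ckM => //.
  by under eq_fun do rewrite mxE; exact: ck_pd.
exact: ck_invG.
Qed.

Lemma ck_gam k u v : ck k.+1 A u -> ck k.+1 A v -> ck k A (gam u v).
Proof.
move=> cu cv; apply: ck_sum => // a _; apply: ckM => //; first exact: ck_gvec.
exact: ck_pd.
Qed.

Lemma ck_christoffel k c a b : ck k A (fun y => christoffel G y c a b).
Proof.
apply: ckM => //; first exact: ck_cst.
apply: ck_sum => // l _; apply: ckM => //; first exact: ck_invG.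
by apply: ckB => //; [apply: ckD => //|]; apply: ck_pd; exact: cG.
Qed.

Lemma ck_hmat k u a b : ck k.+2 A u -> ck k A (fun y => hmat u y a b).
Proof.
move=> cu; under eq_fun do rewrite mxE; apply: ckB => //; first by do 2 apply: ck_pd.
apply: ck_sum => // c _; apply: ckM => //; first exact: ck_christoffel.
by apply: ck_pd; exact: ckW.
Qed.

Lemma diffG y : A y -> forall b c, differentiable (fun z => G z b c) y.
Proof. by move=> Ay b c; apply: ck_differentiable (cG 1 b c) Ay. Qed.

Lemma diff_gvec u y : ck 2 A u -> A y -> diff_field (gvec u) y.
Proof. by move=> cu Ay c; apply: ck_differentiable (ck_gvec c cu) Ay. Qed.

Lemma gvec_dot u y (w : V) : A y -> vdot (G y) (gvec u y) w = \sum_a pd a u y * w 0 a.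
Proof.
move=> Ay; rewrite /vdot /gvec mulmxKV ?unitG// mxE.
by apply: eq_bigr => a _; rewrite !mxE.
Qed.

Lemma gamE u v y : A y -> gam u v y = vdot (G y) (gvec v y) (gvec u y).
Proof. by move=> Ay; rewrite gvec_dot//; apply: eq_bigr => a _; rewrite mulrC. Qed.

Lemma gamC u v y : A y -> gam u v y = gam v u y.
Proof. by move=> Ay; rewrite (gamE u v Ay) (gamE v u Ay) (vdotC _ _ (symG Ay)). Qed.

Lemma cov_bvec a b y : cov a (fun=> bvec R b) y = row b (conn a y).
Proof.
rewrite /cov /bvec -rowE (_ : pdv _ _ _ = 0) ?add0r//.
by apply/rowP => c; rewrite !mxE pd_cst.
Qed.

(** The pairing of the gradient with a constant field is [pd b u]. Differentiating it by metric
    compatibility, the covariant derivative of the constant field yields the Christoffel correction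
    of the Hessian. *)
Lemma cov_gvec a u y : ck 2 A u -> A y -> cov a (gvec u) y *m G y = row a (hmat u y).
Proof.
move=> cu Ay; apply/rowP => b; rewrite [RHS]mxE [RHS]mxE.
have dbv : diff_field (fun=> bvec R b) y by move=> c; exact: differentiable_cst.
have := pd_vdot_cov a Ay (diffG Ay) (diff_gvec cu Ay) dbv.
rewrite (_ : pd a _ y = pd a (pd b u) y); last first.
  apply: near_eq_pd; have : \near y, A y by exact: open_nbhs_nbhs.
  by apply: filterS => z Az; rewrite gvec_dot// sum_bvec.
move=> ->; rewrite cov_bvec gvec_dot//.
rewrite (_ : \sum_c pd c u y * _ = \sum_c christoffel G y c a b * pd c u y); last first.
  by apply: eq_bigr => c _; rewrite !mxE mulrC.
rewrite addrK /vdot [RHS]mxE; under [RHS]eq_bigr do rewrite [X in _ * X]mxE.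
by rewrite sum_bvec.
Qed.

Lemma nabla_gvec v u y : ck 2 A u -> A y -> nabla G v (gvec u) y *m G y = v y *m hmat u y.
Proof.
move=> cu Ay; rewrite nablaE mulmx_suml mulmx_sum_row; apply: eq_bigr => a _.
by rewrite -scalemxAl cov_gvec.
Qed.

Lemma hmat_sym u y : ck 2 A u -> A y -> (hmat u y)^T = hmat u y.
Proof.
move=> cu Ay; apply/matrixP => a b; rewrite !mxE (schwarz _ _ oA cu Ay); congr (_ - _).
apply: eq_bigr => c _; congr (_ * _).
by have := conn_sym a b c Ay; rewrite !mxE => ->.
Qed.

Lemma vdot_nabla v u w y : ck 2 A u -> A y -> vdot (G y) (nabla G v (gvec u) y) w = vdot (hmat u y) (v y) w.
Proof. by move=> cu Ay; rewrite /vdot nabla_gvec. Qed.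

Lemma gam_vdot u v w y : ck 1 A u -> A y -> diff_field v y -> diff_field w y ->
  gam u (fun z => vdot (G z) (v z) (w z)) y =
  vdot (G y) (nabla G (gvec u) v y) (w y) + vdot (G y) (v y) (nabla G (gvec u) w y).
Proof.
move=> cu Ay dv dw; rewrite /gam !nablaE vdot_suml vdotC ?symG// vdot_suml -big_split/=.
apply: eq_bigr => a _; rewrite pd_vdot_cov//; last exact: diffG.
by rewrite !vdotZl [vdot _ (cov a w y) _]vdotC ?symG// mulrDr.
Qed.

Lemma gam_near u v v' y : (\near y, v y = v' y) -> gam u v y = gam u v' y.
Proof. by move=> vv; apply: eq_bigr => a _; rewrite (near_eq_pd a vv). Qed.

Lemma gam_gam u f h y : ck 1 A u -> ck 2 A f -> ck 2 A h -> A y ->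
  gam u (gam f h) y = vdot (hmat f y) (gvec u y) (gvec h y) + vdot (hmat h y) (gvec u y) (gvec f y).
Proof.
move=> cu cf ch Ay; rewrite (@gam_near _ _ (fun z => vdot (G z) (gvec h z) (gvec f z))); last first.
  have : \near y, A y by exact: open_nbhs_nbhs.
  by apply: filterS => z Az; rewrite gamE.
rewrite (gam_vdot cu Ay (diff_gvec ch Ay) (diff_gvec cf Ay)) addrC.
have add_eq (p q p' q' : R) : p = p' -> q = q' -> p + q = p' + q' by move=> -> ->.
by apply: add_eq; [rewrite (vdotC _ _ (symG Ay)); exact: vdot_nabla|exact: vdot_nabla].
Qed.

(** The classical counterpart of the identity that characterises [is_hess]. Expanding by [gam_gam],
    the Hessians of [g] and [h] cancel by symmetry and that of [f] appears twice. *)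
Lemma hmat_gam f g h y : ck 2 A f -> ck 2 A g -> ck 2 A h -> A y ->
  2 * vdot (hmat f y) (gvec g y) (gvec h y) =
  gam g (gam f h) y + gam h (gam f g) y - gam f (gam g h) y.
Proof.
move=> cf cg ch Ay.
rewrite (gam_gam (ckW cg) cf ch Ay) (gam_gam (ckW ch) cf cg Ay) (gam_gam (ckW cf) cg ch Ay).
rewrite (vdotC (gvec h y) (gvec g y) (hmat_sym cf Ay)) (vdotC (gvec h y) (gvec f y) (hmat_sym cg Ay)).
rewrite (vdotC (gvec g y) (gvec f y) (hmat_sym ch Ay)).
move: (vdot (hmat f y) _ _) (vdot (hmat g y) _ _) (vdot (hmat h y) _ _) => p q r; ring.
Qed.

Definition bracket u v y : V := (gvec u y *m hmat v y - gvec v y *m hmat u y) *m invmx (G y).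

(** Torsion-freeness, which comes from the symmetry of the Christoffel symbols ([conn_sym]). *)
Lemma lie_bracketE v w y : A y -> diff_field v y -> diff_field w y -> lie_bracket v w y = nabla G v w y - nabla G w v y.
Proof.
move=> Ay dv dw; apply/rowP => c; rewrite !nablaE !mxE !summxE.
rewrite (eq_bigr (fun a => v y 0 a * pd a (fun z => w z 0 c) y + - (w y 0 a * pd a (fun z => v z 0 c) y)))//.
rewrite big_split/= sumrN.
under [X in _ = X - _]eq_bigr do rewrite !mxE mulrDr.
under [X in _ = _ - X]eq_bigr do rewrite !mxE mulrDr.
rewrite !big_split/= opprD addrACA -[LHS]addr0; congr (_ + _); apply/esym/eqP; rewrite subr_eq0; apply/eqP.
under eq_bigr do rewrite mulr_sumr; rewrite exchange_big/=; apply: eq_bigr => a _.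
rewrite mulr_sumr; apply: eq_bigr => b _; rewrite (conn_sym b a c Ay); ring.
Qed.

Lemma bracketE u v y : ck 2 A u -> ck 2 A v -> A y -> bracket u v y = lie_bracket (gvec u) (gvec v) y.
Proof.
move=> cu cv Ay; rewrite lie_bracketE//; [|exact: diff_gvec..].
by rewrite /bracket -!nabla_gvec// -mulmxBl mulmxK// unitG.
Qed.

Lemma ck_nabla k (v w : V -> V) : (forall c, ck k A (fun y => v y 0 c)) -> (forall c, ck k.+1 A (fun y => w y 0 c)) ->
  forall c, ck k A (fun y => nabla G v w y 0 c).
Proof.
move=> cv cw c; under eq_fun do rewrite mxE; apply: ckD => //; apply: ck_sum => // a _.
  by apply: ckM => //; exact: (ck_pd a (cw c)).
apply: ck_sum => // b _; apply: ckM => //; last exact: ckW.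
by apply: ckM => //; exact: ck_christoffel.
Qed.

Lemma diff_nabla v u y : ck 2 A v -> ck 3 A u -> A y -> diff_field (nabla G (gvec v) (gvec u)) y.
Proof.
move=> cv cu Ay c; apply: (ck_differentiable (k := 0)) Ay; apply: ck_nabla => d; exact: ck_gvec.
Qed.

(** By [gam_vdot], the derivative along grad [g] of the pairing of nabla_(grad h) grad f3 with grad
    f4 is a second covariant derivative plus [P h g], and the latter is subtracted. The bracket term
    supplies the third term of [curv_op]. *)
Lemma curvature_identity f1 f2 f3 f4 y :
  ck 3 A f1 -> ck 3 A f2 -> ck 3 A f3 -> ck 3 A f4 -> A y ->
  let Phi g h z := vdot (hmat f3 z) (gvec g z) (gvec h z) in
  let P g h := vdot (invmx (G y)) (gvec g y *m hmat f3 y) (gvec h y *m hmat f4 y) in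
  (gam f1 (Phi f2 f4) y - P f2 f1) - (gam f2 (Phi f1 f4) y - P f1 f2)
    - vdot (hmat f3 y) (bracket f1 f2 y) (gvec f4 y)
  = vdot (G y) (curv_op G (gvec f1) (gvec f2) (gvec f3) y) (gvec f4 y).
Proof.
move=> c1 c2 c3 c4 Ay Phi P.
have PE g h : P g h = vdot (G y) (nabla G (gvec g) (gvec f3) y) (nabla G (gvec h) (gvec f4) y).
  rewrite /P -(nabla_gvec _ (ckW c3) Ay) -(nabla_gvec _ (ckW c4) Ay).
  by rewrite /vdot mulmxK ?unitG// trmx_mul symG// mulmxA.
have half g h : ck 3 A g -> ck 3 A h -> gam g (Phi h f4) y - P h g =
    vdot (G y) (nabla G (gvec g) (nabla G (gvec h) (gvec f3)) y) (gvec f4 y).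
  move=> cg ch; rewrite (@gam_near _ _ (fun z => vdot (G z) (nabla G (gvec h) (gvec f3) z) (gvec f4 z))); last first.
    have : \near y, A y by exact: open_nbhs_nbhs.
    by apply: filterS => z Az; rewrite (vdot_nabla _ _ (ckW c3) Az).
  rewrite (gam_vdot (ckW (ckW cg)) Ay (diff_nabla (ckW ch) c3 Ay) (diff_gvec (ckW c4) Ay)).
  by rewrite PE addrK.
have sub_eq (a b c a' b' c' : R) : a = a' -> b = b' -> c = c' -> a - b - c = a' - b' - c'.
  by move=> -> -> ->.
have third := etrans (congr1 (fun b => vdot (hmat f3 y) b (gvec f4 y)) (bracketE (ckW c1) (ckW c2) Ay))
  (esym (vdot_nabla (lie_bracket (gvec f1) (gvec f2)) (gvec f4 y) (ckW c3) Ay)).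
apply: etrans (sub_eq _ _ _ _ _ _ (half f1 f2 c1 c2) (half f2 f1 c2 c1) third) _.
by rewrite /curv_op !vdotBl.
Qed.

(* Curvature is tensorial: second derivatives of z cancel by Schwarz' lemma. *)
Definition curv_mx (a b : 'I_n) (y : V) : 'M[R]_n :=
  pdm a (conn b) y - pdm b (conn a) y + conn b y *m conn a y - conn a y *m conn b y.

Lemma pdvE a (w : V -> V) c : (fun t => pdv a w t 0 c) = pd a (fun t => w t 0 c).
Proof. by apply/funext => t; rewrite mxE. Qed.

Lemma pdv_mul a (w : V -> V) (M : V -> 'M[R]_n) y : diff_field w y ->
  (forall b c, differentiable (fun z => M z b c) y) ->
  pdv a (fun z => w z *m M z) y = pdv a w y *m M y + w y *m pdm a M y.
Proof.
move=> dw dM; apply/rowP => c; rewrite !mxE.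
under eq_fun do rewrite mxE.
have d1 b : differentiable (fun z => w z 0 b * M z b c) y by exact: differentiableM.
have [_ ->] := @pd_sum R n _ (index_enum 'I_n) xpredT (fun b z => w z 0 b * M z b c) y a (fun b _ => d1 b).
rewrite -big_split/=; apply: eq_bigr => b _.
by rewrite (@pdM _ _ (fun z => w z 0 b) (fun z => M z b c))// !mxE addrC [in RHS]mulrC; congr (_ + _); exact: mulrC.
Qed.

Lemma pdvD a (v w : V -> V) y : diff_field v y -> diff_field w y ->
  pdv a (fun z => v z + w z) y = pdv a v y + pdv a w y.
Proof.
move=> dv dw; apply/rowP => c; rewrite !mxE.
under eq_fun do rewrite mxE.
by rewrite (@pdD _ _ (fun z => v z 0 c) (fun z => w z 0 c)).
Qed.

Lemma cov_cov a b (z : V -> V) y : (forall c, ck 2 A (fun y => z y 0 c)) -> A y ->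
  cov a (cov b z) y - cov b (cov a z) y = z y *m curv_mx a b y.
Proof.
move=> cz Ay.
have dz : diff_field z y by move=> c; apply: ck_differentiable (cz c) Ay.
have dpz e : diff_field (pdv e z) y.
  move=> c; under eq_fun do rewrite mxE; apply: ck_differentiable Ay; exact: ck_pd (cz c).
have dconn e b' c : differentiable (fun y => conn e y b' c) y.
  under eq_fun do rewrite mxE; apply: (ck_differentiable (k := 0)) Ay; exact: ck_christoffel.
have dzc e : diff_field (fun y => z y *m conn e y) y.
  move=> c; under eq_fun do rewrite mxE.
  by have [] := @pd_sum R n _ (index_enum 'I_n) xpredT (fun b z' => z z' 0 b * conn e z' b c) y a
    (fun b _ => differentiableM (dz b) (dconn e b c)).
have E e e' : cov e (cov e' z) y = pdv e (pdv e' z) y + pdv e z y *m conn e' y + z y *m pdm e (conn e') y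
    + (pdv e' z y *m conn e y + z y *m conn e' y *m conn e y).
  by rewrite {1}/cov /cov (pdvD e (dpz e') (dzc e')) (pdv_mul e dz (dconn e')) mulmxDl !addrA.
have S : pdv a (pdv b z) y = pdv b (pdv a z) y.
  apply/rowP => c; rewrite [LHS]mxE [RHS]mxE !pdvE; exact: schwarz (cz c) Ay.
rewrite !E S /curv_mx mulmxBr mulmxDr mulmxBr !mulmxA.
exact: rV_cancel.
Qed.

Lemma nabla_nabla (v w z : V -> V) y : diff_field w y -> (forall c, ck 2 A (fun y => z y 0 c)) -> A y ->
  nabla G v (nabla G w z) y = \sum_b (\sum_a v y 0 a * pd a (fun t => w t 0 b) y) *: cov b z y
    + \sum_a \sum_b (v y 0 a * w y 0 b) *: cov a (cov b z) y.
Proof.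
move=> dw cz Ay.
have dcz b : diff_field (cov b z) y.
  move=> c; under eq_fun do rewrite /cov mxE mxE mxE; apply: ck_differentiable Ay; apply: ckD => //.
    exact: ck_pd (cz c).
  apply: ck_sum => // d _; apply: ckM => //; first exact: ckW.
  under eq_fun do rewrite mxE; exact: ck_christoffel.
rewrite nablaE.
have E a : cov a (nabla G w z) y = \sum_b (pd a (fun t => w t 0 b) y *: cov b z y + w y 0 b *: cov a (cov b z) y).
  rewrite /cov nablaE mulmx_suml (_ : pdv a _ y = \sum_b (pd a (fun t => w t 0 b) y *: cov b z y + w y 0 b *: pdv a (cov b z) y)).
    by rewrite -big_split/=; apply: eq_bigr => b _; rewrite -addrA -scalemxAl -scalerDr.
  apply/rowP => c; rewrite mxE summxE.
  under eq_fun do rewrite nablaE summxE.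
  under eq_fun do under eq_bigr do rewrite mxE.
  have d1 b : differentiable (fun t => w t 0 b * cov b z t 0 c) y.
    by apply: differentiableM; [exact: dw|exact: dcz].
  have [_ ->] := @pd_sum R n _ (index_enum 'I_n) xpredT (fun b t => w t 0 b * cov b z t 0 c) y a (fun b _ => d1 b).
  apply: eq_bigr => b _.
  rewrite (@pdM _ _ _ _ _ a (dw b) (dcz b c)) [RHS]mxE [X in _ = X + _]mxE [X in _ = _ + X]mxE [X in _ = _ + _ * X]mxE.
  by rewrite addrC; congr (_ + _); exact: mulrC.
transitivity (\sum_a \sum_b ((v y 0 a * pd a (fun t => w t 0 b) y) *: cov b z y
    + (v y 0 a * w y 0 b) *: cov a (cov b z) y)).
  apply: eq_bigr => a _; rewrite E scaler_sumr; apply: eq_bigr => b _.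
  by rewrite scalerDr; congr (_ + _); exact: scalerA.
rewrite -[X in _ = X + _]/(\sum_b _) (eq_bigr (fun a => \sum_b (v y 0 a * pd a (fun t => w t 0 b) y) *: cov b z y
    + \sum_b (v y 0 a * w y 0 b) *: cov a (cov b z) y)); last by move=> a _; rewrite big_split.
rewrite big_split/=; congr (_ + _); rewrite exchange_big/=; apply: eq_bigr => b _.
by rewrite scaler_suml.
Qed.

(** The terms with derivatives of [v] and [w] are exactly those of the covariant derivative along
    the bracket; what remains is antisymmetrised and becomes [curv_mx] by [cov_cov]. *)
Lemma curv_opE (v w z : V -> V) y : diff_field v y -> diff_field w y -> (forall c, ck 2 A (fun y => z y 0 c)) -> A y ->
  curv_op G v w z y = \sum_a \sum_b (v y 0 a * w y 0 b) *: (z y *m curv_mx a b y).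
Proof.
move=> dv dw cz Ay; rewrite /curv_op (nabla_nabla v dw cz Ay) (nabla_nabla w dv cz Ay) nablaE.
have H1 : \sum_b lie_bracket v w y 0 b *: cov b z y =
    \sum_b (\sum_a v y 0 a * pd a (fun t => w t 0 b) y) *: cov b z y
    - \sum_b (\sum_a w y 0 a * pd a (fun t => v t 0 b) y) *: cov b z y.
  apply: etrans (sumrB _ _ _ _); apply: eq_bigr => b _; apply: etrans (scalerBl _ _ _).
  by apply: (congr1 (fun r => r *: cov b z y)); rewrite mxE -sumrB.
apply: etrans (congr1 (fun N => _ - N) H1) _.
have <- : \sum_a \sum_b (v y 0 a * w y 0 b) *: cov a (cov b z) y
    - \sum_a \sum_b (w y 0 a * v y 0 b) *: cov a (cov b z) y
    = \sum_a \sum_b (v y 0 a * w y 0 b) *: (z y *m curv_mx a b y).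
  rewrite [X in _ - X]exchange_big/= -sumrB; apply: eq_bigr => a _.
  rewrite -sumrB; apply: eq_bigr => b _.
  by rewrite [w y 0 b * _]mulrC -scalerBr cov_cov.
exact: rV_cancel4.
Qed.

(* The coordinate fields are constant, so that riem_tensor only involves curv_mx. *)
Lemma riem_tensorE y (s : {ffun 'I_4 -> 'I_n}) : A y ->
  riem_tensor G y s = vdot (G y) (row (s (inord 2)) (curv_mx (s (inord 0)) (s (inord 1)) y)) (bvec R (s (inord 3))).
Proof.
move=> Ay; rewrite /riem_tensor; congr (vdot _ _ _).
have dc a : diff_field (@coord_field R n a) y by move=> c; exact: differentiable_cst.
have cc a c : ck 2 A (fun y => (@coord_field R n a y) 0 c) by exact: ck_cst.
rewrite (curv_opE (dc _) (dc _) (cc _) Ay) /coord_field.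
transitivity (\sum_a (bvec R (s (inord 0))) 0 a *: \sum_b (bvec R (s (inord 1))) 0 b *: (bvec R (s (inord 2)) *m curv_mx a b y)).
  apply: eq_bigr => a _; rewrite scaler_sumr; apply: eq_bigr => b _; by rewrite scalerA.
by rewrite !sum_bvec_scale /bvec -rowE.
Qed.

End ChartCalculus.

(** * Tensors given by their coefficients *)

Section Tensors.
Variables (R : realType) (n : nat).
Local Notation V := 'rV[R]_n.

(** Building multi-indices one entry at a time turns a sum over [{ffun 'I_k -> 'I_n}] into iterated
    sums over single indices. *)
Definition fcons k (a : 'I_n) (s : {ffun 'I_k -> 'I_n}) : {ffun 'I_k.+1 -> 'I_n} :=
  [ffun j => if unlift ord0 j is Some j' then s j' else a].

Lemma fcons0 k a (s : {ffun 'I_k -> 'I_n}) : fcons a s ord0 = a.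
Proof. by rewrite ffunE unlift_none. Qed.

Lemma fconsS k a (s : {ffun 'I_k -> 'I_n}) j : fcons a s (lift ord0 j) = s j.
Proof. by rewrite ffunE liftK. Qed.

Lemma sum_ffunS k (F : {ffun 'I_k.+1 -> 'I_n} -> R) :
  \sum_s F s = \sum_a \sum_(s : {ffun 'I_k -> 'I_n}) F (fcons a s).
Proof.
rewrite pair_big/= (reindex (fun p : 'I_n * {ffun 'I_k -> 'I_n} => fcons p.1 p.2))//=.
exists (fun s => (s ord0, [ffun j => s (lift ord0 j)])) => [[a s] _|s _] /=.
  by rewrite fcons0; congr pair; apply/ffunP => j; rewrite ffunE fconsS.
apply/ffunP => j; have [j'|] := unliftP ord0 j; first by move=> ->; rewrite fconsS ffunE.
by move=> ->; rewrite fcons0.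
Qed.

Definition fnil : {ffun 'I_0 -> 'I_n} := ffun0 (card_ord 0).

Lemma sum_ffun0 (F : {ffun 'I_0 -> 'I_n} -> R) : \sum_s F s = F fnil.
Proof.
rewrite (bigD1 fnil)//= big1 ?addr0// => s /eqP[].
by apply/ffunP => -[].
Qed.

Lemma fcons_const a : fcons a fnil = [ffun=> a].
Proof. by apply/ffunP => j; rewrite (ord1 j) fcons0 ffunE. Qed.

Definition trow (T : tensor R n 1) : V := \row_a T [ffun=> a].
Definition tmat (T : tensor R n 2) : 'M[R]_n := \matrix_(a, b) T (fcons a (fcons b fnil)).

Lemma teval2 (T : tensor R n 2) (u v : V) : teval T [tuple u; v] = vdot (tmat T) u v.
Proof.
rewrite /teval sum_ffunS vdotE; apply: eq_bigr => a _; rewrite sum_ffunS; apply: eq_bigr => b _.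
rewrite sum_ffun0 !big_ord_recl big_ord0 mulr1 fcons0 fconsS fcons0 mxE /=.
by rewrite !(tnth_nth 0)/= mulrA [T _ * _]mulrC.
Qed.

Lemma teval4 (T : tensor R n 4) (u v w z : V) : teval T [tuple u; v; w; z] =
  \sum_a \sum_b \sum_c \sum_d u 0 a * v 0 b * (w 0 c * (z 0 d * T (fcons a (fcons b (fcons c (fcons d fnil)))))).
Proof.
rewrite /teval sum_ffunS; apply: eq_bigr => a _; rewrite sum_ffunS; apply: eq_bigr => b _.
rewrite sum_ffunS; apply: eq_bigr => c _; rewrite sum_ffunS; apply: eq_bigr => d _.
rewrite sum_ffun0 !big_ord_recl big_ord0 mulr1 !(fcons0, fconsS) !(tnth_nth 0)/=; ring.
Qed.

Lemma tdot1 (G : 'M[R]_n) (S T : tensor R n 1) : tdot G S T = vdot (invmx G) (trow S) (trow T).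
Proof.
rewrite /tdot sum_ffunS vdotE; apply: eq_bigr => a _; rewrite sum_ffun0 sum_ffunS; apply: eq_bigr => b _.
rewrite sum_ffun0 big_ord_recl big_ord0 mulr1 !fcons0 !fcons_const !mxE; ring.
Qed.

Lemma trow_tslot (T : tensor R n 2) (u : V) : trow (tslot T u) = u *m tmat T.
Proof.
apply/rowP => b; rewrite mxE /tslot teval2 /vdot ffunE mxE.
under eq_bigr do rewrite [X in _ * X]mxE.
exact: sum_bvec.
Qed.

(** The inverse Gram matrices in [tdot] raise the indices of the covectors, which turns the pairing
    into an evaluation; symmetry lets them act from either side. *)
Lemma tdot_tprod k (G : 'M[R]_n) (T : tensor R n k) (w : k.-tuple (tensor R n 1)) :
  (invmx G)^T = invmx G ->
  tdot G T (tprod w) = teval T [tuple sharp G (tnth w j) | j < k].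
Proof.
move=> GT; rewrite /tdot /teval; apply: eq_bigr => s _; rewrite -[RHS]/(T s * _).
under eq_bigr do rewrite -mulrA /tprod -big_split/=.
rewrite -mulr_sumr; congr (_ * _).
under [RHS]eq_bigr do rewrite tnth_mktuple mxE.
rewrite bigA_distr_bigA/=; apply: eq_bigr => t _; apply: eq_bigr => j _.
by rewrite mxE -{1}GT mxE.
Qed.

Lemma fcons4 a b c d (s := fcons a (fcons b (fcons c (fcons d fnil)))) :
  [/\ s (inord 0) = a, s (inord 1) = b, s (inord 2) = c & s (inord 3) = d].
Proof.
have i0 : inord 0 = ord0 :> 'I_4 by apply: val_inj; rewrite /= inordK.
have i1 : inord 1 = lift ord0 ord0 :> 'I_4 by apply: val_inj; rewrite /= inordK.
have i2 : inord 2 = lift ord0 (lift ord0 ord0) :> 'I_4 by apply: val_inj; rewrite /= inordK.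
have i3 : inord 3 = lift ord0 (lift ord0 (lift ord0 ord0)) :> 'I_4 by apply: val_inj; rewrite /= inordK.
by rewrite /s i0 i1 i2 i3 !(fcons0, fconsS).
Qed.

Lemma vdot_sumr (M : 'M[R]_n) (I : finType) (F : I -> V) (w : V) :
  vdot M w (\sum_i F i) = \sum_i vdot M w (F i).
Proof. by rewrite /vdot linear_sum mulmx_sumr summxE. Qed.

Lemma vdotZr (M : 'M[R]_n) (c : R) (u w : V) : vdot M u (c *: w) = c * vdot M u w.
Proof. by rewrite /vdot linearZ/= -scalemxAr mxE. Qed.

Lemma vdot_bvecr (M : 'M[R]_n) (u w : V) : vdot M u w = \sum_d w 0 d * vdot M u (bvec R d).
Proof.
by rewrite {1}[w]row_sum_delta vdot_sumr; apply: eq_bigr => d _; rewrite vdotZr.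
Qed.

Lemma curv_teval (A : set V) (G : V -> 'M[R]_n) (X1 X2 X3 : V -> V) (w y : V) : open A ->
  (forall k a b, ck k A (fun y => G y a b)) -> (forall y, A y -> (G y)^T = G y) ->
  (forall y, A y -> G y \in unitmx) ->
  diff_field X1 y -> diff_field X2 y -> (forall c, ck 2 A (fun y => X3 y 0 c)) -> A y ->
  vdot (G y) (curv_op G X1 X2 X3 y) w = teval (riem_tensor G y) [tuple X1 y; X2 y; X3 y; w].
Proof.
move=> oA cG sG uG d1 d2 c3 Ay.
have -> := curv_opE oA uG cG d1 d2 c3 Ay.
rewrite teval4 vdot_suml; apply: eq_bigr => a _; rewrite vdot_suml; apply: eq_bigr => b _.
rewrite vdotZl mulmx_sum_row vdot_suml mulr_sumr; apply: eq_bigr => c _.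
rewrite vdotZl vdot_bvecr mulr_sumr mulr_sumr; apply: eq_bigr => d _.
rewrite (riem_tensorE oA uG cG _ Ay).
by have [-> -> -> ->] := fcons4 a b c d.
Qed.

End Tensors.

Lemma mul3_vdot (R : realType) n (P M Q : 'M[R]_n) a b : (P *m M *m Q^T) a b = vdot M (row a P) (row b Q).
Proof. by rewrite /vdot -row_mul !mxE; apply: eq_bigr => c _; rewrite !mxE. Qed.

(** Expanding the standard basis in the rows of [Q], with coefficients from [invmx Q], recovers
    every coefficient of a tensor from its values on those rows. *)
Lemma teval_span (R : realType) n k (Q : 'M[R]_n) (T T' : tensor R n k) : Q \in unitmx ->
  (forall s : {ffun 'I_k -> 'I_n}, teval T [tuple row (s j) Q | j < k] = teval T' [tuple row (s j) Q | j < k]) -> T =1 T'.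
Proof.
move=> uQ H.
have E (T0 : tensor R n k) (r : {ffun 'I_k -> 'I_n}) : T0 r =
    \sum_(s : {ffun 'I_k -> 'I_n}) (\prod_(j < k) (invmx Q) (r j) (s j)) * teval T0 [tuple row (s j) Q | j < k].
  transitivity (\sum_(t : {ffun 'I_k -> 'I_n}) T0 t * \prod_(j < k) \sum_c (invmx Q) (r j) c * Q c (t j)).
    have N (t : {ffun 'I_k -> 'I_n}) : \prod_(j < k) \sum_c (invmx Q) (r j) c * Q c (t j) = \prod_(j < k) (r j == t j)%:R.
      apply: eq_bigr => j _; have := mulVmx uQ => /matrixP/(_ (r j) (t j)).
      by rewrite !mxE.
    rewrite (eq_bigr (fun t : {ffun 'I_k -> 'I_n} => T0 t * \prod_(j < k) (r j == t j)%:R)); last by move=> t _; rewrite N.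
    rewrite (bigD1 r)//= [X in _ * X]big1 ?mulr1; last by move=> j _; rewrite eqxx.
    rewrite [X in _ + X]big1 ?addr0// => t tr.
    have [j rt] : exists j, r j != t j.
      by apply/existsP; rewrite -negb_forall; apply: contra tr => /forallP rt; apply/eqP/ffunP => j; exact/esym/eqP.
    by rewrite (bigD1 j)//= (negbTE rt) mul0r mulr0.
  under eq_bigr => t _ do rewrite bigA_distr_bigA mulr_sumr.
  rewrite exchange_big; apply: eq_bigr => s _; rewrite /teval mulr_sumr; apply: eq_bigr => t _.
  rewrite big_split/= mulrCA; congr (_ * (_ * _)).
  by apply: eq_bigr => j _; rewrite tnth_mktuple mxE.
by move=> r; rewrite (E T) (E T'); apply: eq_bigr => s _; rewrite H.
Qed.

Section CurvatureForm.
Variables (R : realType) (n : nat) (G : 'rV[R]_n -> 'M[R]_n).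
Local Notation V := 'rV[R]_n.

Definition PhiF (f g h : V -> R) (z : V) : R := vdot (hmat G f z) (gvec G g z) (gvec G h z).

Definition PF (f3 f4 g h : V -> R) (z : V) : R :=
  vdot (invmx (G z)) (gvec G g z *m hmat G f3 z) (gvec G h z *m hmat G f4 z).

Definition BF (f3 f4 g h : V -> R) (z : V) : R := vdot (hmat G f3 z) (bracket G g h z) (gvec G f4 z).

(** The integrand that multiplies [f0] in the identity of [is_curvX], once the terms with the
    gradient of [f0] and the Laplacians have been integrated by parts. *)
Definition curvF (f1 f2 f3 f4 : V -> R) (z : V) : R :=
  gam G f1 (PhiF f3 f2 f4) z - PF f3 f4 f2 f1 z - (gam G f2 (PhiF f3 f1 f4) z - PF f3 f4 f1 f2 z)
  - BF f3 f4 f1 f2 z.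

End CurvatureForm.

(** * Change of chart *)

Section Naturality.
Variables (R : realType) (n : nat).
Local Notation V := 'rV[R]_n.
Variables (A B : set V) (G G' : V -> 'M[R]_n) (tau : V -> V).
Hypothesis oA : open A.
Hypothesis oB : open B.
Hypothesis tauAB : forall z, A z -> B (tau z).
Hypothesis ctau : forall k b, ck k A (fun z => tau z 0 b).
Hypothesis symG : forall y, B y -> (G y)^T = G y.
Hypothesis unitG : forall y, B y -> G y \in unitmx.
Hypothesis symG' : forall y, A y -> (G' y)^T = G' y.
Hypothesis unitG' : forall y, A y -> G' y \in unitmx.

Definition jmx (t : V -> V) (z : V) : 'M[R]_n := \matrix_(a, b) pd a (fun w => t w 0 b) z.

Hypothesis compat : forall z, A z -> G' z = jmx tau z *m G (tau z) *m (jmx tau z)^T.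

Lemma jmx_unit z : A z -> jmx tau z \in unitmx.
Proof. by move=> Az; have := unitG' Az; rewrite compat// !unitmx_mul => /andP[/andP[]]. Qed.

Lemma row_pd_comp (f : V -> R) z : A z -> differentiable f (tau z) ->
  \row_a pd a (f \o tau) z = (\row_a pd a f (tau z)) *m (jmx tau z)^T.
Proof.
move=> Az df; have dt b : differentiable (fun z => tau z 0 b) z by exact: (ck_differentiable (ctau 1 b) Az).
have [_ E] := @pd_comp R n tau f z dt df.
by apply/rowP => a; rewrite !mxE E; apply: eq_bigr => b _; rewrite !mxE mulrC.
Qed.

Lemma invmx_compat z : A z -> invmx (G' z) = invmx (jmx tau z)^T *m invmx (G (tau z)) *m invmx (jmx tau z).
Proof.
move=> Az; have uS := jmx_unit Az; have uG := unitG (tauAB Az).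
have uT : (jmx tau z)^T \in unitmx by rewrite unitmx_tr.
have e1 : G' z *m (invmx (jmx tau z)^T *m invmx (G (tau z)) *m invmx (jmx tau z)) = 1%:M.
  by rewrite compat// -!mulmxA mulKVmx// mulKVmx// mulmxV.
by rewrite -[LHS]mulmx1 -e1 mulKmx// unitG'.
Qed.

Lemma gvec_nat f z : A z -> differentiable f (tau z) -> gvec G' (f \o tau) z *m jmx tau z = gvec G f (tau z).
Proof.
move=> Az df; rewrite /gvec (row_pd_comp Az df) invmx_compat//.
have uS := jmx_unit Az; have uT : (jmx tau z)^T \in unitmx by rewrite unitmx_tr.
by rewrite -!mulmxA mulVmx// mulmx1 mulKVmx.
Qed.

Lemma gam_nat f g z : A z -> differentiable f (tau z) -> differentiable g (tau z) ->
  gam G' (f \o tau) (g \o tau) z = gam G f g (tau z).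
Proof.
move=> Az df dg; rewrite (@gamE R n A G' unitG')// (@gamE R n B G unitG); last exact: tauAB.
by rewrite compat// vdot_congr !gvec_nat.
Qed.

Hypothesis cG : forall k a b, ck k B (fun y => G y a b).
Hypothesis cG' : forall k a b, ck k A (fun y => G' y a b).

Lemma ck_tau k f : ck k B f -> ck k A (f \o tau).
Proof. by move=> cf; exact: (ck_comp oA (fun b => ctau k b) tauAB cf). Qed.

Lemma near_gam_nat f g z : ck 2 B f -> ck 2 B g -> A z ->
  \near z, gam G' (f \o tau) (g \o tau) z = (gam G f g \o tau) z.
Proof.
move=> cf cg Az; have : nbhs z A by exact: open_nbhs_nbhs.
apply: filterS => t At /=; apply: gam_nat => //; [exact: (ck_differentiable cf (tauAB At))|exact: (ck_differentiable cg (tauAB At))].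
Qed.

(** By [hmat_gam] the Hessian is a combination of iterated [gam], which are functions and commute
    with [tau] by [gam_nat]. The transformation law of the Christoffel symbols is thereby
    bypassed. *)
Lemma hmat_gvec_nat f g h z : ck 2 B f -> ck 2 B g -> ck 2 B h -> A z ->
  vdot (hmat G' (f \o tau) z) (gvec G' (g \o tau) z) (gvec G' (h \o tau) z) =
  vdot (hmat G f (tau z)) (gvec G g (tau z)) (gvec G h (tau z)).
Proof.
move=> cf cg ch Az; have At := tauAB Az.
have T p q r : ck 2 B p -> ck 2 B q -> ck 2 B r -> gam G' (p \o tau) (gam G' (q \o tau) (r \o tau)) z = gam G p (gam G q r) (tau z).
  move=> cp cq cr; rewrite (gam_near _ _ (near_gam_nat cq cr Az)); apply: gam_nat => //.
    exact: (ck_differentiable cp At).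
  exact: (ck_differentiable (ck_gam oB unitG cG cq cr) At).
have two0 : (2 : R) != 0 by [].
apply: (mulfI two0).
apply: etrans (hmat_gam oA symG' unitG' cG' (ck_tau cf) (ck_tau cg) (ck_tau ch) Az) _.
apply: esym; apply: etrans (hmat_gam oB symG unitG cG cf cg ch At) _.
have T1 := esym (T g f h cg cf ch); have T2 := esym (T h f g ch cf cg); have T3 := esym (T f g h cf cg ch).
exact: (f_equal2 (fun p q => p - q) (f_equal2 (fun p q => p + q) T1 T2) T3).
Qed.

(** The gradients of the coordinate functions are the rows of the inverse Gram matrix, hence a
    basis; on them the identity is [hmat_gvec_nat], and the invertible factors cancel. *)
Lemma hmat_nat f z : ck 2 B f -> A z -> hmat G' (f \o tau) z = jmx tau z *m hmat G f (tau z) *m (jmx tau z)^T.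
Proof.
move=> cf Az; have At := tauAB Az; have uS := jmx_unit Az.
pose x a : V -> R := fun y => y 0 a; have cx a : ck 2 B (x a) by exact: ck_coord.
have E a b := hmat_gvec_nat cf (cx a) (cx b) Az.
have gx a : gvec G (x a) (tau z) = row a (invmx (G (tau z))).
  apply/rowP => c; rewrite /gvec 2!mxE (bigD1 a)//= big1 ?addr0 => [|b ba]; rewrite mxE /x pd_coord.
    by rewrite eqxx mul1r.
  by rewrite (negbTE ba) mul0r.
set Q := invmx (G (tau z)) in gx.
have uQ : Q \in unitmx by rewrite unitmx_inv unitG.
have gx' a : gvec G' (x a \o tau) z = row a (Q *m invmx (jmx tau z)).
  rewrite row_mul -gx -(gvec_nat Az); last exact: (ck_differentiable (cx a) At).
  by rewrite mulmxK.
have E2 : (Q *m invmx (jmx tau z)) *m hmat G' (f \o tau) z *m (Q *m invmx (jmx tau z))^T = Q *m hmat G f (tau z) *m Q^T.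
  by apply/matrixP => a b; rewrite !mul3_vdot -!gx' -!gx; exact: E.
rewrite trmx_mul trmx_inv -!mulmxA in E2; have {}E2 := can_inj (mulKmx uQ) E2.
rewrite !mulmxA in E2; have uQT : Q^T \in unitmx by rewrite unitmx_tr.
have {}E2 := can_inj (mulmxK uQT) E2.
have uT : (jmx tau z)^T \in unitmx by rewrite unitmx_tr.
by rewrite -E2 -!mulmxA mulKVmx// mulVmx// mulmx1.
Qed.

Lemma PhiF_nat f g h z : ck 2 B f -> ck 1 B g -> ck 1 B h -> A z ->
  PhiF G' (f \o tau) (g \o tau) (h \o tau) z = PhiF G f g h (tau z).
Proof.
move=> cf cg ch Az; have At := tauAB Az; rewrite /PhiF (hmat_nat cf Az) vdot_congr.
by rewrite (gvec_nat Az (ck_differentiable cg At)) (gvec_nat Az (ck_differentiable ch At)).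
Qed.

Lemma PF_nat f3 f4 g h z : ck 2 B f3 -> ck 2 B f4 -> ck 1 B g -> ck 1 B h -> A z ->
  PF G' (f3 \o tau) (f4 \o tau) (g \o tau) (h \o tau) z = PF G f3 f4 g h (tau z).
Proof.
move=> c3 c4 cg ch Az; have At := tauAB Az; rewrite /PF (hmat_nat c3 Az) (hmat_nat c4 Az) (invmx_compat Az).
rewrite -(gvec_nat Az (ck_differentiable cg At)) -(gvec_nat Az (ck_differentiable ch At)).
have uS := jmx_unit Az; have uT : (jmx tau z)^T \in unitmx by rewrite unitmx_tr.
rewrite -[X in vdot (_ *m X)](trmxK (invmx (jmx tau z))) trmx_inv vdot_congr.
by rewrite !mulmxA !(mulmxK uT).
Qed.

Lemma BF_nat f3 f4 g h z : ck 2 B f3 -> ck 1 B f4 -> ck 2 B g -> ck 2 B h -> A z ->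
  BF G' (f3 \o tau) (f4 \o tau) (g \o tau) (h \o tau) z = BF G f3 f4 g h (tau z).
Proof.
move=> c3 c4 cg ch Az; have At := tauAB Az; rewrite /BF (hmat_nat c3 Az) vdot_congr.
rewrite (gvec_nat Az (ck_differentiable c4 At)); congr (vdot _ _ _).
have uS := jmx_unit Az; have uT : (jmx tau z)^T \in unitmx by rewrite unitmx_tr.
rewrite /bracket (hmat_nat cg Az) (hmat_nat ch Az) (invmx_compat Az).
rewrite -(gvec_nat Az (ck_differentiable (ckW cg) At)) -(gvec_nat Az (ck_differentiable (ckW ch) At)).
by rewrite !mulmxA -mulmxBl ?mulmxA (mulmxK uT) (mulmxKV uS).
Qed.

Lemma ck_PhiF f g h : ck 3 B f -> ck 2 B g -> ck 2 B h -> ck 1 B (PhiF G f g h).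
Proof.
move=> cf cg ch; apply: (@ck_ext _ _ 1 B (fun y => \sum_a \sum_b gvec G g y 0 a * hmat G f y a b * gvec G h y 0 b)) => //.
  by move=> y _; rewrite /PhiF vdotE.
apply: (ck_sum oB) => a _; apply: (ck_sum oB) => b _; apply: (ckM oB); last exact: (ck_gvec oB unitG cG).
by apply: (ckM oB); [exact: (ck_gvec oB unitG cG)|exact: (ck_hmat oB unitG cG)].
Qed.

Lemma curvF_nat f1 f2 f3 f4 z : ck 3 B f1 -> ck 3 B f2 -> ck 3 B f3 -> ck 3 B f4 -> A z ->
  curvF G' (f1 \o tau) (f2 \o tau) (f3 \o tau) (f4 \o tau) z = curvF G f1 f2 f3 f4 (tau z).
Proof.
move=> c1 c2 c3 c4 Az; have At := tauAB Az.
have d1 := ckW c1; have d2 := ckW c2; have d3 := ckW c3; have d4 := ckW c4.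
have e1 := ckW d1; have e2 := ckW d2; have e4 := ckW d4.
have N (p q : V -> R) : ck 1 B p -> ck 3 B q -> ck 2 B q ->
    gam G' (p \o tau) (PhiF G' (f3 \o tau) (q \o tau) (f4 \o tau)) z = gam G p (PhiF G f3 q f4) (tau z).
  move=> cp cq dq; have -> : gam G' (p \o tau) (PhiF G' (f3 \o tau) (q \o tau) (f4 \o tau)) z =
     gam G' (p \o tau) (PhiF G f3 q f4 \o tau) z.
    apply: gam_near; have : nbhs z A by exact: open_nbhs_nbhs.
    by apply: filterS => t At' /=; exact: PhiF_nat d3 (ckW dq) e4 At'.
  apply: (gam_nat Az); first exact: (ck_differentiable cp At).
  exact: (ck_differentiable (ck_PhiF c3 dq d4) At).
rewrite /curvF (N f1 f2 e1 c2 d2) (N f2 f1 e2 c1 d1) (PF_nat d3 d4 e2 e1 Az) (PF_nat d3 d4 e1 e2 Az).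
by rewrite (BF_nat d3 e4 d1 d2 Az).
Qed.

(* The right-hand side is computed in the chart carrying [G'], the left-hand side in the chart
   carrying [G]. *)
Lemma curvF_riem f1 f2 f3 f4 z : ck 3 B f1 -> ck 3 B f2 -> ck 3 B f3 -> ck 3 B f4 -> A z ->
  curvF G f1 f2 f3 f4 (tau z) =
  teval (riem_tensor G' z) [tuple gvec G' (f1 \o tau) z; gvec G' (f2 \o tau) z; gvec G' (f3 \o tau) z; gvec G' (f4 \o tau) z].
Proof.
move=> c1 c2 c3 c4 Az; rewrite -(curvF_nat c1 c2 c3 c4 Az).
have t1 := ck_tau c1; have t2 := ck_tau c2; have t3 := ck_tau c3; have t4 := ck_tau c4.
apply: etrans (curvature_identity oA symG' unitG' cG' t1 t2 t3 t4 Az) _.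
have D1 := diff_gvec oA unitG' cG' (ckW t1) Az; have D2 := diff_gvec oA unitG' cG' (ckW t2) Az.
apply: (@curv_teval R n A G' _ _ _ _ z oA cG' symG' unitG' D1 D2 _ Az).
by move=> c; exact: (ck_gvec oA unitG' cG').
Qed.

End Naturality.

(** * Differentials and gradients of functions on [X], chart by chart *)

Section Charts.
Variables (R : realType) (n : nat) (X : pmetricType R) (S : riem_structure R n (regular n X)).
Local Notation V := 'rV[R]_n.

Lemma open_chart_image (j : chart S) (W : set X) : open W -> open (phi j @` (dom j `&` W)).
Proof.
move=> oW; rewrite (_ : phi j @` _ = (phi j @` dom j) `&` psi j @^-1` W); last first.
  apply/seteqP; split=> [_ [x [di dj] <-]|y [/img_phi[dy yK] dj]].
    by split; [exists x|rewrite /= phiK].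
  by exists (psi j y).
rewrite openE => y [iy jy]; apply: filterI.
  by apply: open_nbhs_nbhs; split=> //; exact: img_open.
by apply: (psi_continuous iy); apply: open_nbhs_nbhs.
Qed.

Lemma gram_unit (j : chart S) y : (phi j @` dom j) y -> gram j y \in unitmx.
Proof.
move=> iy; rewrite -row_free_unit; apply/inj_row_free => w w0.
apply/eqP; apply: contraT => wn0; have := gram_pos iy wn0.
by rewrite /vdot w0 mul0mx mxE ltxx.
Qed.

Lemma ck_transition m (j k : chart S) b : ck m (phi j @` (dom j `&` dom k)) (fun y => phi k (psi j y) 0 b).
Proof. by apply: smooth_ck; exact: transition_smooth. Qed.

Lemma gram_transition (j k : chart S) z : (phi j @` (dom j `&` dom k)) z ->
  gram j z = jmx (phi k \o psi j) z *m gram k (phi k (psi j z)) *m (jmx (phi k \o psi j) z)^T.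
Proof. by move=> [x [dj dk] <-]; rewrite (gram_compat dj dk) phiK. Qed.

Lemma near_transition (f : X -> R) (j k : chart S) x : dom j x -> dom k x ->
  \forall z \near phi j x, (f \o psi j) z = ((f \o psi k) \o (phi k \o psi j)) z.
Proof.
move=> dj dk; have : nbhs (phi j x) (phi j @` (dom j `&` dom k)).
  by apply: open_nbhs_nbhs; split; [exact: open_transition_dom|exists x].
by apply: filterS => _ [t [tj tk] <-] /=; rewrite phiK//= phiK.
Qed.

Lemma differentiable_chart (f : X -> R) (j k : chart S) x : dom j x -> dom k x ->
  differentiable (f \o psi k) (phi k x) -> differentiable (f \o psi j) (phi j x).
Proof.
move=> dj dk df; have N := near_transition f dj dk.
have N' : \forall z \near phi j x, ((f \o psi k) \o (phi k \o psi j)) z = (f \o psi j) z.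
  by apply: filterS N => z ->.
apply: (near_eq_differentiable N').
apply: (@pd_comp R n (phi k \o psi j) (f \o psi k) (phi j x) _ _).1 => [b|]; last by rewrite /= phiK.
by apply: transition_differentiable; exists x.
Qed.

Lemma trow_dfun (f : X -> R) x : trow (dfun S f x) = \row_a pd a (f \o psi (chart_at S x)) (Defs.coord S x).
Proof. by apply/rowP => a; rewrite !mxE /dfun ffunE. Qed.

Lemma grad_gvec (f : X -> R) x : grad S f x = gvec (gram (chart_at S x)) (f \o psi (chart_at S x)) (Defs.coord S x).
Proof. by rewrite /grad /sharp /gvec -trow_dfun. Qed.

Lemma dotX_vdot (w w' : tensor_field n X 1) x :
  dotX S w w' x = vdot (invmx (gram_at S x)) (trow (w x)) (trow (w' x)).
Proof. exact: tdot1. Qed.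

Lemma gam_vdotV (G : V -> 'M[R]_n) (u v : V -> R) y :
  gam G u v y = vdot (invmx (G y)) (\row_a pd a u y) (\row_a pd a v y).
Proof. by rewrite /gam /vdot /gvec mxE; apply: eq_bigr => a _; rewrite !mxE. Qed.

Lemma gam_near2 (G : V -> 'M[R]_n) (u v u' v' : V -> R) y : (\near y, u y = u' y) -> (\near y, v y = v' y) ->
  gam G u v y = gam G u' v' y.
Proof.
move=> nu nv; rewrite !gam_vdotV; congr (vdot _ _ _); apply/rowP => a; rewrite !mxE.
  exact: (@near_eq_pd R n u u' y a nu).
exact: (@near_eq_pd R n v v' y a nv).
Qed.

Lemma dotX_chart (f g : X -> R) (k : chart S) x : regular n X x -> dom k x ->
  differentiable (f \o psi k) (phi k x) -> differentiable (g \o psi k) (phi k x) ->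
  dotX S (dfun S f) (dfun S g) x = gam (gram k) (f \o psi k) (g \o psi k) (phi k x).
Proof.
move=> rx dk df dg; set j := chart_at S x; have dj : dom j x by exact: dom_chart_at.
rewrite dotX_vdot !trow_dfun -gam_vdotV -/j /Defs.coord -/j.
rewrite (gam_near2 _ (near_transition f dj dk) (near_transition g dj dk)).
have E : (phi k \o psi j) (phi j x) = phi k x by rewrite /= phiK.
rewrite -[in RHS]E; apply: (@gam_nat R n (phi j @` (dom j `&` dom k)) (phi k @` dom k)) => //.
- by move=> z [t [tj tk] <-]; rewrite /= phiK//; exists t.
- by move=> m b; exact: ck_transition.
- by move=> y; exact: gram_unit.
- by move=> y [t [tj _] <-]; apply: gram_unit; exists t.
- by move=> z; exact: gram_transition.
- by exists x.
- by rewrite E.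
- by rewrite E.
Qed.

Lemma teval1 (T : tensor R n 1) (w : V) : teval T [tuple of [:: w]] = \sum_a T [ffun=> a] * w 0 a.
Proof.
rewrite /teval sum_ffunS; apply: eq_bigr => a _; rewrite sum_ffun0 fcons_const big_ord1.
by rewrite (tnth_nth 0)/= ffunE.
Qed.

Lemma teval_jacobian (f : X -> R) (k : chart S) (s : {ffun 'I_1 -> 'I_n}) x : regular n X x -> dom k x ->
  differentiable (f \o psi k) (phi k x) ->
  teval (dfun S f x) [tuple row (s j) (Defs.jacobian (@phi _ _ _ _ S) (@psi _ _ _ _ S) k (chart_at S x) (phi k x)) | j < 1]
  = pd (s ord0) (f \o psi k) (phi k x).
Proof.
move=> rx dk df; set j := chart_at S x; have dj : dom j x by exact: dom_chart_at.
have -> : [tuple row (s i) (Defs.jacobian (@phi _ _ _ _ S) (@psi _ _ _ _ S) k j (phi k x)) | i < 1] =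
   [tuple of [:: row (s ord0) (Defs.jacobian (@phi _ _ _ _ S) (@psi _ _ _ _ S) k j (phi k x))]].
  by apply: eq_from_tnth => i; rewrite tnth_mktuple (tnth_nth 0) ord1.
rewrite teval1 (near_eq_pd _ (near_transition f dk dj)).
have dt b : differentiable (fun z => (phi j \o psi k) z 0 b) (phi k x).
  by apply: transition_differentiable; exists x.
have df' : differentiable (f \o psi j) ((phi j \o psi k) (phi k x)).
  by rewrite /= phiK//; exact: (differentiable_chart dj dk df).
have [_ ->] := @pd_comp R n (phi j \o psi k) (f \o psi j) (phi k x) dt df'.
apply: eq_bigr => b _; rewrite /dfun ffunE !mxE mulrC /Defs.coord -/j /= phiK//.
Qed.

Lemma gvec_near (G : V -> 'M[R]_n) (u v : V -> R) y : (\near y, u y = v y) -> gvec G u y = gvec G v y.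
Proof. by move=> uv; congr (_ *m _); apply/rowP => a; rewrite !mxE; exact: (@near_eq_pd R n u v y a uv). Qed.

Lemma grad_chart (f : X -> R) (k : chart S) x : regular n X x -> dom k x -> differentiable (f \o psi k) (phi k x) ->
  grad S f x = gvec (gram k) (f \o psi k) (phi k x) *m
    Defs.jacobian (@phi _ _ _ _ S) (@psi _ _ _ _ S) k (chart_at S x) (phi k x).
Proof.
move=> rx dk df; set j := chart_at S x; have dj : dom j x by exact: dom_chart_at.
rewrite grad_gvec -/j /Defs.coord -/j (gvec_near _ (near_transition f dk dj)).
have E : (phi j \o psi k) (phi k x) = phi j x by rewrite /= phiK.
rewrite -[in LHS]E; apply: esym.
apply: (@gvec_nat R n (phi k @` (dom k `&` dom j)) (phi j @` dom j) (gram j) (gram k) (phi j \o psi k)) => //.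
- by move=> z [t [tk tj] <-]; rewrite /= phiK//; exists t.
- by move=> m b; exact: ck_transition.
- by move=> y; exact: gram_unit.
- by move=> y [t [tk _] <-]; apply: gram_unit; exists t.
- by move=> z; exact: gram_transition.
- by exists x.
- by rewrite E; exact: (differentiable_chart dj dk df).
Qed.

Lemma dotX_grad (f : X -> R) (w : tensor_field n X 1) x :
  dotX S (dfun S f) w x = \sum_b grad S f x 0 b * w x [ffun=> b].
Proof. by rewrite dotX_vdot /vdot mxE; apply: eq_bigr => b _; rewrite !mxE; congr (_ * _). Qed.

Lemma teval_row1 (T : tensor R n 1) (M : 'M[R]_n) (s : {ffun 'I_1 -> 'I_n}) :
  teval T [tuple row (s j) M | j < 1] = \sum_b T [ffun=> b] * M (s ord0) b.
Proof.
have -> : [tuple row (s i) M | i < 1] = [tuple of [:: row (s ord0) M]].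
  by apply: eq_from_tnth => i; rewrite tnth_mktuple (tnth_nth 0) ord1.
by rewrite teval1; apply: eq_bigr => b _; rewrite mxE.
Qed.

(** For an arbitrary tensor field [w], measurability is given through its components in each chart
    ([borel_section]); hence this form, in which exactly those components occur. *)
Lemma dotX_chart_grad (f : X -> R) (w : tensor_field n X 1) (k : chart S) x : regular n X x -> dom k x ->
  differentiable (f \o psi k) (phi k x) ->
  dotX S (dfun S f) w x = \sum_a gvec (gram k) (f \o psi k) (phi k x) 0 a *
    teval (w x) [tuple row ([ffun=> a] j) (Defs.jacobian (@phi _ _ _ _ S) (@psi _ _ _ _ S) k (chart_at S x) (phi k x)) | j < 1].
Proof.
move=> rx dk df; rewrite dotX_grad (grad_chart rx dk df).
under eq_bigr => b _ do rewrite mxE mulr_suml.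
rewrite exchange_big; apply: eq_bigr => a _; rewrite teval_row1 mulr_sumr.
by apply: eq_bigr => b _; rewrite ffunE -mulrA; congr (_ * _); rewrite mulrC.
Qed.

(** [P] is the transposed inverse of the Cholesky factor; it reduces scalar products of covectors
    and tensors to Euclidean ones. *)
Lemma invmx_gram_sq x : regular n X x -> exists P : 'M[R]_n, invmx (gram_at S x) = P *m P^T.
Proof.
move=> rx; have ix : (phi (chart_at S x) @` dom (chart_at S x)) (Defs.coord S x).
  by exists x => //; exact: dom_chart_at.
have [T [tT pT GT _]] := gram_cholesky ix.
have uT : T \in unitmx.
  by rewrite unitmxE det_trig// unitfE; apply: lt0r_neq0; apply: prodr_gt0 => a _; exact: pT.
exists (invmx T)^T; rewrite trmxK trmx_inv /gram_at GT.
have uTT : T^T \in unitmx by rewrite unitmx_tr.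
have uG : T *m T^T \in unitmx by rewrite unitmx_mul uT.
have e : T *m T^T *m (invmx T^T *m invmx T) = 1%:M by rewrite -!mulmxA mulKVmx// mulmxV.
by rewrite -[LHS]mulmx1 -e mulKmx.
Qed.

End Charts.

Section Cell.
Variables (R : realType) (n : nat) (X : pmetricType R) (S : riem_structure R n (regular n X)).
Local Notation V := 'rV[R]_n.
Local Notation mX := (@hausdorffX R n X).
Local Notation mu := (@muV R n).
Hypothesis hS : locally_induces_dist S.
Hypothesis cS : forall (i : chart S) y, (phi i @` dom i) y -> forall a b, {for y, continuous (fun z => gram i z a b)}.
Variable U : set X.
Hypothesis oU : open U.
Hypothesis Ureg : U `<=` regular n X.
Hypothesis smS : smooth_metric_on S U.

(** [local_comparison] with [e = 1/2], followed by the equivalence of [enorm (v *m T)] with the sup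
    norm of [v]. Crude constants are enough to transport Lipschitz bounds. *)
Lemma comparison_radius (i : chart S) x0 : dom i x0 -> U x0 -> exists r c L : R, [/\ 0 < r, 0 < c, 0 <= L,
  forall y, `|y - phi i x0| < r -> (phi i @` (dom i `&` U)) y &
  forall y z, `|y - phi i x0| < r -> `|z - phi i x0| < r ->
    c * `|y - z| <= mdist (psi i y) (psi i z) <= L * `|y - z|].
Proof.
move=> dx Ux; have ix : (phi i @` dom i) (phi i x0) by exists x0.
have [T [Si [TS GT]]] : exists T Si : 'M[R]_n, T *m Si = 1%:M /\ gram i (phi i x0) = T *m T^T.
  have [T [tT pT GT _]] := gram_cholesky ix; exists T, (invmx T); split=> //; rewrite mulmxV//.
  by rewrite unitmxE det_trig// unitfE; apply: lt0r_neq0; apply: prodr_gt0 => a _; exact: pT.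
have e01 : 0 < (2^-1 : R) < 1 by lra.
have [r1 r10 H] := local_comparison hS dx (cS ix) TS GT e01.
have /nbhs_rV[r2 r20 H2] : nbhs (phi i x0) (phi i @` (dom i `&` U)).
  by apply: open_nbhs_nbhs; split; [exact: open_chart_image|exists x0].
have [C C0 [c c0 HC]] : exists2 C : R, 0 <= C & exists2 c : R, 0 < c & forall w : V, c * `|w| <= enorm (w *m T) <= C * `|w|.
  exists (n%:R * (n%:R * mx_bound T)); first by rewrite !mulr_ge0// mx_bound_ge0.
  have M0 : 0 < n%:R * mx_bound Si + 1 by rewrite ltr_wpDl// mulr_ge0// mx_bound_ge0.
  exists (n%:R * mx_bound Si + 1)^-1; first by rewrite invr_gt0.
  move=> w; apply/andP; split.
    rewrite ler_pdivrMl// mulrDl mul1r; apply: le_trans (enorm_inv w TS) _.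
    by rewrite lerDl enorm_ge0.
  apply: le_trans (enorm_le_norm _) _; rewrite -mulrA ler_wpM2l//.
  exact: lin_norm_le (mx_bound_ge0 T) (mx_boundP T) w.
exists (Num.min r1 r2), (c / 2), (C * 2); split.
- by rewrite lt_min r10.
- by rewrite divr_gt0.
- by rewrite mulr_ge0.
- move=> y; rewrite lt_min => /andP[_ yr]; rewrite distrC in yr; exact: H2.
- move=> y z; rewrite !lt_min => /andP[yr _] /andP[zr _]; rewrite distrC in yr; rewrite distrC in zr.
  have [_] := H y z yr zr; have := HC (z - y); rewrite [`|z - y|]distrC; move: (enorm _) (mdist _ _) `|_| => p q t.
  by nra.
Qed.

End Cell.

(** * Integrals up to null sets, and limits of pairings *)

Section NullSets.
Context d (T : measurableType d) (R : realType) (mu : {measure set T -> \bar R}).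

(** Each simple function below [f] is measurable, and its integral ignores the null set; the
    supremum inherits this. It spares a proof of measurability for the integrands built from
    [hess]. *)
Lemma integral_ge0_null_nomeas (D N : set T) (f : T -> \bar R) : measurable N -> mu N = 0%E ->
  (forall x, D x -> (0 <= f x)%E) -> (\int[mu]_(x in D) f x = \int[mu]_(x in D `\` N) f x)%E.
Proof.
move=> mN N0 f0; apply/eqP; rewrite eq_le; apply/andP; split; last first.
  by apply: integral_le_nomeas => //; exact: subDsetl.
rewrite ge0_integralE//; apply: ge_ereal_sup => _ [h hf <-].
rewrite -integralT_nnsfun.
have -> : (\int[mu]_x (h x)%:E = \int[mu]_(x in ~` N) (h x)%:E)%E.
  have mh : measurable_fun setT (fun x => (h x)%:E) by apply/measurable_EFinP.
  rewrite -(setvU N) ge0_integral_setU//=.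
  - rewrite [X in (_ + X)%E]null_set_integral ?adde0//; exact: measurable_funS mh.
  - exact: measurableC.
  - by rewrite setvU.
  - by move=> x _; rewrite lee_fin.
  - by rewrite disj_set2E setICl.
have hf' x : ((h x)%:E <= (f \_ D) x)%E by exact: hf.
have fD0 x : (0 <= (f \_ D) x)%E by apply: erestrict_ge0.
rewrite setDE setIC integral_mkcondr; exact: integral_le_nomeas.
Qed.

Lemma integral_null_nomeas (D N : set T) (f : T -> \bar R) : measurable N -> mu N = 0%E ->
  (\int[mu]_(x in D) f x = \int[mu]_(x in D `\` N) f x)%E.
Proof.
move=> mN N0; rewrite integralE [RHS]integralE; congr (_ - _)%E;
  by apply: integral_ge0_null_nomeas => // x _; rewrite ?funepos_ge0 ?funeneg_ge0.
Qed.

Lemma ae_eq_integral_nomeas (D : set T) (f g : T -> \bar R) : {ae mu, forall x, D x -> f x = g x} ->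
  (\int[mu]_(x in D) f x = \int[mu]_(x in D) g x)%E.
Proof.
move=> [N [mN N0 fg]]; rewrite (integral_null_nomeas D f mN N0) (integral_null_nomeas D g mN N0).
apply: eq_integral => x /set_mem[Dx Nx]; apply: contrapT => h; apply: Nx; apply: fg => /= e; exact/h/e.
Qed.

Lemma ae_imp (P Q : T -> Prop) : (forall x, P x -> Q x) -> {ae mu, forall x, P x} -> {ae mu, forall x, Q x}.
Proof. by move=> PQ [N [mN N0 PN]]; exists N; split=> // x nQ; apply: PN => /= Px; exact/nQ/PQ. Qed.

Lemma ae_forall_fin (I : finType) (P : I -> T -> Prop) : (forall i, {ae mu, forall x, P i x}) ->
  {ae mu, forall x, forall i, P i x}.
Proof. by move=> H; have FF := ae_filter_ringOfSetsType mu; exact: filter_forall. Qed.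

Lemma integral_zero_off (D E : set T) (f : T -> \bar R) : E `<=` D -> (forall x, D x -> ~ E x -> f x = 0%E) ->
  (\int[mu]_(x in D) f x = \int[mu]_(x in E) f x)%E.
Proof.
move=> ED f0; rewrite integral_mkcond [RHS]integral_mkcond; congr integral; apply/funext => x; rewrite !patchE.
case: ifPn => [/set_mem Dx|xD]; case: ifPn => // xE.
  by apply: f0 => // Ex; move: xE; rewrite mem_set.
by move: xD; rewrite mem_set//; exact/ED/set_mem.
Qed.

(* Cauchy-Schwarz in a form that does not require [B k] to be measurable: by AM-GM,
   [2 t |m k| - t^2 A <= B k], and the left-hand side is measurable. *)
Lemma pairing_cvg (D E : set T) (m B : nat -> T -> R) (A : T -> R) : measurable E -> E `<=` D ->
  (forall k, measurable_fun E (m k)) -> measurable_fun E A -> (forall x, E x -> 0 <= A x) ->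
  (forall k x, D x -> 0 <= B k x) -> (forall k x, E x -> m k x ^+ 2 <= A x * B k x) ->
  (\int[mu]_(x in E) (A x)%:E < +oo)%E -> (\int[mu]_(x in D) (B k x)%:E)%E @[k --> \oo] --> 0%E ->
  forall e : R, 0 < e -> \forall k \near \oo, (\int[mu]_(x in E) `|(m k x)%:E| <= e%:E)%E.
Proof.
move=> mE ED mm mA A0 B0 mAB Afin Bcvg e e0.
have IA0 : (0 <= \int[mu]_(x in E) (A x)%:E)%E by apply: integral_ge0 => x Ex; rewrite lee_fin A0.
set IA := (\int[mu]_(x in E) (A x)%:E)%E in Afin IA0.
have IAf : IA \is a fin_num by rewrite ge0_fin_numE.
have C0 : 0 <= fine IA by rewrite fine_ge0.
(* Once the integral of [B k] is below [t * e], both parts of the bound, with the factors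
   [1 / (2 * t)] and [t / 2], are at most [e / 2]. *)
pose t := e / (fine IA + 1); have t0 : 0 < t by rewrite divr_gt0// ltr_wpDl.
have te : 0 < t * e by rewrite mulr_gt0.
have : nbhs (0%E : \bar R) [set x : \bar R | (x < (t * e)%:E)%E].
  by apply: open_nbhs_nbhs; split; [exact: open_ereal_lt_ereal|rewrite /= lte_fin].
move=> N0.
have N : \forall k \near \oo, (\int[mu]_(x in D) (B k x)%:E < (t * e)%:E)%E by exact: (Bcvg _ N0).
apply: filterS N => k Bk.
pose p x := Num.max 0 (2 * t * `|m k x| - t ^+ 2 * A x).
have mp : measurable_fun E p.
  apply: measurable_maxr; first exact: measurable_cst.
  apply: measurable_funB; apply: measurable_funM; [exact: measurable_cst| |exact: measurable_cst|exact: mA].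
  by apply: measurableT_comp; [exact: normr_measurable|exact: mm].
have p0 x : 0 <= p x by rewrite /p le_max lexx.
have pB x : E x -> p x <= B k x.
  move=> Ex; have Bx := B0 k x (ED _ Ex); have Ax := A0 x Ex; have := mAB k x Ex; rewrite -(real_normK (num_real (m k x))).
  rewrite /p ge_max Bx/= lerBlDr => h.
  have h0 : 0 <= B k x + t ^+ 2 * A x by rewrite addr_ge0// mulr_ge0// sqr_ge0.
  have h1 : 0 <= 2 * t * `|m k x| by apply: mulr_ge0 => //; apply: mulr_ge0 => //; exact: ltW.
  rewrite -(@ler_pXn2r _ 2)// ?nnegrE//.
  have -> : (2 * t * `|m k x|) ^+ 2 = 4 * t ^+ 2 * `|m k x| ^+ 2 by ring.
  have t2 : 0 <= 4 * t ^+ 2 by rewrite mulr_ge0// sqr_ge0.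
  apply: le_trans (ler_wpM2l t2 h) _; rewrite -subr_ge0.
  have -> : (B k x + t ^+ 2 * A x) ^+ 2 - 4 * t ^+ 2 * (A x * B k x) = (B k x - t ^+ 2 * A x) ^+ 2 by ring.
  exact: sqr_ge0.
have mB x : E x -> `|m k x| <= (2 * t)^-1 * p x + t / 2 * A x.
  move=> Ex; have : 2 * t * `|m k x| <= p x + t ^+ 2 * A x by rewrite -lerBlDr /p le_max lexx orbT.
  have t1 : t != 0 by exact: lt0r_neq0.
  have -> : (2 * t)^-1 * p x + t / 2 * A x = (2 * t)^-1 * (p x + t ^+ 2 * A x) by field.
  by rewrite ler_pdivlMl// mulr_gt0.
have tt : 0 <= (2 * t)^-1 by rewrite invr_ge0 mulr_ge0// ltW.
have th : 0 <= t / 2 by rewrite divr_ge0// ltW.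
have I1 : (\int[mu]_(x in E) `|(m k x)%:E| <= (2 * t)^-1%:E * \int[mu]_(x in E) (p x)%:E + (t / 2)%:E * IA)%E.
  rewrite /IA -!ge0_integralZl_EFin//.
  - rewrite -ge0_integralD//.
    + apply: integral_le_nomeas => // x Ex.
      have h1 : 0 <= (2 * t)^-1 * p x by exact: mulr_ge0.
      have h2 : 0 <= t / 2 * A x by apply: mulr_ge0 => //; exact: A0.
      by rewrite -2!EFinM -EFinD lee_fin; exact: addr_ge0.
    + by move=> x Ex; rewrite -EFinM lee_fin mulr_ge0.
    + by apply/measurable_EFinP; apply: measurable_funM => //; exact: measurable_cst.
    + by move=> x Ex; rewrite -EFinM lee_fin mulr_ge0 ?A0.
    + by apply/measurable_EFinP; apply: measurable_funM => //; exact: measurable_cst.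
  - exact/measurable_EFinP.
  - by move=> x Ex; rewrite lee_fin.
  - exact/measurable_EFinP.
have I2 : (\int[mu]_(x in E) (p x)%:E <= (t * e)%:E)%E.
  apply: le_trans (ltW Bk); apply: integral_le_nomeas => // x Dx.
  by rewrite lee_fin B0.
apply: le_trans I1 _; apply: le_trans (leeD (@lee_wpmul2l _ (2 * t)^-1%:E _ _ _ I2) (lexx _)) _ => //.
rewrite -(fineK IAf) -!EFinM -EFinD lee_fin.
have t1 : t != 0 by exact: lt0r_neq0.
have -> : (2 * t)^-1 * (t * e) = e / 2 by field.
have tC : t * (fine IA + 1) = e by rewrite divfK// lt0r_neq0// ltr_wpDl.
move: tC; rewrite mulrDr mulr1 [t / 2 * _]mulrAC; move: (t * _) => z; lra.
Qed.

(** Equality of integrals passes to L^1 limits; the integrability of [a] and [b] is itself deduced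
    from their closeness to some [p k] and [q k]. *)
Lemma integral_eq_limit (E : set T) (a b : T -> R) (p q : nat -> T -> R) : measurable E ->
  measurable_fun E a -> measurable_fun E b ->
  (forall k, mu.-integrable E (EFin \o p k)) -> (forall k, mu.-integrable E (EFin \o q k)) ->
  (forall k, \int[mu]_(x in E) (p k x)%:E = \int[mu]_(x in E) (q k x)%:E)%E ->
  (forall e : R, 0 < e -> \forall k \near \oo, (\int[mu]_(x in E) `|(p k x - a x)%:E| <= e%:E)%E) ->
  (forall e : R, 0 < e -> \forall k \near \oo, (\int[mu]_(x in E) `|(q k x - b x)%:E| <= e%:E)%E) ->
  (\int[mu]_(x in E) (a x)%:E = \int[mu]_(x in E) (b x)%:E)%E.
Proof.
move=> mE ma mb ip iq pq pa qb.
have step (f g : T -> R) (e : R) : measurable_fun E f -> mu.-integrable E (EFin \o g) ->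
    (\int[mu]_(x in E) `|(g x - f x)%:E| <= e%:E)%E -> mu.-integrable E (EFin \o f) /\
    `|fine (\int[mu]_(x in E) (g x)%:E)%E - fine (\int[mu]_(x in E) (f x)%:E)%E| <= e.
  move=> mf ig ge.
  have mg : measurable_fun E g by apply/measurable_EFinP; exact: measurable_int ig.
  have id : mu.-integrable E (EFin \o (fun x => g x - f x)).
    apply/integrableP; split; first by apply/measurable_EFinP; exact: measurable_funB.
    exact: le_lt_trans ge (ltry _).
  have if_ : mu.-integrable E (EFin \o f).
    have -> : (EFin \o f = (EFin \o g) \- (EFin \o (fun x => (g x - f x)%R)))%E.
      by apply/funext => x /=; rewrite -EFinB opprB addrC subrK.
    by apply: integrableB.
  split=> //; have fg := integrable_fin_num mE ig; have ff := integrable_fin_num mE if_.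
  rewrite -fineB// -(integralB_EFin mE ig if_) -lee_fin.
  have -> : (\int[mu]_(x in E) ((g x)%:E - (f x)%:E) = \int[mu]_(x in E) (g x - f x)%:E)%E by [].
  have fd := integrable_fin_num mE id; rewrite -fine_abse// fineK ?abse_fin_num//.
  apply: le_trans ge; apply: le_abse_integral => //; exact: measurable_int id.
have I e : 0 < e -> mu.-integrable E (EFin \o a) /\ mu.-integrable E (EFin \o b) /\
    `|fine (\int[mu]_(x in E) (a x)%:E)%E - fine (\int[mu]_(x in E) (b x)%:E)%E| <= e + e.
  move=> e0; have [k [h1 h2]] : exists k, (\int[mu]_(x in E) `|(p k x - a x)%:E| <= e%:E)%E /\
      (\int[mu]_(x in E) `|(q k x - b x)%:E| <= e%:E)%E.
    have N : \forall k \near \oo, (\int[mu]_(x in E) `|(p k x - a x)%:E| <= e%:E)%E /\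
        (\int[mu]_(x in E) `|(q k x - b x)%:E| <= e%:E)%E by apply: filterI; [exact: pa|exact: qb].
    by have [k hk] := filter_ex N; exists k.
  have [ia da] := step a (p k) e ma (ip k) h1; have [ib db] := step b (q k) e mb (iq k) h2.
  split=> //; split=> //; rewrite pq in da; move: da db.
  move: (fine _) (fine _) (fine _) => z1 z2 z3 da db.
  have -> : z2 - z1 = (z3 - z1) - (z3 - z2) by ring.
  by apply: le_trans (ler_normB _ _) _; exact: lerD.
have [ia [ib _]] := I 1 ltr01.
rewrite -(fineK (integrable_fin_num mE ia)) -(fineK (integrable_fin_num mE ib)); congr (_%:E).
apply/eqP; rewrite -subr_eq0 -normr_le0; apply/ler_addgt0Pl => e e0; rewrite addr0.
have e2 : 0 < e / 2 by rewrite divr_gt0.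
by rewrite (splitr e); exact: (I _ e2).2.2.
Qed.

End NullSets.

Lemma measurable_fun_eqD d (T : measurableType d) (R : realType) (D : set T) (f g : T -> R) :
  (forall x, D x -> g x = f x) -> measurable_fun D f -> measurable_fun D g.
Proof. by move=> fg; apply: eq_measurable_fun => x /set_mem Dx; rewrite fg. Qed.

Section Clamp.
Variables (R : realType) (n : nat) (y0 : 'rV[R]_n) (s : R).
Hypothesis s0 : 0 <= s.
Local Notation V := 'rV[R]_n.

Definition clamp (y : V) : V := \row_a Num.max (y0 0 a - s) (Num.min (y 0 a) (y0 0 a + s)).

Lemma clamp_near y : `|clamp y - y0| <= s.
Proof.
apply/rV_normP => // a; rewrite !mxE ler_norml; move: (y 0 a) (y0 0 a) => p q.
by case: (leP p (q + s)) => ?; case: (leP (q - s) _) => ?; move: s0 => s1; apply/andP; split; lra.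
Qed.

Lemma clamp_id y : `|y - y0| <= s -> clamp y = y.
Proof.
move=> /rV_normP => /(_ s0) h; apply/rowP => a; have := h a; rewrite !mxE ler_norml.
move: (y 0 a) (y0 0 a) => p q /andP[h1 h2].
by case: (leP p (q + s)) => ?; case: (leP (q - s) _) => ?; lra.
Qed.

Lemma clamp_lip y z : `|clamp y - clamp z| <= `|y - z|.
Proof.
apply/rV_normP => // a; apply: le_trans (rV_coord_le (y - z) a); rewrite !mxE.
move: (y 0 a) (z 0 a) (y0 0 a) => p q r.
rewrite ler_norml; have := ler_norm (p - q); have := ler_norm (- (p - q)); rewrite normrN => h1 h2.
by case: (leP p (r + s)) => ?; case: (leP q (r + s)) => ?; do ?[case: (leP (r - s) _) => ?]; apply/andP; split; lra.
Qed.

End Clamp.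

Lemma vdot_cs (R : realType) n (T : 'M[R]_n) (u v : 'rV[R]_n) :
  vdot (T *m T^T) u v ^+ 2 <= vdot (T *m T^T) u u * vdot (T *m T^T) v v.
Proof.
have E (a b : 'rV[R]_n) : vdot (T *m T^T) a b = \sum_k (a *m T) 0 k * (b *m T) 0 k.
  by rewrite /vdot mulmxA -mulmxA -trmx_mul mxE; apply: eq_bigr => k _; rewrite [in X in _ * X]mxE.
rewrite !vdot_enorm -exprMn -(real_normK (num_real (vdot _ u v))) ler_pXn2r ?nnegrE ?mulr_ge0 ?enorm_ge0//.
rewrite ler_norml -lerNl E enorm_dot andbT.
rewrite -[enorm (u *m T)]enormN; apply: le_trans (enorm_dot _ _).
by rewrite -sumrN; apply: ler_sum => k _; rewrite [in leRHS]mxE mulNr.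
Qed.

Section TensorBounds.
Variables (R : realType) (n k : nat).
Local Notation V := 'rV[R]_n.
Local Notation idx := {ffun 'I_k -> 'I_n}.

Lemma teval_mulmx (T : tensor R n k) (v : 'I_k -> V) (M : 'M[R]_n) :
  teval T [tuple v j *m M | j < k] =
  \sum_(r : idx) (\prod_(j < k) v j 0 (r j)) * teval T [tuple row (r j) M | j < k].
Proof.
rewrite /teval; under [RHS]eq_bigr => r _ do rewrite mulr_sumr.
rewrite exchange_big /=; apply: eq_bigr => s _.
transitivity (T s * \prod_(j < k) \sum_b v j 0 b * M b (s j)).
  by congr (_ * _); apply: eq_bigr => j _; rewrite tnth_mktuple mxE.
rewrite bigA_distr_bigA mulr_sumr; apply: eq_bigr => r _.
rewrite big_split /= mulrCA; congr (_ * (_ * _)).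
by apply: eq_bigr => j _; rewrite tnth_mktuple mxE.
Qed.

(** Components in an orthonormal frame: when [invmx G = P *m P^T], they turn [tdot] into the
    standard scalar product ([tdot_conj]). *)
Definition tconj (P : 'M[R]_n) (T : tensor R n k) (r : idx) : R := \sum_(s : idx) T s * \prod_(j < k) P (s j) (r j).

Lemma tdot_conj (G P : 'M[R]_n) (S T : tensor R n k) : invmx G = P *m P^T ->
  tdot G S T = \sum_(r : idx) tconj P S r * tconj P T r.
Proof.
move=> GP; rewrite /tdot /tconj; under [RHS]eq_bigr => r _ do rewrite mulr_suml.
rewrite [RHS]exchange_big /=; apply: eq_bigr => s _.
under [RHS]eq_bigr => r _ do rewrite mulr_sumr.
rewrite [RHS]exchange_big /=; apply: eq_bigr => t _.
transitivity (S s * T t * \prod_(j < k) \sum_c P (s j) c * P (t j) c).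
  by congr (_ * _); apply: eq_bigr => j _; rewrite GP mxE; apply: eq_bigr => c _; rewrite [in LHS]mxE.
by rewrite bigA_distr_bigA mulr_sumr; apply: eq_bigr => r _; rewrite big_split /= mulrACA.
Qed.

Lemma tconj_tprod (P : 'M[R]_n) (w : k.-tuple (tensor R n 1)) (r : idx) :
  tconj P (tprod w) r = \prod_(j < k) (trow (tnth w j) *m P) 0 (r j).
Proof.
transitivity (\prod_(j < k) \sum_b tnth w j [ffun=> b] * P b (r j)).
  by rewrite bigA_distr_bigA; apply: eq_bigr => s _; rewrite /tprod -big_split.
by apply: eq_bigr => j _; rewrite mxE; apply: eq_bigr => b _; rewrite mxE.
Qed.

(** A crude estimate, component by component in an orthonormal frame. It serves to integrate the
    curvature against bounded gradients. *)
Lemma tdot_tprod_bound (G P : 'M[R]_n) (T : tensor R n k) (w : k.-tuple (tensor R n 1)) (B : R) :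
  invmx G = P *m P^T -> (forall j, Num.sqrt (tdot G (tnth w j) (tnth w j)) <= B) ->
  `|tdot G T (tprod w)| <= #|{: idx}|%:R * B ^+ k * Num.sqrt (tdot G T T).
Proof.
move=> GP wB; rewrite (tdot_conj _ _ GP).
have tT : tdot G T T = \sum_(r : idx) tconj P T r ^+ 2.
  by rewrite (tdot_conj _ _ GP); apply: eq_bigr => r _; rewrite expr2.
have Tr r : `|tconj P T r| <= Num.sqrt (tdot G T T).
  rewrite -sqrtr_sqr; apply: ler_wsqrtr; rewrite tT (bigD1 r)//= lerDl.
  by apply: sumr_ge0 => t _; exact: sqr_ge0.
have wr r : `|tconj P (tprod w) r| <= B ^+ k.
  rewrite tconj_tprod normr_prod -[k in leRHS]card_ord -prodr_const; apply: ler_prod => j _; rewrite normr_ge0/=.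
  apply: le_trans (wB j); rewrite tdot1 GP vdot_enorm sqrtr_sqr [X in _ <= X]ger0_norm ?enorm_ge0//.
  by apply: le_trans (norm_le_enorm _); exact: rV_coord_le.
apply: le_trans (ler_norm_sum _ _ _) _.
apply: (@le_trans _ _ (\sum_(r : idx) B ^+ k * Num.sqrt (tdot G T T))).
  by apply: ler_sum => r _; rewrite normrM mulrC ler_pM.
by rewrite sumr_const -[leLHS]mulr_natl mulrA.
Qed.

End TensorBounds.

Section MeasurableParam.
Variables (R : realType) (n : nat) (X : pmetricType R) (D : set X) (S : riem_structure R n D).
Local Notation V := 'rV[R]_n.

Lemma measurable_psi_fun (i : chart S) :
  measurable_fun (phi i @` dom i : set (borel V)) (psi i : borel V -> borel X).
Proof.
apply: (@measurability _ _ (borel V) (borel X) _ _ (@open X)); first by [].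
move=> _ [W oW <-]; apply: open_borel.
rewrite (_ : _ `&` _ = phi i @` (dom i `&` W)).
  rewrite openE => y [x [dx Wx] <-]; have iy : (phi i @` dom i) (phi i x) by exists x.
  have : nbhs (phi i x) ((phi i @` dom i) `&` psi i @^-1` W).
    apply: filterI; first by apply: open_nbhs_nbhs; split=> //; exact: img_open.
    by apply: (psi_continuous iy); apply: open_nbhs_nbhs; split=> //; rewrite phiK.
  by apply: filterS => z [[t dt <-]]; rewrite /= phiK// => Wt; exists t.
apply/seteqP; split=> [_ [[x dx <-]]|_ [x [dx Wx] <-]]; first by rewrite /= phiK// => Wx; exists x.
by split; [exists x|rewrite /= phiK].
Qed.

End MeasurableParam.

(** * Ricci and scalar curvature *)

Section Contractions.
Variables (R : realType) (n : nat).
Local Notation V := 'rV[R]_n.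
Implicit Types (e G : 'M[R]_n) (T : tensor R n 4).

(** Hence contracting over an orthonormal frame amounts to contracting with [invmx G], whichever
    frame is taken. *)
Lemma orthonormal_inv G e : orthonormal_basis G e -> e^T *m e = invmx G.
Proof.
move=> eG; have ue : e \in unitmx.
  by have := congr1 (fun M => M \in unitmx) eG; rewrite unitmx1 !unitmx_mul => /andP[/andP[]].
have GE : G *m (e^T *m e) = 1%:M.
  have h : e *m (G *m e^T) = 1%:M by rewrite mulmxA.
  by rewrite mulmxA (mulmx1C h).
have uG : G \in unitmx by have [] := mulmx1_unit GE.
by rewrite -[LHS](mulKmx uG) GE mulmx1.
Qed.

Definition coef4 T (a b c d : 'I_n) : R := T (fcons a (fcons b (fcons c (fcons d (fnil n))))).

Definition ric_coef (H : 'M[R]_n) T (b c : 'I_n) : R := \sum_a \sum_d H a d * coef4 T a b c d.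

Lemma sum_gram e (K : 'I_n -> 'I_n -> R) :
  \sum_j \sum_a \sum_d e j a * e j d * K a d = \sum_a \sum_d (e^T *m e) a d * K a d.
Proof.
rewrite exchange_big; apply: eq_bigr => a _; rewrite exchange_big; apply: eq_bigr => d _.
by rewrite mxE mulr_suml; apply: eq_bigr => j _; rewrite mxE.
Qed.

Lemma ric_contr_coef G e T (u w : V) : orthonormal_basis G e -> ric_contr e T u w =
  \sum_b \sum_c u 0 b * w 0 c * ric_coef (invmx G) T b c.
Proof.
move=> eG; rewrite /ric_contr.
transitivity (\sum_j \sum_b \sum_c u 0 b * w 0 c * \sum_a \sum_d e j a * e j d * coef4 T a b c d).
  apply: eq_bigr => j _; rewrite teval4 exchange_big; apply: eq_bigr => b _.
  rewrite exchange_big; apply: eq_bigr => c _; rewrite mulr_sumr; apply: eq_bigr => a _.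
  rewrite mulr_sumr; apply: eq_bigr => d _; rewrite !mxE /coef4; ring.
rewrite exchange_big; apply: eq_bigr => b _; rewrite exchange_big; apply: eq_bigr => c _.
by rewrite -mulr_sumr sum_gram (orthonormal_inv eG).
Qed.

Lemma sum_bvec2 (K : 'I_n -> 'I_n -> R) (b c : 'I_n) :
  \sum_b' \sum_c' (bvec R b) 0 b' * (bvec R c) 0 c' * K b' c' = K b c.
Proof.
rewrite -[RHS](sum_bvec (fun b => K b c)); apply: eq_bigr => b' _.
rewrite -[X in _ = X * _](sum_bvec (fun c => K b' c)) mulr_suml; apply: eq_bigr => c' _; ring.
Qed.

Lemma scal_contr_coef G e T : orthonormal_basis G e -> scal_contr e T =
  \sum_b \sum_c invmx G b c * ric_coef (invmx G) T b c.
Proof.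
move=> eG; have := sum_gram e (ric_coef (invmx G) T); rewrite (orthonormal_inv eG) => <-; apply: eq_bigr => j _.
by rewrite (ric_contr_coef _ _ _ eG); apply: eq_bigr => b _; apply: eq_bigr => c _; rewrite !mxE.
Qed.

Lemma fcons_inord (a b c d : 'I_n) : let s := fcons a (fcons b (fcons c (fcons d (fnil n)))) in
  [/\ s (inord 0) = a, s (inord 1) = b, s (inord 2) = c & s (inord 3) = d].
Proof.
have i0 : inord 0 = ord0 :> 'I_4 by apply: val_inj; rewrite /= inordK.
have i1 : inord 1 = lift ord0 ord0 :> 'I_4 by apply: val_inj; rewrite /= inordK.
have i2 : inord 2 = lift ord0 (lift ord0 ord0) :> 'I_4 by apply: val_inj; rewrite /= inordK.
have i3 : inord 3 = lift ord0 (lift ord0 (lift ord0 ord0)) :> 'I_4 by apply: val_inj; rewrite /= inordK.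
by rewrite /= i0 i1 i2 i3 !(fconsS, fcons0).
Qed.

(** In [riem_tensor] the last index has been lowered with [G]; contracting it with [invmx G] raises
    it again and leaves the trace that defines [ric_tensor]. *)
Lemma ric_tensor_coef (G : V -> 'M[R]_n) e (y : V) (b c : 'I_n) : G y \in unitmx -> orthonormal_basis (G y) e ->
  ric_coef (invmx (G y)) (riem_tensor G y) b c = tmat (ric_tensor G y) b c.
Proof.
move=> uG eG; have sG : (invmx (G y))^T = invmx (G y) by rewrite -(orthonormal_inv eG) trmx_mul trmxK.
have i0 : inord 0 = ord0 :> 'I_2 by apply: val_inj; rewrite /= inordK.
have i1 : inord 1 = lift ord0 ord0 :> 'I_2 by apply: val_inj; rewrite /= inordK.
rewrite mxE /ric_tensor i0 i1 !(fconsS, fcons0); apply: eq_bigr => a _.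
pose C := curv_op G (coord_field a) (coord_field b) (coord_field c) y.
transitivity ((C *m (G y *m (invmx (G y))^T)) 0 a); last by rewrite sG mulmxV// mulmx1.
rewrite mulmxA mxE; apply: eq_bigr => d _; rewrite [X in _ = _ * X]mxE mulrC; congr (_ * _).
rewrite /coef4 /riem_tensor; have [-> -> -> ->] := fcons_inord a b c d.
rewrite /vdot -/C [LHS]mxE -[RHS](sum_bvec (fun d => (C *m G y) 0 d)).
by apply: eq_bigr => k _; rewrite [in X in _ * X]mxE.
Qed.

Lemma ric_coef_ext H T T' b c : T =1 T' -> ric_coef H T b c = ric_coef H T' b c.
Proof. by move=> TT; apply: eq_bigr => a _; apply: eq_bigr => d _; rewrite /coef4 TT. Qed.

Lemma ric_contr_riem (G : V -> 'M[R]_n) T e (y u w : V) : G y \in unitmx -> T =1 riem_tensor G y ->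
  orthonormal_basis (G y) e -> ric_contr e T u w = teval (ric_tensor G y) [tuple u; w].
Proof.
move=> uG TR eG; rewrite (ric_contr_coef _ _ _ eG) teval2 vdotE.
apply: eq_bigr => b _; apply: eq_bigr => c _.
by rewrite (ric_coef_ext _ _ _ TR) (ric_tensor_coef _ _ uG eG) mulrAC.
Qed.

Lemma scal_contr_riem (G : V -> 'M[R]_n) T e (y : V) : G y \in unitmx -> T =1 riem_tensor G y ->
  orthonormal_basis (G y) e -> scal_contr e T = scal_curv G y.
Proof.
move=> uG TR eG; rewrite (scal_contr_coef _ eG); apply: eq_bigr => b _; apply: eq_bigr => c _.
rewrite (ric_coef_ext _ _ _ TR) (ric_tensor_coef _ _ uG eG) teval2 vdotE; congr (_ * _).
rewrite -[LHS](sum_bvec2 (fun b c => tmat (ric_tensor G y) b c) b c).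
by apply: eq_bigr => b' _; apply: eq_bigr => c' _; rewrite mulrAC.
Qed.

End Contractions.

(** * Test functions supported in a chart *)

Section Lift.
Variables (R : realType) (n : nat) (X : pmetricType R) (S : riem_structure R n (regular n X)).
Local Notation V := 'rV[R]_n.
Local Notation mX := (@hausdorffX R n X).
Local Notation mu := (@muV R n).
Hypothesis hS : locally_induces_dist S.
Hypothesis cS : forall (j : chart S) y, (phi j @` dom j) y -> forall a b, {for y, continuous (fun z => gram j z a b)}.
Variable U : set X.
Hypothesis oU : open U.
Hypothesis smS : smooth_metric_on S U.
Variables (i : chart S) (y0 : V) (rho c L : R).
Hypothesis rho0 : 0 < rho.
Hypothesis c0 : 0 < c.
Hypothesis L0 : 0 <= L.
Let Om : set V := phi i @` (dom i `&` U).
(** Functions will be supported in the cell of radius [rho]; the room up to [2 * rho] is for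
    [cell_far] and for the clamping in [chart_fun]. *)
Hypothesis inOm : forall y : V, `|y - y0| <= 2 * rho -> Om y.
Hypothesis cmp : forall y z : V, `|y - y0| <= 2 * rho -> `|z - y0| <= 2 * rho ->
  c * `|y - z| <= mdist (psi i y) (psi i z) <= L * `|y - z|.

Definition cell : set V := [set y | `|y - y0| <= rho].

Definition adm m (u : V -> R) := ck m setT u /\ forall y : V, rho < `|y - y0| -> u y = 0.

Definition lift_fun (u : V -> R) (x : X) : R := if x \in dom i then u (phi i x) else 0.

Lemma Om_dom y : Om y -> (phi i @` dom i) y.
Proof. by move=> [x [dx _] <-]; exists x. Qed.

Lemma open_Om : open Om. Proof. exact: open_chart_image. Qed.

Lemma cell_Om : cell `<=` Om.
Proof. by move=> y /= h; apply: inOm; apply: le_trans h _; rewrite ler_peMl ?ltW//; lra. Qed.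

Lemma cell_dom : cell `<=` phi i @` dom i.
Proof. by move=> y /cell_Om /Om_dom. Qed.

Lemma closed_cell : closed cell.
Proof.
rewrite (_ : cell = (fun y : V => `|y - y0|) @^-1` [set t | t <= rho])//.
apply: closed_comp (@closed_le R rho) => y _.
by apply: continuous_comp; [apply: continuousB => //; exact: cst_continuous|exact: norm_continuous].
Qed.

Lemma compact_cell : compact cell.
Proof.
apply: bounded_closed_compact closed_cell; exists (`|y0| + rho); split; first by rewrite num_real.
move=> t tb y /= h; apply: ltW; apply: le_lt_trans tb; rewrite -(subrK y0 y) addrC.
by apply: le_trans (ler_normD _ _) _; rewrite lerD2l.
Qed.

Lemma psi_cell_compact : compact (psi i @` cell).
Proof.
apply: continuous_compact compact_cell; apply: continuous_in_subspaceT => y /set_mem Ky.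
exact: psi_continuous (cell_dom Ky).
Qed.

Lemma psi_cell_closed : closed (psi i @` cell).
Proof. by apply: compact_closed psi_cell_compact; exact: metric_structure.metric_hausdorff. Qed.

Lemma lift_psi u y : (phi i @` dom i) y -> lift_fun u (psi i y) = u y.
Proof. by move=> iy; have [dy e] := img_phi iy; rewrite /lift_fun mem_set// e. Qed.

Lemma lift_out u x : (forall y : V, rho < `|y - y0| -> u y = 0) -> ~ (psi i @` cell) x -> lift_fun u x = 0.
Proof.
move=> u0 xK; rewrite /lift_fun; case: ifPn => // /set_mem dx; apply: u0; rewrite ltNge; apply/negP => h.
by apply: xK; exists (phi i x) => //; rewrite phiK.
Qed.

(** By compactness of the cell, one [eta] works for all its points. It separates the pairs that can
    be compared in the chart from those that are far apart. *)
Lemma cell_far : exists2 eta : R, 0 < eta & forall y x, cell y -> mdist (psi i y) x < eta ->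
  dom i x /\ `|phi i x - y0| <= 2 * rho.
Proof.
pose W : set X := dom i `&` phi0 (S := S) i @^-1` [set z | `|z - y0| < 2 * rho].
have oW : open W.
  rewrite openE => x [dx]; rewrite /phi0/= mem_set// => h.
  have : nbhs x (dom i) by apply: open_nbhs_nbhs; split=> //; exact: dom_open.
  have C : {for x, continuous (fun t => `|phi i t - y0|)}.
    apply: continuous_comp; last exact: norm_continuous.
    by apply: continuousB; [exact: phi_continuous|exact: cst_continuous].
  have := near_lt C h; apply: filterS2 => t ht dt; split=> //.
  by rewrite /phi0/= mem_set.
have KW : psi i @` cell `<=` W.
  move=> _ [y Ky <-]; have [dy e] := img_phi (cell_dom Ky); split=> //; rewrite /phi0/= mem_set// e.
  apply: le_lt_trans Ky _; rewrite ltr_pMl//; lra.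
have /compact_near_coveringP/(_ _ (0 : R)^'+ (fun e x => ball x e `<=` W) _) := psi_cell_compact.
have H x : (psi i @` cell) x -> \forall x' \near x & e \near 0^'+, ball (x' : X) (e : R) `<=` W.
  move=> /KW Wx; have /nbhs_ballP[e e0 eW] : nbhs x W by exact: open_nbhs_nbhs.
  have e2 : 0 < e / 2 by rewrite divr_gt0.
  exists (ball x (e / 2), [set t | t < e / 2]) => /=.
    by split; [exact: nbhsx_ballx|apply: nbhs_right_lt].
  move=> [x' t]/= [xx' te] z x'z; apply: eW; rewrite (splitr e); apply: ball_triangle xx' _.
  exact: le_ball (ltW te) _ x'z.
move=> /(_ H) N; near (0 : R)^'+ => eta; exists eta => // y x Ky yx.
have : W x.
  have : psi i @` cell `<=` (fun x => ball x eta `<=` W) by near: eta.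
  by apply; [exists y|rewrite metric_structure.ballEmdist].
by move=> [dx]; rewrite /phi0/= mem_set// => /ltW.
Unshelve. all: by end_near. Qed.

Lemma adm_lip u : adm 1 u -> exists K, lipV K u.
Proof.
move=> [cu u0]; apply: (@ck1_lip R n u (`|y0| + rho)) => // y h; apply: u0.
by have := ler_normB y y0; have := ler_normD (y - y0) y0; rewrite subrK; lra.
Qed.

Lemma adm_bound m u : adm m u -> exists2 B, 0 <= B & forall y, `|u y| <= B.
Proof.
move=> [cu u0]; have cK : compact (u @` cell).
  apply: continuous_compact compact_cell; apply: continuous_in_subspaceT => y _.
  exact: ck_continuous cu _.
have [B [_ HB]] := compact_bounded cK; exists (`|B| + 1); first by rewrite addr_ge0.
move=> y; have [h|h] := leP `|y - y0| rho; last by rewrite u0// normr0 addr_ge0.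
apply: (HB (`|B| + 1)); last by exists y.
by apply: le_lt_trans (ler_norm B) _; rewrite ltrDl.
Qed.

(** At distance below [eta] from a point of the cell the chart comparison applies; at larger
    distance the bound [2 * B] on the difference is absorbed by [2 * B / eta]. *)
Lemma LIP_lift u : adm 1 u -> LIP (lift_fun u).
Proof.
move=> au; have [K uK] := adm_lip au; have [B B0 uB] := adm_bound au; have u0 := au.2.
have [eta eta0 far] := cell_far.
have H x x' : (psi i @` cell) x -> `|lift_fun u x - lift_fun u x'| <= (`|K| / c + 2 * B / eta) * mdist x x'.
  move=> [y Ky <-]; have m0 : 0 <= mdist (psi i y) x' by exact: metric_structure.mdist_ge0.
  have [h|h] := ltP (mdist (psi i y) x') eta.
    have [dx' px'] := far _ _ Ky h; rewrite -{1}(phiK dx') !lift_psi; [|by exists x'|exact: cell_dom].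
    apply: le_trans (uK _ _) _; rewrite mulrDl -[leLHS]addr0 lerD//; last by rewrite !mulr_ge0// invr_ge0 ltW.
    have := cmp _ px'; rewrite phiK// => /(_ y).
    have y2 : `|y - y0| <= 2 * rho by apply: le_trans Ky _; rewrite ler_peMl ?ltW//; lra.
    have /andP[h1 _] := cmp y2 px'; rewrite phiK// in h1.
    move=> _; apply: le_trans (ler_wpM2r _ (ler_norm K)) _ => //.
    rewrite -mulrA ler_wpM2l// mulrC ler_pdivlMr//; lra.
  have b w : `|lift_fun u w| <= B by rewrite /lift_fun; case: ifP; rewrite ?normr0.
  apply: le_trans (ler_normB _ _) _; apply: le_trans (lerD (b _) (b _)) _.
  rewrite mulrDl -[leLHS]add0r lerD//; first by rewrite !mulr_ge0// invr_ge0 ltW.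
  have -> : B + B = 2 * B * 1 by ring.
  by rewrite -[2 * B / eta * _]mulrA ler_wpM2l ?mulr_ge0// mulrC ler_pdivlMr// mul1r.
exists (`|K| / c + 2 * B / eta) => x x'.
have [xK|xK] := pselect ((psi i @` cell) x); first exact: H.
have [x'K|x'K] := pselect ((psi i @` cell) x').
  by rewrite distrC metric_structure.metric_sym; exact: H.
rewrite !lift_out// subrr normr0 mulr_ge0 ?metric_structure.mdist_ge0//.
by rewrite addr_ge0// !mulr_ge0// invr_ge0 ltW.
Qed.

Lemma lift_near_in u (j : chart S) x : dom j x -> dom i x ->
  \forall z \near phi j x, (lift_fun u \o psi j) z = (u \o (phi i \o psi j)) z.
Proof.
move=> dj di; have : nbhs (phi j x) (phi j @` (dom j `&` dom i)).
  by apply: open_nbhs_nbhs; split; [exact: open_transition_dom|exists x].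
by apply: filterS => _ [t [tj ti] <-] /=; rewrite phiK// /lift_fun mem_set.
Qed.

Lemma lift_near_out m u (j : chart S) x : adm m u -> dom j x -> ~ (psi i @` cell) x ->
  \forall z \near phi j x, (lift_fun u \o psi j) z = 0.
Proof.
move=> [_ u0] dj xK; have : nbhs (phi j x) (phi j @` (dom j `&` ~` (psi i @` cell))).
  apply: open_nbhs_nbhs; split; last by exists x.
  by apply: open_chart_image; apply: closed_openC; exact: psi_cell_closed.
by apply: filterS => _ [t [tj tK] <-] /=; rewrite phiK//; exact: lift_out.
Qed.

(** Two open sets cover the chart [j]: on the domain of the chart [i] the lift is [u] after a
    transition map, and off the closed image of the cell it is 0. *)
Lemma ck_lift m u (j : chart S) : adm m u -> ck m (phi j @` dom j) (lift_fun u \o psi j).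
Proof.
move=> au; have o1 := @open_transition_dom R n X _ S j i.
have oK : open (~` (psi i @` cell)) by apply: closed_openC; exact: psi_cell_closed.
have o2 := @open_chart_image R n X S j _ oK.
apply: (@ck_sub _ _ m _ (phi j @` (dom j `&` dom i) `|` phi j @` (dom j `&` ~` (psi i @` cell)))).
  move=> _ [x dx <-]; have [xK|xK] := pselect ((psi i @` cell) x); last by right; exists x.
  left; exists x => //; split=> //; case: xK => y Ky <-; exact: (img_phi (cell_dom Ky)).1.
apply: ckU.
  apply: (@ck_ext _ _ m _ (u \o (phi i \o psi j))) => //.
    by move=> _ [t [tj ti] <-] /=; rewrite phiK// /lift_fun mem_set.
  exact: (@ck_comp R n _ o1 m setT (phi i \o psi j) u (fun b => ck_transition m j i b) (fun _ _ => I) au.1).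
apply: (@ck_ext _ _ m _ (fun=> 0)) => //; last exact: ck_cst.
by move=> _ [t [tj tK] <-] /=; rewrite phiK//; apply: esym; apply: lift_out => //; exact: au.2.
Qed.

Lemma near_lift_psi u y : (phi i @` dom i) y -> \forall z \near y, (lift_fun u \o psi i) z = u z.
Proof.
move=> iy; have : nbhs y (phi i @` dom i) by apply: open_nbhs_nbhs; split=> //; exact: img_open.
by apply: filterS => z; exact: lift_psi.
Qed.

(** [Om] and the complement of the cell are open and cover R^n. *)
Lemma admP m u : ck m Om u -> (forall y : V, rho < `|y - y0| -> u y = 0) -> adm m u.
Proof.
move=> cu u0; split=> //; have oC : open (~` cell) by apply: closed_openC; exact: closed_cell.
apply: (@ck_sub _ _ m _ (Om `|` ~` cell)).
  by move=> y _; have [/cell_Om|] := pselect (cell y); [left|right].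
apply: ckU => //; apply: (@ck_ext _ _ m _ (fun=> 0)) => //; last exact: ck_cst.
by move=> y; rewrite /cell/= => /negP; rewrite -ltNge => /u0.
Qed.

Lemma pd_out u a y : (forall y : V, rho < `|y - y0| -> u y = 0) -> rho < `|y - y0| -> pd a u y = 0.
Proof.
move=> u0 h; rewrite -(pd_cst (0 : R) a y); apply: near_eq_pd.
have oC : open (~` cell) by apply: closed_openC; exact: closed_cell.
have : nbhs y (~` cell) by apply: open_nbhs_nbhs; split=> //; rewrite /cell/=; apply/negP; rewrite -ltNge.
by apply: filterS => z; rewrite /cell/= => /negP; rewrite -ltNge => /u0.
Qed.

Lemma gramOm_ck m a b : ck m Om (fun y => gram i y a b).
Proof. by apply: smooth_ck; exact: smS. Qed.

Lemma gramOm_unit y : Om y -> gram i y \in unitmx.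
Proof. by move=> /Om_dom; exact: gram_unit. Qed.

Lemma gramOm_sym y : Om y -> (gram i y)^T = gram i y.
Proof. by move=> /Om_dom; exact: gram_sym. Qed.

Lemma adm_gam m u v : adm m.+1 u -> adm m.+1 v -> adm m (gam (gram i) u v).
Proof.
move=> [cu u0] [cv v0]; apply: admP => [|y h].
  apply: (ck_gam open_Om gramOm_unit gramOm_ck); [exact: ck_sub cu|exact: ck_sub cv].
by rewrite /gam big1// => a _; rewrite (pd_out _ v0 h) mulr0.
Qed.

Lemma dotX_lift u v x : adm 1 u -> adm 1 v -> regular n X x ->
  dotX S (dfun S (lift_fun u)) (dfun S (lift_fun v)) x = lift_fun (gam (gram i) u v) x.
Proof.
move=> au av rx; have [xK|xK] := pselect ((psi i @` cell) x).
  have dx : dom i x by case: xK => y Ky <-; exact: (img_phi (cell_dom Ky)).1.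
  have ix : (phi i @` dom i) (phi i x) by exists x.
  have d w : adm 1 w -> differentiable (lift_fun w \o psi i) (phi i x).
    by move=> aw; exact: (ck_differentiable (ck_lift i aw) ix).
  rewrite (dotX_chart rx dx (d _ au) (d _ av)) /lift_fun mem_set//.
  by apply: gam_near2; exact: near_lift_psi.
rewrite lift_out//; last by move=> y h; rewrite /gam big1// => a _; rewrite (pd_out _ av.2 h) mulr0.
have dj : dom (chart_at S x) x by exact: dom_chart_at.
have z w : adm 1 w -> trow (dfun S (lift_fun w) x) = 0.
  move=> aw; rewrite trow_dfun; apply/rowP => a; rewrite !mxE -(pd_cst (0 : R) a (Defs.coord S x)).
  by apply: near_eq_pd; exact: lift_near_out aw dj xK.
by rewrite dotX_vdot (z _ au) /vdot !mul0mx mxE.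
Qed.

Lemma open_regular : open (regular n X).
Proof.
rewrite (_ : regular n X = \bigcup_(j in [set: chart S]) dom j); last first.
  apply/seteqP; split=> [x rx|x [j _ dx]]; last exact: dom_sub dx.
  by exists (chart_at S x) => //; exact: dom_chart_at.
by apply: bigcup_open => j _; exact: dom_open.
Qed.

Lemma measurable_regular : measurable (regular n X : set (borel X)).
Proof. exact: open_borel open_regular. Qed.

Lemma measurable_cell : measurable (cell : set (borel V)).
Proof. exact: closed_borel closed_cell. Qed.

Lemma measurable_psi_cell : measurable (psi i @` cell : set (borel X)).
Proof. exact: closed_borel psi_cell_closed. Qed.

Lemma psi_cell_regular : psi i @` cell `<=` regular n X.
Proof. move=> _ [y Ky <-]; exact: dom_sub (img_phi (cell_dom Ky)).1. Qed.

Lemma LIP_continuous (f : X -> R) : LIP f -> continuous f.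
Proof.
move=> [K fK] x; apply/cvgrPdist_lt => e e0.
have K0 : 0 < `|K| + 1 by rewrite ltr_wpDl.
have : nbhs x (ball x (e / (`|K| + 1))) by apply: nbhsx_ballx; rewrite divr_gt0.
apply: filterS => z; rewrite metric_structure.ballEmdist/= => h.
apply: le_lt_trans (fK x z) _; have m0 := metric_structure.mdist_ge0 x z.
rewrite ltr_pdivlMr// in h; apply: le_lt_trans h; rewrite mulrC ler_wpM2l//.
by apply: le_trans (ler_norm K) _; rewrite lerDl.
Qed.

Lemma ck_measurable m g : ck m Om g -> measurable_fun (cell : set (borel V)) g.
Proof.
move=> cg; apply: (@measurable_funS _ _ (borel V) _ Om); first exact: open_borel open_Om.
  exact: cell_Om.
by apply: continuous_borel; [exact: open_Om|move=> y; exact: ck_continuous cg].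
Qed.

Lemma ck_cell_bound m g : ck m Om g -> exists2 B, 0 <= B & forall y, cell y -> `|g y| <= B.
Proof.
move=> cg; have cK : compact (g @` cell).
  apply: continuous_compact compact_cell; apply: continuous_in_subspaceT => y /set_mem Ky.
  exact: ck_continuous cg (cell_Om Ky).
have [B [_ HB]] := compact_bounded cK; exists (`|B| + 1); first by rewrite addr_ge0.
move=> y Ky; apply: (HB (`|B| + 1)); last by exists y.
by apply: le_lt_trans (ler_norm B) _; rewrite ltrDl.
Qed.

Lemma mu_cell_fin : (mu cell < +oo)%E.
Proof.
apply: le_lt_trans (muV_vball_fin n (`|y0| + rho)).
apply: le_measure; rewrite ?inE; [exact: measurable_cell|exact: measurable_vball|].
move=> y; rewrite /cell /vball/= => h; rewrite -(subrK y0 y) addrC.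
by apply: le_trans (ler_normD _ _) _; rewrite lerD2l.
Qed.

Lemma integrable_cell (A : set (borel V)) (g : V -> R) (B : R) : measurable A -> A `<=` cell ->
  measurable_fun A g -> (forall y, A y -> `|g y| <= B) -> mu.-integrable A (EFin \o g).
Proof.
move=> mA AK mg gB.
have Af : (mu A < +oo)%E.
  apply: le_lt_trans mu_cell_fin; apply: le_measure; rewrite ?inE//; exact: measurable_cell.
apply: (@le_integrable _ _ _ mu A mA (EFin \o g) (cst B%:E)) => //; first exact/measurable_EFinP.
  move=> y Ay /=; rewrite lee_fin; apply: le_trans (gB y Ay) _; exact: ler_norm.
apply/integrableP; split; first exact: measurable_cst.
by rewrite /= integral_cst//= lte_mul_pinfty.
Qed.

Lemma ck_integrable m g (A : set (borel V)) : ck m Om g -> measurable A -> A `<=` cell -> mu.-integrable A (EFin \o g).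
Proof.
move=> cg mA AK; have [B B0 gB] := ck_cell_bound cg.
apply: (@integrable_cell A g B) => // [|y /AK]; last exact: gB.
by apply: measurable_funS (ck_measurable cg) => //; exact: measurable_cell.
Qed.

Lemma ck_weight m : ck m Om (weight i).
Proof.
apply: (ck_sqrt open_Om) => [y Oy|]; last by apply: (ck_det open_Om) => a b; exact: gramOm_ck.
by rewrite -sqrtr_gt0; exact: weight_gt0 (Om_dom Oy).
Qed.

Lemma integralX_cell (F : X -> R) : (forall x, regular n X x -> ~ (psi i @` cell) x -> F x = 0) ->
  integralX n F = (\int[mX]_(x in psi i @` cell) (F x)%:E)%E.
Proof.
by move=> F0; apply: integral_zero_off => [|x rx xK]; [exact: psi_cell_regular|rewrite F0].
Qed.

Lemma integralX_lift u : ck 0 Om u -> (forall y : V, rho < `|y - y0| -> u y = 0) ->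
  integralX n (lift_fun u) = (\int[mu]_(y in cell) (u y * weight i y)%:E)%E.
Proof.
move=> cu u0; rewrite integralX_cell; last by move=> x _; exact: lift_out.
rewrite (transfer hS cS measurable_cell cell_dom); last first.
  apply: (@measurable_fun_eqD _ (borel V) R cell u); last exact: ck_measurable cu.
  by move=> y Ky; rewrite lift_psi//; exact: cell_dom.
by apply: eq_integral => y /set_mem Ky; rewrite lift_psi//; exact: cell_dom.
Qed.

Lemma integralX_lift_fin u : ck 0 Om u -> (forall y : V, rho < `|y - y0| -> u y = 0) ->
  (integralX n (lift_fun u) < +oo)%E.
Proof.
move=> cu u0; rewrite integralX_lift//.
have I : mu.-integrable cell (EFin \o (fun y => u y * weight i y)).
  apply: (@ck_integrable 0) => //; [|exact: measurable_cell].
  by apply: (ckM open_Om) => //; exact: ck_weight.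
by have := integrable_fin_num measurable_cell I; rewrite fin_numElt => /andP[].
Qed.

Lemma lift_M u v x : lift_fun u x * lift_fun v x = lift_fun (fun y => u y * v y) x.
Proof. by rewrite /lift_fun; case: ifP => //; rewrite mulr0. Qed.

Lemma adm_M m u v : adm m u -> ck m Om v -> adm m (fun y => u y * v y).
Proof.
move=> [cu u0] cv; apply: admP => [|y h]; last by rewrite u0// mul0r.
by apply: (ckM open_Om) => //; exact: ck_sub cu.
Qed.

Lemma adm_ck m k u : (k <= m)%N -> adm m u -> ck k Om u.
Proof. by move=> km [cu _]; apply: (ck_sub (fun _ _ => I)); exact: ck_le cu. Qed.

Lemma adm_le m k u : (k <= m)%N -> adm m u -> adm k u.
Proof. by move=> km [cu u0]; split=> //; exact: ck_le cu. Qed.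

Lemma L2_lift f u : adm 1 u -> (forall x, regular n X x -> f x = lift_fun u x) -> L2_fun n f.
Proof.
move=> au fu; split.
  apply: (@measurable_fun_eqD _ (borel X) R (regular n X) (lift_fun u)) => //.
  by apply: continuous_borel; [exact: open_regular|move=> x _; exact: (LIP_continuous (LIP_lift au))].
rewrite (_ : integralX n _ = integralX n (lift_fun (fun y => u y * u y))).
  apply: integralX_lift_fin; last by move=> y h; rewrite au.2// mul0r.
  by apply: (ckM open_Om); exact: (adm_ck _ au).
by apply: eq_integral => x /set_mem rx; rewrite fu// expr2 lift_M.
Qed.

Lemma gam_ge0 u y : Om y -> 0 <= gam (gram i) u u y.
Proof.
move=> Oy; rewrite (@gamE R n Om (gram i) gramOm_unit)//.
have [->|w0] := eqVneq (gvec (gram i) u y) 0; first by rewrite /vdot !mul0mx mxE.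
by apply: ltW; exact: gram_pos (Om_dom Oy) w0.
Qed.

Lemma lift_gam_ge0 u x : adm 1 u -> 0 <= lift_fun (gam (gram i) u u) x.
Proof.
move=> au; have [[y Ky <-]|xK] := pselect ((psi i @` cell) x).
  by rewrite lift_psi; [exact: gam_ge0 (cell_Om Ky)|exact: cell_dom].
by rewrite lift_out// => y h; rewrite /gam big1// => a _; rewrite (pd_out _ au.2 h) mulr0.
Qed.

Lemma Lp_dlift u : adm 1 u -> Lp_tensor S 2 (dfun S (lift_fun u)).
Proof.
move=> au; split.
  move=> k s; apply: (@measurable_fun_eqD _ (borel X) R (dom k) (fun x => pd (s ord0) (lift_fun u \o psi k) (phi k x))).
    move=> x dx; rewrite teval_jacobian//; first exact: dom_sub dx.
    by apply: (ck_differentiable (ck_lift k au)); exists x.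
  apply: continuous_borel; first exact: dom_open.
  move=> x dx; apply: (continuous_comp (phi_continuous dx)).
  by apply: (ck_continuous (ck_pd (s ord0) (ck_lift k au))); exists x.
rewrite (_ : integralX n _ = integralX n (lift_fun (gam (gram i) u u))).
  have [cg g0] := adm_gam au au.
  by apply: integralX_lift_fin => //; exact: ck_sub cg.
apply: eq_integral => x /set_mem rx; rewrite dotX_lift//.
by rewrite powR_mulrn ?sqrtr_ge0// sqr_sqrtr// lift_gam_ge0.
Qed.

(** The lift is Lipschitz, so a constant sequence approximates it. Agreement on the regular set is
    all that is asked of [f], because the lemma is applied to [dotX] of two differentials, which is
    a lift there. *)
Lemma is_diffH_lift f u : adm 1 u -> (forall x, regular n X x -> f x = lift_fun u x) -> is_diffH S f (dfun S (lift_fun u)).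
Proof.
move=> au fu; split; [exact: L2_lift au fu|exact: Lp_dlift|exists (fun=> lift_fun u); split].
- by move=> _; exact: LIP_lift.
- rewrite (_ : (fun=> _) = (fun=> 0%E)); first exact: cvg_cst.
  by apply/funext => k; apply: integral0_eq => x rx; rewrite fu// subrr expr0n.
- rewrite (_ : (fun=> _) = (fun=> 0%E)); first exact: cvg_cst.
  apply/funext => k; apply: integral0_eq => x rx /=; congr (_%:E).
  by rewrite /tdot big1// => s _; rewrite big1// => t _; rewrite /= subrr !mul0r.
Qed.

Definition wv u a (y : V) : R := weight i y * gvec (gram i) u y 0 a.

(* The Laplacian of the paper is [- div grad], that is [- w^-1 sum_a d_a (w g^{ab} d_b u)] with
   [w = sqrt(det g)]. *)
Definition lapf u (y : V) : R := - (weight i y)^-1 * \sum_a pd a (wv u a) y.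

Lemma adm_wv m u a : adm m.+1 u -> adm m (wv u a).
Proof.
move=> [cu u0]; apply: admP => [|y h].
  apply: (ckM open_Om); first exact: ck_weight.
  by apply: (ck_gvec open_Om gramOm_unit gramOm_ck); exact: ck_sub cu.
rewrite /wv /gvec mxE big1 ?mulr0// => b _; by rewrite mxE (pd_out _ u0 h) mul0r.
Qed.

Lemma adm_lapf m u : adm m.+2 u -> adm m (lapf u).
Proof.
move=> au; have aw a := adm_wv a au; apply: admP => [|y h].
  apply: (ckM open_Om).
    apply: (ckN open_Om); apply: (ckV open_Om); last exact: ck_weight.
    by move=> y Oy; apply: lt0r_neq0; exact: weight_gt0 (Om_dom Oy).
  by apply: (ck_sum open_Om) => a _; apply: ck_pd; apply: (ck_sub (fun _ _ => I)); exact: (aw a).1.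
by rewrite /lapf big1 ?mulr0// => a _; rewrite (pd_out _ (aw a).2 h).
Qed.

Lemma lapf_weight u y : Om y -> lapf u y * weight i y = - \sum_a pd a (wv u a) y.
Proof.
move=> Oy; have w0 : weight i y != 0 by apply: lt0r_neq0; exact: weight_gt0 (Om_dom Oy).
by rewrite /lapf !mulNr mulrAC mulVf// mul1r.
Qed.

Lemma integral_cell_all (g : V -> R) : (forall y : V, rho < `|y - y0| -> g y = 0) ->
  (\int[mu]_y (g y)%:E = \int[mu]_(y in cell) (g y)%:E)%E.
Proof.
by move=> g0; apply: integral_zero_off => // y _ /negP; rewrite /cell/= -ltNge => /g0 ->.
Qed.

(** [lip_ibp] along each axis. The density is already part of the field [wv], and [lapf] is
    normalised so as to restore it on the other side. *)
Lemma chart_ibp K F u : 0 <= K -> lipV K F -> adm 2 u ->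
  (\int[mu]_(y in cell) (\sum_a ddir F (bvec R a) y * wv u a y)%:E =
   \int[mu]_(y in cell) (F y * lapf u y * weight i y)%:E)%E.
Proof.
move=> K0 FK au; have aw a := adm_wv a au.
have mc := measurable_cell; have [Bf Bf0 FB] : exists2 B, 0 <= B & forall y, cell y -> `|F y| <= B.
  exists (`|F 0| + `|K| * (`|y0| + rho)); first by rewrite addr_ge0// mulr_ge0// addr_ge0// ltW.
  move=> y h; apply: (lipV_bound FK); rewrite -(subrK y0 y) addrC.
  by apply: le_trans (ler_normD _ _) _; rewrite lerD2l.
have mF : measurable_fun (cell : set (borel V)) F by apply: measurable_funTS; exact: lipV_measurable FK.
have I1 a : mu.-integrable cell (EFin \o (fun y => ddir F (bvec R a) y * wv u a y)).
  have [B B0 wB] := adm_bound (aw a).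
  apply: (@integrable_cell _ _ (K * `|bvec R a| * B)) => // [|y _].
    apply: measurable_funM; first by apply: measurable_funTS; exact: measurable_ddir FK.
    by apply: (@ck_measurable 1); exact: (adm_ck _ (aw a)).
  by rewrite normrM ler_pM//; exact: ddir_bound FK.
have I2 a : mu.-integrable cell (EFin \o (fun y => - (F y * pd a (wv u a) y))).
  have cp : ck 0 Om (pd a (wv u a)) by apply: ck_pd; exact: (adm_ck _ (aw a)).
  have [B B0 wB] := ck_cell_bound cp.
  apply: (@integrable_cell _ _ (Bf * B)) => // [|y Ky].
    apply: measurableT_comp => //; apply: measurable_funM => //; exact: ck_measurable cp.
  by rewrite normrN normrM ler_pM//; [exact: FB|exact: wB].
have E a : (\int[mu]_(y in cell) (ddir F (bvec R a) y * wv u a y)%:E = \int[mu]_(y in cell) (- (F y * pd a (wv u a) y))%:E)%E.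
  rewrite -!integral_cell_all.
  - have [L' wL] := adm_lip (aw a).
    apply: (@lip_ibp R n K L' F (wv u a) (bvec R a) (`|y0| + rho)) => //; first exact: (aw a).1.
      by rewrite addr_ge0// ltW.
    move=> y h; apply: (aw a).2.
    by have := ler_normD (y - y0) y0; rewrite subrK; lra.
  - by move=> y h; rewrite (pd_out _ (aw a).2 h) mulr0 oppr0.
  - by move=> y h; rewrite (aw a).2// mulr0.
transitivity (\sum_a \int[mu]_(y in cell) (ddir F (bvec R a) y * wv u a y)%:E)%E.
  have := @integral_sum _ _ _ mu cell mc _ (fun a => EFin \o (fun y => ddir F (bvec R a) y * wv u a y)) I1 (index_enum 'I_n) xpredT.
  by move=> <-; apply: eq_integral => y _; rewrite sumEFin.
rewrite (eq_bigr _ (fun a _ => E a)).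
have := @integral_sum _ _ _ mu cell mc _ (fun a => EFin \o (fun y => - (F y * pd a (wv u a) y))) I2 (index_enum 'I_n) xpredT.
move=> <-; apply: eq_integral => y /set_mem Ky; rewrite /= sumEFin; congr (_%:E).
by rewrite sumrN -mulr_sumr -mulrA (lapf_weight _ (cell_Om Ky)) mulrN.
Qed.

Lemma measurable_pull (A : set (borel V)) (g : V -> R) : measurable A -> A `<=` cell -> measurable_fun A g ->
  measurable_fun (psi i @` A : set (borel X)) (fun x : borel X => g (phi i x)).
Proof.
move=> mA AK mg; have Ai : A `<=` phi i @` dom i by move=> y /AK; exact: cell_dom.
apply: (@measurable_fun_eqD _ (borel X) R (psi i @` A) (g \o phi0 (S := S) i)).
  by move=> _ [y Ay <-]; have [dy e] := img_phi (Ai _ Ay); rewrite /phi0/= mem_set.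
apply: (measurable_comp mA _ mg).
  by move=> _ [_ [y Ay <-] <-]; have [dy e] := img_phi (Ai _ Ay); rewrite /phi0 mem_set// e.
by apply: measurable_funTS; exact: measurable_phi0.
Qed.

Lemma measurable_of_psi (A : set (borel V)) (F : X -> R) : measurable A -> A `<=` cell ->
  measurable_fun A (F \o psi i) -> measurable_fun (psi i @` A : set (borel X)) (F : borel X -> R).
Proof.
move=> mA AK mF; apply: (@measurable_fun_eqD _ (borel X) R _ (fun x => (F \o psi i) (phi i x))).
  by move=> _ [y Ay <-] /=; rewrite (img_phi (cell_dom (AK _ Ay))).2.
exact: measurable_pull.
Qed.

Lemma measurable_psiA (A : set (borel V)) : measurable A -> A `<=` cell -> measurable (psi i @` A : set (borel X)).
Proof. by move=> mA AK; apply: measurable_psi => // y /AK; exact: cell_dom. Qed.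

Lemma integrable_psi (A : set (borel V)) (F : X -> R) (M : R) : measurable A -> A `<=` cell ->
  measurable_fun A (F \o psi i) -> (forall y, A y -> `|F (psi i y)| <= M) -> mX.-integrable (psi i @` A) (EFin \o F).
Proof.
move=> mA AK mF FM; have Ai : A `<=` phi i @` dom i by move=> y /AK; exact: cell_dom.
apply/integrableP; split; first by apply/measurable_EFinP; exact: measurable_of_psi.
have -> : (\int[mX]_(x in psi i @` A) `|(EFin \o F) x| = \int[mX]_(x in psi i @` A) (`|F x|)%:E)%E by [].
have mN : measurable_fun A (fun y => `|F (psi i y)|) by apply: measurableT_comp mF; exact: normr_measurable.
rewrite (transfer hS cS mA Ai mN).
have [B B0 wB] := ck_cell_bound (ck_weight 0).
have mw := measurable_weightS cS Ai.
have I : mu.-integrable A (EFin \o (fun y => `|F (psi i y)| * weight i y)).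
  apply: (@integrable_cell A _ (M * B)) => //; first exact: measurable_funM.
  by move=> y Ay; rewrite normrM normr_id ler_pM//; [exact: FM|exact: wB (AK _ Ay)].
by have := integrable_fin_num mA I; rewrite fin_numElt => /andP[].
Qed.

Lemma measurable_dotX_lift u (w : tensor_field n X 1) : adm 1 u -> borel_section S w ->
  measurable_fun (psi i @` cell : set (borel X)) (dotX S (dfun S (lift_fun u)) w : borel X -> R).
Proof.
move=> au bw.
pose g x := \sum_a gvec (gram i) u (phi i x) 0 a *
    teval (w x) [tuple row ([ffun=> a] j) (Defs.jacobian (@phi _ _ _ _ S) (@psi _ _ _ _ S) i (chart_at S x) (phi i x)) | j < 1].
apply: (@measurable_fun_eqD _ (borel X) R (psi i @` cell) g).
  move=> _ [y Ky <-]; have [dx e] := img_phi (cell_dom Ky); have rx := dom_sub dx.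
  have dl : differentiable (lift_fun u \o psi i) (phi i (psi i y)).
    by apply: (ck_differentiable (ck_lift i au)); exists (psi i y).
  rewrite (dotX_chart_grad w rx dx dl); apply: eq_bigr => a _; congr (_ * _).
  by rewrite (@gvec_near R n (gram i) (lift_fun u \o psi i) u)//; apply: near_lift_psi; exists (psi i y).
apply: measurable_sum => a; apply: measurable_funM.
  apply: (@measurable_pull cell (fun y => gvec (gram i) u y 0 a) measurable_cell) => //.
  apply: (@ck_measurable 0); apply: (ck_gvec open_Om gramOm_unit gramOm_ck); exact: (adm_ck _ au).
apply: (@measurable_funS _ _ (borel X) _ (dom i)); last exact: bw.
  by apply: open_borel; exact: dom_open.
by move=> _ [y Ky <-]; exact: (img_phi (cell_dom Ky)).1.
Qed.

(* Clamping extends [F \o psi i] from a neighbourhood of the cell to a Lipschitz function on R^n. *)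
Definition chart_fun (F : X -> R) (y : V) : R := F (psi i (clamp y0 (2 * rho) y)).

Lemma chart_fun_lip (F : X -> R) : LIP F -> exists2 K, 0 <= K & lipV K (chart_fun F).
Proof.
move=> [K FK]; have r2 : 0 <= 2 * rho by rewrite mulr_ge0// ltW.
exists (`|K| * L); first exact: mulr_ge0.
move=> y z; apply: le_trans (FK _ _) _.
have /andP[_ h] := cmp (clamp_near y0 r2 y) (clamp_near y0 r2 z).
apply: le_trans (ler_wpM2r (metric_structure.mdist_ge0 _ _) (ler_norm K)) _.
rewrite -mulrA ler_wpM2l//; apply: le_trans h _; rewrite ler_wpM2l//; exact: clamp_lip.
Qed.

Lemma near_chart_fun (F : X -> R) y : cell y -> \forall z \near y, chart_fun F z = (F \o psi i) z.
Proof.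
move=> Ky; have r2 : 0 <= 2 * rho by rewrite mulr_ge0// ltW.
have C : {for y, continuous (fun z : V => `|z - y0|)}.
  by apply: continuous_comp; [apply: continuousB => //; exact: cst_continuous|exact: norm_continuous].
have h : `|y - y0| < 2 * rho by apply: le_lt_trans Ky _; rewrite ltr_pMl//; lra.
have := near_lt C h; apply: filterS => z zr; rewrite /chart_fun/= clamp_id//; exact: ltW.
Qed.

Lemma dotX_chart_fun u (F : X -> R) y : adm 1 u -> cell y -> differentiable (chart_fun F) y ->
  dotX S (dfun S (lift_fun u)) (dfun S F) (psi i y) = \sum_a ddir (chart_fun F) (bvec R a) y * gvec (gram i) u y 0 a.
Proof.
move=> au Ky dF; have [dx e] := img_phi (cell_dom Ky); have rx := dom_sub dx.
have dl : differentiable (lift_fun u \o psi i) (phi i (psi i y)).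
  by apply: (ck_differentiable (ck_lift i au)); exists (psi i y).
have dF' : differentiable (F \o psi i) y by apply: near_eq_differentiable dF; exact: near_chart_fun.
have dF'' : differentiable (F \o psi i) (phi i (psi i y)) by rewrite e.
rewrite (dotX_chart rx dx dl dF'') e.
have n1 : \near y, (lift_fun u \o psi i) y = u y by exact: near_lift_psi (cell_dom Ky).
have n2 : \near y, (F \o psi i) y = chart_fun F y by apply: filterS (near_chart_fun F Ky) => z ->.
rewrite (gam_near2 _ n1 n2) /gam; apply: eq_bigr => a _; rewrite mulrC; congr (_ * _).
by rewrite /ddir /patch mem_set//=; exact: diff_derivable.
Qed.

Lemma dotX_lift_out u (w : tensor_field n X 1) x : adm 1 u -> regular n X x -> ~ (psi i @` cell) x ->
  dotX S (dfun S (lift_fun u)) w x = 0.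
Proof.
move=> au rx xK; have dj : dom (chart_at S x) x by exact: dom_chart_at.
have z : trow (dfun S (lift_fun u) x) = 0.
  rewrite trow_dfun; apply/rowP => a; rewrite !mxE -(pd_cst (0 : R) a (Defs.coord S x)).
  by apply: near_eq_pd; exact: lift_near_out au dj xK.
by rewrite dotX_vdot z /vdot !mul0mx mxE.
Qed.

Lemma dotX_cs (w w' : tensor_field n X 1) x : regular n X x -> dotX S w w' x ^+ 2 <= dotX S w w x * dotX S w' w' x.
Proof. by move=> rx; have [P PG] := invmx_gram_sq S rx; rewrite !dotX_vdot PG; exact: vdot_cs. Qed.

Lemma dotX_ge0 (w : tensor_field n X 1) x : regular n X x -> 0 <= dotX S w w x.
Proof. by move=> rx; have [P PG] := invmx_gram_sq S rx; rewrite dotX_vdot PG vdot_enorm sqr_ge0. Qed.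

(** For each Lipschitz approximant of [h] the identity is [chart_ibp]. The limit is taken in L^1 on
    the cell: [pairing_cvg] turns the L^2 convergence of the approximants and of their differentials
    into convergence of the products. *)
Lemma is_lap_lift u : adm 3 u -> is_lap S (lift_fun u) (lift_fun (lapf u)).
Proof.
move=> au; have au1 : adm 1 u by exact: adm_le au.
have au2 : adm 2 u by exact: adm_le au.
have al : adm 1 (lapf u) by exact: adm_lapf.
split; first exact: L2_lift al _.
exists (dfun S (lift_fun u)); first exact: is_diffH_lift.
move=> h W' [[mh hfin] [bW' Wfin] [F [FL cF cW]]]; set W := dfun S (lift_fun u).
have l0 := lift_out al.2.
rewrite integralX_cell; last by move=> x rx xK; exact: dotX_lift_out.
rewrite integralX_cell; last by move=> x _ xK; rewrite l0// mulr0.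
(* One null set serves all [k]; off it, [dfun] of every approximant is a genuine differential and
   obeys the chain rule between charts. *)
have [N [mN N0 ND]] : {ae mu, forall y : V, forall k, differentiable (chart_fun (F k)) y}.
  by apply: ae_foralln => k; have [K K0 FK] := chart_fun_lip (FL k); exact: rademacher K0 FK.
pose A : set (borel V) := cell `\` N; have mc := measurable_cell.
have mA : measurable A by exact: measurableD.
have AK : A `<=` cell by move=> y [].
have Ai : A `<=` phi i @` dom i by move=> y /AK; exact: cell_dom.
have AD k y : A y -> differentiable (chart_fun (F k)) y.
  by move=> [_ Ny]; apply: contrapT => h0; apply: Ny; apply: ND => /= /(_ k).
have mCN : measurable (cell `&` N : set (borel V)) by exact: measurableI.
have CNi : cell `&` N `<=` phi i @` dom i by move=> y [/cell_dom].
have null : mX (psi i @` (cell `&` N)) = 0%E.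
  rewrite (hausdorffX_psi hS cS mCN CNi); apply: null_set_integral => //.
    by apply/measurable_EFinP; exact: measurable_weightS.
  exact: (subset_measure0 mCN mN (@subIsetr _ cell N) N0).
have mE := measurable_psiA mA AK; have mCNE := measurable_psiA mCN (@subIsetl _ cell N).
have EE : psi i @` cell `\` psi i @` (cell `&` N) = psi i @` A.
  apply/seteqP; split=> [_ [[y Ky <-] Ny]|_ [y [Ky Ny] <-]].
    by exists y => //; split=> // NN; apply: Ny; exists y.
  split; first by exists y.
  by move=> [z [Kz Nz] /(psi_inj (cell_dom Kz) (cell_dom Ky)) zy]; apply: Ny; rewrite -zy.
have EN (q : X -> R) : (\int[mX]_(x in psi i @` cell) (q x)%:E = \int[mX]_(x in psi i @` A) (q x)%:E)%E.
  by rewrite -EE; exact: (@integral_null_nomeas _ (borel X) R mX _ _ _ mCNE null).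
rewrite !EN.
have Ereg : psi i @` A `<=` regular n X by move=> x [y /AK Ky <-]; apply: psi_cell_regular; exists y.
have EK : psi i @` A `<=` psi i @` cell by move=> _ [y /AK Ky <-]; exists y.
have mEK (f : borel X -> R) : measurable_fun (psi i @` cell : set (borel X)) f -> measurable_fun (psi i @` A : set (borel X)) f.
  by apply: measurable_funS => //; exact: measurable_psi_cell.
have mER (f : borel X -> R) : measurable_fun (regular n X : set (borel X)) f -> measurable_fun (psi i @` A : set (borel X)) f.
  by apply: measurable_funS => //; exact: measurable_regular.
have mW : measurable_fun (psi i @` A : set (borel X)) (dotX S W W' : borel X -> R).
  by apply: mEK; exact: measurable_dotX_lift au1 bW'.
have mL : measurable_fun (regular n X : set (borel X)) (lift_fun (lapf u) : borel X -> R).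
  by apply: continuous_borel; [exact: open_regular|move=> x _; exact: (LIP_continuous (LIP_lift al))].
have mFk k : measurable_fun (regular n X : set (borel X)) (F k : borel X -> R).
  by apply: continuous_borel; [exact: open_regular|move=> x _; exact: (LIP_continuous (FL k))].
have KF k := chart_fun_lip (FL k).
pose g k y := \sum_a ddir (chart_fun (F k)) (bvec R a) y * gvec (gram i) u y 0 a.
have gE k y : A y -> dotX S W (dfun S (F k)) (psi i y) = g k y.
  by move=> Ay; apply: dotX_chart_fun => //; [exact: AK|exact: AD].
have cgv a : ck 0 Om (fun y => gvec (gram i) u y 0 a).
  by apply: (ck_gvec open_Om gramOm_unit gramOm_ck); exact: (adm_ck _ au).
have mg k : measurable_fun A (g k).
  apply: measurable_sum => a; apply: measurable_funM.
    by have [K K0 FK] := KF k; apply: measurable_funTS; exact: measurable_ddir FK.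
  by apply: measurable_funS (ck_measurable (cgv a)).
have mgE k : measurable_fun A (dotX S W (dfun S (F k)) \o psi i).
  by apply: (@measurable_fun_eqD _ (borel V) R A (g k)) => // y Ay; rewrite /= gE.
have gB k : exists B, forall y, A y -> `|g k y| <= B.
  have [K K0 FK] := KF k.
  have /fin_all_exists[B HB] a : exists B, forall y, cell y -> `|gvec (gram i) u y 0 a| <= B.
    by have [B _ HB] := ck_cell_bound (cgv a); exists B.
  exists (\sum_a K * `|bvec R a| * B a) => y /AK Ky; apply: le_trans (ler_norm_sum _ _ _) _.
  by apply: ler_sum => a _; rewrite normrM ler_pM//; [exact: ddir_bound FK|exact: HB].
apply: (@integral_eq_limit _ _ R mX _ _ _ (fun k => dotX S W (dfun S (F k))) (fun k x => F k x * lift_fun (lapf u) x)) => //.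
- by apply: measurable_funM; exact: mER.
- move=> k; have [B HB] := gB k; apply: (@integrable_psi A _ B) => // y Ay; rewrite gE//; exact: HB.
- move=> k; have [Bl Bl0 HBl] := adm_bound al; have [K K0 FK] := KF k.
  apply: (@integrable_psi A _ ((`|chart_fun (F k) 0| + `|K| * (`|y0| + rho)) * Bl)) => //.
    apply: (@measurable_fun_eqD _ (borel V) R A (fun y => chart_fun (F k) y * lapf u y)).
      move=> y Ay; have Ky := AK _ Ay; rewrite /= lift_psi; last exact: cell_dom.
      by rewrite (nbhs_singleton (near_chart_fun (F k) Ky)).
    apply: measurable_funM; first by apply: measurable_funTS; exact: lipV_measurable FK.
    by apply: measurable_funS (ck_measurable (adm_ck (leqnn 1) al)).
  move=> y Ay; have Ky := AK _ Ay; rewrite lift_psi; last exact: cell_dom.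
  rewrite normrM ler_pM// -[F k (psi i y)]/((F k \o psi i) y) -(nbhs_singleton (near_chart_fun (F k) Ky)).
  apply: (lipV_bound FK); rewrite -(subrK y0 y) addrC.
  by apply: le_trans (ler_normD _ _) _; rewrite lerD2l.
- move=> k; have [K K0 FK] := KF k.
  rewrite (transfer hS cS mA Ai (mgE k)) (transfer hS cS mA Ai); last first.
    apply: (@measurable_fun_eqD _ (borel V) R A (fun y => chart_fun (F k) y * lapf u y)).
      move=> y Ay; have Ky := AK _ Ay; rewrite lift_psi; last exact: cell_dom.
      by rewrite (nbhs_singleton (near_chart_fun (F k) Ky)).
    apply: measurable_funM; first by apply: measurable_funTS; exact: lipV_measurable FK.
    by apply: measurable_funS (ck_measurable (adm_ck (leqnn 1) al)).
  have := chart_ibp K0 FK au2.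
  have EV (q : V -> R) : (\int[mu]_(y in cell) (q y)%:E = \int[mu]_(y in A) (q y)%:E)%E.
    exact: (@integral_null_nomeas _ (borel V) R mu cell N _ mN N0).
  rewrite !EV => H.
  apply: etrans (etrans _ H) _.
    apply: eq_integral => y /set_mem Ay; rewrite gE// /g mulr_suml; congr (_%:E); apply: eq_bigr => a _.
    by rewrite /wv -mulrA [weight i y * _]mulrC.
  apply: eq_integral => y /set_mem Ay; have Ky := AK _ Ay; rewrite lift_psi; last exact: cell_dom.
  by rewrite (nbhs_singleton (near_chart_fun (F k) Ky)).
- apply: (@pairing_cvg _ _ R mX (regular n X) (psi i @` A) _ (fun k => dotX S (dfun S (F k) \- W') (dfun S (F k) \- W')) (dotX S W W)) => //.
  + move=> k; apply: measurable_funB => //; exact: measurable_of_psi.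
  + by apply: mEK; apply: measurable_dotX_lift => //; exact: (Lp_dlift au1).1.
  + by move=> x /Ereg; exact: dotX_ge0.
  + by move=> k x; exact: dotX_ge0.
  + move=> k x Ex; rewrite (_ : dotX S W (dfun S (F k)) x - dotX S W W' x = dotX S W (dfun S (F k) \- W') x).
      by apply: dotX_cs; exact: Ereg.
    by rewrite !dotX_grad -sumrB; apply: eq_bigr => a _; rewrite -mulrBr.
  + apply: le_lt_trans (_ : (integralX n (lift_fun (gam (gram i) u u)) < +oo)%E).
      apply: integral_le_nomeas => // x; first by move=> Ex; rewrite dotX_lift//; exact: Ereg.
      by move=> rx; rewrite lee_fin lift_gam_ge0.
    by have [cg g0] := adm_gam au1 au1; apply: integralX_lift_fin => //; exact: ck_sub cg.
- apply: (@pairing_cvg _ _ R mX (regular n X) (psi i @` A) (fun k x => F k x * lift_fun (lapf u) x - h x * lift_fun (lapf u) x) (fun k x => (F k x - h x) ^+ 2) (fun x => lift_fun (lapf u) x ^+ 2)) => //.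
  + by move=> k; apply: mER; apply: measurable_funB; apply: measurable_funM.
  + by apply: mER; apply: measurable_funX.
  + by move=> x _; exact: sqr_ge0.
  + by move=> k x _; exact: sqr_ge0.
  + by move=> k x _; rewrite -mulrBl exprMn mulrC.
  + apply: le_lt_trans (L2_lift al (fun _ _ => erefl)).2.
    by apply: integral_le_nomeas => // x _; rewrite lee_fin sqr_ge0.
Qed.

(** Two derivatives go into the Laplacian and the third one makes it Lipschitz. *)
Lemma TestF_lift u : adm 3 u -> TestF S (lift_fun u).
Proof.
move=> au; have al : adm 1 (lapf u) by exact: adm_lapf.
split; first by apply: LIP_lift; exact: adm_le au.
exists (lift_fun (lapf u)); first exact: is_lap_lift.
by exists (dfun S (lift_fun (lapf u))); exact: is_diffH_lift.
Qed.

(** * Cut-off coordinates and the passage to preferred charts *)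

Definition tau (j : chart S) : V -> V := phi i \o psi j.

(** Restricting to [U] makes the Gram matrices of both charts smooth there. *)
Definition overlap (j : chart S) : set V := phi j @` (dom j `&` (dom i `&` U)).

Lemma open_overlap j : open (overlap j).
Proof. by apply: open_chart_image; apply: openI => //; exact: dom_open. Qed.

Lemma overlap_dom j : overlap j `<=` phi j @` dom j.
Proof. by move=> _ [x [dx _] <-]; exists x. Qed.

Lemma tau_Om j z : overlap j z -> Om (tau j z).
Proof. by move=> [x [dj [di Ux]] <-]; rewrite /tau/= phiK//; exists x. Qed.

Lemma ck_tau_chart j m b : ck m (overlap j) (fun z => tau j z 0 b).
Proof.
apply: (@ck_sub _ _ m _ (phi j @` (dom j `&` dom i))); last exact: ck_transition.
by move=> _ [x [dj [di Ux]] <-]; exists x.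
Qed.

Lemma overlap_sym j z : overlap j z -> (gram j z)^T = gram j z.
Proof. by move=> /overlap_dom; exact: gram_sym. Qed.

Lemma overlap_unit j z : overlap j z -> gram j z \in unitmx.
Proof. by move=> /overlap_dom; exact: gram_unit. Qed.

Lemma overlap_ck j m a b : ck m (overlap j) (fun z => gram j z a b).
Proof.
apply: (@ck_sub _ _ m _ (phi j @` (dom j `&` U))); last by apply: smooth_ck; exact: smS.
by move=> _ [x [dj [di Ux]] <-]; exists x.
Qed.

Lemma overlap_compat j z : overlap j z -> gram j z = jmx (tau j) z *m gram i (tau j z) *m (jmx (tau j) z)^T.
Proof. by move=> [x [dj [di Ux]] <-]; apply: gram_transition; exists x. Qed.

Lemma coord_overlap x : dom i x -> U x -> overlap (chart_at S x) (Defs.coord S x) /\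
  tau (chart_at S x) (Defs.coord S x) = phi i x.
Proof.
move=> dx Ux; have dj : dom (chart_at S x) x by apply: dom_chart_at; exact: dom_sub dx.
by split; [exists x|rewrite /tau/= phiK].
Qed.

Lemma grad_lift u x : dom i x ->
  grad S (lift_fun u) x = gvec (gram (chart_at S x)) (u \o tau (chart_at S x)) (Defs.coord S x).
Proof.
move=> dx; rewrite grad_gvec; apply: gvec_near; apply: lift_near_in => //.
by apply: dom_chart_at; exact: dom_sub dx.
Qed.

(** On [core] the cut-off is 1, so the gradients of these functions form a basis there. Order 6
    covers all the derivatives taken below. *)
Definition xi (a : 'I_n) (y : V) : R := cutoff 6 (y0 - const_mx rho) (y0 + const_mx rho) (rho / 2) y * y 0 a.

Definition core : set V := [set y | `|y - y0| < rho / 2].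

Lemma core_cell : core `<=` cell.
Proof. by move=> y /ltW h; apply: le_trans h _; rewrite ler_pdivrMr// ler_peMr ?ltW//; lra. Qed.

Lemma core_cell_le y : `|y - y0| <= rho / 2 -> cell y.
Proof. by move=> h; apply: le_trans h _; rewrite ler_pdivrMr// ler_peMr ?ltW//; lra. Qed.

Lemma near_core y : core y -> nbhs y core.
Proof.
move=> h; have C : {for y, continuous (fun z : V => `|z - y0|)}.
  by apply: continuous_comp; [apply: continuousB => //; exact: cst_continuous|exact: norm_continuous].
exact: near_lt C h.
Qed.

Lemma rho2 : 0 < rho / 2. Proof. by rewrite divr_gt0. Qed.

Lemma xi_core a y : core y -> xi a y = y 0 a.
Proof.
move=> /ltW h; rewrite /xi cutoff1 ?mul1r ?rho2// => b.
have := le_trans (rV_coord_le (y - y0) b) h; rewrite !mxE ler_norml => /andP[h1 h2].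
by apply/andP; split; lra.
Qed.

Lemma adm_xi a : adm 6 (xi a).
Proof.
have oT : open (setT : set V) by exact: openT.
split; first by apply: (ckM oT); [exact: ck_cutoff|exact: ck_coord].
move=> y h; rewrite /xi; have [->|c0'] := eqVneq (cutoff 6 (y0 - const_mx rho) (y0 + const_mx rho) (rho / 2) y) 0.
  by rewrite mul0r.
have H := cutoff_neq0 rho2 c0'; suff : `|y - y0| <= rho by rewrite leNgt h.
apply/rV_normP; first exact: ltW.
by move=> b; have := H b; rewrite !mxE ler_norml => /andP[h1 h2]; apply/andP; split; lra.
Qed.

Lemma gvec_xi a y : core y -> gvec (gram i) (xi a) y = row a (invmx (gram i y)).
Proof.
move=> cy; have N : \near y, xi a y = y 0 a by apply: filterS (near_core cy) => z; exact: xi_core.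
rewrite (gvec_near (gram i) N); apply/rowP => b; rewrite /gvec 2!mxE (bigD1 a)//= big1 ?addr0 => [|d da].
  by rewrite mxE pd_coord eqxx mul1r.
by rewrite mxE pd_coord (negbTE da) mul0r.
Qed.

Lemma psi_core_U x : (psi i @` core) x -> [/\ dom i x, U x, core (phi i x) & regular n X x].
Proof.
move=> [y cy <-]; have Oy := cell_Om (core_cell cy); have [dx e] := img_phi (Om_dom Oy).
split; rewrite ?e//; last exact: dom_sub dx.
by case: Oy => t [dt Ut] <-; rewrite phiK.
Qed.

(** In the chart [i] the gradients are the rows of the inverse Gram matrix; the inverse Jacobian of
    [tau] carries them to the preferred chart, and both matrices are invertible. *)
Lemma grad_xi_basis x : (psi i @` core) x -> exists2 Q : 'M[R]_n, Q \in unitmx &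
  forall a, grad S (lift_fun (xi a)) x = row a Q.
Proof.
move=> /psi_core_U[dx Ux cx rx]; have [oz e] := coord_overlap dx Ux.
set j := chart_at S x in oz e *; set z := Defs.coord S x in oz e *.
have uJ := jmx_unit (@overlap_unit j) (@overlap_compat j) oz.
exists (invmx (gram i (phi i x)) *m invmx (jmx (tau j) z)).
  by rewrite unitmx_mul !unitmx_inv uJ gramOm_unit// -e; exact: tau_Om.
move=> a; rewrite grad_lift// -/j -/z row_mul -(gvec_xi a cx) -e.
have dxi : differentiable (xi a) (tau j z) by exact: (ck_differentiable (adm_ck (isT : 1 <= 6)%N (adm_xi a)) (tau_Om oz)).
rewrite -(@gvec_nat R n (overlap j) Om (gram i) (gram j) (tau j) (@tau_Om j) (@ck_tau_chart j) gramOm_unit (@overlap_unit j) (@overlap_compat j) _ _ oz dxi).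
by rewrite mulmxK.
Qed.

(** The scalar products of gradients that occur in [is_hess] are lifts of [gam], so their
    differentials are classical and [hmat_gam] applies. Finitely many pairs of cut-off coordinates
    are tested, and their gradients determine the matrix. *)
Lemma is_hess_lift u (H : tensor_field n X 2) : adm 5 u -> is_hess S (lift_fun u) H ->
  aeX n (fun x => (psi i @` core) x ->
    tmat (H x) = hmat (gram (chart_at S x)) (u \o tau (chart_at S x)) (Defs.coord S x)).
Proof.
move=> au [_ HH].
have ax a m : (m <= 6)%N -> adm m (xi a) by move=> m6; exact: adm_le m6 (adm_xi a).
have ag a b : adm 1 (gam (gram i) (xi a) (xi b)) by apply: adm_gam; exact: ax.
have agu a : adm 1 (gam (gram i) u (xi a)) by apply: adm_gam; [exact: adm_le au|exact: ax].
have au1 : adm 1 u by exact: adm_le au.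
have D p q : adm 1 p -> adm 1 q -> adm 1 (gam (gram i) p q) ->
    is_diffH S (dotX S (dfun S (lift_fun p)) (dfun S (lift_fun q))) (dfun S (lift_fun (gam (gram i) p q))).
  by move=> ap aq apq; apply: is_diffH_lift => // x rx; exact: dotX_lift.
have K a b := HH _ _ (TestF_lift (ax a 3 isT)) (TestF_lift (ax b 3 isT)) _ _ _
  (D u (xi b) au1 (ax b 1 isT) (agu b)) (D u (xi a) au1 (ax a 1 isT) (agu a)) (D (xi a) (xi b) (ax a 1 isT) (ax b 1 isT) (ag a b)).
have : {ae mX, forall x a b, regular n X x -> 2 * teval (H x) [tuple grad S (lift_fun (xi a)) x; grad S (lift_fun (xi b)) x] =
    dotX S (dfun S (lift_fun (xi a))) (dfun S (lift_fun (gam (gram i) u (xi b)))) x +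
    dotX S (dfun S (lift_fun (xi b))) (dfun S (lift_fun (gam (gram i) u (xi a)))) x -
    dotX S (dfun S (lift_fun u)) (dfun S (lift_fun (gam (gram i) (xi a) (xi b)))) x}.
  apply: (@ae_forall_fin _ (borel X) R mX) => a; apply: (@ae_forall_fin _ (borel X) R mX) => b; exact: K.
apply: (@ae_imp _ (borel X) R mX) => x Hx cx; have [dx Ux cpx rx] := psi_core_U cx.
have [oz e] := coord_overlap dx Ux; have [Q uQ gQ] := grad_xi_basis cx.
set j := chart_at S x in oz e *; set z := Defs.coord S x in oz e *.
have two0 : (2 : R) != 0 by [].
have Opx : Om (phi i x) by rewrite -e; exact: tau_Om.
have c2 a : ck 2 Om (xi a) by exact: (adm_ck (isT : 2 <= 6)%N (adm_xi a)).
have cu : ck 2 Om u by exact: (adm_ck (isT : 2 <= 5)%N au).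
have E a b : vdot (tmat (H x)) (grad S (lift_fun (xi a)) x) (grad S (lift_fun (xi b)) x) =
    vdot (hmat (gram j) (u \o tau j) z) (grad S (lift_fun (xi a)) x) (grad S (lift_fun (xi b)) x).
  rewrite -teval2; apply: (mulfI two0); rewrite (Hx a b rx).
  rewrite (dotX_lift (ax a 1 isT) (agu b) rx) (dotX_lift (ax b 1 isT) (agu a) rx) (dotX_lift au1 (ag a b) rx).
  rewrite /lift_fun mem_set// -(hmat_gam open_Om gramOm_sym gramOm_unit gramOm_ck cu (c2 a) (c2 b) Opx).
  rewrite !grad_lift// -/j -/z; congr (_ * _); apply: esym; rewrite -[in RHS]e.
  exact: (@hmat_gvec_nat R n (overlap j) Om (gram i) (gram j) (tau j) (@open_overlap j) open_Om
    (@tau_Om j) (@ck_tau_chart j) gramOm_sym gramOm_unit (@overlap_sym j) (@overlap_unit j) (@overlap_compat j)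
    gramOm_ck (@overlap_ck j) u (xi a) (xi b) z cu (c2 a) (c2 b) oz).
have uQT : Q^T \in unitmx by rewrite unitmx_tr.
apply: (can_inj (mulKmx uQ)); apply: (can_inj (mulmxK uQT)).
by apply/matrixP => a b; rewrite !mul3_vdot -!gQ.
Qed.

(** * The given Hessians in terms of the chart *)

Variable hess : (X -> R) -> tensor_field n X 2.
Hypothesis hhess : forall f, TestF S f -> is_hess S f (hess f).

(** Once [f1], ..., [f4] are cut-off coordinates, the identity of the curvature involves the
    Hessians of these [n] functions; the exceptional set is thus a finite union of null sets,
    independent of [f0]. *)
Definition good_hess (x : X) := forall a, tmat (hess (lift_fun (xi a)) x) =
  hmat (gram (chart_at S x)) (xi a \o tau (chart_at S x)) (Defs.coord S x).

Lemma ae_good_hess : aeX n (fun x => (psi i @` core) x -> good_hess x).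
Proof.
have : {ae mX, forall x a, (psi i @` core) x -> tmat (hess (lift_fun (xi a)) x) =
  hmat (gram (chart_at S x)) (xi a \o tau (chart_at S x)) (Defs.coord S x)}.
  apply: (@ae_forall_fin _ (borel X) R mX) => a; apply: is_hess_lift; first exact: adm_le (adm_xi a).
  by apply: hhess; apply: TestF_lift; exact: adm_le (adm_xi a).
by apply: (@ae_imp _ (borel X) R mX) => x H cx a; exact: H.
Qed.

Lemma xi_ck a m : (m <= 6)%N -> ck m Om (xi a).
Proof. by move=> m6; exact: adm_ck m6 (adm_xi a). Qed.

Lemma hess_PhiF x a b q3 : (psi i @` core) x -> good_hess x ->
  teval (hess (lift_fun (xi a)) x) [tuple grad S (lift_fun (xi b)) x; grad S (lift_fun (xi q3)) x] =
  PhiF (gram i) (xi a) (xi b) (xi q3) (phi i x).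
Proof.
move=> cx gx; have [dx Ux cpx rx] := psi_core_U cx; have [oz e] := coord_overlap dx Ux.
rewrite teval2 gx !grad_lift// -[in RHS]e.
apply: (@PhiF_nat R n (overlap (chart_at S x)) Om (gram i) (gram (chart_at S x)) (tau (chart_at S x)) (@open_overlap _) open_Om
  (@tau_Om _) (@ck_tau_chart _) gramOm_sym gramOm_unit (@overlap_sym _) (@overlap_unit _) (@overlap_compat _) gramOm_ck (@overlap_ck _)) => //; exact: xi_ck.
Qed.

Lemma hess_PF x a b q3 d : (psi i @` core) x -> good_hess x ->
  tdot (gram_at S x) (tslot (hess (lift_fun (xi a)) x) (grad S (lift_fun (xi b)) x)) (tslot (hess (lift_fun (xi d)) x) (grad S (lift_fun (xi q3)) x)) =
  PF (gram i) (xi a) (xi d) (xi b) (xi q3) (phi i x).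
Proof.
move=> cx gx; have [dx Ux cpx rx] := psi_core_U cx; have [oz e] := coord_overlap dx Ux.
rewrite tdot1 (trow_tslot (hess (lift_fun (xi a)) x)) (trow_tslot (hess (lift_fun (xi d)) x)).
rewrite (gx a) (gx d) (grad_lift (xi b) dx) (grad_lift (xi q3) dx) -[in RHS]e.
apply: (@PF_nat R n (overlap (chart_at S x)) Om (gram i) (gram (chart_at S x)) (tau (chart_at S x)) (@open_overlap _) open_Om
  (@tau_Om _) (@ck_tau_chart _) gramOm_sym gramOm_unit (@overlap_sym _) (@overlap_unit _) (@overlap_compat _) gramOm_ck (@overlap_ck _)) => //; exact: xi_ck.
Qed.

Lemma hess_BF x a b q3 d : (psi i @` core) x -> good_hess x ->
  teval (hess (lift_fun (xi a)) x) [tuple bracketX S hess (lift_fun (xi b)) (lift_fun (xi q3)) x; grad S (lift_fun (xi d)) x] =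
  BF (gram i) (xi a) (xi d) (xi b) (xi q3) (phi i x).
Proof.
move=> cx gx; have [dx Ux cpx rx] := psi_core_U cx; have [oz e] := coord_overlap dx Ux.
have E : bracketX S hess (lift_fun (xi b)) (lift_fun (xi q3)) x =
    bracket (gram (chart_at S x)) (xi b \o tau (chart_at S x)) (xi q3 \o tau (chart_at S x)) (Defs.coord S x).
  rewrite /bracketX /sharp /bracket -!gx -!grad_lift// -!trow_tslot; congr (_ *m _).
  by apply/rowP => q; rewrite !mxE.
rewrite teval2 E gx !grad_lift// -[in RHS]e.
apply: (@BF_nat R n (overlap (chart_at S x)) Om (gram i) (gram (chart_at S x)) (tau (chart_at S x)) (@open_overlap _) open_Om
  (@tau_Om _) (@ck_tau_chart _) gramOm_sym gramOm_unit (@overlap_sym _) (@overlap_unit _) (@overlap_compat _) gramOm_ck (@overlap_ck _)) => //; exact: xi_ck.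
Qed.

Lemma ck_mulmx_row m (v : V -> V) (M : V -> 'M[R]_n) b : (forall a, ck m Om (fun y => v y 0 a)) ->
  (forall a q3, ck m Om (fun y => M y a q3)) -> ck m Om (fun y => (v y *m M y) 0 b).
Proof.
move=> cv cM; apply: (@ck_ext _ _ m Om (fun y => \sum_a v y 0 a * M y a b) _ open_Om).
  by move=> y _; rewrite mxE.
by apply: (ck_sum open_Om) => a _; exact: (ckM open_Om (cv a) (cM a b)).
Qed.

Lemma ck_vdot m (M : V -> 'M[R]_n) (v w : V -> V) : (forall a, ck m Om (fun y => v y 0 a)) ->
  (forall a, ck m Om (fun y => w y 0 a)) -> (forall a q3, ck m Om (fun y => M y a q3)) -> ck m Om (fun y => vdot (M y) (v y) (w y)).
Proof.
move=> cv cw cM; apply: (@ck_ext _ _ m Om (fun y => \sum_a \sum_b v y 0 a * M y a b * w y 0 b) _ open_Om).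
  by move=> y _; rewrite vdotE.
apply: (ck_sum open_Om) => a _; apply: (ck_sum open_Om) => b _.
exact: (ckM open_Om (ckM open_Om (cv a) (cM a b)) (cw b)).
Qed.

Lemma gvec_xi_ck a m b : (m <= 5)%N -> ck m Om (fun y => gvec (gram i) (xi a) y 0 b).
Proof. by move=> m5; apply: (ck_gvec open_Om gramOm_unit gramOm_ck); exact: xi_ck. Qed.

Lemma hmat_xi_ck a m b q3 : (m <= 4)%N -> ck m Om (fun y => hmat (gram i) (xi a) y b q3).
Proof. by move=> m5; apply: (ck_hmat open_Om gramOm_unit gramOm_ck); exact: xi_ck. Qed.

Lemma PhiF_ck a b q3 : ck 1 Om (PhiF (gram i) (xi a) (xi b) (xi q3)).
Proof.
apply: ck_vdot => *; [exact: gvec_xi_ck|exact: gvec_xi_ck|exact: hmat_xi_ck].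
Qed.

Lemma PF_ck a b q3 d : ck 0 Om (PF (gram i) (xi a) (xi b) (xi q3) (xi d)).
Proof.
apply: ck_vdot => [e|e|e f].
- by apply: ck_mulmx_row => *; [exact: gvec_xi_ck|exact: hmat_xi_ck].
- by apply: ck_mulmx_row => *; [exact: gvec_xi_ck|exact: hmat_xi_ck].
- exact: (ck_invG open_Om gramOm_unit gramOm_ck).
Qed.

Lemma BF_ck a b q3 d : ck 0 Om (BF (gram i) (xi a) (xi b) (xi q3) (xi d)).
Proof.
have cb e f q : ck 0 Om (fun y => (gvec (gram i) (xi e) y *m hmat (gram i) (xi f) y) 0 q).
  by apply: ck_mulmx_row => *; [exact: gvec_xi_ck|exact: hmat_xi_ck].
apply: ck_vdot => [e|e|e f]; [|exact: gvec_xi_ck|exact: hmat_xi_ck].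
apply: ck_mulmx_row => [q|q q']; last exact: (ck_invG open_Om gramOm_unit gramOm_ck).
have := ckB open_Om (cb q3 d q) (cb d q3 q).
by apply: (@ck_ext _ _ 0 Om _ _ open_Om) => y _; rewrite [RHS]mxE [X in _ = _ + X]mxE.
Qed.

Lemma gamPhi_ck a b q3 d : ck 0 Om (gam (gram i) (xi a) (PhiF (gram i) (xi b) (xi q3) (xi d))).
Proof. by apply: (ck_gam open_Om gramOm_unit gramOm_ck); [exact: xi_ck|exact: PhiF_ck]. Qed.

Lemma curvF_ck a b q3 d : ck 0 Om (curvF (gram i) (xi a) (xi b) (xi q3) (xi d)).
Proof.
apply: (ckB open_Om); last exact: BF_ck.
by apply: (ckB open_Om); apply: (ckB open_Om); [exact: gamPhi_ck|exact: PF_ck|exact: gamPhi_ck|exact: PF_ck].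
Qed.

Lemma grad_lift_jacobian u x : adm 1 u -> (psi i @` cell) x -> grad S (lift_fun u) x =
  gvec (gram i) u (phi i x) *m Defs.jacobian (@phi _ _ _ _ S) (@psi _ _ _ _ S) i (chart_at S x) (phi i x).
Proof.
move=> au [y Ky <-]; have [dx e] := img_phi (cell_dom Ky); have rx := dom_sub dx.
have ix : (phi i @` dom i) (phi i (psi i y)) by exists (psi i y).
have dl : differentiable (lift_fun u \o psi i) (phi i (psi i y)) by exact: (ck_differentiable (ck_lift i au) ix).
by rewrite (grad_chart rx dx dl); congr (_ *m _); apply: gvec_near; exact: near_lift_psi.
Qed.

(** * The defining identity of the curvature, read in the chart *)

Variable RX : tensor_field n X 4.
Hypothesis hRX : is_curvX S hess RX.
Local Notation idx4 := {ffun 'I_4 -> 'I_n}.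

Definition curv_grad (s : idx4) (x : X) : R := teval (RX x) [tuple grad S (lift_fun (xi (s j))) x | j < 4].

Lemma adm_xi1 a : adm 1 (xi a). Proof. exact: adm_le (adm_xi a). Qed.

Lemma Lp_RX : Lp_tensor S 1 RX.
Proof. by apply: hRX.1; rewrite lexx/=; lra. Qed.

Lemma measurable_curv_grad s : measurable_fun (psi i @` cell : set (borel X)) (curv_grad s : borel X -> R).
Proof.
pose g x := \sum_(r : idx4) (\prod_(j < 4) gvec (gram i) (xi (s j)) (phi i x) 0 (r j)) *
  teval (RX x) [tuple row (r j) (Defs.jacobian (@phi _ _ _ _ S) (@psi _ _ _ _ S) i (chart_at S x) (phi i x)) | j < 4].
apply: (@measurable_fun_eqD _ (borel X) R (psi i @` cell) g).
  move=> x Kx; rewrite /g -teval_mulmx; congr (teval _ _); apply: eq_from_tnth => j.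
  by rewrite !tnth_mktuple (grad_lift_jacobian (adm_xi1 _) Kx).
apply: measurable_sum => r; apply: measurable_funM.
  apply: measurable_prod => j _.
  apply: (@measurable_pull cell (fun y => gvec (gram i) (xi (s j)) y 0 (r j)) measurable_cell) => //.
  by apply: (@ck_measurable 0); exact: gvec_xi_ck.
apply: (@measurable_funS _ _ (borel X) _ (dom i)); last exact: Lp_RX.1.
  by apply: open_borel; exact: dom_open.
by move=> _ [y Ky <-]; exact: (img_phi (cell_dom Ky)).1.
Qed.

Lemma curv_grad_bound s : exists2 C, 0 <= C & forall x, (psi i @` cell) x ->
  `|curv_grad s x| <= C * Num.sqrt (dotX S RX RX x).
Proof.
have /fin_all_exists[B HB] a : exists B, forall y, `|gam (gram i) (xi a) (xi a) y| <= B.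
  by have [B _ HB] := adm_bound (adm_gam (adm_xi1 a) (adm_xi1 a)); exists B.
pose M := \sum_a Num.sqrt (B a); have M0 : 0 <= M by apply: sumr_ge0 => a _; exact: sqrtr_ge0.
exists (#|{: idx4}|%:R * M ^+ 4); first by rewrite mulr_ge0// exprn_ge0.
move=> x Kx; have rx : regular n X x by exact: psi_cell_regular.
have [P PG] := invmx_gram_sq S rx.
have sG : (invmx (gram_at S x))^T = invmx (gram_at S x) by rewrite PG trmx_mul trmxK.
have -> : curv_grad s x = tdot (gram_at S x) (RX x) (tprod [tuple dfun S (lift_fun (xi (s j))) x | j < 4]).
  rewrite (tdot_tprod _ _ sG); congr (teval _ _); apply: eq_from_tnth => j; by rewrite !tnth_mktuple.
apply: (tdot_tprod_bound _ PG) => j; rewrite tnth_mktuple.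
rewrite -[tdot _ _ _]/(dotX S (dfun S (lift_fun (xi (s j)))) (dfun S (lift_fun (xi (s j)))) x).
rewrite (dotX_lift (adm_xi1 _) (adm_xi1 _) rx).
apply: (@le_trans _ _ (Num.sqrt (B (s j)))).
  apply: ler_wsqrtr; have B0 : 0 <= B (s j) by apply: le_trans (HB (s j) 0).
  by rewrite /lift_fun; case: ifP => // _; apply: le_trans (HB (s j) _); exact: ler_norm.
by rewrite /M (bigD1 (s j))//= lerDl; apply: sumr_ge0 => a _; exact: sqrtr_ge0.
Qed.

(** [RX] is in L^1, the exponent [q = 1] of [is_curvX], and the gradients of the cut-off coordinates
    are bounded. [C + 1] replaces [C] in order to divide by it. *)
Lemma integrable_curv_grad s : mX.-integrable (psi i @` cell) (EFin \o curv_grad s).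
Proof.
have [C C0 HC] := curv_grad_bound s; have mK := measurable_psi_cell; have mT := measurable_curv_grad s.
have C1 : 0 < C + 1 by rewrite ltr_wpDl.
have I : mX.-integrable (psi i @` cell) (EFin \o (fun x => (C + 1)^-1 * curv_grad s x)).
  apply/integrableP; split.
    by apply/measurable_EFinP; apply: measurable_funM => //; exact: measurable_cst.
  apply: le_lt_trans Lp_RX.2; apply: integral_le_nomeas.
  - exact: psi_cell_regular.
  - move=> x Kx; rewrite /= lee_fin powRr1 ?sqrtr_ge0// normrM gtr0_norm ?invr_gt0// ler_pdivrMl//.
    by apply: le_trans (HC x Kx) _; rewrite ler_wpM2r ?sqrtr_ge0// lerDl.
  - by move=> x _; rewrite lee_fin powR_ge0.
have := @integrableZl _ _ R mX _ mK (C + 1) _ I.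
by apply: eq_integrable => // x _ /=; rewrite -EFinM mulrA mulfV ?mul1r// lt0r_neq0.
Qed.

Lemma measurable_curv_grad_psi s : measurable_fun (cell : set (borel V)) (curv_grad s \o psi i).
Proof.
apply: (@measurable_comp _ _ _ (borel V) (borel X) _ (psi i @` cell : set (borel X))) (measurable_curv_grad s) _ => //.
- exact: measurable_psi_cell.
- apply: (@measurable_funS _ _ (borel V) _ (phi i @` dom i)); last exact: measurable_psi_fun.
    by apply: open_borel; exact: img_open.
  exact: cell_dom.
Qed.

Lemma integrable_curv_grad_psi s : mu.-integrable cell (EFin \o (fun y => curv_grad s (psi i y) * weight i y)).
Proof.
have mT := measurable_curv_grad_psi s; have mc := measurable_cell; have Ki := cell_dom.
apply/integrableP; split.
  by apply/measurable_EFinP; apply: measurable_funM => //; exact: measurable_weightS.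
have /integrableP[_] := integrable_curv_grad s; apply: le_lt_trans.
have -> : (\int[mX]_(x in psi i @` cell) `|(EFin \o curv_grad s) x| = \int[mX]_(x in psi i @` cell) (`|curv_grad s x|)%:E)%E by [].
rewrite (@transfer R n X _ S hS cS i cell (fun x => `|curv_grad s x|) mc Ki); last first.
  by apply: measurableT_comp mT; exact: normr_measurable.
rewrite le_eqVlt; apply/orP; left; apply/eqP; apply: eq_integral => y _ /=.
by rewrite normrM (ger0_norm (weight_ge0 _ _)).
Qed.

Section TestFunction.
Variables (u0 : V -> R) (r' : R).
Hypothesis cu0 : ck 6 setT u0.
Hypothesis r'rho : r' < rho / 2.
(** The support of [u0] is strictly inside [core], where the Hessians and gradients of the cut-off
    coordinates are identified. *)
Hypothesis u0off : forall y : V, r' < `|y - y0| -> u0 y = 0.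

Lemma core_off y : ~ core y -> r' < `|y - y0|.
Proof. by move=> /negP; rewrite /core/= -leNgt; exact: lt_le_trans. Qed.

Lemma cell_core_off y : rho < `|y - y0| -> ~ core y.
Proof. by move=> h /core_cell; rewrite /cell/= leNgt h. Qed.

Lemma adm_u0 : adm 6 u0.
Proof. by split=> // y /cell_core_off /core_off; exact: u0off. Qed.

Lemma u0_core_off y : ~ core y -> u0 y = 0.
Proof. by move=> /core_off; exact: u0off. Qed.

Lemma gam_u0_off v y : ~ core y -> gam (gram i) u0 v y = 0.
Proof.
move=> cy; have C : {for y, continuous (fun z : V => `|z - y0|)}.
  by apply: continuous_comp; [apply: continuousB => //; exact: cst_continuous|exact: norm_continuous].
have N : \near y, u0 y = 0 by apply: filterS (near_gt C (core_off cy)) => z; exact: u0off.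
rewrite /gam (gvec_near _ (N : \near y, u0 y = (fun=> 0 : R) y)) big1// => a _.
by rewrite /gvec mxE big1 ?mul0r// => b _; rewrite mxE pd_cst mul0r.
Qed.

Lemma lift_core_off v x : (forall y, ~ core y -> v y = 0) -> ~ (psi i @` core) x -> lift_fun v x = 0.
Proof.
move=> v0 xc; rewrite /lift_fun; case: ifPn => // /set_mem dx; apply: v0 => cx; apply: xc.
by exists (phi i x) => //; rewrite phiK.
Qed.

(** An integrand built from [hess] agrees with the lift of a classical one except where [good_hess]
    fails, which is a null set of [core]; the integral can then be moved to R^n. *)
Lemma integralX_core (F : X -> R) (v : V -> R) : ck 0 Om v -> (forall y, ~ core y -> v y = 0) ->
  (forall x, regular n X x -> ~ (psi i @` core) x -> F x = 0) ->
  (forall x, (psi i @` core) x -> good_hess x -> F x = v (phi i x)) ->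
  integralX n F = (\int[mu]_(y in cell) (v y * weight i y)%:E)%E.
Proof.
move=> cv v0 F0 Fv; rewrite -(integralX_lift cv); last by move=> y /cell_core_off; exact: v0.
apply: (@ae_eq_integral_nomeas _ (borel X) R mX).
have := ae_good_hess; apply: (@ae_imp _ (borel X) R mX) => x H rx; congr (_%:E).
have [cx|cx] := pselect ((psi i @` core) x); last by rewrite F0// lift_core_off.
have [dx _ _ _] := psi_core_U cx; rewrite (Fv x cx (H cx)).
by rewrite /lift_fun mem_set.
Qed.

(** [chart_ibp] is applied to [h = u0 * Phi] and [xi a1]. By Leibniz, [gam (xi a1) h] is the sum of
    the term with the gradient of [u0], which is to disappear, and of [u0 * gam (xi a1) Phi], which
    is to stay. *)
Lemma integral_Delta_term a1 a2 a3 a4 :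
  integralX n (fun x => (- dotX S (dfun S (lift_fun u0)) (dfun S (lift_fun (xi a1))) x + lift_fun u0 x * lift_fun (lapf (xi a1)) x) *
     teval (hess (lift_fun (xi a3)) x) [tuple grad S (lift_fun (xi a2)) x; grad S (lift_fun (xi a4)) x]
   - lift_fun u0 x * tdot (gram_at S x) (tslot (hess (lift_fun (xi a3)) x) (grad S (lift_fun (xi a2)) x))
       (tslot (hess (lift_fun (xi a4)) x) (grad S (lift_fun (xi a1)) x))) =
  (\int[mu]_(y in cell) (u0 y * (gam (gram i) (xi a1) (PhiF (gram i) (xi a3) (xi a2) (xi a4)) y
     - PF (gram i) (xi a3) (xi a4) (xi a2) (xi a1) y) * weight i y)%:E)%E.
Proof.
pose Phi := PhiF (gram i) (xi a3) (xi a2) (xi a4); pose P := PF (gram i) (xi a3) (xi a4) (xi a2) (xi a1).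
pose v y := (- gam (gram i) u0 (xi a1) y + u0 y * lapf (xi a1) y) * Phi y - u0 y * P y.
have au1 : adm 1 u0 by exact: adm_le adm_u0.
have c0u : ck 0 Om u0 by exact: (adm_ck _ adm_u0).
have c1u : ck 1 Om u0 by exact: (adm_ck _ adm_u0).
have cP : ck 0 Om P by exact: PF_ck.
have c1Phi : ck 1 Om Phi by exact: PhiF_ck.
have c0Phi : ck 0 Om Phi by exact: ckW c1Phi.
have cl : ck 0 Om (lapf (xi a1)) by apply: (@adm_ck 0 0) => //; apply: adm_lapf; exact: adm_le (adm_xi a1).
have cg : ck 0 Om (gam (gram i) u0 (xi a1)) by apply: (ck_gam open_Om gramOm_unit gramOm_ck) => //; exact: xi_ck.
have cv : ck 0 Om v.
  apply: (ckB open_Om); last exact: (ckM open_Om).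
  apply: (ckM open_Om) => //; apply: (ckD open_Om); [exact: (ckN open_Om)|exact: (ckM open_Om)].
rewrite (@integralX_core _ v cv).
- pose h y := u0 y * Phi y; have ah : adm 1 h by exact: adm_M au1 c1Phi.
  have [K hK] := adm_lip ah; have hK' : lipV `|K| h.
    by move=> y z; apply: le_trans (hK y z) _; rewrite ler_wpM2r// ler_norm.
  have ibp := chart_ibp (normr_ge0 K) hK' (adm_le (isT : 2 <= 6)%N (adm_xi a1)).
  have dh y : differentiable h y by exact: (ck_differentiable ah.1 I).
  have qE y : \sum_a ddir h (bvec R a) y * wv (xi a1) a y = weight i y * gam (gram i) (xi a1) h y.
    rewrite /gam mulr_sumr; apply: eq_bigr => a _; rewrite /ddir /patch mem_set/=; last exact: diff_derivable.
    rewrite /wv -[pd a h y]/('D_(bvec R a) h y).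
    by move: ('D_(bvec R a) h y) (weight i y) (gvec _ _ y 0 a) => p1 p2 p3; ring.
  pose A y := u0 y * (gam (gram i) (xi a1) Phi y - P y) * weight i y.
  have cw := ck_weight 0; have mc := measurable_cell.
  have iv : mu.-integrable cell (EFin \o (fun y => v y * weight i y)).
    by apply: (@ck_integrable 0) => //; exact: (ckM open_Om).
  have iA : mu.-integrable cell (EFin \o A).
    apply: (@ck_integrable 0) => //; apply: (ckM open_Om) => //; apply: (ckM open_Om) => //.
    by apply: (ckB open_Om) => //; exact: gamPhi_ck.
  have iq : mu.-integrable cell (EFin \o (fun y => weight i y * gam (gram i) (xi a1) h y)).
    apply: (@ck_integrable 0) => //; apply: (ckM open_Om) => //.
    by apply: (ck_gam open_Om gramOm_unit gramOm_ck); [exact: xi_ck|exact: (adm_ck _ ah)].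
  have ip : mu.-integrable cell (EFin \o (fun y => h y * lapf (xi a1) y * weight i y)).
    by apply: (@ck_integrable 0) => //; do 2 (apply: (ckM open_Om) => //); exact: (ckM open_Om).
  have ibp' : (\int[mu]_(y in cell) (weight i y * gam (gram i) (xi a1) h y)%:E =
      \int[mu]_(y in cell) (h y * lapf (xi a1) y * weight i y)%:E)%E.
    by rewrite -ibp; apply: eq_integral => y _; rewrite qE.
  (* The integrands agree pointwise after these additions. The two added integrals are equal by
     [ibp'] and finite, so they cancel. *)
  have E : (\int[mu]_(y in cell) (v y * weight i y)%:E + \int[mu]_(y in cell) (weight i y * gam (gram i) (xi a1) h y)%:E =
      \int[mu]_(y in cell) (A y)%:E + \int[mu]_(y in cell) (h y * lapf (xi a1) y * weight i y)%:E)%E.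
    have := integralD_EFin mc iv iq => /= <-; have := integralD_EFin mc iA ip => /= <-.
    apply: eq_integral => y /set_mem Ky; congr (_%:E); have Oy := cell_Om Ky.
    have gh : gam (gram i) (xi a1) h y = gam (gram i) u0 (xi a1) y * Phi y + u0 y * gam (gram i) (xi a1) Phi y.
      rewrite (@gamC R n Om (gram i) gramOm_sym gramOm_unit u0)// /gam mulr_suml mulr_sumr -big_split.
      apply: eq_bigr => a _; rewrite /h (pdM a (ck_differentiable c1u Oy) (ck_differentiable c1Phi Oy)) /=; ring.
    by rewrite gh /v /A /h; ring.
  move: E; rewrite ibp'.
  have fp := integrable_fin_num mc ip; have fA := integrable_fin_num mc iA; have fv := integrable_fin_num mc iv.
  rewrite /= in fp fA fv; rewrite -(fineK fp) -(fineK fA) -(fineK fv) -!EFinD => -[/addIr ->].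
  by rewrite fineK.
- by move=> y cy; rewrite /v gam_u0_off// u0_core_off// oppr0 !mul0r addr0 mul0r subrr.
- move=> x rx cx; rewrite (dotX_lift au1 (adm_xi1 a1) rx) (lift_core_off u0_core_off cx).
  by rewrite (lift_core_off (@gam_u0_off (xi a1)) cx) oppr0 !mul0r addr0 mul0r subrr.
- move=> x cx gx; have [dx Ux cpx rx] := psi_core_U cx.
  rewrite (dotX_lift au1 (adm_xi1 a1) rx) (hess_PhiF _ _ _ cx gx) (hess_PF _ _ _ _ cx gx).
  by rewrite /lift_fun mem_set.
Qed.

Lemma integral_bracket_term a1 a2 a3 a4 :
  integralX n (fun x => lift_fun u0 x * teval (hess (lift_fun (xi a3)) x)
    [tuple bracketX S hess (lift_fun (xi a1)) (lift_fun (xi a2)) x; grad S (lift_fun (xi a4)) x]) =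
  (\int[mu]_(y in cell) (u0 y * BF (gram i) (xi a3) (xi a4) (xi a1) (xi a2) y * weight i y)%:E)%E.
Proof.
have c0u : ck 0 Om u0 by exact: (adm_ck _ adm_u0).
have cB : ck 0 Om (BF (gram i) (xi a3) (xi a4) (xi a1) (xi a2)) by exact: BF_ck.
rewrite (@integralX_core _ (fun y => u0 y * BF (gram i) (xi a3) (xi a4) (xi a1) (xi a2) y) (ckM open_Om c0u cB)) //.
- by move=> y cy; rewrite u0_core_off// mul0r.
- by move=> x rx cx; rewrite (lift_core_off u0_core_off cx) mul0r.
- move=> x cx gx; have [dx Ux cpx rx] := psi_core_U cx; rewrite (hess_BF _ _ _ _ cx gx).
  by rewrite /lift_fun mem_set.
Qed.

Definition curvF_at (s : idx4) (y : V) : R := curvF (gram i) (xi (s (@Ordinal 4 0 isT))) (xi (s (@Ordinal 4 1 isT)))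
  (xi (s (@Ordinal 4 2 isT))) (xi (s (@Ordinal 4 3 isT))) y.

(** The identity of [is_curvX] for [u0] and four cut-off coordinates, with each of its integrals
    moved to the chart; the factor [weight i y] stays in the integrand and is divided out at the
    end, being positive. *)
Lemma test_identity s :
  (\int[mu]_(y in cell) ((curv_grad s (psi i y) - curvF_at s y) * weight i y * u0 y)%:E = 0)%E.
Proof.
set a1 := s (@Ordinal 4 0 isT); set a2 := s (@Ordinal 4 1 isT); set a3 := s (@Ordinal 4 2 isT); set a4 := s (@Ordinal 4 3 isT).
have T a := TestF_lift (adm_le (isT : 3 <= 6)%N (adm_xi a)).
have Lp a := is_lap_lift (adm_le (isT : 3 <= 6)%N (adm_xi a)).
have := hRX.2 _ _ _ _ _ _ _ (TestF_lift (adm_le (isT : 3 <= 6)%N adm_u0)) (T a1) (T a2) (T a3) (T a4) (Lp a1) (Lp a2).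
rewrite (integral_Delta_term a1 a2 a3 a4) (integral_Delta_term a2 a1 a3 a4) (integral_bracket_term a1 a2 a3 a4).
have c0u : ck 0 Om u0 by exact: (adm_ck _ adm_u0).
have mc := measurable_cell; have cw := ck_weight 0; have Ki := cell_dom.
have mT := measurable_curv_grad_psi s.
have mu0 : measurable_fun (cell : set (borel V)) u0 by exact: ck_measurable c0u.
have -> : integralX n (fun x => lift_fun u0 x * tdot (gram_at S x) (RX x)
     (tprod [tuple dfun S (lift_fun (xi a1)) x; dfun S (lift_fun (xi a2)) x; dfun S (lift_fun (xi a3)) x; dfun S (lift_fun (xi a4)) x])) =
   (\int[mu]_(y in cell) (u0 y * curv_grad s (psi i y) * weight i y)%:E)%E.
  transitivity (integralX n (fun x => lift_fun u0 x * curv_grad s x)).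
    apply: eq_integral => x /set_mem rx; congr ((_ * _)%:E); have [P PG] := invmx_gram_sq S rx.
    have sG : (invmx (gram_at S x))^T = invmx (gram_at S x) by rewrite PG trmx_mul trmxK.
    rewrite (tdot_tprod _ _ sG); congr (teval _ _); apply: eq_from_tnth => j; rewrite !tnth_mktuple (tnth_nth (dfun S (lift_fun (xi a1)) x)).
    by case: j => [[|[|[|[|//]]]] hj] /=; congr (grad S (lift_fun (xi (s _))) x); exact: val_inj.
  rewrite integralX_cell; last by move=> x rx xK; rewrite (lift_out adm_u0.2 xK) mul0r.
  rewrite (@transfer R n X _ S hS cS i cell _ mc Ki).
    by apply: eq_integral => y /set_mem Ky; rewrite lift_psi//; exact: Ki.
  apply: (@measurable_fun_eqD _ (borel V) R cell (fun y => u0 y * curv_grad s (psi i y))); last exact: measurable_funM.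
  by move=> y Ky; rewrite lift_psi//; exact: Ki.
pose Q12 y := u0 y * (gam (gram i) (xi a1) (PhiF (gram i) (xi a3) (xi a2) (xi a4)) y
  - PF (gram i) (xi a3) (xi a4) (xi a2) (xi a1) y) * weight i y.
pose Q21 y := u0 y * (gam (gram i) (xi a2) (PhiF (gram i) (xi a3) (xi a1) (xi a4)) y
  - PF (gram i) (xi a3) (xi a4) (xi a1) (xi a2) y) * weight i y.
pose QB y := u0 y * BF (gram i) (xi a3) (xi a4) (xi a1) (xi a2) y * weight i y.
move=> H0; have H : (\int[mu]_(y in cell) (u0 y * curv_grad s (psi i y) * weight i y)%:E =
    \int[mu]_(y in cell) (Q12 y)%:E - \int[mu]_(y in cell) (Q21 y)%:E - \int[mu]_(y in cell) (QB y)%:E)%E by exact: H0.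
have I12 : mu.-integrable cell (EFin \o Q12).
  apply: (@ck_integrable 0) => //; apply: (ckM open_Om _ cw); apply: (ckM open_Om c0u).
  by apply: (ckB open_Om); [exact: gamPhi_ck|exact: PF_ck].
have I21 : mu.-integrable cell (EFin \o Q21).
  apply: (@ck_integrable 0) => //; apply: (ckM open_Om _ cw); apply: (ckM open_Om c0u).
  by apply: (ckB open_Om); [exact: gamPhi_ck|exact: PF_ck].
have IB : mu.-integrable cell (EFin \o QB).
  apply: (@ck_integrable 0) => //; apply: (ckM open_Om _ cw); apply: (ckM open_Om c0u); exact: BF_ck.
have ID : mu.-integrable cell (EFin \o (fun y => Q12 y - Q21 y)).
  by have := integrableB mc I12 I21; apply: eq_integrable.
have IT : mu.-integrable cell (EFin \o (fun y => u0 y * curv_grad s (psi i y) * weight i y)).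
  have [B B0 uB] := adm_bound adm_u0.
  have := @integrableZl _ _ R mu _ mc B _ (integrable_curv_grad_psi s).
  apply: le_integrable => //.
    apply/measurable_EFinP; apply: measurable_funM; first exact: measurable_funM.
    exact: measurable_weightS.
  move=> y _; have -> : (`|B%:E * (EFin \o (fun y => (curv_grad s (psi i y) * weight i y)%R)) y| =
      (B * `|curv_grad s (psi i y) * weight i y|)%R%:E)%E by rewrite abseM EFinM /= (ger0_norm B0).
  by rewrite /= lee_fin -mulrA normrM ler_wpM2r.
have e1 : (\int[mu]_(y in cell) (Q12 y - Q21 y)%:E = \int[mu]_(y in cell) (Q12 y)%:E - \int[mu]_(y in cell) (Q21 y)%:E)%E.
  exact: (integralB_EFin mc I12 I21).
have e2 : (\int[mu]_(y in cell) (Q12 y - Q21 y - QB y)%:E =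
    \int[mu]_(y in cell) (Q12 y - Q21 y)%:E - \int[mu]_(y in cell) (QB y)%:E)%E by exact: (integralB_EFin mc ID IB).
have IC : mu.-integrable cell (EFin \o (fun y => Q12 y - Q21 y - QB y)).
  by have := integrableB mc ID IB; apply: eq_integrable.
transitivity (\int[mu]_(y in cell) ((u0 y * curv_grad s (psi i y) * weight i y)%:E - (Q12 y - Q21 y - QB y)%:E))%E.
  apply: eq_integral => y _; rewrite -EFinB; congr (_%:E).
  have alg (t w p x1 p1 x2 p2 b : R) : (t - (x1 - p1 - (x2 - p2) - b)) * w * p =
    p * t * w - (p * (x1 - p1) * w - p * (x2 - p2) * w - p * b * w) by ring.
  exact: alg.
apply: etrans (integralB_EFin mc IT IC) _; apply: etrans (_ : _ = (\int[mu]_(y in cell) (Q12 y - Q21 y - QB y)%:E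
    - \int[mu]_(y in cell) (Q12 y - Q21 y - QB y)%:E)%E) _.
  by congr (_ - _)%E; rewrite e2 e1; exact: H.
by apply: subee; exact: (integrable_fin_num mc IC).
Qed.

End TestFunction.

Lemma ae_curv_grad s : {ae mu, forall y : V, core y -> curv_grad s (psi i y) = curvF_at s y}.
Proof.
have mc := measurable_cell.
have cc : cube y0 (rho / 2) `<=` cell.
  move=> y h; apply: (core_cell_le _); apply/rV_normP; first exact: ltW rho2.
  by move=> b; have := h b; rewrite !mxE ler_norml => /andP[h1 h2]; apply/andP; split; lra.
have mcu : measurable (cube y0 (rho / 2) : set (borel V)) by exact: measurable_obox.
pose h y := (curv_grad s (psi i y) - curvF_at s y) * weight i y.
have Ih : mu.-integrable cell (EFin \o h).
  have I1 := integrable_curv_grad_psi s.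
  have I2 : mu.-integrable cell (EFin \o (fun y => curvF_at s y * weight i y)).
    by apply: (@ck_integrable 0) => //; apply: (ckM open_Om); [exact: curvF_ck|exact: ck_weight].
  have := integrableB mc I1 I2; apply: eq_integrable => // y _ /=.
  by rewrite -EFinB -mulrBl.
have F := @fundamental_lemma R n 6 y0 (rho / 2) h rho2 (integrableS mc mcu cc Ih).
have : ae_eq mu (cube y0 (rho / 2)) (EFin \o h) (cst 0%E).
  apply: F => u cu [r1 r1r ur1].
  (* The radius [r1] of the cube may be negative; the norm criterion for membership in a ball asks
     for a nonnegative one. *)
  have r2 : Num.max r1 0 < rho / 2 by rewrite gt_max r1r rho2.
  have uoff (y : V) : Num.max r1 0 < `|y - y0| -> u y = 0.
    move=> hy; apply/eqP; apply: contraT => /ur1 cy; move: hy; rewrite ltNge => /negP; case.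
    apply/rV_normP; first by rewrite le_max lexx orbT.
    move=> b; have := cy b; rewrite !mxE ler_norml => /andP[h1 h2].
    have m1 : r1 <= Num.max r1 0 by rewrite le_max lexx.
    by move: m1; move: (Num.max r1 0) => q m1; apply/andP; split; lra.
  rewrite -[RHS](test_identity cu r2 uoff s); apply: esym.
  apply: (@integral_zero_off _ (borel V) R mu) => // y _ yc.
  have [->|/ur1 cy] := eqVneq (u y) 0; first by rewrite mulr0.
  case: yc => b; have := cy b; rewrite !mxE => /andP[h1 h2]; apply/andP; split; lra.
apply: (@ae_imp _ (borel V) R mu) => y H cy.
have cuy : cube y0 (rho / 2) y.
  move=> b; have := le_lt_trans (rV_coord_le (y - y0) b) cy; rewrite !mxE ltr_norml => /andP[h1 h2].
  by apply/andP; split; lra.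
have [] := H cuy; rewrite /h => /eqP; rewrite mulf_eq0 subr_eq0 => /orP[/eqP//|/eqP w0].
by have := weight_gt0 (cell_dom (core_cell cy)); rewrite w0 ltxx.
Qed.

Lemma ae_core_push (P : X -> Prop) : {ae mu, forall y : V, core y -> P (psi i y)} ->
  aeX n (fun x => (psi i @` core) x -> P x).
Proof.
move=> [N [mN N0 NP]]; have mCN : measurable (cell `&` N : set (borel V)) by apply: measurableI => //; exact: measurable_cell.
have CNi : cell `&` N `<=` phi i @` dom i by move=> y [/cell_dom].
exists (psi i @` (cell `&` N)); split.
- exact: (measurable_psiA mCN (@subIsetl _ cell N)).
- apply: (etrans (hausdorffX_psi hS cS mCN CNi)); apply: null_set_integral => //.
    by apply/measurable_EFinP; exact: measurable_weightS.
  exact: (subset_measure0 mCN mN (@subIsetr _ cell N) N0).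
- move=> x /= nP; have [[y cy yx] nPx] : (psi i @` core) x /\ ~ P x.
    split; first by apply: contrapT => h; apply: nP => hx; case: (h hx).
    by move=> h; apply: nP.
  exists y => //; split; first exact: core_cell.
  by apply: NP => /= h; apply: nPx; rewrite -yx; exact: h.
Qed.

Lemma tuple4E (T : Type) (g : 'I_4 -> T) :
  [tuple g (@Ordinal 4 0 isT); g (@Ordinal 4 1 isT); g (@Ordinal 4 2 isT); g (@Ordinal 4 3 isT)] = [tuple g j | j < 4].
Proof.
apply: eq_from_tnth => j; rewrite tnth_mktuple (tnth_nth (g ord0)).
by case: j => [[|[|[|[|//]]]] hj] /=; congr g; exact: val_inj.
Qed.

(** [curvF_at] is computed in the chart [i] and [riem_at] in the preferred chart of the point;
    [curvF_riem] relates them on gradients, and [teval_span] extends the equality to all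
    coefficients. *)
Lemma core_curvature : aeX n (fun x => (psi i @` core) x -> RX x =1 riem_at S x).
Proof.
apply: ae_core_push; have : {ae mu, forall y s, core y -> curv_grad s (psi i y) = curvF_at s y}.
  by apply: (@ae_forall_fin _ (borel V) R mu) => s; exact: ae_curv_grad.
apply: (@ae_imp _ (borel V) R mu) => y H cy.
have cx : (psi i @` core) (psi i y) by exists y.
have [dx Ux cpx rx] := psi_core_U cx; have [oz e] := coord_overlap dx Ux.
have [Q uQ gQ] := grad_xi_basis cx; have e2 := (img_phi (cell_dom (core_cell cy))).2.
apply: (teval_span uQ) => s; have := H s cy.
have -> : curv_grad s (psi i y) = teval (RX (psi i y)) [tuple row (s j) Q | j < 4].
  by congr (teval _ _); apply: eq_from_tnth => j; rewrite !tnth_mktuple gQ.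
move=> ->; rewrite /curvF_at -[in LHS]e2 -e.
have C3 a : ck 3 Om (xi a) by exact: xi_ck.
rewrite (@curvF_riem R n (overlap (chart_at S (psi i y))) Om (gram i) (gram (chart_at S (psi i y))) (tau (chart_at S (psi i y)))
  (@open_overlap _) open_Om (@tau_Om _) (@ck_tau_chart _) gramOm_sym gramOm_unit (@overlap_sym _) (@overlap_unit _)
  (@overlap_compat _) gramOm_ck (@overlap_ck _) _ _ _ _ _ (C3 _) (C3 _) (C3 _) (C3 _) oz).
congr (teval _ _).
apply: etrans (tuple4E (fun k => gvec (gram (chart_at S (psi i y))) (xi (s k) \o tau (chart_at S (psi i y))) (Defs.coord S (psi i y)))) _.
by apply: eq_from_tnth => j; rewrite !tnth_mktuple -gQ (grad_lift _ dx).
Qed.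

End Lift.

Theorem proposition1p16 (R : realType) (n : nat) (d v K1 K2 : R)
  (hd : 0 < d) (hv : 0 < v)
  (X : pmetricType R) (hX : closure_M n d K1 K2 v X)
  (S : riem_structure R n (regular n X))
  (hSreg : C1alpha_metric_on S (regular n X))
  (hSdist : locally_induces_dist S)
  (hess : (X -> R) -> tensor_field n X 2)
  (hhess : forall f, TestF S f -> is_hess S f (hess f))
  (RX : tensor_field n X 4) (hRX : is_curvX S hess RX)
  (U : set X) (hUopen : open U) (hUsub : U `<=` regular n X)
  (hUsmooth : smooth_metric_on S U) :
  aeX n (fun x : X => U x -> RX x =1 riem_at S x) /\
  aeX n (fun x : X => U x ->
    forall e : 'M[R]_n, orthonormal_basis (gram_at S x) e ->
      (forall u w : 'rV[R]_n,
         ric_contr e (RX x) u w = teval (ric_at S x) [tuple u; w]) /\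
      scal_contr e (RX x) = scal_at S x).
Proof.
(* Compactness makes [X] second countable, which turns local statements into global ones by
   [countable_local]. *)
have cX : compact [set: X] by exact: hX.1.
(* Charts need not lie inside [U]; the measure formula is proved on their whole images, where
   continuity of the metric comes from its C^{1,alpha} regularity. *)
have cS (j : chart S) y : (phi j @` dom j) y -> forall a b, {for y, continuous (fun z => gram j z a b)}.
  move=> [x dx <-] a b; apply: differentiable_continuous.
  by apply: (hSreg j a b).1; exists x => //; split=> //; exact: dom_sub dx.
have main : aeX n (fun x : X => U x -> RX x =1 riem_at S x).
  have [F [oF PF UF]] : exists F : nat -> set X, [/\ forall k, open (F k),
      forall k, aeX n (fun x : X => F k x -> RX x =1 riem_at S x) & U `<=` \bigcup_k F k].
    apply: (@countable_local X U (fun A => aeX n (fun x : X => A x -> RX x =1 riem_at S x))).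
    - exact: compact_second_countable.
    - by exists set0; split=> [||x h]; [exact: measurable0|exact: measure0|case: h => -[]].
    - by move=> A B AB; apply: (@ae_imp _ (borel X) R (@hausdorffX R n X)) => x h /AB; exact: h.
    - move=> x0 Ux0; set i := chart_at S x0; have dx0 : dom i x0 by apply: dom_chart_at; exact: hUsub.
      have [r [c [L [r0 c0 L0 inOm cmp]]]] := comparison_radius hSdist cS hUopen dx0 Ux0.
      (* With [rho = r / 4] the closed ball of radius [2 * rho] lies inside the open ball of radius
         [r] where the comparison holds. *)
      have rho0 : 0 < r / 4 by rewrite divr_gt0.
      have lt_r (y : 'rV[R]_n) : `|y - phi i x0| <= 2 * (r / 4) -> `|y - phi i x0| < r.
        by move=> h; apply: le_lt_trans h _; lra.
      exists (psi i @` core (phi i x0) (r / 4)).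
        have C : {for x0, continuous (fun t => `|phi i t - phi i x0|)}.
          apply: continuous_comp; last exact: norm_continuous.
          by apply: continuousB; [exact: phi_continuous|exact: cst_continuous].
        have h : `|phi i x0 - phi i x0| < r / 4 / 2 by rewrite subrr normr0 divr_gt0.
        have : nbhs x0 (dom i) by apply: open_nbhs_nbhs; split=> //; exact: dom_open.
        by move: (near_lt C h); apply: filterS2 => t ht dt; exists (phi i t); rewrite ?phiK.
      apply: (@core_curvature R n X S hSdist cS U hUopen hUsmooth i (phi i x0) (r / 4) c L rho0 c0 L0 _ _ hess hhess RX hRX).
        by move=> y /lt_r; exact: inOm.
      by move=> y z /lt_r hy /lt_r hz; exact: cmp.
  have : {ae @hausdorffX R n X, forall x k, F k x -> RX x =1 riem_at S x} by exact: ae_foralln.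
  by apply: (@ae_imp _ (borel X) R (@hausdorffX R n X)) => x H /UF[k _ Fx]; exact: H Fx.
split=> //; move: main; apply: (@ae_imp _ (borel X) R (@hausdorffX R n X)) => x H Ux e eG.
have uG : gram (chart_at S x) (Defs.coord S x) \in unitmx.
  by apply: gram_unit; exists x => //; apply: dom_chart_at; exact: hUsub.
by split=> [u w|]; [exact: ric_contr_riem uG (H Ux) eG|exact: scal_contr_riem uG (H Ux) eG].
Qed.
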